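(* Let $n\ge 2$, let $a$, $A$, $\Theta$ be as in the context, let $F\in L^A(\mathbb{R}^n)$ ($\mathbb{R}^n$-valued), and let $u\in W^{1,A}(\mathbb{R}^n)$ be a solution of $\Delta_A u=\mathrm{div}(\Theta(F))$ in $\mathbb{R}^n$, i.e. $$\int_{\mathbb{R}^n}\Theta(\nabla u)\cdot\nabla\varphi\,dx=\int_{\mathbb{R}^n}\Theta(F)\cdot\nabla\varphi\,dx\qquad\forall \varphi\in C_c^\infty(\mathbb{R}^n).$$ Assume that $F\in L^B(\mathbb{R}^n)$ for some function $B:[0,\infty)\to[0,\infty)$ such that $B\circ A^{-1}(t)=\int_0^t h(s)\,ds$ for all $t\ge 0$, where $h\in C^1((0,\infty))\cap C^0([0,\infty))$, $h(0)=0$, $h(t)>0$ for $t>0$, and for some positive constants $c_0,c_1$, $$c_0\le \frac{t h'(t)}{h(t)}\le c_1\qquad\forall t>0.$$ Then $|\nabla u|\in L^B(\mathbb{R}^n)$ and $$\int_{\mathbb{R}^n} B(|\nabla u|)\,dx\le C\int_{\mathbb{R}^n}B(|F|)\,dx,$$ where $C$ is a positive constant depending only on $n$, $A$ and $B$.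
   Context: $a\in C^1((0,\infty))\cap C^0([0,\infty))$ satisfies $a(0)=0$, $a(t)>0$ for $t>0$, and there are positive constants $a_0,a_1$ with $a_0\le \frac{t a'(t)}{a(t)}\le a_1$ for all $t>0$. Set $A(t)=\int_0^t a(s)\,ds$ and $\Theta(X)=\frac{a(|X|)}{|X|}X$ for $X\in\mathbb{R}^n$, with $\Theta(0)=0$; $\Delta_A u=\mathrm{div}(\Theta(\nabla u))$. $A^{-1}$ is the inverse of $A:[0,\infty)\to[0,\infty)$. Orlicz spaces: $L^A(\mathbb{R}^n)=\{u\in L^1(\mathbb{R}^n): \int_{\mathbb{R}^n}A(|u|)\,dx<\infty\}$ (a vector field belongs to $L^A$ if its Euclidean norm does), and $W^{1,A}(\mathbb{R}^n)=\{u\in L^A(\mathbb{R}^n): |\nabla u|\in L^A(\mathbb{R}^n)\}$ (weak gradient). $L^B(\mathbb{R}^n)$ is defined in the same way with $B$ in place of $A$. *)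

(* Defs.v *)
From HB Require Import structures.
From mathcomp Require Import all_boot all_order all_algebra.
From mathcomp Require Import all_classical all_reals all_analysis.

Set Implicit Arguments.
Unset Strict Implicit.
Unset Printing Implicit Defensive.
Import Order.TTheory GRing.Theory Num.Theory.
Import numFieldNormedType.Exports.
Local Open Scope classical_set_scope.
Local Open Scope ring_scope.

(* The Borel sigma-algebra of R^n = 'rV[R]_n, in the product form
   used by the library for n.-tuple R: it is generated by the coordinates.
   As for lebesgue_measure, measurable means Borel; a Lebesgue measurable
   function coincides almost everywhere with a Borel one. *)
Definition rV_display : measure_display -> measure_display.
Proof. exact. Qed.

Section measurable_rV.
Context {R : realType} (n : nat).

Let coor (i : 'I_n) (x : 'rV[R]_n) : measurableTypeR R := x ord0 i.

Let rV_set0 : g_sigma_preimage coor set0.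
Proof. exact: sigma_algebra0. Qed.

Let rV_setC A : g_sigma_preimage coor A -> g_sigma_preimage coor (~` A).
Proof. exact: sigma_algebraC. Qed.

Let rV_bigcup (F : _^nat) : (forall i, g_sigma_preimage coor (F i)) ->
  g_sigma_preimage coor (\bigcup_i (F i)).
Proof. exact: sigma_algebra_bigcup. Qed.

HB.instance Definition _ := @isMeasurable.Build
  (rV_display (R.-ocitv.-measurable).-sigma) 'rV[R]_n (g_sigma_preimage coor)
  rV_set0 rV_setC rV_bigcup.

Lemma measurable_coord (i : 'I_n) :
  measurable_fun setT (fun x : 'rV[R]_n => x ord0 i : measurableTypeR R).
Proof.
move=> _ Y mY; rewrite setTI; apply: sub_sigma_algebra => /=.
rewrite -bigcup_seq/=; exists i => /=; first by rewrite mem_index_enum.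
by exists Y => //; rewrite setTI.
Qed.

Lemma measurable_fun_rV d (T : measurableType d) (f : T -> 'rV[R]_n) :
  (forall i, measurable_fun setT (fun t => f t ord0 i : measurableTypeR R)) ->
  measurable_fun setT f.
Proof.
move=> mf.
suff : @measurable _ 'rV[R]_n `<=` [set A | measurable (f @^-1` A)].
  by move=> H _ A mA; rewrite setTI; exact: H.
apply: smallest_sub => /=.
  split=> /=.
  - by rewrite preimage_set0.
  - by move=> A mA; rewrite setTD preimage_setC; exact: measurableC.
  - by move=> F mF; rewrite preimage_bigcup; exact: bigcup_measurable.
rewrite -bigcup_seq => A [i _ [B mB <-]] /=.
by have := mf i measurableT B mB; rewrite !setTI.
Qed.

End measurable_rV.

Definition rV_cons {R : realType} {n} (p : measurableTypeR R * 'rV[R]_n) :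
    'rV[R]_n.+1 :=
  \row_(i < n.+1) oapp (fun j => p.2 ord0 j) p.1 (unlift ord0 i).

Definition rV_uncons {R : realType} {n} (x : 'rV[R]_n.+1) :
    measurableTypeR R * 'rV[R]_n :=
  (x ord0 ord0, \row_(j < n) x ord0 (lift ord0 j)).

Lemma rV_consK {R : realType} n :
  cancel (@rV_cons R n) (@rV_uncons R n).
Proof.
move=> [t y]; rewrite /rV_uncons mxE unlift_none/=; congr pair.
by apply/rowP => j; rewrite !mxE liftK.
Qed.

Lemma measurable_rV_cons {R : realType} n :
  measurable_fun setT (@rV_cons R n).
Proof.
apply: measurable_fun_rV => i.
rewrite /rV_cons; under eq_fun do rewrite mxE.
case: unliftP => [j|] _ /=; last exact: measurable_fst.
exact: (measurableT_comp (measurable_coord j) measurable_snd).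
Qed.

Lemma measurable_rV_uncons {R : realType} n :
  measurable_fun setT (@rV_uncons R n).
Proof.
apply: measurable_fun_pair => /=; first exact: measurable_coord.
apply: measurable_fun_rV => j; under eq_fun do rewrite mxE.
exact: measurable_coord.
Qed.

Section lebesgue_step.
Context {R : realType} (n : nat).
Variable mu : {sigma_finite_measure set 'rV[R]_n -> \bar R}.

Definition lebesgue_step : set 'rV[R]_n.+1 -> \bar R :=
  pushforward (@lebesgue_measure R \x mu)%E (@rV_cons R n).

Let step0 : lebesgue_step set0 = 0%E.
Proof. by rewrite /lebesgue_step /pushforward preimage_set0 measure0. Qed.

Let step_ge0 A : (0 <= lebesgue_step A)%E.
Proof. exact: (measure_ge0 (@lebesgue_measure R \x mu)%E). Qed.

Let step_sigma_additive : semi_sigma_additive lebesgue_step.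
Proof.
have mcons A : measurable A -> measurable (@rV_cons R n @^-1` A).
  by move=> mA; rewrite -[X in measurable X]setTI; exact: measurable_rV_cons.
move=> F mF tF mUF; rewrite /lebesgue_step /pushforward preimage_bigcup.
apply: measure_semi_sigma_additive => [k||].
- exact: mcons.
- apply/trivIsetP => /= i j _ _ ij; rewrite -preimage_setI.
  by move/trivIsetP : tF => /(_ _ _ _ _ ij) ->//; rewrite preimage_set0.
- by rewrite -preimage_bigcup; exact: mcons.
Qed.

HB.instance Definition _ := isMeasure.Build _ _ _ lebesgue_step
  step0 step_ge0 step_sigma_additive.

Let step_sigma_finite : sigma_finite setT lebesgue_step.
Proof.
have /sigma_finiteP[F [UF ndF Foo]] := sigma_finiteT (@lebesgue_measure R).
have /sigma_finiteP[G [UG ndG Goo]] := sigma_finiteT mu.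
exists (fun k => rV_uncons @^-1` (F k `*` G k)).
  apply/esym; rewrite -subTset => x _.
  have : setT (rV_uncons x).1 by []; rewrite UF => -[i _ Fi].
  have : setT (rV_uncons x).2 by []; rewrite UG => -[j _ Gj].
  exists (maxn i j) => //; split.
  - by move: Fi; exact/subsetPset/ndF/leq_maxl.
  - by move: Gj; exact/subsetPset/ndG/leq_maxr.
move=> k; have [mF Fk] := Foo k; have [mG Gk] := Goo k; split.
  rewrite -[X in measurable X]setTI; apply: measurable_rV_uncons => //.
  exact: measurableX.
rewrite /lebesgue_step /pushforward -comp_preimage.
rewrite (_ : _ \o _ = id); last by apply/funext => p /=; rewrite rV_consK.
by rewrite preimage_id product_measure1E// lte_mul_pinfty// ge0_fin_numE.
Qed.

HB.instance Definition _ := Measure_isSigmaFinite.Build _ _ _ lebesgue_step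
  step_sigma_finite.

End lebesgue_step.

(* Lebesgue measure on R^n: the unit mass on R^0, and on R^n.+1 the product of
   the Lebesgue measures of R and R^n. *)
Fixpoint lebesgue_rV {R : realType} (n : nat) :
    {sigma_finite_measure set 'rV[R]_n -> \bar R} :=
  match n with
  | 0 => @dirac _ 'rV[R]_0 0 R
  | m.+1 => lebesgue_step (lebesgue_rV m)
  end.

Lemma lebesgue_rV_box {R : realType} n (A : 'I_n -> set (measurableTypeR R)) :
  (forall i, measurable (A i)) ->
  (lebesgue_rV n [set x : 'rV[R]_n | forall i, A i (x ord0 i)] =
   \prod_(i < n) lebesgue_measure (A i))%E.
Proof.
elim: n A => [|n IH] A mA.
  rewrite big_ord0 /= diracE.
  by rewrite mem_set// => -[].
rewrite big_ord_recl -IH// -product_measure1E//; last first.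
  rewrite (_ : mkset _ = \bigcap_(i in [set: 'I_n])
      ((fun x : 'rV[R]_n => x ord0 i : measurableTypeR R) @^-1` A (lift ord0 i))).
    apply: fin_bigcap_measurable => // i _.
    by rewrite -[X in measurable X]setTI; exact: measurable_coord.
  by apply/seteqP; split => x Ax i => [_|]; [exact: Ax|exact: (Ax i I)].
rewrite /= /lebesgue_step /pushforward; congr (_ _).
apply/seteqP; split => -[t y] /=.
  move=> Ay; split; first by have := Ay ord0; rewrite mxE unlift_none.
  by move=> i; have := Ay (lift ord0 i); rewrite mxE liftK.
move=> [At Ay] i; rewrite mxE; case: unliftP => [j ->|->] //=.
Qed.

Section orlicz.
Context {R : realType}.
Implicit Types (a f A : R -> R).

(* Functions on [0, +oo[ are represented by functions on R whose values on
   ]-oo, 0[ are irrelevant. *)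
Definition growth_function f : Prop :=
  [/\ {within `[0, +oo[, continuous f} /\
      (forall t : R, 0 < t -> derivable f t 1) /\
      {in `]0, +oo[, continuous (derive1 f)},
      f 0 = 0,
      forall t : R, 0 < t -> 0 < f t &
      exists m M : R, [/\ 0 < m, 0 < M &
        forall t : R, 0 < t -> m <= t * derive1 f t / f t <= M]].

Definition primitive f (t : R) : R :=
  \int[@lebesgue_measure R]_(s in `[0, t]) f s.

(* This is the inverse of A as soon as A is a bijection of [0, +oo[, as the
   primitive of a growth_function is. *)
Definition inverse_nonneg A : R -> R := 'pinv_(fun=> 0) `[0, +oo[ A.

Context {n : nat}.
Implicit Types (u : 'rV[R]_n -> R) (F G : 'rV[R]_n -> 'rV[R]_n).

Local Notation mu := (lebesgue_rV n).

Definition dotprod (x y : 'rV[R]_n) : R := \sum_(i < n) x ord0 i * y ord0 i.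

(* The norm `|x| of the library on 'rV[R]_n is the max norm. *)
Definition enorm (x : 'rV[R]_n) : R := Num.sqrt (dotprod x x).

Definition Theta a (x : 'rV[R]_n) : 'rV[R]_n :=
  if x == 0 then 0 else (a (enorm x) / enorm x) *: x.

Definition orlicz A u : Prop :=
  mu.-integrable setT (EFin \o u) /\
  (\int[mu]_x (A `|u x|)%:E < +oo)%E.

Definition orlicz_field A F : Prop :=
  measurable_fun setT F /\ orlicz A (enorm \o F).

Definition partial (i : 'I_n) u : 'rV[R]_n -> R :=
  fun x => 'D_(delta_mx ord0 i) u x.

Definition grad u : 'rV[R]_n -> 'rV[R]_n := fun x => \row_i partial i u x.

Fixpoint Ck (k : nat) u : Prop :=
  continuous u /\
  match k with
  | 0 => True
  | k'.+1 => forall i : 'I_n,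
      (forall x, derivable u x (delta_mx ord0 i)) /\ Ck k' (partial i u)
  end.

Definition test_function u : Prop :=
  (forall k, Ck k u) /\ compact (closure [set x | u x != 0]).

Definition locally_integrable_rV u : Prop :=
  measurable_fun setT u /\
  forall K, compact K -> (\int[mu]_(x in K) `|u x|%:E < +oo)%E.

Definition weak_gradient u G : Prop :=
  [/\ locally_integrable_rV u,
      measurable_fun setT G,
      forall i : 'I_n, locally_integrable_rV (fun x => G x ord0 i) &
      forall phi, test_function phi -> forall i : 'I_n,
        \int[mu]_x (u x * partial i phi x) = - \int[mu]_x (G x ord0 i * phi x)].

(* u belongs to W^{1,A}(R^n) and G is (a representative of) its weak gradient *)
Definition orlicz_sobolev A u G : Prop :=
  [/\ orlicz A u, weak_gradient u G & orlicz_field A G].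

(* div (Theta G) = div (Theta F) in the sense of distributions *)
Definition weak_solution a G F : Prop :=
  forall phi, test_function phi ->
    \int[mu]_x dotprod (Theta a (G x)) (grad phi x) =
    \int[mu]_x dotprod (Theta a (F x)) (grad phi x).

End orlicz.

(* Main.v *)
(* Put e(t) = t a(t), which is comparable to A. On a cube, X = Du is compared with
the gradient X' that solves the homogeneous equation with the same boundary
values, for the nonlinearity made uniformly elliptic by truncation. Caccioppoli's
inequality for difference quotients bounds the L^1 modulus of translation of a
cut-off of X' at level k by the energy of X' above k; hence the set where X' is
large is small and, iterating over the levels, the energy of X' above a large
multiple T of its mean decays like any power of 1/T. Covering the set where
e(X) + e(F)/gamma is large by stopping cubes (Vitali) gives
  int_{e(X) > 2^K L} e(X) <= theta (int_{e(X) > L} e(X) +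
                                   int_{e(F) > gamma L} e(F) / gamma)
with theta as small as the doubling constant of h requires. Summing over dyadic
levels L with weights h(L) yields int e(X) h(e(X)) <= C int e(F) h(e(F)), and
B(t) is comparable to e(t) h(e(t)) because B = H o A where H' = h. *)

Require Import Defs.
From HB Require Import structures.
From mathcomp Require Import all_boot all_order all_algebra.
From mathcomp Require Import all_classical all_reals all_analysis.
From mathcomp Require Import measurable_realfun.
From mathcomp Require Import ring lra.
Set Implicit Arguments.
Unset Strict Implicit.
Unset Printing Implicit Defensive.
Import Order.TTheory GRing.Theory Num.Theory.
Import numFieldNormedType.Exports.
Import HBNNSimple.
Local Open Scope classical_set_scope.
Local Open Scope ring_scope.

Local Notation mble := (measurable_fun setT).
Local Notation via x := (@le_trans _ _ x).
Local Notation L1 mu f := (integrable mu setT (EFin \o f)).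
Local Notation mcomp f := (@measurableT_comp _ _ _ _ _ _ f).

(** No pointwise gradient bound is used for the homogeneous problem; decay like [T^-q] for every [q]
    takes its place. It suffices because good-lambda has only a power to beat: going from level [L]
    to [2^K L] costs [Dh^K] in the weight, where [Dh] is the doubling constant of [h], and [K] is
    affine in log T, so that [Dh^K] is a constant times a fixed power of [T], and [q] is taken
    larger than its exponent. The obstacle is that [a(t)/t] may vanish or blow up at 0 and at
    infinity. Truncation makes the problem quadratic, hence solvable in L^2, but with ellipticity
    bounds that degenerate. All quantitative statements therefore live in the class [slope m M],
    which truncation preserves, while the degenerate bounds enter only errors sent to zero. Du is
    mollified before it serves as boundary datum: it becomes continuous and bounded on the cube, so
    that the truncation level can be placed above it. X' is never differentiated; it is only known
    as an L^2 limit of C^1 gradients, whose index is chosen after the step of the difference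
    quotient. The final absorption is legitimate because e(Du) is integrable and only finitely many
    levels are summed at a time. *)

Lemma eqW d (T : porderType d) (x y : T) : x = y -> (x <= y)%O.
Proof. by move->. Qed.

(** * Euclidean inner product and norm, compared with the max norm *)

Section euclid.
Context {R : realType} {n : nat}.
Implicit Types x y z : 'rV[R]_n.

Lemma dotC x y : dotprod x y = dotprod y x.
Proof. by rewrite /dotprod; apply: eq_bigr => i _; rewrite mulrC. Qed.

Lemma dotDl x y z : dotprod (x + y) z = dotprod x z + dotprod y z.
Proof.
by rewrite /dotprod -big_split; apply: eq_bigr => i _ /=; rewrite mxE mulrDl.
Qed.

Lemma dotZl a x y : dotprod (a *: x) y = a * dotprod x y.
Proof.
by rewrite /dotprod big_distrr; apply: eq_bigr => i _ /=; rewrite mxE mulrA.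
Qed.

Lemma dotNl x y : dotprod (- x) y = - dotprod x y.
Proof. by rewrite -scaleN1r dotZl mulN1r. Qed.

Lemma dotBl x y z : dotprod (x - y) z = dotprod x z - dotprod y z.
Proof. by rewrite dotDl dotNl. Qed.

Lemma dotDr x y z : dotprod x (y + z) = dotprod x y + dotprod x z.
Proof. by rewrite dotC dotDl !(dotC x). Qed.

Lemma dotZr a x y : dotprod x (a *: y) = a * dotprod x y.
Proof. by rewrite dotC dotZl dotC. Qed.

Lemma dotNr x y : dotprod x (- y) = - dotprod x y.
Proof. by rewrite dotC dotNl dotC. Qed.

Lemma dotBr x y z : dotprod x (y - z) = dotprod x y - dotprod x z.
Proof. by rewrite dotDr dotNr. Qed.

Lemma dot0l x : dotprod 0 x = 0.
Proof. by rewrite -(scale0r x) dotZl mul0r. Qed.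

Lemma dot0r x : dotprod x 0 = 0.
Proof. by rewrite dotC dot0l. Qed.

Lemma dot_ge0 x : 0 <= dotprod x x.
Proof. by apply: sumr_ge0 => i _; rewrite -expr2 sqr_ge0. Qed.

Lemma dot_eq0 x : dotprod x x = 0 -> x = 0.
Proof.
move=> x0; apply/rowP => i; rewrite mxE.
have /eqP := x0; rewrite psumr_eq0; last by move=> j _; rewrite -expr2 sqr_ge0.
by move/allP => /(_ i (mem_index_enum _))/=; rewrite -expr2 sqrf_eq0 => /eqP.
Qed.

Lemma dot_delta i x : dotprod x (delta_mx ord0 i) = x ord0 i.
Proof.
rewrite /dotprod (bigD1 i)//= mxE !eqxx mulr1 big1 ?addr0// => j ji.
by rewrite mxE eqxx (negbTE ji) mulr0.
Qed.

Lemma enorm_ge0 x : 0 <= enorm x.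
Proof. exact: sqrtr_ge0. Qed.

Lemma enorm_sqr x : enorm x ^+ 2 = dotprod x x.
Proof. by rewrite sqr_sqrtr// dot_ge0. Qed.

Lemma enorm0 : enorm (0 : 'rV[R]_n) = 0.
Proof. by rewrite /enorm dot0l sqrtr0. Qed.

Lemma enorm_eq0 x : enorm x = 0 -> x = 0.
Proof. by move=> x0; apply: dot_eq0; rewrite -enorm_sqr x0 expr0n. Qed.

Lemma enorm_gt0 x : x != 0 -> 0 < enorm x.
Proof.
move=> x0; rewrite lt_neqAle enorm_ge0 andbT eq_sym; apply: contra_neq x0.
exact: enorm_eq0.
Qed.

Lemma enormZ a x : enorm (a *: x) = `|a| * enorm x.
Proof.
by rewrite /enorm dotZl dotZr mulrA -expr2 sqrtrM ?sqr_ge0// sqrtr_sqr.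
Qed.

Lemma enormN x : enorm (- x) = enorm x.
Proof. by rewrite -scaleN1r enormZ normrN1 mul1r. Qed.

Lemma enormB x y : enorm (x - y) = enorm (y - x).
Proof. by rewrite -opprB enormN. Qed.

Lemma enormBsqr x y :
 enorm (x - y) ^+ 2 = enorm x ^+ 2 + enorm y ^+ 2 - 2 * dotprod x y.
Proof. rewrite !enorm_sqr dotBl !dotBr (dotC y x); ring. Qed.

(** Expand the squared norm of [enorm y *: x - enorm x *: y] and divide by the product of the norms,
    whence the two degenerate cases. *)
Lemma dot_le_enorm x y : dotprod x y <= enorm x * enorm y.
Proof.
have [->|x0] := eqVneq x 0; first by rewrite dot0l enorm0 mul0r.
have [->|y0] := eqVneq y 0; first by rewrite dot0r enorm0 mulr0.
have := sqr_ge0 (enorm (enorm y *: x - enorm x *: y)).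
rewrite enormBsqr !enormZ dotZl dotZr !ger0_norm ?enorm_ge0// => h.
rewrite -(ler_pM2l (enorm_gt0 x0)) -(ler_pM2l (enorm_gt0 y0)).
move: (enorm x) (enorm y) (dotprod x y) h => a b c; nra.
Qed.

Lemma dot_norm_le x y : `|dotprod x y| <= enorm x * enorm y.
Proof.
rewrite ler_norml dot_le_enorm andbT lerNl -dotNl.
by rewrite (le_trans (dot_le_enorm _ _))// enormN.
Qed.

Lemma enormD x y : enorm (x + y) <= enorm x + enorm y.
Proof.
rewrite -ler_sqr ?nnegrE ?addr_ge0 ?enorm_ge0//.
have := enormBsqr x (- y); rewrite opprK enormN dotNr => ->.
have := dot_le_enorm x y; rewrite !sqrrD; nra.
Qed.

Lemma enormB_le x y : enorm (x - y) <= enorm x + enorm y.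
Proof. by rewrite -(enormN y); exact: enormD. Qed.

Lemma enorm_sub_lt x y : enorm x - enorm y <= enorm (x - y).
Proof. by rewrite lerBlDr -{1}(subrK y x); exact: enormD. Qed.

Lemma enorm_dist x y : `|enorm x - enorm y| <= enorm (x - y).
Proof.
rewrite ler_norml enorm_sub_lt andbT.
by rewrite lerNl opprB (le_trans (enorm_sub_lt _ _))// enormB.
Qed.

Lemma coord_le_enorm x i : `|x ord0 i| <= enorm x.
Proof.
rewrite -sqrtr_sqr ler_wsqrtr// expr2 /dotprod (bigD1 i)//=.
by rewrite lerDl sumr_ge0// => j _; rewrite -expr2 sqr_ge0.
Qed.

Lemma enorm_le_sum x : enorm x <= \sum_i `|x ord0 i|.
Proof.
rewrite -ler_sqr ?nnegrE ?enorm_ge0 ?sumr_ge0// enorm_sqr.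
rewrite expr2 mulr_suml ler_sum// => i _.
rewrite -expr2 -real_normK ?num_real// expr2 ler_wpM2l//.
by rewrite (bigD1 i)//= lerDl sumr_ge0.
Qed.

Lemma coord_le_norm x i : `|x ord0 i| <= `|x|.
Proof.
have [->|x0] := eqVneq x 0; first by rewrite mxE normr0.
rewrite [leRHS]/Num.norm/= mx_normrE.
exact: (le_bigmax _ (fun ij : 'I_1 * 'I_n => `|x ij.1 ij.2|) (ord0, i)).
Qed.

Lemma norm_leP x r : 0 <= r -> (forall i, `|x ord0 i| <= r) -> `|x| <= r.
Proof.
move=> r0 xr; rewrite [leLHS]/Num.norm/= mx_normrE.
by apply: bigmax_le => // -[i j] _ /=; rewrite ord1.
Qed.

Lemma norm_ltP x r : 0 < r -> `|x| < r <-> (forall i, `|x ord0 i| < r).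
Proof.
move=> r0; split => [xr i|xr]; first exact: le_lt_trans (coord_le_norm _ _) xr.
rewrite [ltLHS]/Num.norm/= mx_normrE.
by apply: bigmax_lt => // -[i j] _ /=; rewrite ord1.
Qed.

Lemma norm_le_enorm x : `|x| <= enorm x.
Proof. by apply: norm_leP => [|i]; [exact: enorm_ge0|exact: coord_le_enorm]. Qed.

Lemma enorm_le_norm x : enorm x <= n%:R * `|x|.
Proof.
apply: (le_trans (enorm_le_sum x)).
rewrite (le_trans (ler_sum _ (fun i _ => coord_le_norm x i)))//.
by rewrite sumr_const card_ord mulr_natl.
Qed.

Lemma enorm_delta i : enorm (delta_mx ord0 i : 'rV[R]_n) = 1.
Proof. by rewrite /enorm dot_delta mxE !eqxx sqrtr1. Qed.

Lemma cont_coord i : continuous (fun x : 'rV[R]_n => x ord0 i).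
Proof. by move=> x; exact: coord_continuous. Qed.

Lemma cvg_dot (T : Type) (F : set_system T) {FF : Filter F} (f g : T -> 'rV[R]_n)
  (a b : 'rV[R]_n) : f t @[t --> F] --> a -> g t @[t --> F] --> b ->
 dotprod (f t) (g t) @[t --> F] --> dotprod a b.
Proof.
move=> fa gb; rewrite /dotprod.
elim: (index_enum _) => [|i s IH].
 rewrite big_nil (_ : (fun _ => _) = cst 0); first exact: cvg_cst.
 by apply/funext => t; rewrite big_nil.
rewrite big_cons (_ : (fun _ => _) = (fun t => f t ord0 i * g t ord0 i +
 \sum_(j <- s) f t ord0 j * g t ord0 j)); last first.
 by apply/funext => t; rewrite big_cons.
apply: cvgD; last exact: IH.
apply: cvgM.
- exact: (cvg_comp _ _ fa (@cont_coord i a)).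
- exact: (cvg_comp _ _ gb (@cont_coord i b)).
Qed.

Lemma cont_enorm : continuous (@enorm R n).
Proof.
move=> x; apply: (@continuous_comp _ _ _ (fun y => dotprod y y) Num.sqrt).
 apply: (@cvg_dot _ (nbhs x) _ id id x x); exact: cvg_id.
exact: sqrt_continuous.
Qed.

End euclid.

(** * Boxes, cubes and translation invariance of Lebesgue measure *)

Section borel_rV.
Context {R : realType} {n : nat}.
Local Notation E := 'rV[R]_n.
Local Notation mu := (@lebesgue_rV R n).

Definition box (A : 'I_n -> set (measurableTypeR R)) : set E :=
 [set x | forall i, A i (x ord0 i)].

Lemma mbox A : (forall i, measurable (A i)) -> measurable (box A).
Proof.
move=> mA; rewrite (_ : box A = \bigcap_(i in [set: 'I_n])
  ((fun x : E => x ord0 i : measurableTypeR R) @^-1` A i)).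
 apply: fin_bigcap_measurable => // i _.
 by rewrite -[X in measurable X]setTI; exact: measurable_coord.
by apply/seteqP; split => x Ax i => [_|]; [exact: Ax|exact: (Ax i I)].
Qed.

Lemma ball_box (x : E) r : 0 < r ->
 ball x r = box (fun i => `](x ord0 i - r), (x ord0 i + r)[%classic).
Proof.
move=> r0; apply/seteqP; split => y /=; rewrite -ball_normE/= norm_ltP// => h i.
 by have := h i; rewrite !mxE /= in_itv/= ltr_distlC.
by have := h i; rewrite /= in_itv/= !mxE ltr_distlC.
Qed.

Lemma mball_rV (x : E) r : measurable (ball x r : set E).
Proof.
have [r0|r0] := ltP 0 r; last by rewrite (_ : ball x r = set0)//; exact: le0_ball0.
by rewrite ball_box//; apply: mbox => i; exact: measurable_itv.
Qed.

Lemma lebesgue_ball (x : E) r : 0 < r -> mu (ball x r) = ((2 * r) ^+ n)%:E.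
Proof.
move=> r0.
rewrite ball_box// lebesgue_rV_box => [|i]; last exact: measurable_itv.
rewrite (eq_bigr (fun=> (2 * r)%:E)) => [|i _].
 by rewrite prodEFin prodr_const card_ord.
rewrite lebesgue_measure_itv/= lte_fin.
have -> : x ord0 i - r < x ord0 i + r by lra.
by rewrite -EFinD; congr (_%:E); ring.
Qed.

(** The sigma-algebra is generated by coordinates and not by the topology. An open set is the union
    of those max-norm balls with rational centre and radius [1/(k+1)] that it contains, and these
    balls are boxes. *)
Lemma mopen (U : set E) : open U -> measurable U.
Proof.
move=> oU.
pose q2r (q : 'rV[rat]_n) : E := map_mx ratr q.
(* An index whose ball is not contained in [U] contributes the empty set, so that the union runs
   over a fixed countable type. *)
pose B (p : 'rV[rat]_n * nat) : set E :=
 if pselect (ball (q2r p.1) (p.2.+1%:R^-1) `<=` U) then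
  ball (q2r p.1) (p.2.+1%:R^-1) else set0.
rewrite (_ : U = \bigcup_p B p).
 apply: countable_bigcupT_measurable => [|p]; first exact: countableP.
 by rewrite /B; case: pselect => h; [exact: mball_rV|exact: measurable0].
apply/seteqP; split => [x Ux|x [p _]]; last first.
 by rewrite /B; case: pselect => // h; exact: h.
have [e /= e0 eU] : exists2 e : R, 0 < e & ball x e `<=` U.
 by have := oU x Ux; rewrite -nbhs_ballE => -[e /= e0 xe]; exists e.
have [k ke] : exists k, k.+1%:R^-1 < e / 2.
 have e20 : 0 < e / 2 by lra.
 by have [k] := ltr_add_invr e20; rewrite add0r => ke; exists k.
have k0 : 0 < k.+1%:R^-1 :> R by rewrite invr_gt0.
have /choice[q xq] : forall i, exists q : rat, `|x ord0 i - ratr q| < k.+1%:R^-1.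
 move=> i; have [q] := @rat_in_itvoo R (x ord0 i - k.+1%:R^-1)
  (x ord0 i + k.+1%:R^-1) ltac:(by rewrite ltrD2l gtrN).
 by rewrite in_itv/= -ltr_distlC => xq; exists q.
have xb : ball (q2r (\row_i q i)) (k.+1%:R^-1) x.
 rewrite -ball_normE/= norm_ltP// => i.
 by rewrite !mxE distrC; exact: xq.
exists (\row_i q i, k) => //; rewrite /B/=; case: pselect => // -[].
apply: subset_trans eU => y yb.
apply: (@ball_splitl _ _ (q2r (\row_i q i)));
 apply: ball_sym; apply: (le_ball (ltW ke)) => //; exact: xb.
Qed.

Lemma cont_measurable_rV (f : E -> R) :
 continuous f -> mble f.
Proof.
move=> cf; apply: (measurability _ (RGenOpens.measurableE R)).
move=> _ [_ [a [b ->] <-]]; rewrite setTI.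
apply: mopen; apply: open_comp => //.
Qed.

Lemma menorm d (T : measurableType d) (f : T -> E) :
 mble f -> mble (fun t => enorm (f t)).
Proof.
move=> mf; apply: (mcomp (@enorm R n)) => //.
exact: cont_measurable_rV cont_enorm.
Qed.

Lemma mrV_coord d (T : measurableType d) (f : T -> E) i :
 mble f -> mble (fun t => f t ord0 i).
Proof. by move=> mf; exact: (measurableT_comp (measurable_coord i) mf). Qed.

Lemma mdot d (T : measurableType d) (f g : T -> E) :
 mble f -> mble g ->
 mble (fun t => dotprod (f t) (g t)).
Proof.
move=> mf mg; rewrite /dotprod; apply: measurable_sum => i.
by apply: measurable_funM; exact: mrV_coord.
Qed.

Lemma maddV d (T : measurableType d) (f g : T -> E) :
 mble f -> mble g ->
 mble (fun t => f t + g t).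
Proof.
move=> mf mg; apply: measurable_fun_rV => i; under eq_fun do rewrite mxE.
by apply: measurable_funD; exact: mrV_coord.
Qed.

Lemma mscalerV d (T : measurableType d) (a : T -> R) (f : T -> E) :
 mble a -> mble f ->
 mble (fun t => a t *: f t).
Proof.
move=> mf mg; apply: measurable_fun_rV => i; under eq_fun do rewrite mxE.
by apply: measurable_funM => //; exact: mrV_coord.
Qed.

Lemma moppV d (T : measurableType d) (f : T -> E) :
 mble f -> mble (fun t => - f t).
Proof.
move=> mf; apply: measurable_fun_rV => i; under eq_fun do rewrite mxE.
by apply: measurable_funN; exact: mrV_coord.
Qed.

Lemma mcvg_rV (f : E -> E) : continuous f -> mble f.
Proof.
move=> cf; apply: measurable_fun_rV => i; apply: cont_measurable_rV => x.
exact: (continuous_comp (cf x) (@cont_coord _ _ i (f x))).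
Qed.

Definition boxes : set (set E) :=
 [set box A | A in [set A | forall i, measurable (A i)]].

Lemma boxes_gen : @measurable _ E = <<s boxes >>.
Proof.
apply/seteqP; split.
 apply: smallest_sub; first exact: smallest_sigma_algebra.
 rewrite -bigcup_seq/= => _ [i _ [B mB <-]]; apply: sub_sigma_algebra.
 exists (fun j => if j == i then B else setT) => /=.
  by move=> j; case: ifP.
 rewrite setTI; apply/seteqP; split => x /=.
  by move/(_ i); rewrite eqxx.
 by move=> xB j; case: eqP => [->|].
apply: smallest_sub; first exact: sigma_algebra_measurable.
by move=> _ [A mA <-]; exact: mbox.
Qed.

Lemma boxesI : setI_closed boxes.
Proof.
move=> _ _ [A mA <-] [B mB <-]; exists (fun i => A i `&` B i).
 by move=> i; exact: measurableI.
apply/seteqP; split => x /=; first by move=> h; split => i; have [] := h i.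
by move=> [hA hB] i; split; [exact: hA|exact: hB].
Qed.

Definition cubeN k : set E := box (fun=> `](- k%:R), k%:R[%classic).

Lemma cubeN_cover : \bigcup_k cubeN k = setT.
Proof.
rewrite -subTset => x _; have [k xk] := ltr_add_invr (@ltr01 R).
exists (Num.truncn `|x|).+1 => // i /=; rewrite in_itv/= -ltr_norml.
by rewrite (le_lt_trans (coord_le_norm _ _))// truncnS_gt.
Qed.

Lemma mu_cubeN k : (mu (cubeN k) < +oo)%E.
Proof.
rewrite lebesgue_rV_box => [|i]; last exact: measurable_itv.
rewrite (eq_bigr (fun=> (fine (lebesgue_measure (`](- k%:R), (k%:R : R)[%classic : set R)))%:E)).
 by rewrite prodEFin ltry.
move=> i _; rewrite fineK// lebesgue_measure_itv/=; case: ifP => _ //.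
Qed.

Lemma lebesgue_measure_shift (t : R) (A : set (measurableTypeR R)) :
 measurable A -> lebesgue_measure ((fun x : R => x + t) @^-1` A) =
 lebesgue_measure A.
Proof.
move=> mA.
have mf : mble (fun x : measurableTypeR R => x + t : measurableTypeR R).
 exact: measurable_funD.
rewrite -[LHS]/(pushforward lebesgue_measure
 (fun x : measurableTypeR R => x + t : measurableTypeR R) A).
apply/esym/(@lebesgue_measure_unique R (pushforward lebesgue_measure
 (fun x : measurableTypeR R => x + t : measurableTypeR R))) => //.
move=> _ [[a b] /= _ <-]; rewrite /pushforward.
rewrite (_ : _ @^-1` _ = `](a - t), (b - t)]%classic); last first.
 by apply/seteqP; split => x /=; rewrite !in_itv/= ltrBlDr lerBrDr.
rewrite !lebesgue_measure_itv/= !lte_fin ltrD2r.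
by case: ifP => // _; rewrite -!EFinB; congr (_%:E); ring.
Qed.

Definition shiftr (z x : E) : E := x + z.

Lemma mshiftr z : mble (shiftr z).
Proof. by apply: maddV => //; exact: measurable_cst. Qed.

(** Both measures agree on boxes by invariance on the line. Boxes form a generating class closed
    under intersection, and the boxes [cubeN k] exhaust the space with finite measure, so uniqueness
    of measures applies. *)
Lemma lebesgue_shift z (A : set E) : measurable A ->
 mu (shiftr z @^-1` A) = mu A.
Proof.
move=> mA.
have := @measure_unique _ R _ boxes cubeN boxes_gen boxesI _ cubeN_cover
 mu (pushforward mu (shiftr z)).
move=> /(_ _ (mshiftr z) _ _ A mA) h; apply/esym/h.
- by move=> k; exists (fun=> `](- k%:R), k%:R[%classic).
- move=> _ [B mB <-]; rewrite /pushforward.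
 change (mu (box B) = mu (shiftr z @^-1` box B)).
 rewrite [in RHS](_ : _ @^-1` _ = box (fun i => (fun t => t + z ord0 i) @^-1` B i)).
  rewrite !lebesgue_rV_box//.
   apply: eq_bigr => i _.
   by apply/esym; exact: lebesgue_measure_shift.
  move=> i; rewrite -[X in measurable X]setTI.
  apply: (@measurable_funD _ _ _ _ id (cst (z ord0 i)) _ _ measurableT _ (mB i)) => //.
 by apply/seteqP; split => x /= hx i; have := hx i; rewrite mxE.
- by move=> k; exact: mu_cubeN.
Qed.

(** An open ball of the max norm: [r] is half of the side and the volume is [(2 * r) ^+ n]. This
    explains the powers of 2 in the covering constants. *)
Definition cube (x0 : E) (r : R) : set E := [set x | `|x - x0| < r].

Lemma cube_ball x0 r : cube x0 r = ball x0 r.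
Proof. by apply/seteqP; split => x; rewrite -ball_normE/= /cube/= distrC. Qed.

Lemma mcube x0 r : measurable (cube x0 r).
Proof. by rewrite cube_ball; exact: mball_rV. Qed.

Lemma mu_cube x0 r : 0 < r -> mu (cube x0 r) = ((2 * r) ^+ n)%:E.
Proof. by move=> r0; rewrite cube_ball lebesgue_ball. Qed.

Lemma open_cube x0 r : open (cube x0 r).
Proof. by rewrite cube_ball; exact: ball_open. Qed.

Lemma sub_cube x0 r s : r <= s -> cube x0 r `<=` cube x0 s.
Proof. by move=> rs x; rewrite /cube/= => /lt_le_trans; apply. Qed.

Lemma sub_cube_shift x0 (y : E) r s : `|y - x0| + r <= s -> cube y r `<=` cube x0 s.
Proof.
move=> h x; rewrite /cube/= => xr; apply: lt_le_trans h.
by rewrite -(subrKA y) (le_lt_trans (ler_normD _ _))// addrC ltrD2l.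
Qed.

End borel_rV.

(** * Convergence theorems for integrals of nonnegative functions *)

Section nn_integral.
Context d (T : measurableType d) (R : realType) (mu : {measure set T -> \bar R}).
Implicit Types (f g : T -> R) (D : set T).
Local Open Scope ereal_scope.

Lemma mEFin D f : mble f -> measurable_fun D (fun x => (f x)%:E).
Proof. by move=> mf; apply/measurable_EFinP; exact: measurable_funTS. Qed.

Lemma int_ge0 D f : (forall x, D x -> (0 <= f x)%R) ->
 0 <= \int[mu]_(x in D) (f x)%:E.
Proof. by move=> f0; apply: integral_ge0 => x Dx; rewrite lee_fin f0. Qed.

Lemma int_le D f g : measurable D ->
 mble f -> mble g ->
 (forall x, D x -> (0 <= f x)%R) -> (forall x, D x -> (f x <= g x)%R) ->
 \int[mu]_(x in D) (f x)%:E <= \int[mu]_(x in D) (g x)%:E.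
Proof.
move=> mD mf mg f0 fg; apply: ge0_le_integral => //; try exact: mEFin.
Qed.

Lemma int_D D f g : measurable D ->
 mble f -> mble g ->
 (forall x, D x -> (0 <= f x)%R) -> (forall x, D x -> (0 <= g x)%R) ->
 \int[mu]_(x in D) (f x + g x)%:E =
 \int[mu]_(x in D) (f x)%:E + \int[mu]_(x in D) (g x)%:E.
Proof.
move=> mD mf mg f0 g0; under eq_integral do rewrite EFinD.
by apply: ge0_integralD => //; exact: mEFin.
Qed.

Lemma int_Z D f k : measurable D -> mble f ->
 (forall x, D x -> (0 <= f x)%R) -> (0 <= k)%R ->
 \int[mu]_(x in D) (k * f x)%:E = k%:E * \int[mu]_(x in D) (f x)%:E.
Proof.
move=> mD mf f0 k0; under eq_integral do rewrite EFinM.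
by apply: ge0_integralZl_EFin => //; exact: mEFin.
Qed.

Lemma int_sum D I (s : seq I) (F : I -> T -> R) : measurable D ->
 (forall i, mble (F i)) ->
 (forall i x, D x -> (0 <= F i x)%R) ->
 \int[mu]_(x in D) (\sum_(i <- s) F i x)%:E =
 \sum_(i <- s) \int[mu]_(x in D) (F i x)%:E.
Proof.
move=> mD mF F0; under eq_integral do rewrite -sumEFin.
rewrite (ge0_integral_sum _ mD (f := fun i x => (F i x)%:E)) // => i.
exact: mEFin.
Qed.

Lemma int_sub D1 D2 f : measurable D1 -> measurable D2 -> D1 `<=` D2 ->
 mble f -> (forall x, D2 x -> (0 <= f x)%R) ->
 \int[mu]_(x in D1) (f x)%:E <= \int[mu]_(x in D2) (f x)%:E.
Proof.
move=> m1 m2 D12 mf f0; apply: ge0_subset_integral => //; try exact: mEFin.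
Qed.

Lemma lee_addeps_real (x : \bar R) (c : R) :
 (forall e : R, (0 < e)%R -> x <= (c + e)%:E) -> x <= c%:E.
Proof.
move=> h; apply/lee_addgt0Pr => e e0; rewrite -EFinD; exact: h.
Qed.

(** Fatou's lemma for bounds that hold only eventually and up to [e]. The sequence is shifted past
    the index [N] belonging to [e], after which every term obeys the bound. *)
Lemma int_fatou D (h : nat -> T -> R) f (c : R) : measurable D ->
 (forall k, mble (h k)) -> mble f ->
 (forall k x, D x -> (0 <= h k x)%R) -> (forall x, D x -> (0 <= f x)%R) ->
 {ae mu, forall x, D x -> (h k x @[k --> \oo] --> f x)%R} ->
 (forall e : R, (0 < e)%R ->
  exists N, forall k, (N <= k)%N -> \int[mu]_(x in D) (h k x)%:E <= (c + e)%:E) ->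
 \int[mu]_(x in D) (f x)%:E <= c%:E.
Proof.
move=> mD mh mf h0 f0 hf hc; apply: lee_addeps_real => e e0.
have [N hN] := hc e e0.
pose h' k x := (h (k + N)%N x)%:E.
have h'0 : forall k x, D x -> 0 <= h' k x by move=> k x Dx; rewrite lee_fin h0.
have mh' k : measurable_fun D (h' k) by exact: mEFin.
rewrite (via (\int[mu]_(x in D) limn_einf (h' ^~ x)))//.
 apply: ae_ge0_le_integral => //; first exact: mEFin.
 - move=> x Dx; rewrite limn_einf_lim; apply: lime_ge; first exact: is_cvg_einfs.
  by apply: nearW => k; apply: le_ereal_inf_tmp => _ [m /= _ <-]; exact: h'0.
 - rewrite (_ : (fun x => _) = \- (fun x => limn_esup (fun k => - h' k x))).
   apply: measurableT_comp; first exact: oppe_measurable.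
   apply: measurable_fun_limn_esup => k.
   by apply: measurableT_comp; first exact: oppe_measurable.
  apply/funext => x; rewrite -limn_einfN; congr limn_einf.
  by apply/funext => k; rewrite /comp oppeK.
 - apply: filterS hf => x hx Dx; have {}hx := hx Dx.
  have hx' : (h' k x @[k --> \oo] --> (f x)%:E).
   apply: cvg_EFin; first by apply: nearW => k.
   rewrite (_ : fine \o _ = [sequence h (k + N)%N x]_k)%R//.
   by rewrite (cvg_shiftn N (fun k => h k x)).
  by rewrite (cvg_limn_einf_sup hx').1.
apply: le_trans (fatou mu mD mh' h'0) _.
rewrite limn_einf_lim; apply: lime_le; first exact: is_cvg_einfs.
apply: nearW => k; apply: ge_ereal_inf; exists (\int[mu]_(x in D) h' k x) => //.
 by exists k => /=.
by apply: hN; rewrite leq_addl.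
Qed.

Lemma int_dct D (h : nat -> T -> R) f g : measurable D ->
 (forall k, mble (h k)) -> mble f ->
 mble g ->
 (forall k x, D x -> (`|h k x| <= g x)%R) ->
 {ae mu, forall x, D x -> (h k x @[k --> \oo] --> f x)%R} ->
 \int[mu]_(x in D) (g x)%:E < +oo ->
 forall e : R, (0 < e)%R -> exists N, forall k, (N <= k)%N ->
  \int[mu]_(x in D) (`|h k x - f x|)%:E <= e%:E.
Proof.
move=> mD mh mf mg hg hf ig e e0.
have g0 x : D x -> (0 <= g x)%R by move=> Dx; exact: le_trans (hg 0%N x Dx).
have := @dominated_convergence _ _ _ mu D mD (fun k x => (h k x)%:E)
 (EFin \o f) (EFin \o g) (fun k => mEFin (mh k)) (mEFin mf).
have hf' : \forall x \ae mu, D x -> (h k x)%:E @[k --> \oo] --> (EFin \o f) x.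
 apply: filterS hf => x hx Dx; apply: cvg_EFin; first by apply: nearW.
 exact: hx.
have ig' : mu.-integrable D (EFin \o g).
 apply/integrableP; split; first exact: mEFin.
 by under eq_integral => x /set_mem Dx do rewrite /= ger0_norm ?g0//.
have hg' : \forall x \ae mu, forall k, D x -> `|(h k x)%:E| <= (EFin \o g) x.
 by apply: aeW => x k Dx; rewrite /= lee_fin hg.
move=> /(_ hf' ig' hg')[_ + _].
move/fine_cvgP => [fin /cvgrPdist_le/(_ e e0)[N _ hN]].
have [M _ hM] := fin.
exists (maxn N M) => k; rewrite geq_max => /andP[Nk Mk].
have /= := hN _ Nk; rewrite sub0r normrN => hk.
rewrite -[leLHS]fineK; last exact: hM.
rewrite lee_fin; apply: le_trans hk; rewrite ler_norm//.
Qed.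

(** The series of the [h k] has integral at most 2, hence is finite almost everywhere, and the terms
    of a convergent series tend to 0. *)
Lemma int_ae_cvg0 D (h : nat -> T -> R) : measurable D ->
 (forall k, mble (h k)) ->
 (forall k x, D x -> (0 <= h k x)%R) ->
 (forall k, \int[mu]_(x in D) (h k x)%:E <= (2^-1 ^+ k)%:E) ->
 {ae mu, forall x, D x -> (h k x @[k --> \oo] --> 0)%R}.
Proof.
move=> mD mh h0 hc.
have mh' k : measurable_fun D (fun x => (h k x)%:E) by exact: mEFin.
have h'0 k x : D x -> 0 <= (h k x)%:E by move=> Dx; rewrite lee_fin h0.
have fs : \int[mu]_(x in D) (\sum_(0 <= k <oo) (h k x)%:E) < +oo.
 rewrite integral_nneseries//.
 apply: (@le_lt_trans _ _ (\sum_(0 <= k <oo) ((2^-1 ^+ k : R)%:E))).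
  apply: lee_nneseries => [k _ _|k _]; last exact: hc.
  by apply: integral_ge0 => x; exact: h'0.
 rewrite (_ : \sum_(0 <= k <oo) _ = 2%:E) ?ltry//.
 apply/cvg_lim => //; rewrite (_ : (fun n => _) = EFin \o series (geometric 1 2^-1%R)).
  apply: cvg_EFin; first exact: nearW.
  rewrite [X in _ --> X](_ : 2%R = 1 / (1 - 2^-1))%R; last by field.
  by apply: cvg_geometric_series; rewrite ger0_norm; lra.
 by apply/funext => k; rewrite /= sumEFin; congr (_%:E); apply: eq_bigr => i _; rewrite /geometric/= mul1r.
have /integrable_ae : mu.-integrable D (fun x => \sum_(0 <= k <oo) (h k x)%:E).
 apply/integrableP; split.
  by apply: ge0_emeasurable_sum => // k x Dx _; exact: h'0.
 under eq_integral => x /set_mem Dx.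
  rewrite gee0_abs; last by apply: nneseries_ge0 => k _ _; exact: h'0.
  over.
 exact: fs.
move=> /(_ mD); apply: filterS => x hx Dx.
have {}hx := hx Dx.
apply: (@cvg_series_cvg_0 _ _ (fun k => h k x)).
apply: nondecreasing_is_cvgn.
 by apply: nondecreasing_series => k _ _; exact: h0.
exists (fine (\sum_(0 <= k <oo) (h k x)%:E)) => _ [k _ <-].
rewrite -lee_fin fineK// /series/= -sumEFin.
by apply: nneseries_lim_ge => i _ _; exact: h'0.
Qed.

Lemma int_ae_subseq D (h : nat -> T -> R) : measurable D ->
 (forall k, mble (h k)) ->
 (forall k x, D x -> (0 <= h k x)%R) ->
 (forall e : R, (0 < e)%R -> exists N, forall k, (N <= k)%N ->
  \int[mu]_(x in D) (h k x)%:E <= e%:E) ->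
 exists phi : nat -> nat, (forall k, (k <= phi k)%N) /\
  {ae mu, forall x, D x -> (h (phi k) x @[k --> \oo] --> 0)%R}.
Proof.
move=> mD mh h0 hc.
have /choice[phi hphi] : forall k, exists N, (k <= N)%N /\
  \int[mu]_(x in D) (h N x)%:E <= (2^-1 ^+ k)%:E.
 move=> k; have [|N hN] := hc (2^-1 ^+ k)%R; first by rewrite exprn_gt0.
 by exists (maxn k N); split; [exact: leq_maxl|apply: hN; exact: leq_maxr].
exists phi; split => [k|]; first by have [] := hphi k.
apply: (@int_ae_cvg0 D (fun k => h (phi k))) => // [k x Dx|k]; first exact: h0.
by have [] := hphi k.
Qed.

Lemma cvgn_geom (u : nat -> R) K :
 (forall k, (K <= k)%N -> `|u k.+1 - u k| <= 2^-1 ^+ k)%R -> cvgn u.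
Proof.
move=> uK.
have u2 k j : (K <= k)%N -> (`|u (k + j)%N - u k| <= 2 * 2^-1 ^+ k * (1 - 2^-1 ^+ j))%R.
 move=> Kk; elim: j => [|j IH].
  by rewrite addn0 subrr normr0 expr0 subrr mulr0.
 rewrite addnS -(subrKA (u (k + j)%N)).
 apply: (le_trans (ler_normD _ _)).
 apply: (le_trans (lerD (uK _ (leq_trans Kk (leq_addr _ _))) IH)).
 by rewrite exprD exprS le_eqVlt; apply/orP; left; apply/eqP; field.
apply/cauchy_cvgP; apply/cauchy_ballP => e e0.
have := @cvg_expr R (2^-1)%R; rewrite ger0_norm ?invr_ge0// invf_lt1 ?ltr1n// => /(_ isT).
move=> /cvgrPdist_lt /(_ (e / 4)%R); case; first by rewrite divr_gt0.
move=> N _ hN; pose M := maxn N K.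
have H k : (M <= k)%N -> (`|u k - u M| < e / 2)%R.
 move=> Mk; rewrite -(subnKC Mk).
 have KM : (K <= M)%N by exact: leq_maxr.
 apply: (le_lt_trans (u2 _ _ KM)).
 have := hN M (leq_maxl _ _); rewrite sub0r normrN ger0_norm ?exprn_ge0// => hM.
 have x0 : (0 <= 2^-1 ^+ (k - M) :> R)%R by rewrite exprn_ge0.
 have y0 : (0 <= 2^-1 ^+ M :> R)%R by rewrite exprn_ge0.
 nra.
exists (u @` [set k | (M <= k)%N], u @` [set k | (M <= k)%N]).
 by split; exists M => // k Mk; exists k.
move=> [_ _] /= [[i Mi <-] [j Mj <-]].
rewrite -ball_normE/= -(subrKA (u M)) (le_lt_trans (ler_normD _ _))//.
by rewrite [in ltRHS](splitr e) ltrD ?H// distrC H.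
Qed.

(** Riesz-Fischer. Along a subsequence with squared distances at most [8^-k], the functions [4^k]
    times the squared increments have integrals at most [2^-k], so almost everywhere the increments
    are eventually below [2^-k] and the subsequence converges. Fatou then bounds the distance of
    [f i] to the limit. *)
Lemma L2_complete D (f : nat -> T -> R) : measurable D ->
 (forall k, mble (f k)) ->
 (forall e : R, (0 < e)%R -> exists N, forall i j, (N <= i)%N -> (N <= j)%N ->
  \int[mu]_(x in D) ((f i x - f j x) ^+ 2)%:E <= e%:E) ->
 exists g : T -> R, mble g /\
  forall e : R, (0 < e)%R -> exists N, forall i, (N <= i)%N ->
  \int[mu]_(x in D) ((f i x - g x) ^+ 2)%:E <= e%:E.
Proof.
move=> mD mf fC.
have /choice[phi_ phi_P0] : forall k, exists N, (k <= N)%N /\ forall i j, (N <= i)%N ->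
  (N <= j)%N -> \int[mu]_(x in D) ((f i x - f j x) ^+ 2)%:E <= (8^-1 ^+ k)%:E.
 move=> k; have [|N hN] := fC (8^-1 ^+ k)%R; first by rewrite exprn_gt0.
 exists (maxn k N); split; first exact: leq_maxl.
 by move=> i j; rewrite !geq_max => /andP[_ Ni] /andP[_ Nj]; exact: hN.
have phi_P k := (phi_P0 k).2.
pose phi := fix F k := if k is k'.+1 then maxn (F k') (phi_ k) else phi_ 0%N.
have phi_le k : (phi_ k <= phi k)%N by case: k => //= k; exact: leq_maxr.
have phi_mono k : (phi k <= phi k.+1)%N by exact: leq_maxl.
have phi_phi k j : (k <= j)%N -> (phi_ k <= phi j)%N.
 move=> kj; apply: leq_trans (phi_le k) _.
 by rewrite -(subnKC kj); elim: (j - k)%N => [|l IH]; rewrite ?addn0// addnS (leq_trans IH).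
have msq i j : mble (fun x => (f i x - f j x) ^+ 2)%R.
 by apply: measurable_funX; apply: measurable_funB.
pose dk k x := (4 ^+ k * (f (phi k.+1) x - f (phi k) x) ^+ 2)%R.
have mdk k : mble (dk k) by apply: measurable_funM.
have dk0 k x : D x -> (0 <= dk k x)%R.
 by move=> _; rewrite /dk mulr_ge0 ?sqr_ge0 ?exprn_ge0.
have idk k : \int[mu]_(x in D) (dk k x)%:E <= (2^-1 ^+ k)%:E.
 rewrite int_Z ?exprn_ge0// => [|x _]; rewrite ?sqr_ge0//.
 rewrite (_ : 2^-1 = 4 * 8^-1)%R; last by field.
 rewrite exprMn EFinM lee_wpmul2l ?lee_fin ?exprn_ge0//.
 by apply: phi_P => //; exact: leq_trans (phi_le k) _.
have hdk := int_ae_cvg0 mD mdk dk0 idk.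
(* A limit superior is measurable whether or not the sequence converges; [fine] gives a harmless
   value on the exceptional null set. *)
pose g x := fine (limn_esup (fun k => (f (phi k) x)%:E)).
have fg : {ae mu, forall x, D x -> (f (phi k) x @[k --> \oo] --> g x)%R}.
 apply: filterS hdk => x hx Dx; have {}hx := hx Dx.
 have [K _ hK] : \forall k \near \oo, (dk k x <= 1)%R.
  move/cvgrPdist_le : hx => /(_ 1%R ltr01); apply: filterS => k.
  by rewrite sub0r normrN => /(le_trans (ler_norm _)).
 have /cvg_ex[l ul] : cvgn (fun k => f (phi k) x).
  apply: (@cvgn_geom _ K) => k /hK; rewrite /dk => h1.
  rewrite -ler_sqr ?nnegrE ?exprn_ge0// real_normK ?num_real//.
  rewrite -(ler_pM2l (exprn_gt0 k (ltr0Sn R 3))) (le_trans h1)//.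
  by rewrite -exprM mulnC exprM -exprMn (_ : 4 * 2^-1 ^+ 2 = 1)%R ?expr1n//; field.
 suff -> : g x = l by [].
 have ul' : ((f (phi k) x)%:E @[k --> \oo] --> l%:E).
  by apply: cvg_EFin => //; exact: nearW.
 by rewrite /g (cvg_limn_einf_sup ul').2.
have mg : mble g.
 apply: (measurableT_comp (fine_measurable measurableT)).
 by apply: measurable_fun_limn_esup => k; exact: mEFin.
exists g; split => // e e0.
have [N hN] := fC e e0; exists N => i Ni.
apply: (@int_fatou D (fun k x => (f i x - f (phi k) x) ^+ 2)%R) => //.
- by apply: measurable_funX; apply: measurable_funB.
- by move=> k x _; exact: sqr_ge0.
- by move=> x _; exact: sqr_ge0.
- apply: filterS fg => x hx Dx; have {}hx := hx Dx.
 by rewrite expr2; apply: cvgM; (apply: cvgB; [exact: cvg_cst|exact: hx]).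
- move=> e' e'0; exists N => k Nk'.
 have Nk : (N <= phi k)%N.
  by apply: leq_trans (phi_le k); apply: leq_trans (phi_P0 k).1.
 by apply: le_trans (hN i _ Ni Nk) _; rewrite lee_fin lerDl ltW.
Qed.

End nn_integral.

(** * Continuity of translations in L^1 *)

Section translation.
Context {R : realType} {n : nat}.
Local Notation E := 'rV[R]_n.
Local Notation mu := (@lebesgue_rV R n).
Implicit Types (f g : E -> R) (D : set E).
Local Open Scope ereal_scope.

Lemma mshiftf d (U : measurableType d) (f : E -> U) (z : E) :
 mble f -> mble (fun x : E => f (x + z)%R).
Proof. by move=> mf; exact: (measurableT_comp mf (mshiftr z)). Qed.

Lemma int_shift D f z : measurable D -> mble f ->
 (forall x, D x -> (0 <= f x)%R) ->
 \int[mu]_(x in shiftr z @^-1` D) (f (x + z)%R)%:E = \int[mu]_(x in D) (f x)%:E.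
Proof.
move=> mD mf f0.
have fD : {in D, forall x, 0 <= (EFin \o f) x} by move=> x /set_mem Dx; rewrite lee_fin f0.
apply: etrans (esym (ge0_integral_pushforward (mshiftr z) mu mD (mEFin mf) fD)) _.
apply: (@eq_measure_integral _ _ _ D mu) => [|m A mA _].
 exact: mshiftr.
exact: (lebesgue_shift z mA).
Qed.

Lemma int_shiftT f z : mble f -> (forall x, (0 <= f x)%R) ->
 \int[mu]_x (f (x + z)%R)%:E = \int[mu]_x (f x)%:E.
Proof. by move=> mf f0; rewrite -(int_shift z measurableT mf). Qed.

Lemma int_shift_cube (x0 z : E) r f : mble f ->
 (forall x, (0 <= f x)%R) ->
 \int[mu]_(x in cube x0 r) (f (x + z)%R)%:E =
 \int[mu]_(x in cube (x0 + z)%R r) (f x)%:E.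
Proof.
move=> mf f0.
have := int_shift z (mcube (x0 + z)%R r) mf (fun x _ => f0 x).
suff -> : shiftr z @^-1` cube (x0 + z)%R r = cube x0 r by exact.
have xz (x : E) : (x + z - (x0 + z) = x - x0)%R by rewrite opprD addrACA subrr addr0.
by apply/seteqP; split => x; rewrite /preimage/mkset /cube/mkset /shiftr xz.
Qed.

Lemma int_shift_cube_le (x0 z : E) r s f : mble f ->
 (forall x, (0 <= f x)%R) -> (`|z| + r <= s)%R ->
 \int[mu]_(x in cube x0 r) (f (x + z)%R)%:E <= \int[mu]_(x in cube x0 s) (f x)%:E.
Proof.
move=> mf f0 zrs; rewrite int_shift_cube//.
apply: (int_sub _ (mcube _ _) (mcube _ _) _ mf) => //.
by apply: sub_cube_shift; rewrite addrAC subrr add0r.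
Qed.

Definition tc f := forall e : R, (0 < e)%R -> exists d : R, (0 < d)%R /\
 forall z : E, (`|z| < d)%R -> \int[mu]_x (`|f (x + z)%R - f x|)%:E <= e%:E.

Lemma mabsB f g : mble f -> mble g ->
 mble (fun x => `|f x - g x|)%R.
Proof. by move=> mf mg; apply: measurableT_comp => //; exact: measurable_funB. Qed.

Lemma tc_approx f : mble f ->
 (forall e : R, (0 < e)%R -> exists g, [/\ mble g, tc g &
  \int[mu]_x (`|f x - g x|)%:E <= e%:E]) -> tc f.
Proof.
move=> mf fg e e0; have [|g [mg tg fge]] := fg (e / 3)%R; first by rewrite divr_gt0.
have [|d [d0 hd]] := tg (e / 3)%R; first by rewrite divr_gt0.
exists d; split=> // z zd.
have m1 := mabsB mf mg.
have m1z : mble (fun x : E => `|f (x + z)%R - g (x + z)%R|)%R.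
 exact: (@mshiftf _ _ (fun x => `|f x - g x|)%R).
have m2 : mble (fun x : E => `|g (x + z)%R - g x|)%R.
 by apply: mabsB => //; exact: mshiftf.
apply: (via (\int[mu]_x (`|f (x + z)%R - g (x + z)%R| +
 (`|g (x + z)%R - g x| + `|f x - g x|))%:E)).
 apply: int_le => //.
 - by apply: mabsB => //; exact: mshiftf.
 - by apply: measurable_funD => //; exact: measurable_funD.
 - move=> x _; rewrite -(subrKA (g (x + z)%R)) (le_trans (ler_normD _ _))//.
  rewrite lerD2l -(subrKA (g x)) (le_trans (ler_normD _ _))//.
  by rewrite lerD2l distrC.
rewrite int_D//; [|exact: measurable_funD].
rewrite int_D// (int_shiftT z m1)//.
rewrite [e](_ : _ = e / 3 + (e / 3 + e / 3))%R; last by field.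
by rewrite !EFinD leeD// leeD// hd.
Qed.

Lemma tc_add f g : mble f -> mble g ->
 tc f -> tc g -> tc (fun x => f x + g x)%R.
Proof.
move=> mf mg tf tg e e0.
have [|d [d0 hd]] := tf (e / 2)%R; first by rewrite divr_gt0.
have [|d' [d'0 hd']] := tg (e / 2)%R; first by rewrite divr_gt0.
exists (Num.min d d'); split => [|z]; first by rewrite lt_min d0.
rewrite lt_min => /andP[zd zd'].
have m1 : mble (fun x : E => `|f (x + z)%R - f x|)%R.
 by apply: mabsB => //; exact: mshiftf.
have m2 : mble (fun x : E => `|g (x + z)%R - g x|)%R.
 by apply: mabsB => //; exact: mshiftf.
apply: (via (\int[mu]_x (`|f (x + z)%R - f x| + `|g (x + z)%R - g x|)%:E)).
 apply: int_le => //.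
 - apply: (@mabsB (fun x : E => f (x + z)%R + g (x + z)%R)%R (fun x => f x + g x)%R).
   by apply: measurable_funD; exact: mshiftf.
  exact: measurable_funD.
 - exact: measurable_funD.
 - by move=> x _; rewrite opprD addrACA ler_normD.
by rewrite int_D// [e]splitr EFinD leeD ?hd ?hd'.
Qed.

Lemma tc_scale f k : mble f -> tc f -> tc (fun x => k * f x)%R.
Proof.
move=> mf tf e e0.
have [|d [d0 hd]] := tf (e / (`|k| + 1))%R.
 by rewrite divr_gt0// ltr_wpDl.
exists d; split => // z /hd {}hd.
under eq_integral do rewrite -mulrBr normrM.
rewrite int_Z//; last by apply: mabsB => //; exact: mshiftf.
apply: (le_trans (lee_wpmul2l _ hd)); first by rewrite lee_fin.
rewrite -EFinM lee_fin mulrCA ler_piMr ?(ltW e0)//.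
by rewrite ler_pdivrMr ?mul1r ?ltr_wpDl// lerDl.
Qed.

(** Open sets are the generating class from which the induction of [tc_set] starts. *)
Lemma open_measurable_gen : @measurable _ E = <<s [set U : set E | open U] >>.
Proof.
apply/seteqP; split; last first.
 apply: smallest_sub; first exact: sigma_algebra_measurable.
 by move=> U; exact: mopen.
apply: smallest_sub; first exact: smallest_sigma_algebra.
rewrite -bigcup_seq/= => _ [i _ [B mB <-]]; rewrite setTI.
have sG := @smallest_sigma_algebra _ setT [set U : set E | open U].
suff : @measurable _ (measurableTypeR R) `<=`
  [set B | <<s [set U : set E | open U] >> ((fun x : E => x ord0 i) @^-1` B)].
 by apply.
rewrite (_ : @measurable _ (measurableTypeR R) = <<s (@RGenOpens.G R) >>); last first.
 exact: RGenOpens.measurableE.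
apply: smallest_sub.
 split => /=.
 - by rewrite preimage_set0; case: sG.
 - by move=> A; rewrite setTD preimage_setC; case: sG => _ + _ => /[apply]; rewrite setTD.
 - by move=> F hF; rewrite preimage_bigcup; case: sG => _ _; apply.
move=> A [a [b ->]] /=; apply: sub_sigma_algebra => /=.
by apply: open_comp => // x _; exact: cont_coord.
Qed.

Lemma mindicT (D : set E) : measurable D -> mble (\1_D : E -> R).
Proof. by move=> mD; exact: measurable_indic. Qed.

Lemma norm_maxB (a b : R) : (`|b - a| = (b - a) + 2 * Num.max (a - b) 0)%R.
Proof.
case: (leP a b) => ab.
 by rewrite ger0_norm ?subr_ge0// max_r ?mulr0 ?addr0// subr_le0.
rewrite ltr0_norm ?subr_lt0// max_l ?subr_ge0 1?ltW//; ring.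
Qed.

(** Along a sequence of shifts tending to 0, the positive part of [\1_U x - \1_U (x + z)] tends to 0
    pointwise because [U] is open, and [\1_U] dominates it. The negative part need not converge
    pointwise, at boundary points, but the two indicators have equal finite integrals, so by
    [norm_maxB] the integral of the modulus is twice that of the positive part. *)
Lemma tc_open (U : set E) : open U -> mu U < +oo -> tc (\1_U).
Proof.
move=> oU Ufin e e0; apply: contrapT => /forallNP H.
have /choice[z hz] : forall k : nat, exists z : E, (`|z| < k.+1%:R^-1)%R /\
  ~ \int[mu]_x (`|\1_U (x + z)%R - \1_U x|)%:E <= e%:E.
 move=> k; apply: contrapT => /forallNP Hk; apply: (H k.+1%:R^-1%R); split => //.
 by move=> z zk; apply: contrapT => h; exact: (Hk z).
have mU := mopen oU.
have m1 := mindicT mU.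
pose h k x : R := Num.max (\1_U x - \1_U (x + z k)%R)%R 0%R.
have mh k : mble (h k).
 apply: measurable_maxr => //.
 by apply: measurable_funB => //; exact: mshiftf.
have mz k : mble (fun x : E => \1_U (x + z k)%R : R) by exact: mshiftf.
have i1 : \int[mu]_x (\1_U x)%:E = mu U by rewrite integral_indic// setIT.
have iz k : \int[mu]_x (\1_U (x + z k)%R)%:E = mu U by rewrite int_shiftT.
have hle k x : setT x -> (`|h k x| <= \1_U x)%R.
 move=> _; rewrite ger0_norm ?le_max ?lexx ?orbT// ge_max.
 by rewrite gerBl !indicE; do 2 case: (_ \in _); rewrite ?lexx ?ler01.
have hcv : {ae mu, forall x, setT x -> (h k x @[k --> \oo] --> cst 0%R x)%R}.
 apply: aeW => x _; rewrite /h.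
 have [xU|xU] := boolP (x \in U); last first.
  apply: cvg_near_cst; apply: nearW => k.
  by rewrite indicE (negbTE xU) sub0r max_r// oppr_le0 indicE.
 have [r /= r0 rU] : exists2 r : R, (0 < r)%R & ball x r `<=` U.
  by have := oU x (set_mem xU); rewrite -nbhs_ballE => -[r /= r0 xr]; exists r.
 have [N hN] := ltr_add_invr r0; rewrite add0r in hN.
 apply: cvg_near_cst; exists N => // k /= Nk.
 have xzU : U (x + z k)%R.
  apply: rU; rewrite -ball_normE/= opprD addrA subrr sub0r normrN.
  apply: lt_trans (hz k).1 _; apply: le_lt_trans hN.
  by rewrite lef_pV2 ?posrE ?ltr0Sn// ler_nat.
 by rewrite !indicE xU mem_set// subrr maxxx.
have iU : \int[mu]_x (\1_U x)%:E < +oo by rewrite i1.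
have e20 : (0 < e / 2)%R by rewrite divr_gt0.
have [N hN] := @int_dct _ _ _ mu setT h (cst 0%R) (\1_U) measurableT mh
 (measurable_cst _) m1 hle hcv iU _ e20.
have {hN} := hN N (leqnn _).
under eq_integral do rewrite /= subr0 ger0_norm ?le_max ?lexx ?orbT//.
move=> hN; apply: (hz N).2.
have : \int[mu]_x (`|\1_U (x + z N)%R - \1_U x| + \1_U x)%:E =
  \int[mu]_x (\1_U (x + z N)%R + 2 * h N x)%:E.
 apply: eq_integral => x _; congr (_%:E); rewrite norm_maxB /h.
 by rewrite addrAC subrK.
have h0 x : setT x -> (0 <= 2 * h N x)%R by rewrite mulr_ge0 ?le_max ?lexx ?orbT.
have a1 : mble (fun x : E => `|\1_U (x + z N)%R - \1_U x| : R)%R by exact: mabsB.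
rewrite !int_D//; last exact: measurable_funM.
rewrite i1 iz addeC => /eqP; rewrite -ge0_fin_numE// in Ufin.
move=> /eqP/(congr1 (fun t => t - mu U)); rewrite !(addeC (mu U)) !addeK// => ->.
rewrite int_Z// => [|x _]; last by rewrite le_max lexx orbT.
apply: (le_trans (lee_wpmul2l _ hN)); first by rewrite lee_fin.
by rewrite -EFinM lee_fin mulrC divfK.
Qed.

End translation.
Section tc2.
Context {R : realType} {n : nat}.
Local Notation E := 'rV[R]_n.
Local Notation mu := (@lebesgue_rV R n).
Implicit Types (f g : E -> R) (D : set E).
Local Open Scope ereal_scope.

Lemma tc0 : tc (cst 0%R : E -> R).
Proof.
move=> e e0; exists 1%R; split=> // z _.
by under eq_integral do rewrite subrr normr0; rewrite integral0 lee_fin ltW.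
Qed.

(** Dynkin induction over [S], relative to a fixed open set [C] of finite measure: complements are
    then taken within [C], and [\1_C] dominates the countable disjoint unions. *)
Lemma tc_set (C S : set E) : open C -> mu C < +oo -> measurable S ->
 tc (\1_(S `&` C) : E -> R).
Proof.
move=> oC Cfin; have mC := mopen oC.
have m1C := mindicT mC.
have mI (A : set E) : measurable A -> mble (\1_(A `&` C) : E -> R).
 by move=> mA; apply: mindicT; exact: measurableI.
rewrite open_measurable_gen.
apply: (@dynkin_induction _ _ [set U : set E | open U]
 (fun S => tc (\1_(S `&` C) : E -> R))).
- exact: open_measurable_gen.
- by move=> A B /= oA oB; exact: openI.
- by rewrite setTI; exact: tc_open.
- move=> A /= oA; apply: tc_open; first exact: openI.
 apply: le_lt_trans Cfin; apply: le_measure; rewrite ?inE//.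
 by apply: measurableI => //; exact: mopen.
- move=> A mA tA.
 rewrite (_ : \1_(~` A `&` C) = (fun x => \1_C x + -1 * \1_(A `&` C) x)%R); last first.
  apply/funext => x; rewrite !indicE !in_setI in_setC.
  by case: (_ \in A); case: (_ \in C) => /=; rewrite ?mulr0 ?addr0// mulr1 subrr.
 apply: tc_add => //; first by apply: measurable_funM => //; exact: mI.
  exact: tc_open.
 by apply: tc_scale => //; exact: mI.
- move=> F mF tF hF.
 have mU := bigcupT_measurable F mF.
 apply: tc_approx; first exact: mI.
 move=> e e0.
 pose G k := \big[setU/set0]_(i < k) F i.
 have mG k : measurable (G k) by apply: bigsetU_measurable => i _.
 have tG k : tc (\1_(G k `&` C) : E -> R).
  elim: k => [|k IH].
   rewrite /G big_ord0 set0I indic0; exact: tc0.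
  rewrite (_ : \1_(G k.+1 `&` C) = (fun x => \1_(G k `&` C) x + \1_(F k `&` C) x)%R).
   by apply: tc_add => //; exact: mI.
  apply/funext => x; rewrite /G big_ord_recr/= !indicE !in_setI in_setU.
  have [xF|] := boolP (x \in F k); last by rewrite orbF addr0.
  have [xG|xG] := boolP (x \in _) => /=; last by rewrite add0r.
  exfalso; move: xG; rewrite inE -bigcup_mkord => -[i /= ik xi].
  have /trivIsetP/(_ i k I I) := tF; rewrite neq_ltn ik => /(_ isT) h.
  have : (F i `&` F k) x by split => //; exact: set_mem.
  by rewrite h.
 have [N hN] : exists N, \int[mu]_x (`|\1_(G N `&` C) x - \1_(\bigcup_k F k `&` C) x|)%:E <= e%:E.
  have H1 k x : setT x -> (`|(\1_(G k `&` C) x : R)| <= \1_C x)%R.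
   by move=> _; rewrite !indicE ger0_norm// in_setI; case: (_ \in C); rewrite ?andbF ?andbT ?ler_nat ?leq_b1.
  have H2 : {ae mu, forall x, setT x -> (\1_(G k `&` C) x : R)%R @[k --> \oo] --> (\1_(\bigcup_k F k `&` C) x : R)}.
   apply: aeW => x _; apply: cvg_near_cst.
   have [xF|xF] := pselect ((\bigcup_k F k) x); last first.
    apply: nearW => k; rewrite !indicE !in_setI; congr ((_ && _)%:R).
    rewrite (memNset xF); apply: memNset; rewrite /G -bigcup_mkord.
    by move=> [i _ xi]; apply: xF; exists i.
   have [i _ xi] := xF; exists i.+1 => // k /= ik.
   rewrite !indicE !in_setI; congr ((_ && _)%:R).
   by rewrite !mem_set// /G -bigcup_mkord; exists i.
  have H3 : \int[mu]_x (\1_C x)%:E < +oo by rewrite integral_indic// setIT.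
  have [N hN] := int_dct measurableT (fun k => mI _ (mG k)) (mI _ mU) m1C H1 H2 H3 e0.
  by exists N; exact: hN.
 exists (\1_(G N `&` C)); split => //; first exact: mI.
 by under eq_integral do rewrite distrC.
Qed.

Lemma tc_simple (h : {nnsfun E >-> R}) (C : set E) : open C -> mu C < +oo ->
 tc (fun x : E => h x * \1_C x)%R.
Proof.
move=> oC Cfin.
have mC := mopen oC.
have mi r : measurable (h @^-1` [set r]) by [].
rewrite (_ : (fun x => _) = (fun x => \sum_(r <- finmap.enum_fset (fset_set (range h))) r * \1_(h @^-1` [set r] `&` C) x)%R); last first.
 apply/funext => x; rewrite {1}(fimfunE h x) fsbig_finite//= mulr_suml.
 apply: eq_bigr => r _; rewrite -mulrA; congr (_ * _)%R.
 by rewrite !indicE in_setI -mulnb natrM.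
elim: (finmap.enum_fset _) => [|r s IH].
 by rewrite (_ : (fun x => _) = cst 0%R); [exact: tc0|apply/funext => x; rewrite big_nil].
rewrite (_ : (fun x => _) = (fun x => r * \1_(h @^-1` [set r] `&` C) x + \sum_(j <- s) (j * \1_(h @^-1` [set j] `&` C) x))%R); last first.
 by apply/funext => x; rewrite big_cons.
have mI r' : mble (\1_(h @^-1` [set r'] `&` C) : E -> R).
 by apply: mindicT; exact: measurableI.
apply: tc_add => //.
- exact: measurable_funM.
- by apply: measurable_sum => j; exact: measurable_funM.
- by apply: tc_scale => //; exact: tc_set.
Qed.

(** Simple approximations from below are cut to growing cubes, so that each of them is covered by
    [tc_simple]; dominated convergence makes them close to [f] in L^1. *)
Lemma tc_nonneg f : mble f -> (forall x, (0 <= f x)%R) ->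
 \int[mu]_x (f x)%:E < +oo -> tc f.
Proof.
move=> mf f0 fi; apply: tc_approx => // e e0.
pose h k := nnsfun_approx measurableT (mEFin mf) k.
pose C k := cube (0 : E) k.+1%:R.
have Cfin k : mu (C k) < +oo by rewrite mu_cube// ltry.
pose g k x := (h k x * \1_(C k) x)%R.
have mg k : mble (g k).
 by apply: measurable_funM => //; apply: mindicT; exact: mcube.
have hf k x : (h k x <= f x)%R.
 have hc := cvg_nnsfun_approx measurableT (mEFin mf) (fun x _ => f0 x) (I : setT x).
 have hr : h j x @[j --> \oo] --> f x by exact: (fine_cvg hc).
 have nd : nondecreasing_seq (fun j => h j x).
  move=> i j ij.
  by have /lefP := nd_nnsfun_approx measurableT (mEFin mf) ij; apply.
 rewrite -(cvg_lim _ hr)//; apply: (nondecreasing_cvgn_le nd).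
 by apply/cvg_ex; exists (f x).
have h0 k x : (0 <= h k x)%R by [].
have H1 k x : setT x -> (`|g k x| <= f x)%R.
 move=> _; rewrite ger0_norm; last by rewrite mulr_ge0// indicE.
 by apply: le_trans (hf k x); rewrite ler_piMr// indicE.
have H2 : {ae mu, forall x, setT x -> g k x @[k --> \oo] --> f x}.
 apply: aeW => x _.
 have hc := cvg_nnsfun_approx measurableT (mEFin mf) (fun x _ => f0 x) (I : setT x).
 have hr : h j x @[j --> \oo] --> f x by exact: (fine_cvg hc).
 rewrite -[f x]mulr1; apply: cvgM => //; apply: cvg_near_cst.
 exists (Num.truncn `|x|) => // k /= xk; rewrite indicE mem_set//.
 rewrite /C/cube/= subr0 (lt_le_trans (truncnS_gt _))// ler_nat.
 exact: leq_ltn_trans xk _.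
have [N hN] := int_dct measurableT mg mf mf H1 H2 fi e0.
exists (g N); split => //.
 by apply: tc_simple => //; exact: open_cube.
under eq_integral do rewrite distrC.
by have := hN N (leqnn _).
Qed.

Lemma tc_integrable f : L1 mu f -> tc f.
Proof.
move=> /integrableP[/measurable_EFinP mf fi].
have mp : mble (fun x => Num.max (f x) 0)%R.
 by apply: measurable_maxr.
have mn : mble (fun x => Num.max (- f x) 0)%R.
 by apply: measurable_maxr => //; exact: measurable_funN.
have m0 : mble (fun x => `|f x|)%R by exact: measurableT_comp.
have tp : tc (fun x => Num.max (f x) 0)%R.
 apply: tc_nonneg => // [x|]; first by rewrite le_max lexx orbT.
 apply: le_lt_trans fi; apply: int_le => // x _; first by rewrite le_max lexx orbT.
 by rewrite ge_max normr_ge0 ler_norm.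
have tn : tc (fun x => Num.max (- f x) 0)%R.
 apply: tc_nonneg => // [x|]; first by rewrite le_max lexx orbT.
 apply: le_lt_trans fi; apply: int_le => // x _; first by rewrite le_max lexx orbT.
 by rewrite ge_max normr_ge0 -normrN ler_norm.
rewrite (_ : f = (fun x => Num.max (f x) 0 + -1 * Num.max (- f x) 0)%R).
 by apply: tc_add => //; [exact: measurable_funM|exact: tc_scale].
apply/funext => x; case: (leP (f x) 0%R) => h.
 rewrite max_l ?oppr_ge0//; ring.
by rewrite max_r ?oppr_le0 1?ltW// mulr0 addr0.
Qed.

End tc2.

(* Closes goals about functions introduced later; redefined as they appear. *)
Ltac pos_hook := fail.

Ltac pos :=
 lazy beta;
 match goal with
 | H : ?G |- ?G => exact H
 | |- is_true (@Order.le _ _ ?z ?x) =>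
  match x with
  | z => exact: lexx
  | @GRing.exp _ _ 2 => exact: sqr_ge0
  | @Num.norm _ _ _ => exact: normr_ge0
  | enorm _ => exact: enorm_ge0
  | \1_ _ _ => by rewrite indicE
  | @Algebra.natmul _ (@GRing.one _) _ => exact: ler0n
  | @GRing.one _ => exact: ler01
  | _ => pos_hook
  | @GRing.mul _ _ _ => apply: mulr_ge0; pos
  | @GRing.inv _ _ => rewrite invr_ge0; pos
  | @GRing.exp _ _ _ => apply: exprn_ge0; pos
  | @Algebra.add _ _ (@Algebra.opp _ _) => rewrite subr_ge0; solve [pos | by []]
  | @Algebra.add _ _ _ => apply: addr_ge0; pos
  | \sum_(_ <- _ | _) _ => apply: sumr_ge0 => ? _; pos
  | Rintegral _ _ _ => apply: Rintegral_ge0 => ? _; pos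
  | integral _ _ _ => apply: int_ge0 => ? _; pos
  | EFin _ => rewrite lee_fin; pos
  | @Algebra.add _ _ _ => first [rewrite lerDl; pos | rewrite lerDr; pos]
  | @GRing.mul _ _ _ => first [apply: ler_wpM2r; pos | apply: ler_wpM2l; pos]
  end
 | |- is_true (@Order.lt _ _ ?z ?x) =>
  match x with
  | @Algebra.natmul _ (@GRing.one _) _ => by rewrite ltr0n
  | @GRing.one _ => exact: ltr01
  | _ => pos_hook
  | @GRing.mul _ _ _ => apply: mulr_gt0; pos
  | @GRing.inv _ _ => rewrite invr_gt0; pos
  | @GRing.exp _ _ _ => apply: exprn_gt0; pos
  | @Algebra.add _ _ (@Algebra.opp _ _) => rewrite subr_gt0; solve [pos | by []]
  | @Algebra.add _ _ _ => first [apply: addr_gt0; pos | apply: ltr_wpDl; pos | apply: ltr_wpDr; pos]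
  | EFin _ => rewrite lte_fin; pos
  end
 | H : is_true (@Order.lt _ _ ?y ?x) |- is_true (@Order.le _ _ ?y ?x) => exact: ltW H
 | H : is_true (@Order.le _ _ (@GRing.one _) ?x) |- is_true (_ _ _ ?x) =>
  solve [exact: le_trans ler01 H | exact: lt_le_trans ltr01 H]
 | H : is_true (@Order.lt _ _ _ ?x) |- is_true (@Order.le _ _ _ ?x) => exact: ltW H
 | H : is_true (_ _ _ ?y), H' : is_true (@Order.le _ _ ?y ?x) |- is_true (_ _ _ ?x) =>
  solve [exact: le_trans H H' | exact: lt_le_trans H H']
 | |- is_true (~~ (@eq_op _ _ _)) => apply: lt0r_neq0; pos
 | |- (?x == _) = false => apply: gt_eqF; pos
 | H : forall _, _ |- is_true (_ _ _ _) => solve [apply: H; pos]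
 | |- is_true (_ && _) => apply/andP; split; pos
 | f := _ |- is_true (_ _ _ (?f _)) => rewrite /f; pos
 | f := _ |- is_true (_ _ _ ?f) => rewrite /f; pos
 end.

Ltac meas :=
 lazy beta;
 match goal with
 | H : ?G |- ?G => exact H
 | |- measurable_fun _ ?f =>
  match f with
  | (fun _ => ?c) => exact: measurable_cst
  | cst _ => exact: measurable_cst
  | (fun x => EFin _) => apply: mEFin; meas
  | (fun x => @GRing.mul _ _ _) => apply: measurable_funM; meas
  | (fun x => @Algebra.add _ _ (@Algebra.opp _ _)) => apply: measurable_funB; meas
  | (fun x => @Algebra.add _ _ _) => first [apply: measurable_funD; meas | apply: maddV; meas]
  | (fun x => @Algebra.opp _ _) => first [apply: measurable_funN; meas | apply: moppV; meas]
  | (fun x => @GRing.scale _ _ _ _) => apply: mscalerV; meas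
  | (fun x => @GRing.exp _ _ _) => apply: measurable_funX; meas
  | (fun x => @Num.norm _ _ _) => apply: measurableT_comp; [by []|meas]
  | (fun x => Num.max _ _) => apply: measurable_maxr; meas
  | (fun x => enorm _) => apply: menorm; meas
  | (fun x => dotprod _ _) => apply: mdot; meas
  | (fun x => \sum_(_ <- _ | _) _) => apply: measurable_sum => ?; meas
  | (fun x => fun_of_matrix _ _ _) => apply: mrV_coord; meas
  | \1_ _ => apply: mindicT; meas
  | (fun x => \1_ _ _) => apply: mindicT; meas
  | (fun x => fst _) => exact: measurable_fst
  | (fun x => snd _) => exact: measurable_snd
  | fst => exact: measurable_fst
  | snd => exact: measurable_snd
  | (fun x => ?f (@Algebra.add _ x ?z)) => apply: (@mshiftf _ _ _ _ f z); meas
  end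
 | |- measurable (cube _ _) => exact: mcube
 | |- measurable setT => exact: measurableT
 | H : measurable_fun _ ?f |- measurable_fun _ (fun x => ?f _) => apply: (measurableT_comp H); meas
 | H : forall _, _ |- measurable_fun _ _ => solve [apply: H; meas]
 | H : forall _, _ |- measurable _ => solve [apply: H; meas]
 | f := _ |- measurable_fun _ ?f => rewrite /f; meas
 | f := _ |- measurable_fun _ (fun x => ?f _) => rewrite /f; meas
 end.

Ltac side := intros; first [pos | meas].

(** * Nonlinearities a(t) = t sg(t): monotonicity, doubling and decay *)

Section slope_class.
Context {R : realType}.
Implicit Types (sg : R -> R) (m M s t : R).

(* Integrated form of [m <= t a'(t) / a(t) <= M] for [a t = t * sg t], stable
  under truncations of [sg]. *)
Definition slope m M sg := [/\ 0 < m <= 1, 1 <= M, forall t, 0 < t -> 0 < sg t &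
 forall s t, 0 < s -> s <= t ->
  sg t * ((1 - M) * t + M * s) <= s * sg s <= sg t * ((1 - m) * t + m * s)].

Lemma slope_mono m M sg s t : slope m M sg -> 0 < s -> s <= t ->
 s * sg s <= t * sg t.
Proof.
move=> [/andP[m0 m1] M1 p h] s0 st; have t0 := lt_le_trans s0 st.
have /andP[_ h1] := h s t s0 st; apply: (le_trans h1).
rewrite [leRHS]mulrC ler_pM2l ?p//; nra.
Qed.

Lemma slope_mono0 m M sg s t : slope m M sg -> 0 <= s -> s <= t ->
 s * sg s <= t * sg t.
Proof.
move=> h; rewrite le_eqVlt => /predU1P[<-|s0 st]; last exact: (slope_mono h).
rewrite mul0r le_eqVlt => /predU1P[<-|t0]; first by rewrite mul0r.
by rewrite mulr_ge0 ?(ltW t0)// ltW//; case: h => _ _ + _; apply.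
Qed.

Lemma slope_al_ge0 m M sg t : slope m M sg -> 0 <= t -> 0 <= t * sg t.
Proof. by move=> h t0; have := slope_mono0 h (lexx 0) t0; rewrite mul0r. Qed.

Lemma expr_small (c k : R) : 0 <= c < 1 -> 0 < k -> exists j, c ^+ j <= k.
Proof.
move=> /andP[c0 c1] k0.
have := @cvg_expr R c; rewrite ger0_norm// => /(_ c1)/cvgrPdist_le/(_ k k0)[N _].
move=> /(_ N (leqnn _)); rewrite sub0r normrN ger0_norm ?exprn_ge0// => h.
by exists N.
Qed.

(** The lower slope inequality at [s = th * u] reads a(th u) >= a(u)/2 for this choice of [th]. One
    step of ratio [th] thus loses a factor 2, and [j] steps with [th ^+ j <= 1/2] reach down to half
    of the argument. The constant depends on [M] alone. *)
Lemma slope_doubling M : 1 <= M -> exists D : R, 1 <= D /\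
 forall m sg, slope m M sg -> forall t, 0 < t -> 2 * t * sg (2 * t) <= D * (t * sg t).
Proof.
move=> M1; pose th := 1 - (2 * M)^-1.
have M0 : 0 < M by side.
have i1 : 0 < (2 * M)^-1 <= 2^-1.
 by rewrite invr_gt0 mulr_gt0//= lef_pV2 ?posrE ?mulr_gt0//; lra.
have th0 : 0 < th by rewrite /th; lra.
have [j hj] : exists j, th ^+ j <= 2^-1 by apply: expr_small => //; rewrite /th; lra.
exists (2 ^+ j); split; first by rewrite exprn_ege1// ler1n.
move=> m sg h t t0; have [_ _ p hh] := h.
have step u : 0 < u -> u * sg u <= 2 * (th * u * sg (th * u)).
 move=> u0; have /andP[+ _] := hh (th * u) u (mulr_gt0 th0 u0) ltac:(rewrite ler_piMl// ?(ltW u0)//; rewrite /th; lra).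
 rewrite (_ : (1 - M) * u + M * (th * u) = u / 2); last by rewrite /th; field; rewrite gt_eqF.
 have := p u u0; nra.
have iter i u : 0 < u -> u * sg u <= 2 ^+ i * (th ^+ i * u * sg (th ^+ i * u)).
 move=> u0; elim: i => [|i IH]; first by rewrite !expr0 !mul1r.
 apply: (le_trans IH); rewrite exprSr -[in leRHS]mulrA ler_pM2l ?exprn_gt0//.
 have := step (th ^+ i * u) (mulr_gt0 (exprn_gt0 _ th0) u0).
 by rewrite (mulrA th) -exprS.
have t20 : 0 < 2 * t by side.
apply: (le_trans (iter j _ t20)); rewrite ler_pM2l ?exprn_gt0//.
apply: (slope_mono h); first by side.
have : th ^+ j * (2 * t) <= 2^-1 * (2 * t) by side.
by rewrite mulKf.
Qed.

(** The upper slope inequality at [s = t/2] says that halving the argument multiplies a(t) by at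
    most [1 - m/2]; this is iterated. The ratio [r] depends on [m] and [k] alone. *)
Lemma slope_decay m : 0 < m <= 1 -> forall k : R, 0 < k -> exists r : R, 0 < r <= 1 /\
 forall M sg, slope m M sg -> forall t, 0 < t -> r * t * sg (r * t) <= k * (t * sg t).
Proof.
move=> m01 k k0.
have [j hj] : exists j, (1 - m / 2) ^+ j <= k by apply: expr_small => //; lra.
have r0 i : 0 < (2^-1 : R) ^+ i by side.
exists (2^-1 ^+ j); split; first by rewrite r0/= exprn_ile1//; lra.
move=> M sg h t t0; have [_ _ p hh] := h.
apply: (via ((1 - m / 2) ^+ j * (t * sg t))); last first.
 by apply: ler_wpM2r hj; exact: (slope_al_ge0 h (ltW t0)).
elim: j {hj} => [|j IH]; first by rewrite !expr0 !mul1r.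
have q0 : 0 < 2^-1 ^+ j * t by side.
have /andP[_] := hh (2^-1 ^+ j.+1 * t) (2^-1 ^+ j * t) ltac:(rewrite mulr_gt0//) ltac:(rewrite exprS -mulrA; lra).
rewrite [in X in _ <= X -> _]exprS => /le_trans; apply.
rewrite [leRHS](_ : _ = (1 - m / 2) * ((1 - m / 2) ^+ j * (t * sg t))); last by rewrite exprS mulrA.
rewrite [leLHS](_ : _ = (1 - m / 2) * (2^-1 ^+ j * t * sg (2^-1 ^+ j * t))); last by field.
by apply: ler_wpM2l IH; lra.
Qed.

(* Comparability of [sg] on dyadic ranges. *)
Lemma slope_comp M : 1 <= M -> exists D : R, 1 <= D /\
 forall m sg, slope m M sg -> forall s t, 0 < s -> s <= t -> t <= 2 * s ->
  sg t <= D * sg s /\ sg s <= 2 * sg t.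
Proof.
move=> M1; have [D [D1 hD]] := slope_doubling M1; exists D; split=> // m sg h s t s0 st ts.
have t0 := lt_le_trans s0 st.
have h1 := hD _ _ h s s0; have h2 := slope_mono h t0 ts; have h3 := slope_mono h s0 st.
have [_ _ p _] := h; have ps := p s s0; have pt := p t t0; split.
 have : t * sg t <= D * (t * sg s).
  by apply: (le_trans h2); apply: (le_trans h1); rewrite ler_wpM2l ?(le_trans ler01)// ler_wpM2r// ltW.
 by rewrite mulrCA ler_pM2l.
rewrite -(ler_pM2l s0); apply: (le_trans h3); rewrite mulrA ler_wpM2r ?(ltW pt)//.
by rewrite mulrC.
Qed.

End slope_class.

(** * Monotonicity and Lipschitz bounds of the vector field *)

Section slope_vector.
Context {R : realType} {n : nat}.
Implicit Types (sg : R -> R) (m M s t : R) (X Y : 'rV[R]_n).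

Definition Th sg X := sg (enorm X) *: X.

(** Separates a radial part, governed by the scalar function t sg(t), from an angular part, the
    defect in the Cauchy-Schwarz inequality. Both are nonnegative. *)
Lemma Th_dotE sg X Y : dotprod (Th sg X - Th sg Y) (X - Y) =
 (enorm X * sg (enorm X) - enorm Y * sg (enorm Y)) * (enorm X - enorm Y) +
 (sg (enorm X) + sg (enorm Y)) * (enorm X * enorm Y - dotprod X Y).
Proof.
rewrite /Th !dotBr !dotBl !dotZl -!enorm_sqr (dotC Y X); ring.
Qed.

Lemma sg_sum_comp M : 1 <= M -> exists D : R, 1 <= D /\
 forall m sg, slope m M sg -> forall s t, 0 <= s -> 0 < t -> s <= t ->
  sg (t + s) <= D * sg t /\ sg t <= 2 * sg (t + s).
Proof.
move=> M1; have [D [D1 hD]] := slope_comp M1; exists D; split=> // m sg h s t s0 t0 st.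
by apply: (hD _ _ h) => //; lra.
Qed.

(** Write t = |X| >= s = |Y| and d = X.Y. Then |X - Y|^2 = (t - s)^2 + 2 (ts - d), while the radial
    part of [Th_dotE] is at least m sg(t) (t - s)^2 and the angular part at least m sg(t) (ts - d).
    The remaining factor [D] replaces sg(t) by sg(t + s). *)
Lemma Th_mono m M : 0 < m <= 1 -> 1 <= M -> exists c : R, 0 < c /\
 forall sg, slope m M sg -> forall X Y,
 c * (sg (enorm X + enorm Y) * enorm (X - Y) ^+ 2) <=
 dotprod (Th sg X - Th sg Y) (X - Y).
Proof.
move=> m01 M1; have [D [D1 hD]] := sg_sum_comp M1.
have D0 : 0 < D by side.
have c0 : 0 < m / (2 * D) by rewrite divr_gt0 ?mulr_gt0//; lra.
exists (m / (2 * D)); split => // sg h X Y.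
have [_ _ p hh] := h.
wlog YX : X Y / enorm Y <= enorm X.
 move=> H; have [|/ltW] := leP (enorm Y) (enorm X); first exact: H.
 move=> /H; rewrite addrC enormB -(opprB X Y) -(opprB (Th sg X)).
 by rewrite dotNl dotNr opprK.
have [X0|X0] := eqVneq X 0.
 have Y0 : Y = 0.
  apply: enorm_eq0; apply/eqP; rewrite eq_le enorm_ge0 andbT (le_trans YX)//.
  by rewrite X0 enorm0.
 by rewrite X0 Y0 !subr0 enorm0 expr0n/= !mulr0 dot0r.
have t0 := enorm_gt0 X0; have s0 := enorm_ge0 Y.
rewrite Th_dotE enormBsqr.
have cs := dot_norm_le X Y.
have [h1 _] := hD _ _ h _ _ s0 t0 YX.
move: (enorm X) (enorm Y) (dotprod X Y) t0 s0 YX cs h1 => t s d t0 s0 st cs h1.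
have pt := p t t0.
have sl : m * sg t * (t - s) <= t * sg t - s * sg s.
 move: s0; rewrite le_eqVlt => /predU1P[<-|s0].
  rewrite mul0r !subr0; have := mulr_ge0 (ltW pt) (ltW t0); nra.
 have /andP[_] := hh s t s0 st; lra.
have tsd : 0 <= t * s - d by rewrite subr_ge0 (le_trans (ler_norm _) cs).
have sgs : 0 <= sg s * (t * s - d).
 move: s0; rewrite le_eqVlt => /predU1P[s0|s0]; last by rewrite mulr_ge0 ?(ltW (p _ s0)).
 by move: cs; rewrite -s0 mulr0 normr_le0 => /eqP ->; rewrite subrr mulr0.
have q : m / (2 * D) * sg (t + s) <= m / 2 * sg t.
 rewrite invfM mulrA -[leLHS]mulrA ler_wpM2l//; first by lra.
 by rewrite ler_pdivrMl.
apply: (via (m / 2 * sg t * (t ^+ 2 + s ^+ 2 - 2 * d))).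
 rewrite mulrA ler_wpM2r//; have := sqr_ge0 (t - s); lra.
have ts0 : 0 <= t - s by side.
have sl2 : m * sg t * (t - s) * (t - s) <= (t * sg t - s * sg s) * (t - s) by side.
have x1 : 0 <= sg t * (t * s - d) by side.
have x2 : m * (sg t * (t * s - d)) <= sg t * (t * s - d) by rewrite ler_piMl//; lra.
have x3 : 0 <= sg t * (t - s) ^+ 2 by side.
have x4 : 0 <= m * (sg t * (t - s) ^+ 2) by rewrite mulr_ge0//; lra.
rewrite (_ : m / 2 * sg t * (t ^+ 2 + s ^+ 2 - 2 * d) =
 2^-1 * (m * (sg t * (t - s) ^+ 2)) + m * (sg t * (t * s - d))); last by field.
rewrite mulrDl; move: sl2; rewrite (_ : m * sg t * (t - s) * (t - s) = m * (sg t * (t - s) ^+ 2)); last by ring.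
lra.
Qed.

(** For |Y| <= |X| the difference is sg(|X|)(X - Y) + (sg(|X|) - sg(|Y|)) Y. Both slope inequalities
    together bound the last coefficient times |Y| by M sg(|X|) |X - Y|, and monotonicity of t sg(t)
    gives sg(t) <= 2 sg(t + s). *)
Lemma Th_lip m M sg X Y : slope m M sg ->
 enorm (Th sg X - Th sg Y) <= 2 * (1 + M) * (sg (enorm X + enorm Y) * enorm (X - Y)).
Proof.
move=> h; have [m01 M1 p hh] := h.
wlog YX : X Y / enorm Y <= enorm X.
 move=> H; have [|/ltW] := leP (enorm Y) (enorm X); first exact: H.
 by move=> /H; rewrite (addrC (enorm Y)) (enormB Y) (enormB (Th sg Y)).
have [X0|X0] := eqVneq X 0.
 have Y0 : Y = 0.
  apply: enorm_eq0; apply/eqP; rewrite eq_le enorm_ge0 andbT (le_trans YX)//.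
  by rewrite X0 enorm0.
 by rewrite X0 Y0 !subrr enorm0 !mulr0.
have t0 := enorm_gt0 X0; have s0 := enorm_ge0 Y.
rewrite (_ : Th sg X - Th sg Y = sg (enorm X) *: (X - Y) + (sg (enorm X) - sg (enorm Y)) *: Y); last first.
 by rewrite /Th scalerBr scalerBl addrA subrK.
apply: (le_trans (enormD _ _)); rewrite !enormZ (gtr0_norm (p _ t0)).
have d0 := enorm_ge0 (X - Y); have td := enorm_sub_lt X Y.
move: (enorm X) (enorm Y) (enorm (X - Y)) t0 s0 YX d0 td => t s d t0 s0 st d0 td.
have pt := p t t0.
have st2 : sg t <= 2 * sg (t + s).
 have h3 := slope_mono h t0 (ltac:(lra) : t <= t + s).
 rewrite -(ler_pM2l t0); apply: (le_trans h3).
 rewrite mulrA ler_wpM2r ?(ltW (p _ _))//; lra.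
have ab : `|sg t - sg s| * s <= M * (sg t * d).
 apply: (via (M * (sg t * (t - s)))); last first.
  by side.
 move: s0; rewrite le_eqVlt => /predU1P[<-|s0].
  by rewrite mulr0 !mulr_ge0 ?(ltW pt)// ?subr0 ?(ltW t0)//; lra.
 rewrite -{2}(gtr0_norm s0) -normrM ler_norml mulrBl (mulrC (sg s)).
 have /andP[h1 h2] := hh s t s0 st.
 have := mulr_ge0 (ltW pt) (ltac:(lra) : 0 <= t - s); nra.
have e1 : sg t * d + M * (sg t * d) <= (1 + M) * (2 * sg (t + s) * d).
 rewrite -[X in X + _]mul1r -mulrDl ler_wpM2l//; first by lra.
 by side.
rewrite (_ : 2 * (1 + M) * _ = (1 + M) * (2 * sg (t + s) * d)); last by ring.
by apply: le_trans e1; rewrite lerD2l.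
Qed.

End slope_vector.

(** * The energy e(t) = t^2 sg(t): scaling and Young inequalities *)

Section slope_energy.
Context {R : realType}.
Implicit Types (sg : R -> R) (m M s t : R).

Lemma e_mono m M sg s t : slope m M sg -> 0 <= s -> s <= t ->
 s ^+ 2 * sg s <= t ^+ 2 * sg t.
Proof.
move=> h s0 st; rewrite !expr2 -!mulrA ler_pM//.
 exact: slope_al_ge0 h s0.
exact: (slope_mono0 h).
Qed.

Lemma e_ge0 m M sg t : slope m M sg -> 0 <= t -> 0 <= t ^+ 2 * sg t.
Proof. by move=> h t0; rewrite expr2 -mulrA mulr_ge0//; exact: slope_al_ge0 h t0. Qed.

Lemma e_small m M sg k t : slope m M sg -> 0 <= t -> 0 <= k <= 1 ->
 (k * t) ^+ 2 * sg (k * t) <= k * (t ^+ 2 * sg t).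
Proof.
move=> h t0 /andP[k0 k1]; rewrite !expr2 -!mulrA ler_wpM2l// ler_wpM2l// mulrA.
by apply: (slope_mono0 h); rewrite ?mulr_ge0// ler_piMl.
Qed.

Lemma e_scale M : 1 <= M -> forall K : R, exists C : R, 1 <= C /\
 forall m sg, slope m M sg -> forall s t, 0 <= s -> 0 <= t -> s <= K * t ->
 s ^+ 2 * sg s <= C * (t ^+ 2 * sg t).
Proof.
move=> M1 K; have [D [D1 hD]] := slope_doubling M1.
have [j hj] : exists j, K <= 2 ^+ j.
 have [j hj] := @expr_small _ 2^-1 (`|K| + 1)^-1 ltac:(lra) ltac:(by rewrite invr_gt0 ltr_wpDl).
 exists j; move: hj; rewrite exprVn lef_pV2 ?posrE ?exprn_gt0 ?ltr_wpDl//.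
 by apply: le_trans; apply: (le_trans (ler_norm _)); rewrite lerDl.
have D0 : 0 < D by side.
exists ((2 * D) ^+ j); split; first by rewrite exprn_ege1//; lra.
move=> m sg h s t s0 t0 st.
apply: (via ((2 ^+ j * t) ^+ 2 * sg (2 ^+ j * t))).
 apply: (e_mono h s0); apply: (le_trans st); exact: ler_wpM2r.
move: t0; rewrite le_eqVlt => /predU1P[<-|t0].
 by rewrite !mulr0 !expr0n/= !mul0r mulr0.
elim: j {hj st} => [|j IH]; first by rewrite !expr0 !mul1r.
have q0 : 0 < 2 ^+ j * t by side.
rewrite (exprS (2 * D)) -mulrA.
apply: (via (2 * D * ((2 ^+ j * t) ^+ 2 * sg (2 ^+ j * t)))); last first.
 by side.
have := hD _ _ h _ q0.
have -> : 2 ^+ j.+1 * t = 2 * (2 ^+ j * t) by rewrite exprS mulrA.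
move: (2 ^+ j * t) q0 => q q0 hq.
rewrite (_ : (2 * q) ^+ 2 * sg (2 * q) = (2 * q) * (2 * q * sg (2 * q))); last by ring.
rewrite (_ : 2 * D * _ = (2 * q) * (D * (q * sg q))); last by ring.
by side.
Qed.

Lemma e_add M : 1 <= M -> exists C : R, 1 <= C /\
 forall m sg, slope m M sg -> forall u s t, 0 <= s -> 0 <= t -> 0 <= u -> u <= s + t ->
 u ^+ 2 * sg u <= C * (s ^+ 2 * sg s + t ^+ 2 * sg t).
Proof.
move=> M1; have [C [C1 hC]] := e_scale M1 2; exists C; split => // m sg h.
have C0 : 0 <= C by side.
move=> u s t s0 t0 u0 ust.
have [st|/ltW ts] := leP s t.
 apply: (le_trans (hC _ _ h u t u0 t0 _)); first by lra.
 by rewrite ler_wpM2l// lerDr (e_ge0 h).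
apply: (le_trans (hC _ _ h u s u0 s0 _)); first by lra.
by rewrite ler_wpM2l// lerDl (e_ge0 h).
Qed.

(** If s <= r t, then a(s) t <= a(r t) t <= k e(t) by [slope_decay]; otherwise t < s / r and a(s) t
    is at most e(s) / r. *)
Lemma young m : 0 < m <= 1 -> forall k : R, 0 < k -> exists C : R, 0 < C /\
 forall M sg, slope m M sg -> forall s t, 0 <= s -> 0 <= t ->
 s * sg s * t <= k * (t ^+ 2 * sg t) + C * (s ^+ 2 * sg s).
Proof.
move=> m01 k k0; have [r [/andP[r0 r1] hr]] := slope_decay m01 k0.
exists r^-1; split; first by side.
move=> M sg h s t s0 t0.
have es := e_ge0 h s0; have et := e_ge0 h t0.
have [st|ts] := leP s (r * t).
 rewrite (le_trans (_ : _ <= k * (t ^+ 2 * sg t)))//; last first.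
  by side.
 move: t0; rewrite le_eqVlt => /predU1P[t0|t0].
  by rewrite -t0 mulr0 expr0n/= mul0r mulr0.
 rewrite [leRHS](_ : _ = k * (t * sg t) * t); last by ring.
 rewrite ler_wpM2r ?(ltW t0)//.
 by apply: le_trans (hr _ _ h t t0); exact: (slope_mono0 h).
rewrite (le_trans (_ : _ <= r^-1 * (s ^+ 2 * sg s)))//; last first.
 by side.
rewrite ler_pdivlMl// (_ : r * _ = (r * t) * (s * sg s)); last by ring.
rewrite (_ : s ^+ 2 * _ = s * (s * sg s)); last by ring.
by rewrite ler_wpM2r ?(slope_al_ge0 h)// ltW.
Qed.

(** The variant of [young] suited to |Th X - Th Y|, which is of order sg(S) |X - Y| with S = |X| +
    |Y|: the error term stays linear in the difference [d], so it is small when X and Y are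
    close. *)
Lemma young_diff m : 0 < m <= 1 -> forall k : R, 0 < k -> exists C : R, 0 < C /\
 forall M sg, slope m M sg -> forall S d t, 0 <= d -> d <= S -> 0 <= t ->
 sg S * d * t <= k * (t ^+ 2 * sg t) + C * (S * sg S * d).
Proof.
move=> m01 k k0; have [r [/andP[r0 r1] hr]] := slope_decay m01 k0.
exists r^-1; split; first by side.
move=> M sg h S d t d0 dS t0; have [_ _ p _] := h.
have S0 := le_trans d0 dS; have et := e_ge0 h t0.
have aS := slope_al_ge0 h S0.
move: S0; rewrite le_eqVlt => /predU1P[S0|S0].
 have -> : d = 0 by lra.
 by rewrite !mulr0 mul0r addr0 mulr_ge0// ltW.
have sS := p _ S0.
have [st|ts] := leP S (r * t).
 rewrite (le_trans (_ : _ <= k * (t ^+ 2 * sg t)))//; last first.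
  by side.
 have t1 : 0 < t by rewrite -(pmulr_rgt0 _ r0); exact: lt_le_trans st.
 rewrite [leRHS](_ : _ = k * (t * sg t) * t); last by ring.
 rewrite ler_wpM2r//.
 apply: le_trans (hr _ _ h t t1); apply: (via (S * sg S)); last exact: (slope_mono0 h (ltW S0)).
 by rewrite mulrC ler_wpM2r// ltW.
rewrite (le_trans (_ : _ <= r^-1 * (S * sg S * d)))//; last first.
 by side.
rewrite ler_pdivlMl// (_ : r * _ = (r * t) * (sg S * d)); last by ring.
have q0 : 0 <= sg S * d by side.
by rewrite -[leRHS]mulrA ler_wpM2r// ltW.
Qed.

(** Monotonicity controls only the weighted square sg(x + y) w^2 of a difference [w]; this recovers
    its energy. If w <= k x, then e(w) <= k e(x). Otherwise x + y <= 2 x + w <= (1 + 2/k) w, and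
    a(w) <= a(x + y). *)
Lemma e_diff m M sg k x y w : slope m M sg -> 0 < k <= 1 -> 0 <= x -> 0 <= y ->
 0 <= w -> w <= x + y -> y <= x + w ->
 w ^+ 2 * sg w <= k * (x ^+ 2 * sg x) + (1 + 2 / k) * (sg (x + y) * w ^+ 2).
Proof.
move=> h /andP[k0 k1] x0 y0 w0 wxy yxw; have [_ _ p _] := h.
have ex := e_ge0 h x0.
move: w0; rewrite le_eqVlt => /predU1P[<-|w0].
 by rewrite expr0n/= mulr0 mulr0 mul0r addr0 mulr_ge0// ltW.
have S0 : 0 < x + y by side.
have i0 : 0 <= 2 / k by side.
have r0 : 0 <= (1 + 2 / k) * (sg (x + y) * w ^+ 2).
 rewrite !mulr_ge0 ?sqr_ge0 ?(ltW (p _ S0))//; lra.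
have [wx|xw] := leP w (k * x).
 rewrite (le_trans (_ : _ <= k * (x ^+ 2 * sg x)))// ?lerDl//.
 apply: le_trans (e_mono h (ltW w0) wx) _; apply: (e_small h x0).
 by side.
rewrite (le_trans (_ : _ <= (1 + 2 / k) * (sg (x + y) * w ^+ 2)))//; last first.
 by side.
rewrite (_ : (1 + 2 / k) * _ = w * (sg (x + y) * (w * (1 + 2 / k)))); last by ring.
rewrite expr2 -mulrA ler_pM2l//; apply: (le_trans (slope_mono h w0 wxy)).
rewrite mulrC ler_wpM2l ?(ltW (p _ _))//.
have : x <= w / k by rewrite ler_pdivlMr// mulrC ltW.
rewrite mulrDr mulr1 [w * (2 / k)]mulrCA; lra.
Qed.

End slope_energy.

(** * Truncation, and growth functions as members of the class *)

Section clamp.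
Context {R : realType}.
Implicit Types (sg a : R -> R) (m M s t lo hi : R).

Definition clamp lo hi t := Num.min hi (Num.max lo t).

Lemma clamp_itv lo hi t : lo <= hi -> lo <= clamp lo hi t <= hi.
Proof.
by move=> lohi; rewrite /clamp le_min lohi le_max lexx ge_min lexx.
Qed.

Lemma clamp_id lo hi t : lo <= t <= hi -> clamp lo hi t = t.
Proof. by move=> /andP[lt th]; rewrite /clamp max_r// min_r. Qed.

(** A constant [sg] satisfies both inequalities, because (1 - M) t + M s <= s <= (1 - m) t + m s for
    s <= t. The pieces glue: for s <= lo < t the inequality at [lo] is multiplied by s / lo <= 1,
    and for s <= hi < t the affine bounds at [t] are weaker than those at [hi]. *)
Lemma slope_clamp m M sg lo hi : 0 < lo -> lo <= hi -> slope m M sg ->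
 slope m M (sg \o clamp lo hi).
Proof.
move=> lo0 lohi [m01 M1 p hh]; split => //.
 by move=> t t0 /=; apply: p; apply: lt_le_trans lo0 _; case/andP: (clamp_itv t lohi).
have [/andP[m0 m1] hi0] : 0 < m <= 1 /\ 0 < hi by split => //; exact: lt_le_trans lohi.
(* truncation from below, then from above *)
have H1 s t : 0 < s -> s <= t ->
  sg (Num.max lo t) * ((1 - M) * t + M * s) <= s * sg (Num.max lo s) <=
  sg (Num.max lo t) * ((1 - m) * t + m * s).
 move=> s0 st; have t0 := lt_le_trans s0 st; have pl := p _ lo0.
 have [tl|lt] := leP t lo.
  rewrite !max_l ?(le_trans st)//; rewrite !(mulrC s) !ler_pM2l//.
  by apply/andP; split; nra.
 have [sl|ls] := leP s lo; last by apply: hh.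
 have /andP[a1 a2] := hh lo t lo0 (ltW lt).
 have pt := p t t0; have slo : 0 <= s / lo <= 1.
  by rewrite divr_ge0 ?(ltW s0) ?(ltW lo0)//= ler_pdivrMr// mul1r.
 case/andP: slo => q0 q1; set q := s / lo in q0 q1.
 have sE : s = q * lo by rewrite /q divfK// gt_eqF.
 have b1 := ler_wpM2l q0 a1; have b2 := ler_wpM2l q0 a2.
 have tt := mulr_gt0 pt t0.
 rewrite [in X in _ <= X <= _]sE; apply/andP; split.
  rewrite -mulrA; apply: le_trans b1; rewrite {1}sE.
  have : 0 <= (M - 1) * (1 - q) * (sg t * t) by side.
  lra.
 rewrite -mulrA; apply: (le_trans b2); rewrite [in leRHS]sE.
 have : 0 <= (1 - m) * (1 - q) * (sg t * t) by side.
 lra.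
move=> s t s0 st; have t0 := lt_le_trans s0 st; rewrite /clamp/=.
have [tl|lt] := leP (Num.max lo t) hi.
 rewrite (min_r (_ : Num.max lo s <= hi)); first exact: H1.
 by apply: le_trans tl; rewrite ge_max !le_max lexx st orbT.
have [sl|ls] := leP (Num.max lo s) hi; last first.
 by rewrite !(mulrC s) !ler_pM2l ?p//; apply/andP; split; nra.
have {}lt : hi < t by move: lt; rewrite lt_max => /orP[|//]; rewrite ltNge lohi.
have shi : s <= hi by apply: le_trans sl; rewrite le_max lexx orbT.
have := H1 s hi s0 shi; rewrite (max_r lohi) => /andP[a1 a2].
have ph := p hi hi0.
apply/andP; split.
 by apply: le_trans a1; rewrite ler_pM2l//; nra.
by apply: (le_trans a2); rewrite ler_pM2l//; nra.
Qed.

Lemma cont_clamp lo hi : continuous (@clamp lo hi).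
Proof.
move=> t; apply: (@continuous_min _ _ (cst hi) (fun t => Num.max lo t)).
 exact: cvg_cst.
by apply: (@continuous_max _ _ (cst lo) id); [exact: cvg_cst|exact: cvg_id].
Qed.

Lemma bernoulli_lo m x : 0 < m <= 1 -> 0 <= x <= 1 -> x `^ m <= 1 - m + m * x.
Proof.
move=> /andP[m0 m1] /andP[x0 x1].
move: m1; rewrite le_eqVlt => /predU1P[->|m1]; first by rewrite powRr1//; lra.
have := @conjugate_powR R (x `^ m) 1 m^-1 (1 - m)^-1 (powR_ge0 _ _) ler01.
rewrite !invr_gt0 !invrK m0 subr_gt0 m1 => /(_ isT isT).
rewrite -powRrM mulfV ?gt_eqF// powRr1// powR1 mulr1 mul1r subrKC => /(_ erefl); lra.
Qed.

Lemma bernoulli_hi M x : 1 <= M -> 0 <= x <= 1 -> 1 - M + M * x <= x `^ M.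
Proof.
move=> M1 /andP[x0 x1]; have M0 : 0 < M by side.
have := @bernoulli_lo M^-1 (x `^ M).
rewrite invr_gt0 M0 invf_le1// M1 powR_ge0/= -powRrM mulfV ?gt_eqF// powRr1//.
have xM1 : x `^ M <= 1.
 by have := @ge0_ler_powR R M (ltW M0) x 1; rewrite powR1 !nnegrE => ->.
move=> /(_ isT xM1) h; have := ler_wpM2l (ltW M0) h.
rewrite mulrDr mulrBr mulr1 mulrA mulfV ?gt_eqF// mul1r; lra.
Qed.

(** The bounds on t a'/a make a(t) t^-m nondecreasing and a(t) t^-M nonincreasing, so a(s)/a(t) lies
    between the powers (s/t)^M and (s/t)^m. Bernoulli's inequalities then replace powers by affine
    functions, the form that truncation preserves. *)
Lemma growth_slope a : growth_function a ->
 exists m M, slope m M (fun t => a t / t).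
Proof.
move=> [[cont [der _]] a0 apos [m [M [m0 M0 hm]]]].
(* The exponents are moved to the two sides of 1, where Bernoulli's inequalities hold. *)
pose m' := Num.min m 1; pose M' := Num.max M 1.
(* Mean value theorem for a(u) u^-q: the increment is a nonnegative multiple of c a'(c)/a(c) - q at
   some intermediate point. *)
have mono (q s t : R) : 0 < s -> s <= t -> exists2 c, 0 < c &
  exists2 k, 0 <= k & a t * t `^ (- q) - a s * s `^ (- q) = k * (c * derive1 a c / a c - q).
 move=> s0; rewrite le_eqVlt => /predU1P[->|st].
  by exists 1 => //; exists 0 => //; rewrite subrr mul0r.
 have df (u : R) : 0 < u -> is_derive u 1 (a * (fun u => u `^ (- q)))
   (a u *: (- q * u `^ (- q - 1)) + u `^ (- q) *: derive1 a u).
  move=> u0; apply: is_deriveM; last exact: is_derive1_powR.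
  by rewrite derive1E; apply: DeriveDef => //; exact: der.
 have dfst (u : R) : u \in `]s, t[ -> is_derive u 1 (a * (fun u => u `^ (- q)))
   (a u *: (- q * u `^ (- q - 1)) + u `^ (- q) *: derive1 a u).
  by move=> hu; apply: df; apply: lt_trans s0 _; rewrite (itvP hu).
 have [|c ci] := @MVT R _ _ s t st dfst.
  apply: derivable_within_continuous => u hu.
  have u0 : 0 < u by apply: lt_le_trans s0 _; rewrite (itvP hu).
  by have [] := df u u0.
 have c0 : 0 < c by apply: lt_trans s0 _; rewrite (itvP ci).
 rewrite /= => ->; exists c => //; exists (a c * c `^ (- q) / c * (t - s)).
  by rewrite !mulr_ge0 ?powR_ge0 ?invr_ge0 ?subr_ge0 1?ltW// apos.
 rewrite powRD; last by rewrite (gt_eqF c0) implybT.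
 rewrite powR_inv1 ?(ltW c0)// /GRing.scale/=.
 by field; rewrite !gt_eqF// apos.
exists m', M'; split.
- by rewrite /m' lt_min m0 ltr01/= ge_min lexx orbT.
- by rewrite /M' le_max lexx orbT.
- by move=> t t0; rewrite divr_gt0// apos.
move=> s t s0 st; have t0 := lt_le_trans s0 st.
have x01 : 0 <= s / t <= 1 by rewrite divr_ge0 ?(ltW s0) ?(ltW t0)//= ler_pdivrMr// mul1r.
rewrite [s * _]mulrC divfK ?gt_eqF//.
have key q : a s = (a s * s `^ (- q)) * (t `^ q * (s / t) `^ q).
 rewrite -[a s in LHS]mulr1 -!mulrA; congr (_ * _).
 rewrite -powRM ?divr_ge0 ?(ltW s0) ?(ltW t0)// (mulrC t (s / t)) divfK ?gt_eqF// powRN.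
 by rewrite mulVf// gt_eqF// powR_gt0.
have key' q : a t * (s / t) `^ q = (a t * t `^ (- q)) * (t `^ q * (s / t) `^ q).
 by rewrite mulrA -[a t * _ * _]mulrA powRN mulVf ?mulr1// gt_eqF// powR_gt0.
have at0 := apos t t0.
have nn q : 0 <= t `^ q * (s / t) `^ q by rewrite mulr_ge0 ?powR_ge0.
apply/andP; split.
 apply: (via (a t * (s / t) `^ M')); last first.
  rewrite [leRHS](key M') key' ler_wpM2r// ?nn//.
  rewrite -subr_le0; have [c c0 [k k0 ->]] := mono M' s t s0 st.
  rewrite mulr_ge0_le0// subr_le0; have /andP[_ h] := hm c c0.
  by rewrite (le_trans h)// /M' le_max lexx.
 have := bernoulli_hi (_ : 1 <= M') x01; rewrite /M' le_max lexx orbT => /(_ isT) h.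
 apply: le_trans (ler_wpM2l (ltW at0) h).
 by apply: eqW; field; rewrite gt_eqF.
apply: (via (a t * (s / t) `^ m')).
 rewrite [leLHS](key m') key' ler_wpM2r// ?nn//.
 rewrite -subr_ge0; have [c c0 [k k0 ->]] := mono m' s t s0 st.
 rewrite mulr_ge0// subr_ge0; have /andP[h _] := hm c c0.
 by apply: le_trans h; rewrite /m' ge_min lexx.
have := bernoulli_lo (_ : 0 < m' <= 1) x01.
rewrite {1 2}/m' lt_min m0 ltr01/= ge_min lexx orbT => /(_ isT) h.
apply: (le_trans (ler_wpM2l (ltW at0) h)).
by apply: eqW; field; rewrite gt_eqF.
Qed.

End clamp.

(** * Convex potential of the truncated field *)

Section bregman.
Context {R : realType} {n : nat}.
Variables (m M c C : R) (sg : R -> R).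
Hypotheses (hs : slope m M sg) (c0 : 0 < c) (cont : continuous sg).
Hypothesis sgb : forall t, c <= sg t <= C.

Let al (s : R) : R := s * sg s.

Let al_cont : continuous al.
Proof. by move=> s; apply: cvgM; [exact: cvg_id|exact: cont]. Qed.

(** Starting the integral at -1 makes every t >= 0 an interior point, so that the fundamental
    theorem of calculus applies at 0 as well; only differences of [pot] matter. *)
Definition pot (t : R) : R := \int[@lebesgue_measure R]_(s in `[-1, t]) (s * sg s).

Lemma pot_derive (t : R) : 0 <= t -> is_derive t 1 pot (t * sg t).
Proof.
move=> t0.
have t1 : t < t + 1 by rewrite ltrDl.
have mt : -1 < t by apply: lt_le_trans t0; rewrite oppr_lt0.
have int : lebesgue_measure.-integrable `[-1, (t + 1)] (EFin \o al).
 apply: continuous_compact_integrable; first exact: segment_compact.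
 exact: continuous_subspaceT.
have [dP PE] := continuous_FTC1_closed t1 int mt (@al_cont t).
apply: DeriveDef; first exact: dP.
by rewrite -derive1E; exact: PE.
Qed.

Let al_slope s t : 0 <= s -> s <= t -> m * c * (t - s) <= al t - al s <= M * C * (t - s).
Proof.
move=> s0 st; have [/andP[m0 m1] M1 p hh] := hs.
have ct := sgb t.
have C0 : 0 < C by case/andP: ct => h1 h2; apply: lt_le_trans c0 _; exact: le_trans h1 h2.
have sl : m * sg t * (t - s) <= al t - al s <= M * sg t * (t - s).
 move: s0 st; rewrite le_eqVlt => /predU1P[<-|s0] st.
  have h : 0 <= sg t * t.
   by rewrite mulr_ge0// (le_trans (ltW c0))//; case/andP: ct.
  rewrite /al mul0r !subr0 !(mulrC t); apply/andP; split; nra.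
 have /andP[h1 h2] := hh s t s0 st; rewrite /al; apply/andP; split; lra.
case/andP: sl => a1 a2; case/andP: ct => b1 b2; have ts : 0 <= t - s by side.
apply/andP; split.
 by apply: le_trans a1; rewrite ler_wpM2r// ler_wpM2l// ltW.
by apply: (le_trans a2); rewrite ler_wpM2r// ler_wpM2l//; lra.
Qed.

(** Mean value theorem for pot(u) - a(s) u - k (u - s)^2, whose derivative a(u) - a(s) - 2k (u - s)
    has the sign of u - s for k = mc/2 and the opposite sign for k = MC/2. *)
Lemma pot_bregman s t : 0 <= s -> 0 <= t ->
 m * c / 2 * (t - s) ^+ 2 <= pot t - pot s - s * sg s * (t - s) <= M * C / 2 * (t - s) ^+ 2.
Proof.
move=> s0 t0.
pose b (k : R) : R -> R := fun u => pot u - s * sg s * u - k * (u - s) ^+ 2.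
have db k (u : R) : 0 <= u -> is_derive u 1 (b k) (u * sg u - s * sg s - 2 * k * (u - s)).
 move=> u0; rewrite /b; have := pot_derive u0 => dp.
 apply: is_derive_eq.
 by rewrite /GRing.scale/=; ring.
have bts k : b k t - b k s = pot t - pot s - s * sg s * (t - s) - k * (t - s) ^+ 2.
 by rewrite /b subrr expr0n mulr0 subr0; ring.
have mvt k : exists2 xi, 0 <= xi & (0 <= (xi - s) * (t - s)) /\
  b k t - b k s = (xi * sg xi - s * sg s - 2 * k * (xi - s)) * (t - s).
 have cb (u v : R) : 0 <= u -> {within `[u, v], continuous (b k)}.
  move=> u0; apply: derivable_within_continuous => w wi.
  have w0 : 0 <= w by apply: le_trans u0 _; rewrite (itvP wi).
  by have [] := db k w w0.
 have [ts|st|->] := ltgtP t s.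
 - have dk (u : R) : u \in `]t, s[ -> is_derive u 1 (b k) (u * sg u - s * sg s - 2 * k * (u - s)).
   by move=> ui; apply: db; apply: le_trans t0 _; rewrite (itvP ui).
  have [xi xii h] := MVT ts dk (cb _ _ t0).
  exists xi; first by apply: le_trans t0 _; rewrite (itvP xii).
  split; last by rewrite -opprB h; ring.
  by rewrite mulr_le0// subr_le0 ?(itvP xii)// ltW.
 - have dk (u : R) : u \in `]s, t[ -> is_derive u 1 (b k) (u * sg u - s * sg s - 2 * k * (u - s)).
   by move=> ui; apply: db; apply: le_trans s0 _; rewrite (itvP ui).
  have [xi xii h] := MVT st dk (cb _ _ s0).
  exists xi; first by apply: le_trans s0 _; rewrite (itvP xii).
  split; last by side.
  by rewrite mulr_ge0// subr_ge0 ?(itvP xii)// ltW.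
 - by exists s => //; rewrite !subrr !mulr0.
have key xi : 0 <= xi -> 0 <= (xi - s) * (t - s) ->
  m * c * (xi - s) * (t - s) <= (xi * sg xi - s * sg s) * (t - s) <= M * C * (xi - s) * (t - s).
 move=> xi0; have [sx|/ltW xs] := leP s xi.
  move: sx; rewrite le_eqVlt => /predU1P[<-|sx]; first by rewrite !subrr !mulr0 !mul0r lexx.
  have sx' : 0 < xi - s by side.
  rewrite pmulr_rge0// => ts0.
  by have /andP[h1 h2] := al_slope s0 (ltW sx); rewrite !ler_wpM2r.
 move: xs; rewrite le_eqVlt => /predU1P[->|sx]; first by rewrite !subrr !mulr0 !mul0r lexx.
 have sx' : xi - s < 0 by rewrite subr_lt0.
 rewrite nmulr_rge0// => ts0.
 have /andP[h1 h2] := al_slope xi0 (ltW sx).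
 by apply/andP; split; apply: ler_wnM2r => //; rewrite /al in h1 h2 *; lra.
apply/andP; split; rewrite -subr_ge0.
 rewrite -bts; have [xi xi0 [h ->]] := mvt (m * c / 2).
 have /andP[+ _] := key xi xi0 h; rewrite -subr_ge0.
 by congr (_ <= _); field.
rewrite -oppr_le0 opprB -bts; have [xi xi0 [h ->]] := mvt (M * C / 2).
have /andP[_] := key xi xi0 h; rewrite -subr_le0.
by congr (_ <= _); field.
Qed.

(* The Bregman divergence of the convex potential [pot \o enorm] of [Th sg]. *)
Lemma pot_vec (X Y : 'rV[R]_n) :
 m * c / 2 * enorm (Y - X) ^+ 2 <=
 pot (enorm Y) - pot (enorm X) - dotprod (Th sg X) (Y - X) <=
 (M + 1) * C * enorm (Y - X) ^+ 2.
Proof.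
have [/andP[m0 m1] M1 _ _] := hs.
have /andP[h1 h2] := pot_bregman (enorm_ge0 X) (enorm_ge0 Y).
have /andP[b1 b2] := sgb (enorm X).
have cs := dot_le_enorm X Y.
rewrite enormBsqr /Th dotZl dotBr -enorm_sqr (dotC Y).
move: (enorm X) (enorm Y) (dotprod X Y) (pot _) (pot _) h1 h2 b1 b2 cs
 => s t d ps pt h1 h2 b1 b2 cs.
have ts : 0 <= t * s - d by lra.
have w1 : m * (c * (t * s - d)) <= sg s * (t * s - d).
 apply: (via (c * (t * s - d))); last by side.
 by rewrite ler_piMl// mulr_ge0// ltW.
have w2 : sg s * (t * s - d) <= C * (t * s - d) by side.
have C0 : 0 <= C by apply: le_trans (ltW c0) _; apply: le_trans b1 b2.
have w3 : 0 <= C * (t * s - d) by side.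
have w4 : 0 <= C * (t - s) ^+ 2 by side.
have w5 : 0 <= M * (C * (t - s) ^+ 2) by side.
have w6 : 0 <= M * (C * (t * s - d)) by side.
apply/andP; split; lra.
Qed.

End bregman.

Ltac pos_hook ::= match goal with
 | H : slope _ _ ?sg |- is_true (_ _ _ (_ ^+ 2 * ?sg _)) => apply: (e_ge0 H); pos
 | H : slope _ _ ?sg |- is_true (_ _ _ (_ * ?sg _)) => apply: (slope_al_ge0 H); pos
 end.

(** * Continuity, Tonelli's theorem and signed integrals *)

Section cont.
Context {K : numFieldType} {T : topologicalType} {V : normedModType K}.
Implicit Types (f g : T -> V) (k : T -> K).

Lemma contD f g : continuous f -> continuous g -> continuous (fun x => f x + g x).
Proof. by move=> cf cg x; apply: cvgD; [exact: cf|exact: cg]. Qed.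

Lemma contZ k f : continuous k -> continuous f -> continuous (fun x => k x *: f x).
Proof. by move=> cf cg x; apply: cvgZ; [exact: cf|exact: cg]. Qed.

Lemma contM (f g : T -> K) : continuous f -> continuous g -> continuous (fun x => f x * g x).
Proof. by move=> cf cg x; apply: cvgM; [exact: cf|exact: cg]. Qed.

Lemma contX (f : T -> K) i : continuous f -> continuous (fun x => f x ^+ i).
Proof.
move=> cf; elim: i => [|i IH]; first by move=> x; exact: cvg_cst.
by under eq_fun do rewrite exprS; exact: contM.
Qed.

Lemma contB f g : continuous f -> continuous g -> continuous (fun x => f x - g x).
Proof. by move=> cf cg x; apply: cvgB; [exact: cf|exact: cg]. Qed.

Lemma cont_cst (v : V) : continuous (fun _ : T => v).
Proof. by move=> x; exact: cvg_cst. Qed.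

Lemma cont_comp (U W : topologicalType) (f : T -> U) (g : U -> W) :
 continuous f -> continuous g -> continuous (fun x => g (f x)).
Proof. by move=> cf cg x; apply: continuous_comp; [exact: cf|exact: cg]. Qed.

Lemma cont_id : continuous (fun x : T => x).
Proof. by move=> x; exact: cvg_id. Qed.

End cont.

Lemma cont_dot (R : realType) n (T : topologicalType) (f g : T -> 'rV[R]_n) :
 continuous f -> continuous g -> continuous (fun x => dotprod (f x) (g x)).
Proof. by move=> cf cg x; apply: cvg_dot; [exact: cf|exact: cg]. Qed.

Section tonelli.
Local Open Scope ereal_scope.

Lemma int_indic d (T : measurableType d) (R : realType)
  (mu : {measure set T -> \bar R}) (D : set T) (f : T -> R) :
 \int[mu]_(x in D) (f x)%:E = \int[mu]_x (f x * \1_D x)%R%:E.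
Proof.
rewrite integral_mkcond; apply: eq_integral => x _; rewrite patchE indicE.
by case: ifP => _; rewrite ?mulr1 ?mulr0.
Qed.

Lemma tonelli_dom d1 d2 (T1 : measurableType d1) (T2 : measurableType d2)
  (R : realType) (m1 : {sigma_finite_measure set T1 -> \bar R})
  (m2 : {sigma_finite_measure set T2 -> \bar R}) (D1 : set T1) (D2 : set T2)
  (f : T1 * T2 -> R) : measurable D1 -> measurable D2 ->
 mble f -> (forall p, (0 <= f p)%R) ->
 \int[m1]_(x in D1) \int[m2]_(y in D2) (f (x, y))%:E =
 \int[m2]_(y in D2) \int[m1]_(x in D1) (f (x, y))%:E.
Proof.
move=> mD1 mD2 mf f0.
pose H (p : T1 * T2) := (f p * (\1_D1 p.1 * \1_D2 p.2))%R.
have mH : mble H.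
 apply: measurable_funM => //; apply: measurable_funM.
  by apply: measurableT_comp; [exact: measurable_indic|exact: measurable_fst].
 by apply: measurableT_comp; [exact: measurable_indic|exact: measurable_snd].
have H0 p : 0 <= (EFin \o H) p.
 by side.
have := fubini_tonelli (m1 := m1) (m2 := m2) (EFin \o H) (mEFin mH) H0.
rewrite /H /comp /= => FT.
transitivity (\int[m1]_x \int[m2]_y (f (x, y) * (\1_D1 x * \1_D2 y))%:E).
 rewrite integral_mkcond; apply: eq_integral => x _; rewrite patchE.
 case: ifPn => xD.
  by rewrite int_indic; apply: eq_integral => y _; rewrite (indicE _ D1) xD mul1r.
 by under eq_integral do rewrite (indicE _ D1) (negbTE xD) mul0r mulr0; rewrite integral0.
rewrite FT [RHS]integral_mkcond; apply: eq_integral => y _; rewrite patchE.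
case: ifPn => yD.
 rewrite [RHS]int_indic; apply: eq_integral => x _; by rewrite (indicE _ D2) yD !mulr1.
by under eq_integral do rewrite (indicE _ D2) (negbTE yD) !mulr0; rewrite integral0.
Qed.

End tonelli.

Section signed.
Context d (T : measurableType d) (R : realType) (mu : {measure set T -> \bar R}).
Implicit Types (f g P Q : T -> R) (D : set T).

Lemma intg_dom D f g : measurable D -> mble f ->
 mble g -> (forall x, D x -> `|f x| <= g x) ->
 (\int[mu]_(x in D) (g x)%:E < +oo)%E -> mu.-integrable D (EFin \o f).
Proof.
move=> mD mf mg fg gi; apply/integrableP; split; first exact: mEFin.
apply: le_lt_trans gi; apply: int_le => //; exact: measurableT_comp.
Qed.

Lemma intg_fine D f : measurable D -> mu.-integrable D (EFin \o f) ->
 (\int[mu]_(x in D) f x)%:E = (\int[mu]_(x in D) (f x)%:E)%E.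
Proof. by move=> mD fi; rewrite fineK// integrable_fin_num. Qed.

(** How a tested equation becomes an estimate: [f] is the integrand of the equation, [P] the term to
    be bounded, [Q] the errors. Nothing is presupposed on the integrability of [P], and an infinite
    right side is allowed. *)
Lemma Rint_sum0_le D f P Q : measurable D -> mu.-integrable D (EFin \o f) ->
 \int[mu]_(x in D) f x = 0 ->
 mble P -> mble Q ->
 (forall x, D x -> 0 <= P x) -> (forall x, D x -> 0 <= Q x) ->
 (forall x, D x -> P x <= f x + Q x) ->
 (\int[mu]_(x in D) (P x)%:E <= \int[mu]_(x in D) (Q x)%:E)%E.
Proof.
move=> mD fi f0 mP mQ P0 Q0 PQ.
have [->|Qfin] := eqVneq (\int[mu]_(x in D) (Q x)%:E)%E (+oo)%E; first exact: leey.
have Qi : mu.-integrable D (EFin \o Q).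
 apply: (@intg_dom _ _ Q) => //; last by rewrite ltey.
 by move=> x Dx; rewrite ger0_norm// Q0.
have fQi : mu.-integrable D (EFin \o (fun x => f x + Q x)).
 by have := integrableD mD fi Qi; apply: eq_integrable.
apply: (via (\int[mu]_(x in D) (f x + Q x)%:E)%E).
 apply: ge0_le_integral => //.
 - by side.
 - by case/integrableP: fQi.
rewrite -(intg_fine mD fQi) RintegralD// f0 add0r.
by rewrite (intg_fine mD Qi).
Qed.

End signed.

Section signed_shift.
Context {R : realType} {n : nat}.
Local Notation E := 'rV[R]_n.
Local Notation mu := (@lebesgue_rV R n).
Implicit Types (f : E -> R).

Lemma intg_shift f (z : E) : L1 mu f ->
 L1 mu (fun x : E => f (x + z)).
Proof.
move=> /integrableP[/measurable_EFinP mf fi]; apply/integrableP; split.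
 by apply: mEFin; exact: mshiftf.
have mn : mble (fun x : E => `|f x|) by side.
have := int_shiftT z mn (fun x => normr_ge0 _) => h.
by apply: le_lt_trans fi; rewrite -h.
Qed.

Lemma Rint_shift f (z : E) : L1 mu f ->
 \int[mu]_x f (x + z) = \int[mu]_x f x.
Proof.
move=> fi; have fsi := intg_shift z fi.
have /integrableP[mf _] := fi.
have := @integral_pushforward _ _ _ _ R _ (mshiftr z) mu setT (EFin \o f) mf.
rewrite preimage_setT => /(_ fsi measurableT) h.
rewrite /Rintegral; congr fine; rewrite -[LHS]h.
apply: eq_measure_integral => [|m A mA _]; first exact: mshiftr.
exact: (lebesgue_shift z mA).
Qed.

End signed_shift.

(** * C^1 functions: increments along segments and vanishing integrals of gradients *)

Section c1.
Context {R : realType} {n : nat}.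
Local Notation E := 'rV[R]_n.
Local Notation mu := (@lebesgue_rV R n).
Implicit Types (f : E -> R) (g : E -> E).

(* [g] is the gradient of the C^1 function [f]. *)
Definition C1 f g := [/\ continuous f, continuous g &
 forall (x y : E) (t : R),
  is_derive t 1 (fun t : R => f (x + t *: y)) (dotprod (g (x + t *: y)) y)].

Lemma C1_cst c : C1 (cst c) (cst 0).
Proof.
split; [exact: cont_cst|exact: cont_cst|].
by move=> x y t; rewrite dot0l; exact: is_derive_cst.
Qed.

Lemma C1_add f g f' g' : C1 f g -> C1 f' g' ->
 C1 (fun x => f x + f' x) (fun x => g x + g' x).
Proof.
move=> [cf cg df] [cf' cg' df']; split.
- exact: contD.
- exact: contD.
- by move=> x y t; rewrite dotDl; exact: (is_deriveD (df x y t) (df' x y t)).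
Qed.

Lemma C1_mul f g f' g' : C1 f g -> C1 f' g' ->
 C1 (fun x => f x * f' x) (fun x => f x *: g' x + f' x *: g x).
Proof.
move=> [cf cg df] [cf' cg' df']; split.
- exact: contM.
- by apply: contD; exact: contZ.
- move=> x y t; rewrite dotDl !dotZl.
 exact: (is_deriveM (df x y t) (df' x y t)).
Qed.

Lemma C1_comp f g (p p' : R -> R) : C1 f g ->
 (forall u : R, is_derive u 1 p (p' u)) -> continuous p' ->
 C1 (fun x => p (f x)) (fun x => p' (f x) *: g x).
Proof.
move=> [cf cg df] dp cp'; split.
- apply: (cont_comp cf) => u.
 by apply/differentiable_continuous/derivable1_diffP; have [] := dp u.
- by apply: contZ => //; exact: (cont_comp cf).
- move=> x y t; rewrite dotZl.
 exact: (@is_derive1_comp R p (fun t => f (x + t *: y)) t _ _ (dp _) (df x y t)).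
Qed.

Lemma C1_shift f g z : C1 f g -> C1 (fun x => f (x + z)) (fun x => g (x + z)).
Proof.
move=> [cf cg df]; split.
- by apply: (@cont_comp _ _ _ (fun x : E => x + z) f) => //; apply: contD; [exact: cont_id|exact: cont_cst].
- by apply: (@cont_comp _ _ _ (fun x : E => x + z) g) => //; apply: contD; [exact: cont_id|exact: cont_cst].
- move=> x y t; rewrite addrAC.
 have := df (x + z) y t.
 by rewrite (_ : (fun t => f (x + t *: y + z)) = (fun t => f (x + z + t *: y)))//;
  apply/funext => u; rewrite addrAC.
Qed.

Lemma C1_scale f g k : C1 f g -> C1 (fun x => k * f x) (fun x => k *: g x).
Proof.
move=> [cf cg df]; split.
- by apply: contM => //; exact: cont_cst.
- by apply: contZ => //; exact: cont_cst.
- by move=> x y t; rewrite dotZl; apply: is_deriveZ.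
Qed.

Lemma C1_sub f g f' g' : C1 f g -> C1 f' g' ->
 C1 (fun x => f x - f' x) (fun x => g x - g' x).
Proof.
move=> h h'; have := C1_add h (C1_scale (-1) h').
rewrite (_ : (fun x => f x + _) = (fun x => f x - f' x)); last first.
 by apply/funext => x; rewrite mulN1r.
rewrite (_ : (fun x => g x + _) = (fun x => g x - g' x))//.
by apply/funext => x; rewrite scaleN1r.
Qed.

Lemma C1_coord i : C1 (fun x => x ord0 i) (cst (delta_mx ord0 i)).
Proof.
split; [exact: cont_coord|exact: cont_cst|].
move=> x y t; rewrite dotC dot_delta.
rewrite (_ : (fun t => _) = (fun t : R => x ord0 i + t * y ord0 i)); last first.
 by apply/funext => u; rewrite !mxE.
by apply: is_derive_eq; rewrite /GRing.scale/=; ring.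
Qed.

Lemma C1_sum (I : Type) (s : seq I) (F : I -> E -> R) (G : I -> E -> E) :
 (forall i, C1 (F i) (G i)) ->
 C1 (fun x => \sum_(i <- s) F i x) (fun x => \sum_(i <- s) G i x).
Proof.
move=> h; elim: s => [|i s IH].
 have := C1_cst 0; congr C1; apply/funext => x; by rewrite big_nil.
have := C1_add (h i) IH.
by congr C1; apply/funext => x; rewrite big_cons.
Qed.

Lemma mC1 f g : C1 f g -> mble f /\ mble g.
Proof.
by move=> [cf cg _]; split; [exact: cont_measurable_rV|exact: mcvg_rV].
Qed.

Let line_cont g (x y : E) : continuous g ->
 continuous (fun s : R => dotprod (g (x + s *: y)) y).
Proof.
move=> cg; apply: cont_dot; last exact: cont_cst.
apply: (@cont_comp _ _ _ (fun s : R => x + s *: y) g) => //.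
apply: contD; first exact: cont_cst.
by apply: contZ; [exact: cont_id|exact: cont_cst].
Qed.

Lemma C1_mvt f g (x y : E) : C1 f g -> exists2 s : R, 0 <= s <= 1 &
 f (x + y) - f x = dotprod (g (x + s *: y)) y.
Proof.
move=> [cf cg df].
have cw : {within `[0, 1], continuous (fun t : R => f (x + t *: y))}.
 by apply: derivable_within_continuous => t _; have [] := df x y t.
have [s si] := MVT (@ltr01 R) (fun t _ => df x y t) cw.
rewrite scale0r scale1r addr0 subr0 mulr1 => h; exists s => //.
by rewrite !(itvP si).
Qed.

(** Jensen's inequality on the segment: with k the value to be squared and psi the derivative, [h] =
    2k (psi - c) - k^2 lies below (psi - c)^2, and its integral is exactly k^2. *)
Lemma C1_ftc_sq f g (x y : E) (c : R) : C1 f g ->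
 (((f (x + y) - f x - c) ^+ 2)%:E <=
  \int[lebesgue_measure]_(s in `[0%R, 1%R]) ((dotprod (g (x + s *: y)) y - c) ^+ 2)%:E)%E.
Proof.
move=> [cf cg df].
pose k := f (x + y) - f x - c.
pose psi (s : R) := dotprod (g (x + s *: y)) y.
have cpsi : continuous psi by exact: line_cont.
pose F (s : R) := 2 * k * (f (x + s *: y) - c * s) - k ^+ 2 * s.
pose h (s : R) := 2 * k * (psi s - c) - k ^+ 2.
have ch : continuous h.
 apply: contB; last exact: cont_cst.
 by apply: contM; [exact: cont_cst|apply: contB => //; exact: cont_cst].
have csq : continuous (fun s : R => (psi s - c) ^+ 2).
 by apply: contX; apply: contB => //; exact: cont_cst.
have dF (s : R) : is_derive s 1 F (h s).
 have := df x y s => d; rewrite /F; apply: is_derive_eq.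
 by rewrite /h /psi /GRing.scale/=; ring.
have cI (u : R -> R) : continuous u -> lebesgue_measure.-integrable `[0, 1] (EFin \o u).
 move=> cu; apply: continuous_compact_integrable; first exact: segment_compact.
 exact: continuous_subspaceT.
have FTC : (\int[lebesgue_measure]_(s in `[0%R, 1%R]) (h s)%:E = ((F 1%R)%:E - (F 0%R)%:E))%E.
 apply: continuous_FTC2 => //; first exact: continuous_subspaceT.
  have cF : continuous F.
   by move=> s; apply/differentiable_continuous/derivable1_diffP; have [] := dF s.
  split; first by move=> s _; have [] := dF s.
  - exact: (cvg_at_right_filter (cF 0)).
  - exact: (cvg_at_left_filter (cF 1)).
 by move=> s _; rewrite derive1E; have [] := dF s.
rewrite -/k (_ : (k ^+ 2)%:E = \int[lebesgue_measure]_(s in `[0%R, 1%R]) (h s)%:E)%E; last first.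
 by rewrite FTC -EFinB /F scale1r scale0r addr0 /k; congr (_%:E); ring.
apply: le_integral => //; [exact: cI|exact: cI|].
move=> s _; rewrite lee_fin /h; have := sqr_ge0 (psi s - c - k); rewrite -/(psi s); nra.
Qed.

Lemma C1_ftc_abs f g (x y : E) : C1 f g ->
 (`|f (x + y) - f x|%:E <=
  \int[lebesgue_measure]_(s in `[0%R, 1%R]) `|dotprod (g (x + s *: y)) y|%:E)%E.
Proof.
move=> [cf cg df].
pose psi (s : R) := dotprod (g (x + s *: y)) y.
have cpsi : continuous psi by exact: line_cont.
pose F (s : R) := f (x + s *: y).
have cI (u : R -> R) : continuous u -> lebesgue_measure.-integrable `[0, 1] (EFin \o u).
 move=> cu; apply: continuous_compact_integrable; first exact: segment_compact.
 exact: continuous_subspaceT.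
have FTC : (\int[lebesgue_measure]_(s in `[0%R, 1%R]) (psi s)%:E = ((F 1%R)%:E - (F 0%R)%:E))%E.
 apply: continuous_FTC2 => //; first exact: continuous_subspaceT.
  have cF : continuous F.
   by move=> s; apply/differentiable_continuous/derivable1_diffP; have [] := df x y s.
  split; first by move=> s _; have [] := df x y s.
  - exact: (cvg_at_right_filter (cF 0)).
  - exact: (cvg_at_left_filter (cF 1)).
 by move=> s _; rewrite derive1E; have [] := df x y s.
rewrite (_ : f (x + y) - f x = F 1 - F 0); last by rewrite /F scale1r scale0r addr0.
rewrite -abse_EFin EFinB -FTC; apply: le_abse_integral => //.
by case/integrableP: (cI _ cpsi).
Qed.

(** Tonelli's theorem exchanges the segment parameter and the point: a bound valid for each
    parameter [s] survives integration over [0, 1], whose length is 1. *)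
Lemma line_bound (D : set E) (k : E -> R) (H : E * measurableTypeR R -> R) (K : R) :
 measurable D -> mble k -> (forall x, 0 <= k x) ->
 mble H -> (forall p, 0 <= H p) ->
 (forall x, ((k x)%:E <= \int[lebesgue_measure]_(s in `[0%R, 1%R]) (H (x, s))%:E)%E) ->
 (forall s : R, 0 <= s <= 1 -> (\int[mu]_(x in D) (H (x, s))%:E <= K%:E)%E) ->
 (\int[mu]_(x in D) (k x)%:E <= K%:E)%E.
Proof.
move=> mD mk k0 mH H0 kH hK.
have m01 : measurable (`[0%R, 1%R]%classic : set (measurableTypeR R)) by [].
apply: (via (\int[mu]_(x in D) \int[lebesgue_measure]_(s in `[0%R, 1%R]) (H (x, s))%:E)%E).
 apply: ge0_le_integral => //.
 - by side.
 - by side.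
 - apply: measurable_funTS.
  have := @measurable_fun_fubini_tonelli_F _ _ _ _ R (@lebesgue_measure R) (fun p : E * measurableTypeR R => (H p * \1_(`[0, 1]%classic) p.2)%:E).
  rewrite /fubini_F => mF; under eq_fun do rewrite int_indic.
  apply: mF; last by side.
  apply: mEFin; apply: measurable_funM => //.
  by apply: measurableT_comp; [exact: measurable_indic|exact: measurable_snd].
rewrite (tonelli_dom mu (@lebesgue_measure R) mD m01 mH H0).
apply: (via (\int[lebesgue_measure]_(s in `[0%R, 1%R]) (cst K%:E s))%E).
 apply: ge0_le_integral => //.
 - by side.
 - apply: measurable_funTS.
  have := @measurable_fun_fubini_tonelli_G _ _ _ _ R mu (fun p : E * measurableTypeR R => (H p * \1_D p.1)%:E).
  rewrite /fubini_G => mF; under eq_fun do rewrite int_indic.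
  apply: mF; last by side.
  apply: mEFin; apply: measurable_funM => //.
  by apply: measurableT_comp; [exact: measurable_indic|exact: measurable_fst].
have -> := @integral_cst _ _ R (@lebesgue_measure R) _ m01 K%:E.
have e1 : @lebesgue_measure R `[0%R, 1%R]%classic = 1%E.
 by rewrite lebesgue_measure_itv/= lte_fin ltr01 sube0.
rewrite -[leRHS]mule1 le_eqVlt; apply/orP; left; apply/eqP.
by congr (_ * _)%E; exact: e1.
Qed.

Lemma mline (h : E -> R) (y : E) : mble h ->
 mble (fun p : E * measurableTypeR R => h (p.1 + p.2 *: y)).
Proof.
move=> mh.
apply: (@measurableT_comp _ _ _ _ _ _ h _ (fun p : E * measurableTypeR R => p.1 + p.2 *: y)) => //.
apply: maddV; first exact: measurable_fst.
by side.
Qed.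

Lemma C1_L2_diff f g (D : set E) (y : E) (c : E -> R) (K : R) : C1 f g ->
 measurable D -> mble c ->
 (forall s : R, 0 <= s <= 1 ->
  (\int[mu]_(x in D) ((dotprod (g (x + s *: y)) y - c x) ^+ 2)%:E <= K%:E)%E) ->
 (\int[mu]_(x in D) ((f (x + y) - f x - c x) ^+ 2)%:E <= K%:E)%E.
Proof.
move=> fg mD mc hK; have [mf mg] := mC1 fg.
have mgy : mble (fun x : E => dotprod (g x) y).
 by side.
apply: (@line_bound D _ (fun p => (dotprod (g (p.1 + p.2 *: y)) y - c p.1) ^+ 2)) => //.
- apply: measurable_funX; apply: measurable_funB => //.
 by side.
- by side.
- apply: measurable_funX; apply: measurable_funB; first exact: (mline y mgy).
 by side.
- by side.
- by move=> x; exact: C1_ftc_sq.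
Qed.

Lemma C1_L1_shift f g (x0 y : E) (r s K : R) : C1 f g -> `|y| + r <= s ->
 (\int[mu]_(x in cube x0 s) `|dotprod (g x) y|%:E <= K%:E)%E ->
 (\int[mu]_(x in cube x0 r) `|f (x + y) - f x|%:E <= K%:E)%E.
Proof.
move=> fg yrs hK; have [mf mg] := mC1 fg.
have mgy : mble (fun x : E => `|dotprod (g x) y|).
 by side.
apply: (@line_bound (cube x0 r) _ (fun p => `|dotprod (g (p.1 + p.2 *: y)) y|)) => //.
- by side.
- by side.
- by side.
- by move=> x; exact: C1_ftc_abs.
- move=> t /andP[t0 t1]; apply: le_trans hK.
 have ts : `|t *: y| + r <= s.
  by apply: le_trans yrs; rewrite lerD2r normrZ ger0_norm// ler_piMl.
 have := @int_shift_cube_le R n x0 (t *: y) r s _ mgy (fun x => normr_ge0 _) ts.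
 exact.
Qed.

Lemma C1_L2_shift f g (x0 y : E) (r s K : R) : C1 f g -> `|y| + r <= s ->
 (\int[mu]_(x in cube x0 s) ((dotprod (g x) y) ^+ 2)%:E <= K%:E)%E ->
 (\int[mu]_(x in cube x0 r) ((f (x + y) - f x) ^+ 2)%:E <= K%:E)%E.
Proof.
move=> fg yrs hK; have [mf mg] := mC1 fg.
have md : mble (fun x => (dotprod (g x) y) ^+ 2).
 by side.
have := @C1_L2_diff f g (cube x0 r) y (cst 0) K fg (mcube _ _) (measurable_cst _).
under eq_integral do rewrite /cst subr0.
apply => t /andP[t0 t1].
under eq_integral do rewrite /cst subr0.
apply: le_trans hK; apply: (int_shift_cube_le x0 md (fun x => sqr_ge0 _)).
apply: le_trans yrs; rewrite lerD2r normrZ ger0_norm// ler_piMl//.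
Qed.

Lemma cont_bounded (f : E -> R) r : continuous f ->
 exists2 B : R, 0 <= B & forall x : E, `|x| <= r -> `|f x| <= B.
Proof.
move=> cf.
have cC : compact [set x : E | `|x| <= r].
 apply: bounded_closed_compact.
  exists r; split; first exact: num_real.
  by move=> u ru x /= xr; exact: le_trans xr (ltW ru).
 rewrite (_ : [set x : E | _] = (fun x : E => `|x|) @^-1` [set u | u <= r])//.
 apply: closed_comp; last exact: closed_le.
 by move=> x _; exact: norm_continuous.
have := continuous_compact (continuous_subspaceT cf) cC.
move=> /compact_bounded[B [_ hB]].
exists (`|B| + 1); first by side.
move=> x xr; apply: (hB (`|B| + 1)); last by exists x.
by rewrite (le_lt_trans (ler_norm _))// ltrDl.
Qed.

Definition csupp f g (x0 : E) r := forall x, ~ cube x0 r x -> f x = 0 /\ g x = 0.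

Lemma int_cst_cube (x0 : E) (B r : R) : 0 < r ->
 (\int[mu]_(x in cube x0 r) (cst B x)%:E = (B * (2 * r) ^+ n)%:E)%E.
Proof.
move=> r0; have mc := mcube x0 r.
apply: (etrans (@integral_cst _ _ R mu _ mc B%:E)).
by rewrite EFinM; congr (_ * _)%E; exact: mu_cube.
Qed.

Lemma intg_bounded_cube (f : E -> R) (x0 : E) (r B : R) : mble f ->
 (forall x, ~ cube x0 r x -> f x = 0) -> (forall x, `|f x| <= B) ->
 L1 mu f.
Proof.
move=> mf fs fB.
apply/integrableP; split; first exact: mEFin.
have [r0|r0] := ltP 0 r; last first.
 under eq_integral => x _.
  rewrite /= fs ?normr0; last first.
   by rewrite /cube/= => h; have := le_lt_trans (normr_ge0 _) h; rewrite ltNge r0.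
  over.
 by rewrite integral0.
apply: (@le_lt_trans _ _ (\int[mu]_x (B * \1_(cube x0 r) x)%:E)%E).
 apply: int_le => //.
 - by side.
 - by side.
 - move=> x _; rewrite indicE; have [xc|xc] := boolP (x \in cube x0 r); first by rewrite mulr1.
  by rewrite mulr0 fs ?normr0// => /mem_set; apply/negP.
have mc := mcube x0 r.
have -> := esym (int_indic mu (cube x0 r) (cst B)).
by have -> := int_cst_cube x0 B r0; rewrite ltry.
Qed.

Lemma cont_csupp_bounded (f : E -> R) (x0 : E) r : continuous f ->
 (forall x, ~ cube x0 r x -> f x = 0) -> exists2 B, 0 <= B & forall x, `|f x| <= B.
Proof.
move=> cf fs; have [B B0 hB] := @cont_bounded f (`|x0| + r) cf.
exists B => // x; have [xc|xc] := pselect (cube x0 r x); last by rewrite fs// normr0.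
apply: hB; rewrite -(subrK x0 x) addrC (le_trans (ler_normD _ _))// lerD2l ltW//.
Qed.

(** Difference quotients have integral 0 by translation invariance. The mean value theorem bounds
    them by the maximum of the directional derivative, to which they converge, and they share a
    bounded support. *)
Lemma integral_grad0 f g (x0 : E) r (y : E) : C1 f g -> csupp f g x0 r ->
 \int[mu]_x dotprod (g x) y = 0.
Proof.
move=> fg fs; have [cf cg df] := fg; have [mf mg] := mC1 fg.
have cd : continuous (fun x => dotprod (g x) y) by apply: cont_dot => //; exact: cont_cst.
have ds x : ~ cube x0 r x -> dotprod (g x) y = 0 by move=> /fs[_ ->]; rewrite dot0l.
have [B B0 hB] := cont_csupp_bounded cd ds.
have [Bf Bf0 hBf] := cont_csupp_bounded cf (fun x h => (fs x h).1).
have md : mble (fun x => dotprod (g x) y) by side.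
have intd := intg_bounded_cube md ds hB.
have intf := intg_bounded_cube mf (fun x h => (fs x h).1) hBf.
pose t k : R := k.+1%:R^-1.
pose h k x := (f (x + t k *: y) - f x) / t k.
have tp k : 0 < t k by side.
have t1 k : t k <= 1 by rewrite invf_le1 ?ltr0n// ler1n.
have mh k : mble (h k).
 by side.
have Ih k : L1 mu (h k) /\ \int[mu]_x h k x = 0.
 have i1 : L1 mu (fun x : E => f (x + t k *: y) - f x).
  by have := integrableB measurableT (intg_shift (t k *: y) intf) intf.
 have i2 : L1 mu (h k).
  by have := integrableZr measurableT (t k)^-1 i1.
 split; first exact: i2.
 have -> : \int[mu]_x h k x = (\int[mu]_x (f (x + t k *: y) - f x)) * (t k)^-1.
  exact: (RintegralZr (t k)^-1 measurableT i1).
 have -> := RintegralB measurableT (intg_shift (t k *: y) intf) intf.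
 by rewrite Rint_shift// subrr mul0r.
(* The steps [t k] are at most 1, so this cube contains the supports of all quotients. *)
pose D := cube x0 (r + `|y|).
have mD : measurable D by exact: mcube.
have hD k x : ~ D x -> h k x = 0.
 move=> nD; rewrite /h.
 have s1 : ~ cube x0 r x by apply: contra_not nD; apply: sub_cube; rewrite lerDl.
 have s2 : ~ cube x0 r (x + t k *: y).
  apply: contra_not nD => h1; rewrite /D /cube/=.
  have -> : x - x0 = (x + t k *: y - x0) - t k *: y by rewrite addrAC addrK.
  rewrite (le_lt_trans (ler_normB _ _))// ltr_leD// normrZ gtr0_norm//.
  by rewrite ler_piMl.
 by rewrite (fs _ s1).1 (fs _ s2).1 subrr mul0r.
have hb k x : `|h k x| <= B.
 have [s s01 hs] := C1_mvt x (t k *: y) fg.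
 by rewrite /h hs dotZr mulrAC divff ?gt_eqF// mul1r.
have hcv x : h k x @[k --> \oo] --> dotprod (g x) y.
 have [dd de] := df x y 0.
 rewrite scale0r addr0 in de; rewrite -de.
 have /cvg_dnbhs_at_right/cvg_at_rightP := dd.
 move=> hh; have := hh t (conj tp (@cvg_harmonic R)).
 have -> : (fun k => h k x) = (fun k => (t k)^-1 *: (((fun t0 : R => f (x + t0 *: y)) \o shift 0) (t k *: 1) - f (x + 0 *: y))).
  apply/funext => k; rewrite /= addr0 scale0r addr0 [(t k)%:A]mulr1.
  exact: mulrC.
 exact.
have hBD k x : D x -> `|h k x| <= cst B x by side.
have BD : (\int[mu]_(x in D) (cst B x)%:E < +oo)%E.
 have [r0|r0] := ltP 0 (r + `|y|); first by have -> := int_cst_cube x0 B r0; rewrite ltry.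
 rewrite (_ : D = set0) ?integral_set0// -subset0 => x.
 by rewrite /D /cube/= => xr; have := le_lt_trans (normr_ge0 _) xr; rewrite ltNge r0.
have mB : mble (cst B : E -> R) by side.
have cvgI := int_dct mD mh md mB hBD (aeW _ (fun x _ => hcv x)) BD.
apply/eqP; rewrite -normr_le0; apply/ler_addgt0Pr => e e0; rewrite add0r.
have [N /(_ _ (leqnn N)) hN] := cvgI e e0.
have [iN zN] := Ih N.
have iD : L1 mu (fun x : E => h N x - dotprod (g x) y).
 by have := integrableB measurableT iN intd.
have -> : `|\int[mu]_x dotprod (g x) y| = `|\int[mu]_x (h N x - dotprod (g x) y)|.
 by have -> := RintegralB measurableT iN intd; rewrite zN sub0r normrN.
rewrite -lee_fin (EFin_normr_Rintegral measurableT iD).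
apply: (le_trans (le_abse_integral mu measurableT _)).
 by side.
apply: le_trans hN; rewrite [leRHS]int_indic.
apply: int_le => //.
- by side.
- apply: measurable_funM; first exact: mabsB.
 by side.
- move=> x _; rewrite indicE; have [xD|xD] := boolP (x \in D); first by rewrite mulr1.
 have nD : ~ D x by move=> /mem_set; apply/negP.
 rewrite hD// ds ?subrr ?normr0 ?mul0r//.
 by apply: contra_not nD; apply: sub_cube; rewrite lerDl.
Qed.

End c1.

(** A quadratic remainder settles differentiability where formulas are glued, such as [pos2] at its
    kink and [psi] at 0, and under the integral sign of a convolution. *)
Lemma is_derive_quad {R : realType} (f : R -> R) (K u l : R) :
 (forall t, `|t| <= 1 -> `|f (u + t) - f u - l * t| <= K * t ^+ 2) ->
 is_derive u 1 f l.
Proof.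
move=> fK.
have h : (h^-1 *: ((f \o shift u) h%:A - f u)) @[h --> 0^'] --> l.
 apply/cvgrPdist_le => e e0; near=> h.
 have h0 : h != 0 by near: h; exact: nbhs_dnbhs_neq.
 rewrite /= /GRing.scale/= mulr1.
 have -> : l - h^-1 * (f (h + u) - f u) = - (h^-1 * (f (u + h) - f u - l * h)).
  by rewrite (addrC h u); field.
 rewrite normrN normrM normfV ler_pdivrMl ?normr_gt0//.
 have h1 : `|h| <= 1 by near: h; exact: dnbhs0_le.
 apply: le_trans (fK h h1) _.
 have K1 : 0 < `|K| + 1 by side.
 have he : `|h| <= e / (`|K| + 1) by near: h; apply: dnbhs0_le; rewrite divr_gt0.
 rewrite ler_pdivlMr// in he.
 rewrite -real_normK ?num_real// expr2 mulrCA ler_wpM2l//.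
 by have := ler_norm K; have := normr_ge0 h; nra.
split; first by apply/cvg_ex; exists l.
exact: (cvg_lim _ h).
Unshelve. all: by end_near. Qed.

(** * Cut-off profiles of class C^1 *)

Section profile.
Context {R : realType} {n : nat}.
Local Notation E := 'rV[R]_n.
Implicit Types (u k d : R) (x y : E).

Definition pos2 u := Num.max u 0 ^+ 2.
Definition dpos2 u := 2 * Num.max u 0.

Lemma pos2_ge0 u : 0 <= pos2 u. Proof. exact: sqr_ge0. Qed.

Lemma dpos2_ge0 u : 0 <= dpos2 u.
Proof. by rewrite mulr_ge0// le_max lexx orbT. Qed.

Lemma pos2_eq0 u : u <= 0 -> pos2 u = 0.
Proof. by move=> u0; rewrite /pos2 max_r// expr0n. Qed.

Lemma dpos2_eq0 u : u <= 0 -> dpos2 u = 0.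
Proof. by move=> u0; rewrite /dpos2 max_r// mulr0. Qed.

Lemma pos2_pos u : 0 <= u -> pos2 u = u ^+ 2.
Proof. by move=> u0; rewrite /pos2 max_l. Qed.

Lemma dpos2_pos u : 0 <= u -> dpos2 u = 2 * u.
Proof. by move=> u0; rewrite /dpos2 max_l. Qed.

Lemma pos2_taylor u t : `|pos2 (u + t) - pos2 u - dpos2 u * t| <= t ^+ 2.
Proof.
rewrite ler_norml /pos2 /dpos2.
by case: (leP u 0) => u0; case: (leP (u + t) 0) => t0;
 rewrite ?(max_r u0) ?(max_r t0) ?(max_l (ltW u0)) ?(max_l (ltW t0)); nra.
Qed.

Lemma cont_dpos2 : continuous dpos2.
Proof.
apply: contM; first exact: cont_cst.
move=> u; apply: continuous_max; [exact: cvg_id|exact: cvg_cst].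
Qed.

Lemma is_derive_pos2 u : is_derive u 1 pos2 (dpos2 u).
Proof. by apply: (@is_derive_quad R pos2 1) => t _; rewrite mul1r; exact: pos2_taylor. Qed.

(* C^1 profile: 1 where |y| <= k and 0 where k + d <= |y|. *)
Definition prof_sum k d y :=
 \sum_i (pos2 ((y ord0 i - k) / d) + pos2 ((- y ord0 i - k) / d)).
Definition prof k d y := pos2 (1 - prof_sum k d y).
Definition dprof_sum k d y : E :=
 \sum_i (dpos2 ((y ord0 i - k) / d) / d - dpos2 ((- y ord0 i - k) / d) / d) *: delta_mx ord0 i.
Definition dprof k d y : E := - (dpos2 (1 - prof_sum k d y) *: dprof_sum k d y).

Lemma prof_C1 k d : C1 (prof k d) (dprof k d).
Proof.
have pc (s : R) i : C1 (fun x : E => pos2 ((s * x ord0 i - k) / d))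
  (fun x : E => (dpos2 ((s * x ord0 i - k) / d) / d * s) *: delta_mx ord0 i).
 have h := C1_comp (C1_scale d^-1 (C1_sub (C1_scale s (@C1_coord R n i)) (C1_cst k))) is_derive_pos2 cont_dpos2.
 move: h; congr C1; apply/funext => x; rewrite ?(mulrC d^-1)//.
 by rewrite /cst subr0 !scalerA -!mulrA.
have sc : C1 (prof_sum k d) (dprof_sum k d).
 apply: C1_sum => i; have := C1_add (pc 1 i) (pc (-1) i).
 congr C1; apply/funext => x; rewrite !mul1r !mulN1r//.
 by rewrite mulr1 mulrN1 -scalerDl.
have := C1_comp (C1_sub (C1_cst 1) sc) is_derive_pos2 cont_dpos2.
by congr C1; apply/funext => x; rewrite /cst sub0r scalerN.
Qed.

Lemma prof_sum_ge0 k d y : 0 <= prof_sum k d y.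
Proof. by apply: sumr_ge0 => i _; rewrite addr_ge0 ?pos2_ge0. Qed.

Lemma prof_ge0 k d y : 0 <= prof k d y. Proof. exact: pos2_ge0. Qed.

Lemma prof_le1 k d y : prof k d y <= 1.
Proof.
rewrite /prof /pos2; have := prof_sum_ge0 k d y; set s := prof_sum k d y => s0.
by case: (leP (1 - s) 0) => h; nra.
Qed.

Lemma prof_eq1 k d y : 0 < d -> (forall i, `|y ord0 i| <= k) -> prof k d y = 1.
Proof.
move=> d0 yk; rewrite /prof /prof_sum big1 ?subr0.
 by rewrite pos2_pos// expr1n.
move=> i _; have := yk i; rewrite ler_norml => /andP[h1 h2].
by rewrite !pos2_eq0 ?addr0// pmulr_lle0 ?invr_gt0//; lra.
Qed.

Lemma prof_sum_ge1 k d y i : 0 < d -> k + d <= `|y ord0 i| -> 1 <= prof_sum k d y.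
Proof.
move=> d0 yk; rewrite /prof_sum (bigD1 i)//=.
have r0 : 0 <= \sum_(j < n | j != i) (pos2 ((y ord0 j - k) / d) + pos2 ((- y ord0 j - k) / d)).
 by apply: sumr_ge0 => j _; rewrite addr_ge0 ?pos2_ge0.
rewrite ler_wpDr//.
case: (leP 0 (y ord0 i)) => yi.
 rewrite ger0_norm// in yk; rewrite ler_wpDr ?pos2_ge0//.
 have h1 : 1 <= (y ord0 i - k) / d by rewrite ler_pdivlMr//; lra.
 by rewrite pos2_pos ?(le_trans _ h1)// exprn_ege1.
rewrite ltr0_norm// in yk; rewrite ler_wpDl ?pos2_ge0//.
have h1 : 1 <= (- y ord0 i - k) / d by rewrite ler_pdivlMr//; lra.
by rewrite pos2_pos ?(le_trans _ h1)// exprn_ege1.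
Qed.

Lemma prof_eq0 k d y i : 0 < d -> k + d <= `|y ord0 i| -> prof k d y = 0 /\ dprof k d y = 0.
Proof.
move=> d0 yk; have h := prof_sum_ge1 d0 yk.
by rewrite /prof /dprof pos2_eq0 ?dpos2_eq0 ?subr_le0// scale0r oppr0.
Qed.

(** Where the penalties sum up to 1 or more the outer derivative vanishes. Elsewhere each penalty is
    at most 1, so outer and inner derivatives are at most 2 and 2/d. The case distinction records
    that direction [i] contributes only where |y_i| >= k; this is what later matches the profile
    with the truncation of a single component. *)
Lemma dprof_coord k d y i : 0 < d ->
 `|dprof k d y ord0 i| <= 4 / d * (if (k <= `|y ord0 i|) then 1 else 0).
Proof.
move=> d0; have sE : dprof_sum k d y ord0 i = dpos2 ((y ord0 i - k) / d) / d - dpos2 ((- y ord0 i - k) / d) / d.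
 rewrite /dprof_sum summxE (bigD1 i)//= !mxE !eqxx mulr1 big1 ?addr0// => j ji.
 by rewrite !mxE [i == j]eq_sym (negbTE ji) andbF mulr0.
have [h1|h1] := leP 1 (prof_sum k d y).
 have -> : dprof k d y = 0 by rewrite /dprof dpos2_eq0 ?subr_le0// scale0r oppr0.
 rewrite [X in `|X|]mxE normr0; apply: mulr_ge0; first by side.
 by case: (k <= _).
have p1 : dpos2 (1 - prof_sum k d y) <= 2.
 by rewrite dpos2_pos; have := prof_sum_ge0 k d y; lra.
have pp := dpos2_ge0 (1 - prof_sum k d y).
have term : pos2 ((y ord0 i - k) / d) <= 1 /\ pos2 ((- y ord0 i - k) / d) <= 1.
 have : pos2 ((y ord0 i - k) / d) + pos2 ((- y ord0 i - k) / d) <= prof_sum k d y.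
  rewrite /prof_sum (bigD1 i)//= lerDl.
  by apply: sumr_ge0 => j _; rewrite addr_ge0 ?pos2_ge0.
 by have := pos2_ge0 ((y ord0 i - k) / d); have := pos2_ge0 ((- y ord0 i - k) / d); lra.
have d2 u : pos2 u <= 1 -> dpos2 u <= 2.
 case: (leP u 0) => u0; first by rewrite dpos2_eq0.
 by rewrite (pos2_pos (ltW u0)) (dpos2_pos (ltW u0)) (expr_le1 (n := 2)) ?(ltW u0)// => u1; lra.
have [t1 t2] := term.
have := d2 _ t1; have := d2 _ t2; have := dpos2_ge0 ((y ord0 i - k) / d); have := dpos2_ge0 ((- y ord0 i - k) / d).
set A := dpos2 _ => A0; set B := dpos2 _ => B0 A2 B2.
have -> : dprof k d y ord0 i = - (dpos2 (1 - prof_sum k d y) * ((B - A) / d)).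
 by rewrite /dprof !mxE sE -mulrBl.
rewrite normrN normrM (ger0_norm pp) normrM (gtr0_norm (_ : 0 < d^-1)) ?invr_gt0//.
have [ky|ky] := leP k `|y ord0 i|.
 rewrite mulr1 mulrA ler_wpM2r ?invr_ge0 ?(ltW d0)//.
 have : `|B - A| <= 2 by rewrite ler_norml; lra.
 by have := normr_ge0 (B - A); nra.
move: ky; rewrite ltr_norml => /andP[k1 k2].
have a1 : (y ord0 i - k) / d <= 0 by rewrite pmulr_lle0 ?invr_gt0//; lra.
have a2 : (- y ord0 i - k) / d <= 0 by rewrite pmulr_lle0 ?invr_gt0//; lra.
by rewrite /A /B (dpos2_eq0 a1) (dpos2_eq0 a2) subrr normr0 mul0r !mulr0.
Qed.

End profile.

(** * Smooth functions and bumps *)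

Section psi.
Context {R : realType}.
Implicit Types (t : R) (j : nat).

(* [fun t => t^-j e^(-1/t)], extended by 0: the family is stable under
  derivation, which makes bumps built from it smooth. *)
Definition psi j t := if 0 < t then t^-1 ^+ j * expR (- t^-1) else 0.

Definition dpsi j t := psi j.+2 t - j%:R * psi j.+1 t.

Lemma psi_ge0 j t : 0 <= psi j t.
Proof.
by rewrite /psi; case: ifP => // t0; rewrite mulr_ge0 ?expR_ge0// exprn_ge0// invr_ge0 ltW.
Qed.

(** From e^x = (e^(x/N))^N >= (x/N)^N with N = j + 2 and x = 1/t. The two powers of [t] left over
    give the quadratic remainder that makes [psi j] differentiable at 0. *)
Lemma psi_le j t : 0 <= t -> psi j t <= (j.+2%:R ^+ j.+2) * t ^+ 2.
Proof.
move=> t0; rewrite /psi; case: ifPn => [tp|_]; last first.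
 by side.
have k0 : 0 < j.+2%:R :> R by side.
have e1 : (j.+2%:R * t)^-1 ^+ j.+2 <= expR (t^-1).
 have -> : t^-1 = (j.+2%:R * t)^-1 * j.+2%:R by field; rewrite gt_eqF//= gt_eqF.
 rewrite expRM_natr lerXn2r// ?nnegrE ?expR_ge0// ?invr_ge0 ?mulr_ge0//.
 by apply: le_trans (expR_ge1Dx _); rewrite lerDr.
rewrite expRN.
have e2 : (expR t^-1)^-1 <= (j.+2%:R * t) ^+ j.+2.
 rewrite -[leRHS]invrK lef_pV2 ?posrE ?expR_gt0 ?invr_gt0 ?exprn_gt0 ?mulr_gt0//.
 by rewrite -exprVn.
apply: le_trans (ler_wpM2l _ e2) _; first by side.
rewrite exprMn mulrCA ler_wpM2l ?exprn_ge0//.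
rewrite exprVn -(addn2 j) exprD mulrA mulVf ?mul1r//.
by side.
Qed.

Lemma is_derive_psi j t : is_derive t 1 (psi j) (dpsi j t).
Proof.
have [t0|t0|->] := ltgtP t 0.
- have -> : dpsi j t = 0 by rewrite /dpsi /psi ltNge (ltW t0)/= mulr0 subr0.
 have nr : \near t, cst 0 t = psi j t.
  near=> s; rewrite /psi /cst ifF//; apply/negbTE; rewrite -leNgt.
  apply: ltW; by near: s; exact: lt_nbhsl.
 exact: (near_eq_is_derive nr (@is_derive_cst R R R 0 t 1)).
- have -> : dpsi j t = t^-1 ^+ j.+2 * expR (- t^-1) - j%:R * (t^-1 ^+ j.+1 * expR (- t^-1)).
  by rewrite /dpsi /psi t0.
 have nr : \near t, t^-1 ^+ j * expR (- t^-1) = psi j t.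
  near=> s; rewrite /psi ifT//.
  by near: s; exact: lt_nbhsr.
 apply: (near_eq_is_derive nr) => {nr}.
 have tn : t != 0 by side.
 have dV : is_derive t 1 (fun s : R => s^-1) (- t ^- 2).
  by apply: is_derive_eq; [exact: (@is_deriveV R id)|rewrite /GRing.scale/= mulr1].
 elim: j => [|j IH].
  rewrite mul0r subr0.
  have -> : (fun s : R => s^-1 ^+ 0 * expR (- s^-1)) = expR \o (fun s : R => - s^-1).
   by apply/funext => s; rewrite expr0 mul1r.
  apply: is_derive_eq.
  by rewrite /GRing.scale/= opprK mulrC exprVn.
 have -> : (fun s : R => s^-1 ^+ j.+1 * expR (- s^-1)) = (fun s : R => s^-1 * (s^-1 ^+ j * expR (- s^-1))).
  by apply/funext => s; rewrite exprS mulrA.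
 have h := is_deriveM dV IH; apply: (is_derive_eq h).
 rewrite /GRing.scale/= -exprVn -[j.+1%:R]natr1 !exprS; ring.
- have -> : dpsi j 0 = 0 by rewrite /dpsi /psi ltxx/= mulr0 subr0.
 apply: (@is_derive_quad R (psi j) (j.+2%:R ^+ j.+2)) => h _.
 rewrite add0r mul0r subr0 {2}/psi ltxx subr0 ger0_norm ?psi_ge0//.
 have [h0|h0] := leP 0 h; first exact: psi_le.
 by rewrite /psi ltNge (ltW h0)/= mulr_ge0 ?sqr_ge0 ?exprn_ge0.
Unshelve. all: by end_near. Qed.

Lemma cont_dpsi j : continuous (dpsi j).
Proof.
have cp i : continuous (psi i).
 by move=> t; apply/differentiable_continuous/derivable1_diffP; have [] := is_derive_psi i t.
by apply: contB => //; apply: contM => //; exact: cont_cst.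
Qed.

End psi.

Section smooth.
Context {R : realType} {n : nat}.
Local Notation E := 'rV[R]_n.
Local Notation mu := (@lebesgue_rV R n).
Implicit Types (f : E -> R) (g : E -> E).

(** A syntactic class closed under partial derivatives, since [dpsi j] is a combination of
    [psi j.+2] and [psi j.+1]. Membership yields [Ck k] for all [k] by induction on [k], without
    formulas for higher derivatives. *)
Inductive smooth : (E -> R) -> Prop :=
| smooth_cst c : smooth (cst c)
| smooth_coord i : smooth (fun x => x ord0 i)
| smooth_add f f' : smooth f -> smooth f' -> smooth (fun x => f x + f' x)
| smooth_mul f f' : smooth f -> smooth f' -> smooth (fun x => f x * f' x)
| smooth_psi j f : smooth f -> smooth (fun x => psi j (f x)).

Lemma smooth_sum (I : Type) (s : seq I) (F : I -> E -> R) :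
 (forall i, smooth (F i)) -> smooth (fun x => \sum_(i <- s) F i x).
Proof.
move=> h; elim: s => [|i s IH].
 rewrite (_ : (fun x => _) = cst 0); first exact: smooth_cst.
 by apply/funext => x; rewrite big_nil.
rewrite (_ : (fun x => _) = (fun x => F i x + \sum_(j <- s) F j x)); first exact: smooth_add.
by apply/funext => x; rewrite big_cons.
Qed.

Lemma smooth_C1_ex f : smooth f ->
 exists2 g, C1 f g & forall i, smooth (fun x => g x ord0 i).
Proof.
elim=> {f} [c|i|f f' _ [g fg sg] _ [g' fg' sg']|f f' sf [g fg sg] sf' [g' fg' sg']|j f sf [g fg sg]].
- exists (cst 0); first exact: C1_cst.
 by move=> i; rewrite (_ : (fun x => _) = cst 0); [exact: smooth_cst|apply/funext => x; rewrite mxE].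
- exists (cst (delta_mx ord0 i)); first exact: C1_coord.
 move=> k; exact: smooth_cst.
- exists (fun x => g x + g' x); first exact: C1_add.
 move=> i; rewrite (_ : (fun x => _) = (fun x => g x ord0 i + g' x ord0 i)).
  exact: smooth_add.
 by apply/funext => x; rewrite mxE.
- exists (fun x => f x *: g' x + f' x *: g x); first exact: C1_mul.
 move=> i; rewrite (_ : (fun x => _) = (fun x => f x * g' x ord0 i + f' x * g x ord0 i)).
  by apply: smooth_add; exact: smooth_mul.
 by apply/funext => x; rewrite !mxE.
- exists (fun x => dpsi j (f x) *: g x).
  by apply: C1_comp => //; [exact: is_derive_psi|exact: cont_dpsi].
 move=> i; rewrite (_ : (fun x => _) = (fun x => (psi j.+2 (f x) + (- j%:R) * psi j.+1 (f x)) * g x ord0 i)).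
  apply: smooth_mul => //; apply: smooth_add; first exact: smooth_psi.
  apply: smooth_mul; [exact: smooth_cst|exact: smooth_psi].
 by apply/funext => x; rewrite !mxE /dpsi mulNr.
Qed.

Lemma C1_derive f g (x y : E) : C1 f g ->
 derivable f x y /\ 'D_y f x = dotprod (g x) y.
Proof.
move=> [_ _ df]; have [dd de] := df x y 0.
rewrite scale0r addr0 in de; rewrite -de.
have eqF : (fun h : R => h^-1 *: ((f \o shift x) (h *: y) - f x)) =
  (fun h : R => h^-1 *: (((fun t : R => f (x + t *: y)) \o shift 0) h%:A - f (x + 0 *: y))).
 apply/funext => h; rewrite /= addr0 scale0r addr0 [h%:A]mulr1.
 by rewrite (addrC x).
by split; [rewrite /derivable eqF|rewrite /derive eqF].
Qed.

Lemma C1_grad f g : C1 f g -> g = grad f.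
Proof.
move=> fg; apply/funext => x; apply/rowP => i; rewrite mxE /partial.
by rewrite (C1_derive x _ fg).2 dot_delta.
Qed.

Lemma smooth_C1 f : smooth f -> C1 f (grad f).
Proof. by move=> /smooth_C1_ex[g fg _]; rewrite -(C1_grad fg). Qed.

Lemma smooth_partial f i : smooth f -> smooth (partial i f).
Proof.
move=> /smooth_C1_ex[g fg sg]; have := sg i; rewrite (C1_grad fg).
by congr smooth; apply/funext => x; rewrite mxE.
Qed.

Lemma smooth_Ck k f : smooth f -> Ck k f.
Proof.
elim: k f => [|k IH] f sf; have fg := smooth_C1 sf; have [cf _ _] := fg; split => // i.
split; first by move=> x; exact: (C1_derive x _ fg).1.
by apply: IH; exact: smooth_partial.
Qed.

Lemma smooth_test f (x0 : E) r : smooth f -> (forall x, ~ cube x0 r x -> f x = 0) ->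
 test_function f.
Proof.
move=> sf f0; split; first by move=> k; exact: smooth_Ck.
apply: bounded_closed_compact; last exact: closed_closure.
have cl : closure [set x | f x != 0] `<=` [set x | `|x| <= `|x0| + r].
 have c1 : closed [set x : E | `|x| <= `|x0| + r].
  rewrite (_ : [set x : E | _] = (fun x : E => `|x|) @^-1` [set u | u <= `|x0| + r])//.
  apply: closed_comp; last exact: closed_le.
  by move=> x _; exact: norm_continuous.
 have s1 : [set x | f x != 0] `<=` [set x | `|x| <= `|x0| + r].
  move=> x /= fx.
  have : cube x0 r x by apply: contrapT => /f0 /eqP; apply/negP.
  by rewrite /cube/= => h; rewrite -(subrK x0 x) addrC (le_trans (ler_normD _ _))// lerD2l ltW.
 by have h := closure_subset s1; rewrite -((closure_id _).1 c1) in h.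
exists (`|x0| + r); split; first exact: num_real.
by move=> u ru x /cl /= h; exact: le_trans h (ltW ru).
Qed.

(** The standard unnormalised mollifier, exp(-1/(d^2 - |z|^2)) extended by 0. Its support lies in
    the Euclidean ball, hence in the max-norm cube, of radius [d]. *)
Definition bump (d : R) (z : E) : R := psi 0 (d ^+ 2 - dotprod z z).

Lemma bump_smooth d (x : E) (s : R) : smooth (fun y => bump d (x + s *: y)).
Proof.
apply: smooth_psi.
rewrite (_ : (fun y : E => _) = (fun y : E => d ^+ 2 + (-1) * \sum_(i < n) (x ord0 i + s * y ord0 i) * (x ord0 i + s * y ord0 i))).
 apply: smooth_add; first exact: smooth_cst.
 apply: smooth_mul; first exact: smooth_cst.
 apply: smooth_sum => i; apply: smooth_mul; apply: smooth_add; try exact: smooth_cst;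
  by apply: smooth_mul; [exact: smooth_cst|exact: smooth_coord].
apply/funext => y; rewrite mulN1r; congr (_ - _).
by apply: eq_bigr => i _; rewrite !mxE.
Qed.

Lemma bump0 d z : 0 < d -> d <= `|z| -> bump d z = 0.
Proof.
move=> d0 dz; rewrite /bump /psi ifF//; apply/negbTE; rewrite -leNgt subr_le0.
have h := le_trans dz (norm_le_enorm z).
by rewrite -enorm_sqr lerXn2r ?nnegrE ?enorm_ge0// (ltW d0).
Qed.

Lemma bumpN d z : bump d (- z) = bump d z.
Proof. by rewrite /bump dotNl dotNr opprK. Qed.

Lemma bump_ge0 d z : 0 <= bump d z. Proof. exact: psi_ge0. Qed.

Lemma bump_int d : 0 < d -> exists2 c : R, 0 < c & (\int[mu]_z (bump d z)%:E = c%:E)%E.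
Proof.
move=> d0; have sm := bump_smooth d 0 1.
have eqb : (fun y : E => bump d (0 + 1 *: y)) = bump d.
 by apply/funext => y; rewrite add0r scale1r.
rewrite eqb in sm; have [cb _ _] := smooth_C1 sm.
have mb := cont_measurable_rV cb.
have b0 z : ~ cube 0 d z -> bump d z = 0.
 by rewrite /cube/= subr0 => /negP; rewrite -leNgt; exact: bump0.
have [B B0 hB] := cont_csupp_bounded cb b0.
have bi := intg_bounded_cube mb b0 hB.
exists (\int[mu]_z bump d z); last by rewrite intg_fine.
rewrite -lte_fin intg_fine//.
(* On the cube of this radius |z| <= n r <= d/2, so d^2 - |z|^2 >= d^2/2 and the bump is at least
   [k]; this makes its integral positive. *)
pose r := d / (2 * (n%:R + 1)).
have n0 : 0 <= n%:R :> R by side.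
have n1 : 0 < 2 * (n%:R + 1) :> R by side.
have r0 : 0 < r by side.
pose k := expR (- (d ^+ 2 / 2)^-1).
have mc := mcube (0 : E) r.
apply: (@lt_le_trans _ _ (\int[mu]_(z in cube 0%R r) (cst k z)%:E)%E).
 have -> := int_cst_cube (0 : E) k r0.
 by rewrite lte_fin mulr_gt0 ?expR_gt0// exprn_gt0// mulr_gt0.
apply: (via (\int[mu]_(z in cube 0%R r) (bump d z)%:E)%E).
 apply: int_le => //.
 - by move=> x _; rewrite expR_ge0.
 - move=> x; rewrite /cube/= subr0 => xr.
  have h : dotprod x x <= d ^+ 2 / 2.
   rewrite -enorm_sqr.
   have h1 : enorm x <= d / 2.
    apply: le_trans (enorm_le_norm x) _.
    apply: le_trans (ler_wpM2l n0 (ltW xr)) _.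
    rewrite /r mulrA ler_pdivrMr//.
    have -> : d / 2 * (2 * (n%:R + 1)) = n%:R * d + d by field.
    by side.
   apply: (via ((d / 2) ^+ 2)).
    by rewrite lerXn2r// nnegrE ?enorm_ge0// divr_ge0// (ltW d0).
   by rewrite expr_div_n; nra.
  have d2 : 0 < d ^+ 2 / 2 by side.
  have h2 : d ^+ 2 / 2 <= d ^+ 2 - dotprod x x by lra.
  have h3 := lt_le_trans d2 h2.
  rewrite /cst /bump /psi h3 expr0 mul1r /k ler_expR lerN2 lef_pV2//.
apply: int_sub => // x _; exact: bump_ge0.
Qed.

End smooth.

Section lipschitz.
Context {R : realType} {V W : normedModType R}.

Lemma lip_continuous (f : V -> W) (L : R) :
 (forall x y, `|f y - f x| <= L * `|y - x|) -> continuous f.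
Proof.
move=> fL x; apply/cvgrPdist_le => e e0.
have L1 : 0 < `|L| + 1 by side.
near=> y.
have hy : `|x - y| <= e / (`|L| + 1) by near: y; apply: cvgr_dist_le; [exact: cvg_id|rewrite divr_gt0].
rewrite distrC; apply: le_trans (fL x y) _; rewrite distrC in hy.
rewrite ler_pdivlMr// in hy; apply: le_trans hy.
by rewrite mulrC; have := ler_norm L; have := normr_ge0 (y - x); nra.
Unshelve. all: by end_near. Qed.

End lipschitz.

Section signed2.
Context d (T : measurableType d) (R : realType) (mu : {measure set T -> \bar R}).
Implicit Types (f g : T -> R) (D : set T).

Lemma Rint_le_int D f g : measurable D -> mu.-integrable D (EFin \o f) ->
 mble g -> (forall x, D x -> 0 <= g x) ->
 (forall x, D x -> f x <= g x) ->
 ((\int[mu]_(x in D) f x)%:E <= \int[mu]_(x in D) (g x)%:E)%E.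
Proof.
move=> mD fi mg g0 fg.
have [->|gfin] := eqVneq (\int[mu]_(x in D) (g x)%:E)%E (+oo)%E; first exact: leey.
have gi : mu.-integrable D (EFin \o g).
 apply: (@intg_dom _ _ _ _ _ _ g) => //; last by rewrite ltey.
 by move=> x Dx; rewrite ger0_norm// g0.
rewrite -(intg_fine mD gi) lee_fin; exact: le_Rintegral.
Qed.

Lemma Rint_sum D (I : Type) (s : seq I) (F : I -> T -> R) : measurable D ->
 (forall i, mu.-integrable D (EFin \o F i)) ->
 mu.-integrable D (EFin \o (fun x => \sum_(i <- s) F i x)) /\
 \int[mu]_(x in D) (\sum_(i <- s) F i x) = \sum_(i <- s) \int[mu]_(x in D) F i x.
Proof.
move=> mD Fi; elim: s => [|i s [IH1 IH2]].
 rewrite (_ : (fun x => _) = cst 0); last by apply/funext => x; rewrite big_nil.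
 split; first exact: integrable0.
 by rewrite big_nil /Rintegral integral0_eq.
rewrite (_ : (fun x => _) = (fun x => F i x + \sum_(j <- s) F j x)); last first.
 by apply/funext => x; rewrite big_cons.
have a1 : mu.-integrable D (EFin \o (fun x => F i x + \sum_(j <- s) F j x)).
 by have := integrableD mD (Fi i) IH1.
by split => //; rewrite big_cons -IH2 -RintegralD.
Qed.

End signed2.

(** * Mollification of functions and fields *)

Section mollification.
Context {R : realType} {n : nat}.
Local Notation E := 'rV[R]_n.
Local Notation mu := (@lebesgue_rV R n).
Implicit Types (f k : E -> R) (g : E -> E).

Lemma C1_csupp f g (x0 : E) (r s : R) : C1 f g -> (forall x, ~ cube x0 r x -> f x = 0) ->
 r < s -> csupp f g x0 s.
Proof.
move=> fg f0 rs x nx.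
have xr : r < `|x - x0|.
 by apply: lt_le_trans rs _; rewrite leNgt; apply/negP => h; apply: nx.
split; first by apply: f0; rewrite /cube/= => /(lt_trans xr); rewrite ltxx.
have nr : \near x, f x = cst 0 x.
 have cn : continuous (fun y : E => `|y - x0|).
  apply: (@cont_comp _ _ _ (fun y : E => y - x0) (fun y : E => `|y|)); last exact: norm_continuous.
  by apply: contB; [exact: cont_id|exact: cont_cst].
 have : \forall y \near x, r < `|y - x0|.
  exact: (cvgr_gt _ (cn x) _ xr).
 apply: filterS => y ry; apply: f0; rewrite /cube/= => h.
 by have := lt_trans ry h; rewrite ltxx.
apply: dot_eq0; rewrite -(C1_derive x (g x) fg).2.
by rewrite (near_eq_derive _ nr) derive_cst.
Qed.

Lemma C1_refl f g (x : E) : C1 f g -> C1 (fun y => f (x - y)) (fun y => - g (x - y)).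
Proof.
move=> [cf cg df].
have cr : continuous (fun y : E => x - y) by apply: contB; [exact: cont_cst|exact: cont_id].
split.
- exact: (cont_comp cr cf).
- apply: (@cont_comp _ _ _ (fun y : E => g (x - y)) (fun z => - z)); first exact: (cont_comp cr cg).
 by move=> y; exact: opp_continuous.
- move=> y z t; have := df (x - y) (- z) t.
 rewrite dotNr -dotNl opprD addrA scalerN.
 rewrite (_ : (fun t : R => f (x - y + t *: - z)) = (fun t : R => f (x - (y + t *: z))))//.
 by apply/funext => u; rewrite opprD addrA scalerN.
Qed.

(* A kernel all of whose derivatives are bounded and Lipschitz. *)
Definition kernel k := smooth k /\ exists r, forall x, ~ cube 0 r x -> k x = 0.

Lemma kernel_bounded k : kernel k -> exists2 B : R, 0 <= B & forall x, `|k x| <= B.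
Proof.
move=> [sk [r kr]]; have [ck _ _] := smooth_C1 sk; exact: cont_csupp_bounded ck kr.
Qed.

Lemma kernel_partial k i : kernel k -> kernel (partial i k).
Proof.
move=> [sk [r kr]]; split; first exact: smooth_partial.
exists (r + 1) => x nx.
have [|_ g0] := C1_csupp (s := r + 1) (smooth_C1 sk) kr _ nx; first by rewrite ltrDl.
by have := congr1 (fun z : E => z ord0 i) g0; rewrite !mxE.
Qed.

Lemma kernel_lip k : kernel k -> exists2 L : R, 0 <= L &
 forall x y, `|k (x + y) - k x| <= L * `|y|.
Proof.
move=> kk.
have /choice[B hB] : forall i, exists B, 0 <= B /\ forall x, `|partial i k x| <= B.
 by move=> i; have [B B0 h] := kernel_bounded (kernel_partial i kk); exists B.
exists (\sum_i B i); first by apply: sumr_ge0 => i _; have [] := hB i.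
move=> x y; have [s _ ->] := C1_mvt x y (smooth_C1 kk.1).
rewrite mulr_suml; apply: le_trans (ler_norm_sum _ _ _) _.
apply: ler_sum => i _; rewrite normrM mxE.
by apply: ler_pM => //; [have [_] := hB i; exact|exact: coord_le_norm].
Qed.

Definition mol k f (x : E) := \int[mu]_y (f y * k (x - y)).

Section mol.
Variable f : E -> R.
Hypothesis fi : L1 mu f.
Let N := \int[mu]_y `|f y|.

Let mf : mble f.
Proof. by have /integrableP[/measurable_EFinP] := fi. Qed.

Lemma mol_bound (k1 : E -> R) B : mble k1 -> (forall y, `|k1 y| <= B) ->
 L1 mu (fun y => f y * k1 y) /\
 `|\int[mu]_y (f y * k1 y)| <= B * N.
Proof.
move=> mk kB.
have B0 : 0 <= B by apply: le_trans (kB 0).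
have afi : L1 mu (fun y => `|f y|) by have := integrable_norm fi.
have Bfi : L1 mu (fun y => B * `|f y|).
 by have := integrableZl measurableT B afi.
have i1 : L1 mu (fun y => f y * k1 y).
 apply: (@intg_dom _ _ _ _ _ _ (fun y => B * `|f y|)) => //.
 - by side.
 - by side.
 - by move=> y _; rewrite normrM mulrC ler_wpM2r.
 - by rewrite -(intg_fine measurableT Bfi) ltry.
split => //; apply: le_trans (le_normr_Rintegral measurableT i1) _.
rewrite /N -RintegralZl//; apply: le_Rintegral => //.
- by have := integrable_norm i1.
- by move=> y _; rewrite normrM mulrC ler_wpM2r.
Qed.

Let N0 : 0 <= N. Proof. by side. Qed.

Lemma mrefl k (x : E) : continuous k -> mble (fun y : E => k (x - y)).
Proof.
move=> ck; apply: cont_measurable_rV; apply: (cont_comp _ ck).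
by apply: contB; [exact: cont_cst|exact: cont_id].
Qed.

Lemma mol_integrable k x : kernel k ->
 L1 mu (fun y => f y * k (x - y)).
Proof.
move=> kk; have [B B0 hB] := kernel_bounded kk; have [ck _ _] := smooth_C1 kk.1.
exact: (mol_bound (mrefl x ck) (fun y => hB _)).1.
Qed.

Lemma mol_lip k : kernel k -> exists2 L : R, 0 <= L &
 forall x y, `|mol k f y - mol k f x| <= L * `|y - x|.
Proof.
move=> kk; have [L L0 hL] := kernel_lip kk; have [ck _ _] := smooth_C1 kk.1.
exists (L * N); first by side.
move=> x y; rewrite /mol -RintegralB//; [|exact: mol_integrable|exact: mol_integrable].
have -> : \int[mu]_z (f z * k (y - z) - f z * k (x - z)) =
  \int[mu]_z (f z * (k (y - z) - k (x - z))).
 by apply: eq_Rintegral => z _; rewrite mulrBr.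
have mk : mble (fun z : E => k (y - z) - k (x - z)).
 by apply: measurable_funB; exact: mrefl.
rewrite mulrAC; apply: (mol_bound mk _).2 => z.
have -> : y - z = (x - z) + (y - x) by rewrite [RHS]addrC addrA subrK.
exact: hL.
Qed.

Lemma mol_continuous k : kernel k -> continuous (mol k f).
Proof. by move=> /mol_lip[L _ hL]; exact: lip_continuous hL. Qed.

(** The derivative falls on the kernel. Since the partial derivatives of [k] are Lipschitz, its
    first-order Taylor remainder is quadratic uniformly in the integration variable, and integrating
    against [f] keeps it quadratic. *)
Lemma mol_C1 k : kernel k -> C1 (mol k f) (fun x => \row_i mol (partial i k) f x).
Proof.
move=> kk; have C1k := smooth_C1 kk.1; split; first exact: mol_continuous.
 have /choice[L hL] : forall i, exists L, 0 <= L /\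
   forall x y, `|mol (partial i k) f y - mol (partial i k) f x| <= L * `|y - x|.
  by move=> i; have [L L0 h] := mol_lip (kernel_partial i kk); exists L.
 apply: (@lip_continuous _ _ _ _ (\sum_i L i)) => x y.
 have sL : 0 <= \sum_i L i by apply: sumr_ge0 => i _; have [] := hL i.
 apply: norm_leP; first by side.
 move=> i; rewrite !mxE; apply: le_trans ((hL i).2 x y) _.
 rewrite ler_wpM2r// (bigD1 i)//= lerDl; apply: sumr_ge0 => j _.
 by have [] := hL j.
move=> x y t.
have /choice[L hL] : forall i, exists L, 0 <= L /\
   forall x y, `|partial i k (x + y) - partial i k x| <= L * `|y|.
 by move=> i; have [L L0 h] := kernel_lip (kernel_partial i kk); exists L.
pose K := \sum_i (L i * `|y ord0 i|) * `|y|.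
apply: (@is_derive_quad _ _ (K * N)) => h _.
set w := x + t *: y.
have wh : x + (t + h) *: y = w + h *: y by rewrite scalerDl addrA.
have -> : dotprod (\row_i mol (partial i k) f w) y * h =
  \int[mu]_z (\sum_i f z * (partial i k (w - z) * y ord0 i * h)).
 have ii i : L1 mu (fun z => f z * (partial i k (w - z) * y ord0 i * h)).
  have := integrableZr measurableT (y ord0 i * h) (mol_integrable w (kernel_partial i kk)).
  by congr integrable; apply/funext => z /=; rewrite -EFinM !mulrA.
 rewrite (Rint_sum (index_enum 'I_n) measurableT ii).2 mulr_suml.
 apply: eq_bigr => i _; rewrite mxE /mol -mulrA -RintegralZr//; last first.
  exact: mol_integrable (kernel_partial i kk).
 by apply: eq_Rintegral => z _; rewrite !mulrA.
have m1 : L1 mu (fun z => f z * k (x + (t + h) *: y - z) - f z * k (w - z)).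
 by have := integrableB measurableT (mol_integrable (x + (t + h) *: y) kk) (mol_integrable w kk).
have m2 : L1 mu (fun z => \sum_i f z * (partial i k (w - z) * y ord0 i * h)).
 apply: (Rint_sum (index_enum 'I_n) measurableT _).1 => i.
 have := integrableZr measurableT (y ord0 i * h) (mol_integrable w (kernel_partial i kk)).
 by congr integrable; apply/funext => z /=; rewrite -EFinM !mulrA.
rewrite /mol -RintegralB//; [|exact: mol_integrable|exact: mol_integrable].
rewrite -RintegralB//.
pose q z := k (w - z + h *: y) - k (w - z) - \sum_i partial i k (w - z) * y ord0 i * h.
have -> : \int[mu]_z (f z * k (x + (t + h) *: y - z) - f z * k (w - z) - \sum_i f z * (partial i k (w - z) * y ord0 i * h)) =
  \int[mu]_z (f z * q z).
 by apply: eq_Rintegral => z _; rewrite /q wh (addrAC w (h *: y) (- z)) !mulrBr mulr_sumr.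
have [ck cg _] := C1k.
have mq : mble q.
 apply: measurable_funB.
  apply: measurable_funB; last exact: mrefl.
  rewrite (_ : (fun z : E => _) = (fun z : E => k (w + h *: y - z))); first exact: mrefl.
  by apply/funext => z; rewrite addrAC.
 apply: measurable_sum => i; apply: measurable_funM => //; apply: measurable_funM => //.
 apply: (@mrefl (partial i k)).
 by have [c _ _] := smooth_C1 (kernel_partial i kk).1.
rewrite mulrAC; apply: (mol_bound mq _).2 => z.
rewrite /q; have [s /andP[s0 s1] ->] := C1_mvt (w - z) (h *: y) C1k.
rewrite /dotprod -sumrB; apply: le_trans (ler_norm_sum _ _ _) _.
rewrite /K mulr_suml; apply: ler_sum => i _; rewrite !mxE.
have -> : partial i k (w - z + s *: (h *: y)) * (h * y ord0 i) - partial i k (w - z) * y ord0 i * h =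
 (h * y ord0 i) * (partial i k (w - z + s *: (h *: y)) - partial i k (w - z)) by ring.
rewrite !normrM; have [L0 /(_ (w - z) (s *: (h *: y))) hi] := hL i.
apply: le_trans (ler_wpM2l _ hi) _; first by side.
rewrite !normrZ (ger0_norm s0) -(real_normK (num_real h)) .
have := normr_ge0 h; have := normr_ge0 (y ord0 i); have := normr_ge0 y.
set a := `|h|; set b := `|y ord0 i|; set c := `|y| => c0 b0 a0.
have -> : a * b * (L i * (s * (a * c))) = s * (L i * b * c * a ^+ 2) by ring.
by rewrite ler_piMl// !mulr_ge0.
Qed.

End mol.

Lemma kernel_test k x : kernel k -> smooth (fun y => k (x - y)) ->
 test_function (fun y => k (x - y)) /\
 (forall i y, partial i (fun y => k (x - y)) y = - partial i k (x - y)).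
Proof.
move=> [sk [r kr]] sr; split.
 apply: (@smooth_test _ _ _ x r sr) => y ny; apply: kr; apply: contra_not ny.
 by rewrite /cube/= subr0 distrC.
move=> i y; rewrite /partial.
rewrite (C1_derive y _ (C1_refl x (smooth_C1 sk))).2 dot_delta mxE.
by rewrite mxE /partial.
Qed.

(** The weak gradient is tested with [y |-> k (x - y)], whose partial derivatives are those of [k]
    at [x - y] with the opposite sign. *)
Lemma mol_weak k (u : E -> R) (G : E -> E) (x : E) i : kernel k -> smooth (fun y => k (x - y)) ->
 L1 mu u ->
 L1 mu (fun y => G y ord0 i) ->
 weak_gradient u G ->
 mol (partial i k) u x = mol k (fun y => G y ord0 i) x.
Proof.
move=> kk sr ui Gi [_ _ _ /(_ _ (kernel_test kk sr).1 i) h].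
have -> : mol (partial i k) u x = - \int[mu]_y (u y * partial i (fun y => k (x - y)) y).
 rewrite -[RHS]mulN1r -RintegralZl//; last first.
  have := integrableN (mol_integrable ui x (kernel_partial i kk)).
  congr integrable; apply/funext => y /=.
  by rewrite (kernel_test kk sr).2 mulrN.
 by apply: eq_Rintegral => y _; rewrite (kernel_test kk sr).2 mulrN mulN1r opprK.
by rewrite h opprK.
Qed.

(** Integration by parts between C^1 functions turns the integral into minus that of [f] times the
    divergence of the mollified field. The divergence vanishes in the cube, [f] outside it. *)
Lemma mol_div0 k (Y : E -> E) (x0 : E) r (f : E -> R) g : kernel k ->
 (forall i, L1 mu (fun y => Y y ord0 i)) ->
 (forall x, cube x0 r x -> \sum_i mol (partial i k) (fun y => Y y ord0 i) x = 0) ->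
 C1 f g -> csupp f g x0 r ->
 \int[mu]_x dotprod (\row_i mol k (fun y => Y y ord0 i) x) (g x) = 0.
Proof.
move=> kk Yi div0 fg fs.
have [cf cg _] := fg.
pose V i := mol k (fun y => Y y ord0 i); pose P i := mol (partial i k) (fun y => Y y ord0 i).
have CV i := mol_C1 (Yi i) kk.
have cV i : continuous (V i) by have [] := CV i.
have cP i : continuous (P i) by exact: (mol_continuous (Yi i) (kernel_partial i kk)).
have cgi i : continuous (fun x => g x ord0 i).
 by apply: (@cont_comp _ _ _ g (fun z : E => z ord0 i)) => //; exact: cont_coord.
have ci (h : E -> R) : continuous h -> (forall x, ~ cube x0 r x -> h x = 0) ->
  L1 mu h.
 move=> ch hs; have [B _ hB] := cont_csupp_bounded ch hs.
 exact: intg_bounded_cube (cont_measurable_rV ch) hs hB.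
have i1 i : L1 mu (fun x => V i x * g x ord0 i).
 by apply: ci; [exact: contM|move=> x /fs[_ ->]; rewrite mxE mulr0].
have i2 i : L1 mu (fun x => f x * P i x).
 by apply: ci; [exact: contM|move=> x /fs[-> _]; rewrite mul0r].
have z i : \int[mu]_x (V i x * g x ord0 i) = - \int[mu]_x (f x * P i x).
 apply/eqP; rewrite -addr_eq0 -RintegralD//; apply/eqP.
 have supp : csupp (fun x => V i x * f x) (fun x => V i x *: g x + f x *: \row_j mol (partial j k) (fun y => Y y ord0 i) x) x0 r.
  by move=> x /fs[-> ->]; rewrite mulr0 scaler0 scale0r addr0.
 rewrite -[RHS](integral_grad0 (delta_mx ord0 i) (C1_mul (CV i) fg) supp).
 by apply: eq_Rintegral => x _; rewrite dot_delta !mxE.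
rewrite /dotprod.
have -> : \int[mu]_x (\sum_i (\row_i mol k (fun y => Y y ord0 i) x) ord0 i * g x ord0 i) =
  \int[mu]_x (\sum_i V i x * g x ord0 i).
 by apply: eq_Rintegral => x _; apply: eq_bigr => i _; rewrite mxE.
rewrite (Rint_sum (index_enum 'I_n) measurableT i1).2.
under eq_bigr do rewrite z.
rewrite sumrN -(Rint_sum (index_enum 'I_n) measurableT i2).2.
rewrite (_ : \int[mu]_x _ = 0) ?oppr0//.
rewrite /Rintegral integral0_eq// => x _; rewrite -mulr_sumr.
have [xc|xc] := pselect (cube x0 r x); first by rewrite div0// mulr0.
by rewrite (fs _ xc).1 mul0r.
Qed.

Definition rho (d : R) (z : E) : R := (\int[mu]_y bump d y)^-1 * bump d z.

Lemma rho_smooth d x s : smooth (fun y => rho d (x + s *: y)).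
Proof. by apply: smooth_mul; [exact: smooth_cst|exact: bump_smooth]. Qed.

Lemma rho_smooth1 d : smooth (rho d).
Proof.
have := rho_smooth d 0 1; congr smooth.
by apply/funext => y; rewrite add0r scale1r.
Qed.

Lemma rho_smoothN d x : smooth (fun y => rho d (x - y)).
Proof.
have := rho_smooth d x (-1); congr smooth.
by apply/funext => y; rewrite scaleN1r.
Qed.

Lemma rho_eq0 d z : 0 < d -> d <= `|z| -> rho d z = 0.
Proof. by move=> d0 dz; rewrite /rho bump0// mulr0. Qed.

Lemma rhoN d z : rho d (- z) = rho d z. Proof. by rewrite /rho bumpN. Qed.

Lemma rho_ge0 d z : 0 < d -> 0 <= rho d z.
Proof.
by move=> d0; rewrite mulr_ge0 ?bump_ge0// invr_ge0; apply: Rintegral_ge0 => y _; exact: bump_ge0.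
Qed.

Lemma kernel_rho d : 0 < d -> kernel (rho d).
Proof.
move=> d0; split; first exact: rho_smooth1.
by exists d => x; rewrite /cube/= subr0 => /negP; rewrite -leNgt; exact: rho_eq0.
Qed.

Lemma cont_rho d : continuous (rho d).
Proof. by have [] := smooth_C1 (rho_smooth1 d). Qed.

Lemma mrho d : mble (rho d).
Proof. by apply: cont_measurable_rV; exact: cont_rho. Qed.

Lemma rho_int d : 0 < d -> (\int[mu]_z (rho d z)%:E = 1%:E)%E.
Proof.
move=> d0; have [c c0 hc] := @bump_int R n d d0.
have [cb _ _] : C1 (bump d : E -> R) (grad (bump d : E -> R)).
 apply: smooth_C1; have := @bump_smooth R n d 0 1; congr smooth.
 by apply/funext => y; rewrite add0r scale1r.
have cE : \int[mu]_y bump d y = c by rewrite /Rintegral hc.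
rewrite /rho cE int_Z//; last 3 first.
- exact: cont_measurable_rV.
- by move=> x _; exact: bump_ge0.
- by side.
by rewrite hc -EFinM mulVf// gt_eqF.
Qed.

Lemma rho_int_refl d x : 0 < d -> (\int[mu]_y (rho d (x - y))%:E = 1%:E)%E.
Proof.
move=> d0; rewrite -(rho_int d0) -(int_shiftT (- x) (mrho d)).
 by apply: eq_integral => y _; rewrite -rhoN opprB.
by move=> y; exact: rho_ge0.
Qed.

(* The average of [G] against [rho d (x - y) dy], seen from [x]. *)
Lemma rho_shift d (x : E) (G : E -> R) : 0 < d -> mble G ->
 (forall y, 0 <= G y) ->
 (\int[mu]_y (rho d (x - y) * G y)%:E = \int[mu]_z (rho d z * G (x + z)%R)%:E)%E.
Proof.
move=> d0 mG G0.
have m1 : mble (fun y : E => rho d (x - y) * G y).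
 apply: measurable_funM => //; apply: mrefl; exact: cont_rho.
rewrite -(int_shiftT x m1).
 by apply: eq_integral => z _; rewrite opprD addrCA subrr addr0 rhoN (addrC z).
by move=> y; rewrite mulr_ge0// rho_ge0.
Qed.

End mollification.

(** * Averages and translations of fields of finite energy *)

Section averages.
Context {R : realType} {n : nat}.
Local Notation E := 'rV[R]_n.
Local Notation mu := (@lebesgue_rV R n).
Implicit Types (sg : R -> R) (m M t : R).

Lemma msq_sg sg : continuous (fun t => t * sg t) ->
 mble (fun t : R => t ^+ 2 * sg t).
Proof.
move=> cs; rewrite (_ : (fun t => _) = (fun t => t * (t * sg t))); last first.
 by apply/funext => t; rewrite expr2 mulrA.
by apply: measurable_funM => //; exact: continuous_measurable_fun.
Qed.

(* Jensen's inequality up to a constant: with [D e(f) >= a(s) (f - s/2)] in place of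
  a supporting line at [s]. *)
Lemma qjensen M : 1 <= M -> exists C : R, 1 <= C /\
 forall m sg, slope m M sg -> continuous (fun t => t * sg t) -> forall (w f : E -> R),
 mble w -> mble f ->
 (forall x, 0 <= w x) -> (forall x, 0 <= f x) ->
 (\int[mu]_x (w x)%:E = 1%:E)%E ->
 L1 mu (fun x => f x * w x) ->
 (((\int[mu]_x (f x * w x)) ^+ 2 * sg (\int[mu]_x (f x * w x)))%:E <=
  \int[mu]_x (C * (w x * (f x ^+ 2 * sg (f x))))%:E)%E.
Proof.
move=> M1; have [D [D1 hD]] := slope_doubling M1.
exists (2 * D); split; first by lra.
move=> m sg hs cs w f mw mf w0 f0 w1 fwi.
have hds := hD m sg hs.
set s := \int[mu]_x (f x * w x).
have s0 : 0 <= s by side.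
have wi : L1 mu w.
 apply: (@intg_dom _ _ _ _ _ _ w) => //; last by rewrite w1 ltry.
 by move=> x _; rewrite ger0_norm.
have a0 := slope_al_ge0 hs s0; set a := s * sg s in a0.
have i1 : L1 mu (fun x => (2 * a) * (f x * w x)).
 by have := integrableZl measurableT (2 * a) fwi.
have i2 : L1 mu (fun x => (a * s) * w x).
 by have := integrableZl measurableT (a * s) wi.
have i3 : L1 mu (fun x => (2 * a) * (f x * w x) - (a * s) * w x).
 by have := integrableB measurableT i1 i2.
have -> : s ^+ 2 * sg s = \int[mu]_x ((2 * a) * (f x * w x) - (a * s) * w x).
 rewrite RintegralB// RintegralZl// RintegralZl// -/s.
 have -> : \int[mu]_x w x = 1 by rewrite /Rintegral w1.
 by rewrite /a; ring.
have ef x : 0 <= f x ^+ 2 * sg (f x) by side.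
apply: Rint_le_int => //.
- apply: measurable_funM => //; apply: measurable_funM => //.
 by apply: (mcomp (fun t => t ^+ 2 * sg t)) => //; exact: msq_sg.
- move=> x _; have := mulr_ge0 (w0 x) (ef x) => h; rewrite mulr_ge0//; lra.
move=> x _; have := w0 x; have := ef x; have := f0 x; set u := f x => u0 eu wx.
suff h : 2 * a * u - a * s <= 2 * D * (u ^+ 2 * sg u).
 have := ler_wpM2l wx h; lra.
have [us|su] := leP (2 * u) s.
 by apply: (via 0); [nra|rewrite mulr_ge0//; lra].
have up : 0 < u by lra.
have al : a <= D * (u * sg u).
 apply: le_trans (hds u up).
 exact: slope_mono0 hs s0 (ltW su).
have := ler_wpM2r u0 al; nra.
Qed.

Lemma measurable_e sg (F : E -> E) : continuous (fun t => t * sg t) -> mble F ->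
 mble (fun x => enorm (F x) ^+ 2 * sg (enorm (F x))).
Proof.
move=> cs mF; have me := menorm mF.
by apply: (mcomp (fun t => t ^+ 2 * sg t)) => //; exact: msq_sg.
Qed.

Lemma intg_field (X : E -> E) : mble X ->
 L1 mu (enorm \o X) ->
 forall i, L1 mu (fun y => X y ord0 i).
Proof.
move=> mX Xi i; apply: (@intg_dom _ _ _ _ _ _ (enorm \o X)) => //.
- by side.
- exact: menorm.
- by move=> x _; exact: coord_le_enorm.
- by rewrite -(intg_fine measurableT Xi) ltry.
Qed.

(* [field_mol d X] is the convolution of [X] with [rho d]. *)
Definition field_mol (d : R) (X : E -> E) (x : E) : E :=
 \row_i mol (rho d) (fun y => X y ord0 i) x.

(** The kernel has mass 1, so [a] may be moved under the average. Integrals are scalar, so the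
    estimate is made coordinate by coordinate, which costs the factor [n]. *)
Lemma field_mol_dist d (X : E -> E) (x a : E) : 0 < d ->
 (forall i, L1 mu (fun y => X y ord0 i)) ->
 L1 mu (fun y => enorm (X y - a) * rho d (x - y)) /\
 enorm (field_mol d X x - a) <= n%:R * \int[mu]_y (enorm (X y - a) * rho d (x - y)).
Proof.
move=> d0 Xi; have kk := @kernel_rho R n d d0.
have mX : mble X.
 by apply: measurable_fun_rV => i; have /integrableP[/measurable_EFinP] := Xi i.
have [B B0 hB] := kernel_bounded kk.
have mr : mble (fun y : E => rho d (x - y)).
 by apply: mrefl; exact: cont_rho.
have r0 y : 0 <= rho d (x - y) by exact: rho_ge0.
have ri : L1 mu (fun y : E => rho d (x - y)).
 apply: (@intg_dom _ _ _ _ _ _ (fun y : E => rho d (x - y))) => //.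
  by move=> y _; rewrite ger0_norm.
 by rewrite rho_int_refl// ltry.
have rI : \int[mu]_y rho d (x - y) = 1 by rewrite /Rintegral rho_int_refl.
have ci i : L1 mu (fun y => (X y ord0 i - a ord0 i) * rho d (x - y)).
 have i1 := mol_integrable (Xi i) x kk.
 have i2 : L1 mu (fun y => a ord0 i * rho d (x - y)).
  by have := integrableZl measurableT (a ord0 i) ri.
 have := integrableB measurableT i1 i2.
 by congr integrable; apply/funext => y /=; rewrite mulrBl.
have ni i : L1 mu (fun y => `|(X y ord0 i - a ord0 i) * rho d (x - y)|).
 by have := integrable_norm (ci i).
have si := (Rint_sum (index_enum 'I_n) measurableT ni).1.
have mXa : mble (fun y => X y - a).
 by side.
have ei : L1 mu (fun y => enorm (X y - a) * rho d (x - y)).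
 apply: (@intg_dom _ _ _ _ _ _ (fun y => \sum_i `|(X y ord0 i - a ord0 i) * rho d (x - y)|)) => //.
 - by side.
 - by side.
 - move=> y _; rewrite normrM (ger0_norm (enorm_ge0 _)) ger0_norm//.
  have -> : \sum_i `|(X y ord0 i - a ord0 i) * rho d (x - y)| = (\sum_i `|(X y - a) ord0 i|) * rho d (x - y).
   by rewrite mulr_suml; apply: eq_bigr => i _; rewrite normrM !mxE (ger0_norm (r0 y)).
  by rewrite ler_wpM2r//; exact: enorm_le_sum.
 - by rewrite -(intg_fine measurableT si) ltry.
split => //; apply: le_trans (enorm_le_sum _) _.
have -> : n%:R * \int[mu]_y (enorm (X y - a) * rho d (x - y)) = \sum_(i < n) \int[mu]_y (enorm (X y - a) * rho d (x - y)).
 by rewrite sumr_const card_ord mulr_natl.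
apply: ler_sum => i _.
have -> : (field_mol d X x - a) ord0 i = \int[mu]_y ((X y ord0 i - a ord0 i) * rho d (x - y)).
 rewrite !mxE /mol.
 have i2 : L1 mu (fun y => a ord0 i * rho d (x - y)).
  by have := integrableZl measurableT (a ord0 i) ri.
 have -> : \int[mu]_y ((X y ord0 i - a ord0 i) * rho d (x - y)) =
  \int[mu]_y (X y ord0 i * rho d (x - y) - a ord0 i * rho d (x - y)).
  by apply: eq_Rintegral => y _; rewrite mulrBl.
 rewrite RintegralB//; last exact: (mol_integrable (Xi i) x kk).
 by rewrite RintegralZl// rI mulr1.
apply: le_trans (le_normr_Rintegral measurableT (ci i)) _.
apply: le_Rintegral => // y _.
rewrite normrM (ger0_norm (r0 y)) ler_wpM2r//.
by have := coord_le_enorm (X y - a) i; rewrite !mxE.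
Qed.

Lemma field_mol_e M : 1 <= M -> exists C : R, 1 <= C /\
 forall m sg, slope m M sg -> continuous (fun t => t * sg t) -> forall d (X : E -> E) (x a : E), 0 < d ->
 (forall i, L1 mu (fun y => X y ord0 i)) ->
 ((enorm (field_mol d X x - a) ^+ 2 * sg (enorm (field_mol d X x - a)))%:E <=
  \int[mu]_y (C * (rho d (x - y) * (enorm (X y - a) ^+ 2 * sg (enorm (X y - a)))))%:E)%E.
Proof.
move=> M1; have [C [C1 hC]] := qjensen M1.
have [D [D1 hD]] := e_scale M1 n%:R.
exists (D * C); split; first nra.
move=> m sg hs cs d X x a d0 Xi.
have [ei le] := field_mol_dist x a d0 Xi.
have mX : mble X.
 by apply: measurable_fun_rV => i; have /integrableP[/measurable_EFinP] := Xi i.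
have mXa : mble (fun y => X y - a).
 by side.
have mr : mble (fun y : E => rho d (x - y)).
 by apply: mrefl; exact: cont_rho.
have r0 y : 0 <= rho d (x - y) by exact: rho_ge0.
have J := hC m sg hs cs (fun y : E => rho d (x - y)) (fun y => enorm (X y - a)) mr
 (menorm mXa) r0 (fun y => enorm_ge0 _) (rho_int_refl x d0) ei.
set I := \int[mu]_y (enorm (X y - a) * rho d (x - y)) in le J.
have I0 : 0 <= I by side.
have := hD m sg hs _ _ (enorm_ge0 _) I0 le; rewrite -lee_fin EFinM => h.
apply: le_trans h _.
have D0 : 0 <= D by lra.
have D0' : (0 <= D%:E)%E by side.
apply: le_trans (lee_wpmul2l D0' J) _.
have mI : mble (fun y : E => C * (rho d (x - y) * (enorm (X y - a) ^+ 2 * sg (enorm (X y - a))))).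
 by apply: measurable_funM => //; apply: measurable_funM => //; exact: measurable_e.
rewrite -int_Z//; last first.
 move=> y _; rewrite mulr_ge0//; first lra.
 by side.
apply: eqW; apply: eq_integral => y _.
by congr EFin; exact: mulrA.
Qed.

Lemma enorm_add_cvg0 (X : E -> E) (z : nat -> E) (x : E) :
 \sum_(i < n) `|X (x + z k) ord0 i - X x ord0 i| @[k --> \oo] --> 0 ->
 enorm (X (x + z k) - X x) @[k --> \oo] --> 0.
Proof.
move=> hs.
apply: (@squeeze_cvgr _ _ _ _ (cst 0) (fun k => \sum_(i < n) `|X (x + z k) ord0 i - X x ord0 i|)) => //.
 near=> k; rewrite enorm_ge0/=; apply: le_trans (enorm_le_sum _) _.
 by apply: ler_sum => i _; rewrite !mxE.
exact: cvg_cst.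
Unshelve. all: by end_near. Qed.

(** Suppose shifts tending to 0 keep the modular above [e]. A subsequence of translates converges
    almost everywhere, by continuity of translations in L^1 for each coordinate. Fatou applied to C
    (e(X(x+z)) + e(X)) - e(X(x+z) - X), which is nonnegative by [e_add], gives 2 C I <= 2 C I - e
    with I the finite energy. *)
Lemma modular_translation m M sg (X : E -> E) : slope m M sg ->
 continuous (fun t => t * sg t) ->
 (forall i, L1 mu (fun y => X y ord0 i)) ->
 (\int[mu]_x (enorm (X x) ^+ 2 * sg (enorm (X x)))%:E < +oo)%E ->
 forall e : R, 0 < e -> exists d : R, 0 < d /\ forall z : E, `|z| < d ->
 (\int[mu]_x (enorm (X (x + z) - X x) ^+ 2 * sg (enorm (X (x + z) - X x)))%:E <= e%:E)%E.
Proof.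
move=> hs cs Xi eX e e0; apply: contrapT => /forallNP H.
have [M0 M1 _ _] := hs.
have mXi i : mble (fun y => X y ord0 i).
 by have /integrableP[/measurable_EFinP] := Xi i.
have mX : mble X by exact: measurable_fun_rV.
pose en (x : E) := enorm x ^+ 2 * sg (enorm x).
have en0 x : 0 <= en x by side.
have /choice[z hz] : forall k : nat, exists z : E, `|z| < k.+1%:R^-1 /\
  ~ (\int[mu]_x (en (X (x + z) - X x))%:E <= e%:E)%E.
 move=> k; apply: contrapT => /forallNP Hk; apply: (H k.+1%:R^-1); split => //.
 by move=> z zk; apply: contrapT => h; exact: (Hk z).
have mshift k i : mble (fun x : E => `|X (x + z k) ord0 i - X x ord0 i|).
 apply: mabsB => //; exact: (mshiftf (z k) (mXi i)).
pose h0 k (x : E) := \sum_(i < n) `|X (x + z k) ord0 i - X x ord0 i|.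
have mh0 k : mble (h0 k) by side.
have [phi [phik aec]] : exists phi : nat -> nat, (forall k, (k <= phi k)%N) /\
  {ae mu, forall x, setT x -> (h0 (phi k) x @[k --> \oo] --> 0)}.
 apply: int_ae_subseq => //.
  by side.
 move=> e' e'0.
 have en1 : 0 < e' / n.+1%:R by side.
 have /choice[d hd] : forall i, exists d : R, 0 < d /\ forall z : E, `|z| < d ->
   (\int[mu]_x (`|X (x + z) ord0 i - X x ord0 i|)%:E <= (e' / n.+1%:R)%:E)%E.
  by move=> i; exact: (tc_integrable (Xi i) en1).
 have [N hN] : exists N, forall k, (N <= k)%N -> forall i, `|z k| < d i.
  (* [D^-1] is a positive lower bound of all the [d i]; the added 1 keeps it positive when there is
     no coordinate. *)
  pose D := \sum_i (d i)^-1 + 1.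
  have di i : 0 < (d i)^-1 by rewrite invr_gt0; have [] := hd i.
  have D0 : 0 < D by rewrite ltr_wpDl// sumr_ge0// => i _; exact: ltW.
  have Di i : D^-1 <= d i.
   rewrite -[leRHS]invrK lef_pV2 ?posrE// /D (bigD1 i)//= -addrA lerDl addr_ge0//.
   by apply: sumr_ge0 => j _; exact: ltW.
  have D1 : 0 < D^-1 by side.
  have [N _ hN] := near_infty_natSinv_lt (PosNum D1).
  exists N => k Nk i; apply: lt_le_trans (hz k).1 _.
  by apply: le_trans (Di i); apply: ltW; exact: hN.
 exists N => k /hN hk.
 rewrite /h0 int_sum//.
 apply: (via (\sum_(i < n) (e' / n.+1%:R)%:E)%E).
  by apply: lee_sum => i _; apply: (hd i).2; exact: hk.
 rewrite sumEFin lee_fin sumr_const card_ord -[leLHS]mulr_natl.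
 by rewrite mulrCA ler_piMr ?(ltW e'0)// ler_pdivrMr// mul1r ler_nat.
have [C [C1 hC]] := e_add M1.
have hCs := hC m sg hs.
have menX : mble (fun x => en (X x)) by exact: measurable_e.
have mXs k : mble (fun x : E => X (x + z k)) by side.
have mD k : mble (fun x : E => X (x + z k) - X x).
 by side.
pose h k (x : E) := C * (en (X (x + z (phi k))) + en (X x)) - en (X (x + z (phi k)) - X x).
have mes k : mble (fun x : E => en (X (x + z k))) by exact: measurable_e.
have med k : mble (fun x : E => en (X (x + z k) - X x)) by exact: measurable_e.
have C0 : 0 <= C by lra.
have mS k : mble (fun x : E => C * (en (X (x + z (phi k))) + en (X x))).
 by apply: measurable_funM => //; apply: measurable_funD => //.
have mh k : mble (h k) by apply: measurable_funB => //.
have hh0 k x : setT x -> 0 <= h k x.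
 move=> _; rewrite subr_ge0; apply: hCs; rewrite ?enorm_ge0//.
 exact: enormB_le.
have Ifin : (\int[mu]_x (en (X x))%:E)%E \is a fin_num.
 by rewrite ge0_fin_numE// int_ge0.
set I := fine (\int[mu]_x (en (X x))%:E)%E.
have IE : (\int[mu]_x (en (X x))%:E = I%:E)%E by rewrite /I fineK.
have IS k : (\int[mu]_x (C * (en (X (x + z (phi k))) + en (X x)))%:E = (C * (I + I))%:E)%E.
 rewrite int_Z//; last 2 first.
 - by apply: measurable_funD.
 - by side.
 rewrite int_D// (int_shiftT (z (phi k)) menX)// IE.
 by rewrite -EFinD -EFinM.
have hI k : (\int[mu]_x (h k x)%:E <= (C * (I + I) - e)%:E)%E.
 have : (\int[mu]_x (h k x + en (X (x + z (phi k)) - X x))%:E = (C * (I + I))%:E)%E.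
  by rewrite -(IS k); apply: eq_integral => x _; rewrite /h subrK.
 have -> := int_D mu measurableT (mh k) (med (phi k)) (hh0 k) (fun x _ => en0 _).
 move=> /eqP hd.
 have := (hz (phi k)).2 => /negP; rewrite -ltNge => lt.
 have h1 : (0 <= \int[mu]_x (h k x)%:E)%E by exact: (int_ge0 mu (hh0 k)).
 move: hd h1 lt.
 case: (\int[mu]_x (h k x)%:E)%E => [r| |]//=; case: (\int[mu]_x (en (X (x + z (phi k)) - X x))%:E)%E => [s| |]//=.
 rewrite -EFinD eqe => /eqP rs _; rewrite lte_fin lee_fin => es; lra.
have mlim : mble (fun x : E => C * (en (X x) + en (X x))).
 by side.
have := int_fatou (c := C * (I + I) - e) measurableT mh mlim hh0 _ _ _.
move=> F; have : (\int[mu]_x (C * (en (X x) + en (X x)))%:E <= (C * (I + I) - e)%:E)%E.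
 apply: F.
 - by side.
 - apply: filterS aec => x hx _; have {}hx := hx Logic.I.
  have ce : continuous (fun t => t ^+ 2 * sg t).
   rewrite (_ : (fun t => _) = (fun t => t * (t * sg t))); last first.
    by apply/funext => t; rewrite expr2 mulrA.
   by apply: contM => //; exact: cont_id.
  have c0 := enorm_add_cvg0 (z := z \o phi) hx.
  have c1 : enorm (X (x + z (phi k))) @[k --> \oo] --> enorm (X x).
   apply/cvgrPdist_le => e' e'0; have /cvgrPdist_le/(_ e' e'0) := c0.
   apply: filterS => k /=; rewrite sub0r normrN ger0_norm ?enorm_ge0// distrC.
   by apply: le_trans; exact: enorm_dist.
  have c2 : en (X (x + z (phi k)) - X x) @[k --> \oo] --> 0.
   have := cvg_comp _ _ c0 (ce 0); rewrite expr0n mul0r; exact.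
  have c3 : en (X (x + z (phi k))) @[k --> \oo] --> en (X x).
   exact: cvg_comp _ _ c1 (ce _).
  rewrite -[X in _ --> X]subr0; apply: cvgB => //.
  by apply: cvgM; [exact: cvg_cst|apply: cvgD => //; exact: cvg_cst].
 - move=> e' e'0; exists 0%N => k _; apply: le_trans (hI k) _.
  by side.
rewrite int_Z//; last 2 first.
- by side.
- by side.
by rewrite int_D// IE -EFinD -EFinM lee_fin; lra.
Qed.

End averages.

(** * Square integrable fields *)

Section sqint.
Context {R : realType} {n : nat}.
Local Notation E := 'rV[R]_n.
Local Notation mu := (@lebesgue_rV R n).
Implicit Types (D : set E) (F G H : E -> E).

Definition sqint D F := mble F /\
 (\int[mu]_(x in D) (enorm (F x) ^+ 2)%:E < +oo)%E.

Lemma menorm2 F : mble F ->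
 mble (fun x => enorm (F x) ^+ 2).
Proof. by side. Qed.

Lemma enormD_sqr (x y : E) : enorm (x + y) ^+ 2 <= 2 * (enorm x ^+ 2 + enorm y ^+ 2).
Proof.
have := enormD x y; have := enorm_ge0 (x + y); have := enorm_ge0 x; have := enorm_ge0 y.
have := sqr_ge0 (enorm x - enorm y); nra.
Qed.

Lemma sqint_dom D F (h : E -> R) : measurable D -> mble F ->
 mble h -> (forall x, D x -> enorm (F x) ^+ 2 <= h x) ->
 (\int[mu]_(x in D) (h x)%:E < +oo)%E -> sqint D F.
Proof.
move=> mD mF mh Fh hi; split => //; apply: le_lt_trans hi.
by apply: int_le => //; [exact: menorm2|move=> x _; exact: sqr_ge0].
Qed.

Lemma sqintD D F G : measurable D -> sqint D F -> sqint D G -> sqint D (fun x => F x + G x).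
Proof.
move=> mD [mF Fi] [mG Gi].
have m1 := menorm2 mF; have m2 := menorm2 mG.
apply: (@sqint_dom _ _ (fun x => 2 * (enorm (F x) ^+ 2 + enorm (G x) ^+ 2))) => //.
- by side.
- by side.
- by move=> x _; exact: enormD_sqr.
- rewrite int_Z//; last 2 first.
 + by side.
 + by side.
 rewrite int_D//; last 2 first.
 + by side.
 + by side.
 by rewrite lte_mul_pinfty ?lee_fin// lte_add_pinfty.
Qed.

Lemma sqintZ D F (k : R) : measurable D -> sqint D F -> sqint D (fun x => k *: F x).
Proof.
move=> mD [mF Fi]; have m1 := menorm2 mF.
apply: (@sqint_dom _ _ (fun x => k ^+ 2 * enorm (F x) ^+ 2)) => //.
- by side.
- by side.
- by move=> x _; rewrite enormZ exprMn real_normK ?num_real.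
- rewrite int_Z// ?sqr_ge0//; last by side.
 by rewrite lte_mul_pinfty ?lee_fin ?sqr_ge0.
Qed.

Lemma sqintB D F G : measurable D -> sqint D F -> sqint D G -> sqint D (fun x => F x - G x).
Proof.
move=> mD sF sG; have := sqintD mD sF (sqintZ (-1) mD sG).
by congr sqint; apply/funext => x; rewrite scaleN1r.
Qed.

Lemma sqint_cont (x0 : E) r G : continuous G -> sqint (cube x0 r) G.
Proof.
move=> cG; have mc := mcube x0 r.
have ce : continuous (fun x => enorm (G x)).
 by apply: (cont_comp cG); exact: cont_enorm.
have [B B0 hB] := cont_bounded (`|x0| + r) ce.
apply: (@sqint_dom _ _ (cst (B ^+ 2))) => //; first exact: mcvg_rV.
- move=> x xr; rewrite /cst lerXn2r ?nnegrE ?enorm_ge0//.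
 have := hB x; rewrite ger0_norm ?enorm_ge0//; apply.
 by rewrite -(subrK x0 x) addrC (le_trans (ler_normD _ _))// lerD2l (ltW xr).
- have [r0|r0] := ltP 0 r; first by rewrite int_cst_cube// ltry.
 rewrite (_ : cube x0 r = set0) ?integral_set0// -subset0 => x.
 by rewrite /cube/= => xr; have := le_lt_trans (normr_ge0 _) xr; rewrite ltNge r0.
Qed.

Lemma dot_young (x y : E) (t : R) : 0 < t ->
 `|dotprod x y| <= t * enorm x ^+ 2 + t^-1 * enorm y ^+ 2.
Proof.
move=> t0; apply: le_trans (dot_norm_le x y) _.
have := enorm_ge0 x; have := enorm_ge0 y; set a := enorm x; set b := enorm y => b0 a0.
have t1 : 0 < t^-1 by side.
have tt : t * t^-1 = 1 by rewrite mulfV// gt_eqF.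
have : 0 <= t^-1 * (t * a - b) ^+ 2 by side.
have -> : t^-1 * (t * a - b) ^+ 2 = t * a ^+ 2 * (t * t^-1) - 2 * a * b * (t * t^-1) + t^-1 * b ^+ 2 by ring.
rewrite tt !mulr1; have : 0 <= a * b by side.
lra.
Qed.

Lemma intg_sqint D F : measurable D -> sqint D F ->
 mu.-integrable D (EFin \o (fun x => enorm (F x) ^+ 2)).
Proof.
move=> mD [mF Fi]; apply: (@intg_dom _ _ _ _ _ _ (fun x => enorm (F x) ^+ 2)) => //;
 try exact: menorm2.
by move=> x _; rewrite ger0_norm ?sqr_ge0.
Qed.

Lemma dot_integrable D F G : measurable D -> sqint D F -> sqint D G ->
 mu.-integrable D (EFin \o (fun x => dotprod (F x) (G x))).
Proof.
move=> mD sF sG; have [mF Fi] := sF; have [mG Gi] := sG.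
have i1 := intg_sqint mD sF; have i2 := intg_sqint mD sG.
have i3 : mu.-integrable D (EFin \o (fun x => 1 * enorm (F x) ^+ 2 + 1^-1 * enorm (G x) ^+ 2)).
 have := integrableD mD i1 i2; congr integrable.
 by apply/funext => x /=; rewrite invr1 !mul1r.
apply: (@intg_dom _ _ _ _ _ _ (fun x => 1 * enorm (F x) ^+ 2 + 1^-1 * enorm (G x) ^+ 2)) => //.
- by side.
- by side.
- by move=> x _; exact: dot_young.
- by rewrite -(intg_fine mD i3) ltry.
Qed.

Lemma dot_Rint_le D F G (t : R) : measurable D -> sqint D F -> sqint D G -> 0 < t ->
 `|\int[mu]_(x in D) dotprod (F x) (G x)| <=
 t * (\int[mu]_(x in D) enorm (F x) ^+ 2) + t^-1 * (\int[mu]_(x in D) enorm (G x) ^+ 2).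
Proof.
move=> mD sF sG t0; have i1 := intg_sqint mD sF; have i2 := intg_sqint mD sG.
have i3 : mu.-integrable D (EFin \o (fun x => t * enorm (F x) ^+ 2)).
 by have := integrableZl mD t i1.
have i4 : mu.-integrable D (EFin \o (fun x => t^-1 * enorm (G x) ^+ 2)).
 by have := integrableZl mD t^-1 i2.
have i0 := dot_integrable mD sF sG.
apply: le_trans (le_normr_Rintegral mD i0) _.
rewrite -RintegralZl// -RintegralZl// -RintegralD//; apply: le_Rintegral => //.
- by have := integrable_norm i0.
- by have := integrableD mD i3 i4.
- by move=> x _; exact: dot_young.
Qed.

Definition L2cvg D (F : nat -> E -> E) G := forall e : R, 0 < e -> exists N, forall j, (N <= j)%N ->
 (\int[mu]_(x in D) (enorm (F j x - G x) ^+ 2)%:E <= e%:E)%E.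

(** Young's inequality with a small weight on the fixed field [H] and its inverse on the difference
    [F j - G], which tends to 0 in L^2. *)
Lemma dot_lim D (F : nat -> E -> E) G H : measurable D ->
 (forall j, sqint D (F j)) -> sqint D G -> sqint D H -> L2cvg D F G ->
 (forall e : R, 0 < e -> exists N, forall j, (N <= j)%N ->
  `|\int[mu]_(x in D) dotprod (F j x) (H x)| <= e) ->
 \int[mu]_(x in D) dotprod (G x) (H x) = 0.
Proof.
move=> mD sF sG sH FG Fz.
apply/eqP; rewrite -normr_le0; apply/ler_addgt0Pr => e e0; rewrite add0r.
set K := \int[mu]_(x in D) enorm (H x) ^+ 2.
have K0 : 0 <= K by side.
pose t := e / (4 * (K + 1)).
have K1 : 0 < 4 * (K + 1) by lra.
have t0 : 0 < t by side.
have tK : t * K <= e / 4.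
 rewrite /t mulrAC ler_pdivrMr// mulrC.
 have -> : e / 4 * (4 * (K + 1)) = e * (K + 1) by field.
 by rewrite mulrC ler_wpM2l ?(ltW e0)//; lra.
have te : 0 < t * e / 4 by side.
have [N1 hN1] := FG _ te; have e2 : 0 < e / 2 by lra.
have [N2 hN2] := Fz _ e2.
pose j := maxn N1 N2.
have h1 := hN1 j (leq_maxl _ _); have h2 := hN2 j (leq_maxr _ _).
have sd := sqintB mD (sF j) sG.
have i1 := dot_integrable mD (sF j) sH; have i2 := dot_integrable mD sd sH.
have -> : \int[mu]_(x in D) dotprod (G x) (H x) =
  \int[mu]_(x in D) dotprod (F j x) (H x) - \int[mu]_(x in D) dotprod (F j x - G x) (H x).
 rewrite -RintegralB//; apply: eq_Rintegral => x _.
 by rewrite dotBl opprB addrC subrK.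
apply: le_trans (ler_normB _ _) _.
have tp : 0 < t^-1 by side.
have := dot_Rint_le mD sd sH tp; rewrite invrK -/K.
have : \int[mu]_(x in D) enorm (F j x - G x) ^+ 2 <= t * e / 4.
 by rewrite -lee_fin (intg_fine mD (intg_sqint mD sd)).
move=> /(ler_wpM2l (ltW tp)).
have -> : t^-1 * (t * e / 4) = e / 4 by field; rewrite gt_eqF.
lra.
Qed.

Lemma L2_completeV D (F : nat -> E -> E) : measurable D ->
 (forall j, mble (F j)) ->
 (forall e : R, 0 < e -> exists N, forall i j, (N <= i)%N -> (N <= j)%N ->
  (\int[mu]_(x in D) (enorm (F i x - F j x) ^+ 2)%:E <= e%:E)%E) ->
 exists2 G, mble G & L2cvg D F G.
Proof.
move=> mD mF cF.
have mB (A B : E -> E) : mble A -> mble B -> mble (fun x => A x - B x).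
 by side.
have mFk k j : mble (fun x => F j x ord0 k) by side.
have /choice[g hg] : forall k : 'I_n, exists g : E -> R, mble g /\
  forall e : R, 0 < e -> exists N, forall i, (N <= i)%N ->
  (\int[mu]_(x in D) ((F i x ord0 k - g x) ^+ 2)%:E <= e%:E)%E.
 move=> k; apply: L2_complete => // e /cF[N hN]; exists N => i j Ni Nj.
 apply: le_trans (hN i j Ni Nj); apply: int_le => //.
 - by side.
 - by side.
 - by side.
 - move=> x _; have := coord_le_enorm (F i x - F j x) k; rewrite !mxE => h.
  by rewrite -real_normK ?num_real// lerXn2r ?nnegrE ?enorm_ge0.
have mG : mble (fun x => \row_k g k x).
 by apply: measurable_fun_rV => k; under eq_fun do rewrite mxE; have [] := hg k.
exists (fun x => \row_k g k x) => // e e0.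
have e1 : 0 < e / n.+1%:R by side.
have /choice[N hN] : forall k : 'I_n, exists N, forall i, (N <= i)%N ->
  (\int[mu]_(x in D) ((F i x ord0 k - g k x) ^+ 2)%:E <= (e / n.+1%:R)%:E)%E.
 by move=> k; exact: ((hg k).2 _ e1).
exists (\max_k N k)%N => j Nj.
have -> : (\int[mu]_(x in D) (enorm (F j x - \row_k g k x) ^+ 2)%:E =
  \int[mu]_(x in D) (\sum_k (F j x ord0 k - g k x) ^+ 2)%:E)%E.
 apply: eq_integral => x _; rewrite enorm_sqr; congr EFin.
 by apply: eq_bigr => k _; rewrite !mxE expr2.
rewrite int_sum//; last 2 first.
- by move=> k; apply: measurable_funX; apply: measurable_funB => //; have [] := hg k.
- by side.
apply: (via (\sum_(k < n) (e / n.+1%:R)%:E)%E).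
 apply: lee_sum => k _; apply: hN; apply: leq_trans Nj; exact: leq_bigmax.
rewrite sumEFin lee_fin sumr_const card_ord -[leLHS]mulr_natl.
by rewrite mulrCA ler_piMr ?(ltW e0)// ler_pdivrMr// mul1r ler_nat.
Qed.

End sqint.

(** * Direct method for the truncated energy *)

Section existence.
Context {R : realType} {n : nat}.
Local Notation E := 'rV[R]_n.
Local Notation mu := (@lebesgue_rV R n).
Variables (m M c C : R) (sg : R -> R).
Hypotheses (hs : slope m M sg) (c0 : 0 < c) (cont : continuous sg).
Hypothesis sgb : forall t, c <= sg t <= C.

Definition spot (X : E) : R := pot sg (enorm X) - pot sg 0.
Local Notation P := spot.

Let hm : 0 < m. Proof. by have [/andP[]] := hs. Qed.
Let hM : 1 <= M. Proof. by have [] := hs. Qed.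
Let hC : 0 < C. Proof. by have /andP[h1 h2] := sgb 0; exact: lt_le_trans c0 (le_trans h1 h2). Qed.

Lemma spot_bound X : m * c / 2 * enorm X ^+ 2 <= P X <= (M + 1) * C * enorm X ^+ 2.
Proof.
have := pot_vec hs c0 cont sgb (0 : E) X.
by rewrite subr0 enorm0 /Th enorm0 scaler0 dot0l subr0 /spot.
Qed.

(** Add the Bregman lower bounds of X and Y taken at their midpoint: the linear terms cancel since X
    - Z and Y - Z are opposite. *)
Lemma spot_mid X Y : m * c / 4 * enorm (X - Y) ^+ 2 + 2 * P (2^-1 *: (X + Y)) <= P X + P Y.
Proof.
pose Z := 2^-1 *: (X + Y).
have XZ : X - Z = 2^-1 *: (X - Y).
 rewrite /Z scalerDr scalerBr opprD addrA; congr (_ - _).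
 by rewrite -[X in X - _]scale1r -scalerBl; congr (_ *: _); field.
have YZ : Y - Z = - (2^-1 *: (X - Y)).
 rewrite /Z scalerDr scalerBr opprD opprB (addrC (- _)) addrA; congr (_ - _).
 by rewrite -[X in X - _]scale1r -scalerBl; congr (_ *: _); field.
have /andP[h1 _] := pot_vec hs c0 cont sgb Z X.
have /andP[h2 _] := pot_vec hs c0 cont sgb Z Y.
move: h1 h2; rewrite XZ YZ enormN dotNr opprK /spot -/Z enormZ exprMn real_normK ?num_real//.
set a := enorm (X - Y); set k := dotprod _ _.
have -> : m * c / 2 * (2^-1 ^+ 2 * a ^+ 2) = m * c * a ^+ 2 / 8 by field.
have -> : m * c / 4 * a ^+ 2 = m * c * a ^+ 2 / 4 by field.
move: (m * c * a ^+ 2) k (pot sg (enorm X)) (pot sg (enorm Y)) (pot sg (enorm Z)) (pot sg 0) => *.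
lra.
Qed.

Lemma Th_lip2 (X Y : E) : enorm (Th sg X - Th sg Y) <= 2 * (1 + M) * C * enorm (X - Y).
Proof.
apply: le_trans (Th_lip X Y hs) _.
rewrite -[leRHS]mulrA; apply: ler_wpM2l.
 by side.
by rewrite ler_wpM2r ?enorm_ge0//; have /andP[] := sgb (enorm X + enorm Y).
Qed.

Lemma mTh (X : E -> E) : mble X -> mble (fun x => Th sg (X x)).
Proof.
move=> mX; apply: mscalerV => //.
apply: (mcomp sg) => //; last exact: menorm.
exact: continuous_measurable_fun.
Qed.

Lemma sqint_Th D (X : E -> E) : measurable D -> sqint D X -> sqint D (fun x => Th sg (X x)).
Proof.
move=> mD sX; have [mX iX] := sX; have := sqintZ C mD sX => -[_ hi].
apply: (@sqint_dom _ _ _ _ (fun x => enorm (C *: X x) ^+ 2)) => //; first exact: mTh.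
 by side.
move=> x _; rewrite lerXn2r ?nnegrE ?enorm_ge0//.
rewrite /Th !enormZ ler_wpM2r ?enorm_ge0//.
have /andP[h1 h2] := sgb (enorm (X x)).
by rewrite (ger0_norm (le_trans (ltW c0) h1)) (ger0_norm (ltW hC)).
Qed.

Lemma mspot (X : E -> E) : mble X -> mble (fun x => P (X x)).
Proof.
move=> mX; apply: measurable_funB => //.
have -> : (fun x => pot sg (enorm (X x))) = (fun t => pot sg (Num.max t 0)) \o (fun x => enorm (X x)).
 by apply/funext => x /=; rewrite max_l// enorm_ge0.
apply: measurableT_comp; last exact: menorm.
apply: continuous_measurable_fun.
have cm : continuous (fun t : R => Num.max t 0).
 by move=> t; apply: continuous_max; [exact: cvg_id|exact: cvg_cst].
move=> t; apply: (@continuous_comp _ _ _ (fun t : R => Num.max t 0) (pot sg)); first exact: cm.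
apply/differentiable_continuous/derivable1_diffP.
have t0 : 0 <= Num.max t 0 by rewrite le_max lexx orbT.
by have [] := pot_derive cont t0.
Qed.

Lemma spot_taylor X Y t :
 P (X + t *: Y) <= P X + (t * dotprod (Th sg X) Y + t ^+ 2 * ((M + 1) * C) * enorm Y ^+ 2).
Proof.
have /andP[_] := pot_vec hs c0 cont sgb X (X + t *: Y).
have -> : X + t *: Y - X = t *: Y by rewrite addrC addKr.
rewrite dotZr enormZ exprMn real_normK ?num_real// /spot.
have -> : (M + 1) * C * (t ^+ 2 * enorm Y ^+ 2) = t ^+ 2 * ((M + 1) * C) * enorm Y ^+ 2 by ring.
move: (t ^+ 2 * _ * _) (t * _) (pot sg (enorm (_ + _))) (pot sg (enorm X)) (pot sg 0) => *.
lra.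
Qed.

End existence.

Section minimize.
Context {R : realType} {n : nat}.
Local Notation E := 'rV[R]_n.
Local Notation mu := (@lebesgue_rV R n).
Variables (m M c C : R) (sg : R -> R) (P : E -> R).
Hypotheses (hm : 0 < m) (c0 : 0 < c) (hM : 1 <= M) (hC : 0 < C).
Hypothesis sqint_Th : forall D (X : E -> E), measurable D -> sqint D X -> sqint D (fun x => Th sg (X x)).
Hypothesis Th_lip2 : forall X Y : E, enorm (Th sg X - Th sg Y) <= 2 * (1 + M) * C * enorm (X - Y).
Hypothesis P_bound : forall X, m * c / 2 * enorm X ^+ 2 <= P X <= (M + 1) * C * enorm X ^+ 2.
Hypothesis P_mid : forall X Y, m * c / 4 * enorm (X - Y) ^+ 2 + 2 * P (2^-1 *: (X + Y)) <= P X + P Y.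
Hypothesis P_taylor : forall X Y t,
 P (X + t *: Y) <= P X + (t * dotprod (Th sg X) Y + t ^+ 2 * ((M + 1) * C) * enorm Y ^+ 2).
Hypothesis measurable_P : forall X : E -> E, mble X -> mble (fun x => P (X x)).

Variables (v0 : E -> R) (g0 : E -> E) (x0 : E) (r : R).
Hypothesis C1v0 : C1 v0 g0.
Local Notation U := (cube x0 r).

Let mU : measurable U. Proof. by side. Qed.

Let adm (p : (E -> R) * (E -> E)) := C1 p.1 p.2 /\ csupp p.1 p.2 x0 r.
Let J (p : (E -> R) * (E -> E)) := \int[mu]_(x in U) P (g0 x + p.2 x).

Let sq0 : sqint U g0. Proof. by apply: sqint_cont; have [] := C1v0. Qed.

Let sqa p : adm p -> sqint U p.2.
Proof. by move=> [[_ cg _] _]; exact: sqint_cont. Qed.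

Let sqS p : adm p -> sqint U (fun x => g0 x + p.2 x).
Proof. by move=> /sqa; exact: sqintD. Qed.

Let iP (X : E -> E) : sqint U X -> mu.-integrable U (EFin \o (fun x => P (X x))).
Proof.
move=> sX; have [mX _] := sX.
have i1 := integrableZl mU ((M + 1) * C) (intg_sqint mU sX).
apply: (@intg_dom _ _ _ _ _ _ (fun x => (M + 1) * C * enorm (X x) ^+ 2)) => //.
- by side.
- by side.
- move=> x _; have /andP[h1 h2] := P_bound (X x); rewrite ger0_norm//.
 by apply: le_trans h1; rewrite mulr_ge0 ?sqr_ge0// divr_ge0// mulr_ge0// ltW.
- have i2 : mu.-integrable U (EFin \o (fun x => (M + 1) * C * enorm (X x) ^+ 2)) by side.
 by rewrite -(intg_fine mU i2) ltry.
Qed.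

Let J_ge0 p : adm p -> 0 <= J p.
Proof.
move=> ap; apply: Rintegral_ge0 => x _; have /andP[h1 _] := P_bound (g0 x + p.2 x).
by apply: le_trans h1; rewrite mulr_ge0 ?sqr_ge0// divr_ge0// mulr_ge0// ltW.
Qed.

Let adm0 : adm (cst 0, cst 0).
Proof. by split; [exact: C1_cst|]. Qed.

Let admD p q (k l : R) : adm p -> adm q ->
 adm (fun x => k * p.1 x + l * q.1 x, fun x => k *: p.2 x + l *: q.2 x).
Proof.
move=> [c1 s1] [c2 s2]; split => /=.
 by apply: C1_add; exact: C1_scale.
by move=> x nx; have [-> ->] := s1 x nx; have [-> ->] := s2 x nx; rewrite !mulr0 !scaler0 !addr0.
Qed.

Let I := inf [set J p | p in adm].

Let Ile p : adm p -> I <= J p.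
Proof.
move=> ap; apply: ge_inf; last by exists p.
by exists 0 => _ [q aq <-]; exact: J_ge0.
Qed.

Let Iadh e : 0 < e -> exists p, adm p /\ J p < I + e.
Proof.
move=> e0; have hI : has_inf [set J p | p in adm].
 split; first by exists (J (cst 0, cst 0)); exists (cst 0, cst 0).
 by exists 0 => _ [q aq <-]; exact: J_ge0.
have [_ [p ap <-] h] := inf_adherent e0 hI.
by exists p.
Qed.

(** Integrating [P_mid] gives m c/4 times the left side <= J p + J q - 2 J(midpoint). The midpoint
    is admissible, so the right side is below 2 e. *)
Let cauchy p q e : adm p -> adm q -> J p < I + e -> J q < I + e ->
 (\int[mu]_(x in U) (enorm ((g0 x + p.2 x) - (g0 x + q.2 x)) ^+ 2)%:E <= (8 * e / (m * c))%:E)%E.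
Proof.
move=> ap aq Jp Jq.
have sp := sqS ap; have sq := sqS aq.
have sd := sqintB mU sp sq.
have am := admD 2^-1 2^-1 ap aq.
have sm := sqS am.
have i1 := intg_sqint mU sd.
have i2 := iP sm; have i3 := iP sp; have i4 := iP sq.
have i5 : mu.-integrable U (EFin \o (fun x => m * c / 4 * enorm ((g0 x + p.2 x) - (g0 x + q.2 x)) ^+ 2)).
 by have := integrableZl mU (m * c / 4) i1.
have i6 : mu.-integrable U (EFin \o (fun x => 2 * P (g0 x + (2^-1 *: p.2 x + 2^-1 *: q.2 x)))).
 by have := integrableZl mU 2 i2.
have h : \int[mu]_(x in U) (m * c / 4 * enorm ((g0 x + p.2 x) - (g0 x + q.2 x)) ^+ 2 +
   2 * P (g0 x + (2^-1 *: p.2 x + 2^-1 *: q.2 x))) <=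
  \int[mu]_(x in U) (P (g0 x + p.2 x) + P (g0 x + q.2 x)).
 have i7 : mu.-integrable U (EFin \o (fun x => m * c / 4 * enorm ((g0 x + p.2 x) - (g0 x + q.2 x)) ^+ 2 +
   2 * P (g0 x + (2^-1 *: p.2 x + 2^-1 *: q.2 x)))).
  by have := integrableD mU i5 i6.
 have i8 : mu.-integrable U (EFin \o (fun x => P (g0 x + p.2 x) + P (g0 x + q.2 x))).
  by have := integrableD mU i3 i4.
 apply: (@le_Rintegral _ _ _ mu U _ _ mU i7 i8).
 move=> x _; apply: le_trans (P_mid _ _); rewrite lerD2l; apply: ler_wpM2l => //.
 apply: eqW; congr P.
 rewrite addrACA scalerDr scalerDr; congr (_ + _).
 by rewrite -scalerDl -[LHS]scale1r; congr (_ *: _); field.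
 by rewrite scalerDr.
move: h; rewrite (RintegralD mU i5 i6) (RintegralD mU i3 i4) (RintegralZl _ mU i1) (RintegralZl _ mU i2) -/(J p) -/(J q).
rewrite -/(J (fun x => 2^-1 * p.1 x + 2^-1 * q.1 x, fun x => 2^-1 *: p.2 x + 2^-1 *: q.2 x)).
have := Ile am; set Jm := J _ => h1 h2.
rewrite -(intg_fine mU i1) lee_fin ler_pdivlMr ?mulr_gt0//.
by set S := \int[mu]_(x in U) _ in h2 *; nra.
Qed.

(** The infimum need not be attained among C^1 functions. A minimising sequence is L^2-Cauchy by
    uniform convexity, its limit [X] is merely a field, and the Euler-Lagrange equation is obtained
    for the approximate minimisers with an error and then passed to the limit. No Sobolev space with
    zero boundary values is involved. *)
Lemma minimize_exists : exists (phi : nat -> E -> R) (gphi : nat -> E -> E) (X : E -> E),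
 [/\ forall j, C1 (phi j) (gphi j) /\ csupp (phi j) (gphi j) x0 r,
   sqint U X, L2cvg U (fun j x => g0 x + gphi j x) X &
   forall f g, C1 f g -> csupp f g x0 r -> \int[mu]_(x in U) dotprod (Th sg (X x)) (g x) = 0].
Proof.
have /choice[p hp] : forall j : nat, exists p, adm p /\ J p < I + j.+1%:R^-1.
 by move=> j; apply: Iadh; rewrite invr_gt0.
have mc0 : 0 < m * c by side.
have small (e : R) : 0 < e -> exists N, forall j, (N <= j)%N -> j.+1%:R^-1 <= e.
 move=> e0; have [N _ hN] := near_infty_natSinv_lt (PosNum e0).
 by exists N => j Nj; apply/ltW/hN.
have sqj j := sqS (hp j).1.
have hcau : forall e : R, 0 < e -> exists N, forall i j, (N <= i)%N -> (N <= j)%N ->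
  (\int[mu]_(x in U) (enorm ((g0 x + (p i).2 x) - (g0 x + (p j).2 x)) ^+ 2)%:E <= e%:E)%E.
 move=> e e0; have [|N hN] := small (m * c * e / 8); first by side.
 exists N => i j Ni Nj.
 have a1 : J (p i) < I + m * c * e / 8 by apply: lt_le_trans (hp i).2 _; rewrite lerD2l hN.
 have a2 : J (p j) < I + m * c * e / 8 by apply: lt_le_trans (hp j).2 _; rewrite lerD2l hN.
 apply: le_trans (cauchy (hp i).1 (hp j).1 a1 a2) _.
 rewrite lee_fin le_eqVlt; apply/orP; left; apply/eqP; field.
 by side.
have [X mX cX] := @L2_completeV R n U (fun j x => g0 x + (p j).2 x) mU (fun j => (sqj j).1) hcau.
have sX : sqint U X.
 have [N hN] := cX 1 ltr01; have hN1 := hN N (leqnn N).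
 have sd : sqint U (fun x => g0 x + (p N).2 x - X x).
  split; last by apply: le_lt_trans hN1 _; rewrite ltry.
  by apply: maddV; [exact: (sqj N).1|exact: moppV].
 have := sqintB mU (sqj N) sd; congr sqint.
 by apply/funext => x; rewrite opprB addrC subrK.
exists (fun j => (p j).1), (fun j => (p j).2), X; split => //.
- by move=> j; exact: (hp j).1.
move=> f g fg fs.
have af : adm (f, g) by [].
have sg' : sqint U g := sqa af.
pose K := \int[mu]_(x in U) enorm (g x) ^+ 2.
have K0 : 0 <= K by apply: Rintegral_ge0 => x _; exact: sqr_ge0.
pose a j := \int[mu]_(x in U) dotprod (Th sg (g0 x + (p j).2 x)) (g x).
have ig := intg_sqint mU sg'.
have ia j : mu.-integrable U (EFin \o (fun x => dotprod (Th sg (g0 x + (p j).2 x)) (g x))).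
 by apply: dot_integrable => //; exact: sqint_Th.
(* Perturbing the j-th function by [t f] cannot lower the energy by more than its excess 1/(j+1)
   over the infimum; [spot_taylor] expands the perturbed energy. *)
have var j t : - j.+1%:R^-1 <= t * a j + t ^+ 2 * ((M + 1) * C * K).
 have am := admD 1 t (hp j).1 af.
 have h1 : I <= J (fun x => 1 * (p j).1 x + t * f x, fun x => 1 *: (p j).2 x + t *: g x) := Ile am.
 have h2 := (hp j).2.
 have i1 : mu.-integrable U (EFin \o (fun x => t * dotprod (Th sg (g0 x + (p j).2 x)) (g x))).
  by have := integrableZl mU t (ia j).
 have i2 : mu.-integrable U (EFin \o (fun x => t ^+ 2 * ((M + 1) * C) * enorm (g x) ^+ 2)).
  by have := integrableZl mU (t ^+ 2 * ((M + 1) * C)) ig.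
 have i3 : mu.-integrable U (EFin \o (fun x => t * dotprod (Th sg (g0 x + (p j).2 x)) (g x) + t ^+ 2 * ((M + 1) * C) * enorm (g x) ^+ 2)).
  by have := integrableD mU i1 i2.
 have i4 := iP (sqj j).
 have h : J (fun x => 1 * (p j).1 x + t * f x, fun x => 1 *: (p j).2 x + t *: g x) <=
   \int[mu]_(x in U) (P (g0 x + (p j).2 x) + (t * dotprod (Th sg (g0 x + (p j).2 x)) (g x) + t ^+ 2 * ((M + 1) * C) * enorm (g x) ^+ 2)).
  have i5 : mu.-integrable U (EFin \o (fun x => P (g0 x + (p j).2 x) + (t * dotprod (Th sg (g0 x + (p j).2 x)) (g x) + t ^+ 2 * ((M + 1) * C) * enorm (g x) ^+ 2))).
   by have := integrableD mU i4 i3.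
  apply: (@le_Rintegral _ _ _ mu U _ _ mU (iP (sqS am)) i5).
  move=> x _; rewrite [X in P X](_ : _ = (g0 x + (p j).2 x) + t *: g x); last by rewrite /= scale1r addrA.
  by side.
 move: h; rewrite (RintegralD mU i4 i3) (RintegralD mU i1 i2) (RintegralZl _ mU (ia j)) (RintegralZl _ mU ig) -/(J (p j)) -/(a j) -/K.
 rewrite -[t ^+ 2 * ((M + 1) * C) * K]mulrA => h3; have h4 := le_lt_trans (le_trans h1 h3) (ltr_leD h2 (lexx _)).
 rewrite -addrA ltrDl in h4.
 by rewrite -subr_ge0 opprK addrC ltW.
apply: (@dot_lim _ _ U (fun j x => Th sg (g0 x + (p j).2 x)) (fun x => Th sg (X x))) => //.
- by move=> j; exact: sqint_Th.
- exact: sqint_Th.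
- move=> e e0; pose L := (2 * (1 + M) * C) ^+ 2 + 1.
 have L0 : 0 < L by rewrite ltr_wpDl// sqr_ge0.
 have [|N hN] := cX (e / L); first by side.
 exists N => j /hN hj.
 have sd : sqint U (fun x => g0 x + (p j).2 x - X x) by exact: sqintB.
 apply: (via (\int[mu]_(x in U) (L * enorm (g0 x + (p j).2 x - X x) ^+ 2)%:E)%E).
  apply: int_le => //.
  - apply: menorm2; apply: maddV; last apply: moppV.
   + exact: (sqint_Th mU (sqj j)).1.
   + exact: (sqint_Th mU sX).1.
  - by apply: measurable_funM => //; apply: menorm2; exact: sd.1.
  - by side.
  - move=> x _; have h := Th_lip2 (g0 x + (p j).2 x) (X x).
   apply: (via ((2 * (1 + M) * C * enorm (g0 x + (p j).2 x - X x)) ^+ 2)).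
    rewrite lerXn2r ?nnegrE ?enorm_ge0// mulr_ge0 ?enorm_ge0//.
    by side.
   by rewrite exprMn ler_wpM2r ?sqr_ge0// lerDl.
 rewrite int_Z//; last 3 first.
 - by apply: menorm2; exact: sd.1.
 - by side.
 - by side.
 apply: le_trans (lee_wpmul2l _ hj) _; first by rewrite lee_fin ltW.
 by rewrite -EFinM lee_fin mulrC divfK// gt_eqF.
(* Apply [var] with t and -t: |a j| <= 1/((j+1) t) + t b. First [t] makes t b at most e/2, then [j]
   is taken large. *)
move=> e e0; pose b := (M + 1) * C * K.
have b0 : 0 <= b by rewrite !mulr_ge0 ?(ltW hC)//; have M1' := hM; lra.
pose t := e / (2 * (b + 1)).
have b1 : 0 < 2 * (b + 1) by lra.
have t0 : 0 < t by rewrite divr_gt0.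
have tb : t * b <= e / 2.
 rewrite /t mulrAC ler_pdivrMr//.
 have -> : e / 2 * (2 * (b + 1)) = e * (b + 1) by field.
 by side.
have [|N hN] := small (t * e / 2); first by side.
exists N => j /hN hj.
have v1 := var j t; have v2 := var j (- t).
rewrite -/b in v1 v2; rewrite -/(a j) ler_norml.
have tt : t ^+ 2 * b <= t * e / 2 by rewrite expr2 -mulrA -mulrA ler_wpM2l// ltW.
suff /andP[u1 u2] : - (t * e) <= t * a j <= t * e.
 by apply/andP; split; rewrite -(ler_pM2l t0) ?mulrN.
move: hj v1 v2 tt; rewrite sqrrN mulNr.
move: (j.+1%:R^-1) (t * a j) (t ^+ 2 * b) (t * e) => kk ta tbb te w1 w2 w3 w4.
by apply/andP; split; lra.
Qed.

End minimize.

Lemma minimizer_exists {R : realType} {n : nat} (m M c C : R) (sg : R -> R)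
  (v0 : 'rV[R]_n -> R) (g0 : 'rV[R]_n -> 'rV[R]_n) (x0 : 'rV[R]_n) (r : R) :
 slope m M sg -> 0 < c -> continuous sg -> (forall t, c <= sg t <= C) -> C1 v0 g0 ->
 exists (phi : nat -> 'rV[R]_n -> R) (gphi : nat -> 'rV[R]_n -> 'rV[R]_n) (X : 'rV[R]_n -> 'rV[R]_n),
 [/\ forall j, C1 (phi j) (gphi j) /\ csupp (phi j) (gphi j) x0 r,
   sqint (cube x0 r) X, L2cvg (cube x0 r) (fun j x => g0 x + gphi j x) X &
   forall f g, C1 f g -> csupp f g x0 r ->
    \int[@lebesgue_rV R n]_(x in cube x0 r) dotprod (Th sg (X x)) (g x) = 0].
Proof.
move=> hs c0 cs sgb h0; have [/andP[m0 _] M1 _ _] := hs.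
have C0 : 0 < C by have /andP[h1 h2] := sgb 0; exact: lt_le_trans c0 (le_trans h1 h2).
apply: (@minimize_exists R n m M c C sg (spot sg) m0 c0 M1 C0 _ _ _ _ _ _ v0 g0 x0 r h0).
- by move=> D X mD sX; exact: (sqint_Th c0 cs sgb mD sX).
- exact: (Th_lip2 hs sgb).
- exact: (spot_bound hs c0 cs sgb).
- exact: (spot_mid hs c0 cs sgb).
- exact: (spot_taylor hs c0 cs sgb).
- by move=> X mX; exact: (mspot cs mX).
Qed.

(** * Truncations used in test functions *)

Section hinge.
Context {R : realType}.
Implicit Types (k u : R).

(* Odd C^1 truncation: its derivative vanishes on [-k, k] and is 1 beyond 2k. *)
Definition hinge1 k u := (pos2 (u - k) - pos2 (u - 2 * k)) / (2 * k).
Definition dhinge1 k u := (dpos2 (u - k) - dpos2 (u - 2 * k)) / (2 * k).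
Definition hinge k u := hinge1 k u - hinge1 k (- u).
Definition dhinge k u := dhinge1 k u + dhinge1 k (- u).

Lemma is_derive_hinge k u : is_derive u 1 (hinge k) (dhinge k u).
Proof.
have d1 (s a v : R) : is_derive v 1 (fun v : R => pos2 (s * v - a)) (dpos2 (s * v - a) * s).
 have di : is_derive v 1 (fun v : R => s * v - a) s.
  by apply: is_derive_eq; rewrite /GRing.scale/=; ring.
 exact: (@is_derive1_comp R pos2 (fun v => s * v - a) v _ _ (is_derive_pos2 _) di).
have e1 : hinge k = (fun v => (2 * k)^-1 *: ((pos2 (1 * v - k) - pos2 (1 * v - 2 * k)) - (pos2 (-1 * v - k) - pos2 (-1 * v - 2 * k)))).
 apply/funext => v; rewrite /hinge /hinge1 /GRing.scale/= !mul1r !mulN1r; ring.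
rewrite e1.
have h := is_deriveZ _ (is_deriveB (is_deriveB (d1 1 k u) (d1 1 (2 * k) u)) (is_deriveB (d1 (-1) k u) (d1 (-1) (2 * k) u))).
apply: (is_derive_eq (h (2 * k)^-1)).
rewrite /dhinge /dhinge1 /GRing.scale/= !mul1r !mulN1r; ring.
Qed.

Lemma cont_dhinge k : continuous (dhinge k).
Proof.
have c1 (s a : R) : continuous (fun v : R => dpos2 (s * v - a)).
 apply: (@cont_comp _ _ _ (fun v : R => s * v - a) dpos2); last exact: cont_dpos2.
 apply: contB; last exact: cont_cst.
 by apply: contM; [exact: cont_cst|exact: cont_id].
rewrite (_ : dhinge k = (fun v => (dpos2 (1 * v - k) - dpos2 (1 * v - 2 * k)) * (2 * k)^-1 + (dpos2 (-1 * v - k) - dpos2 (-1 * v - 2 * k)) * (2 * k)^-1)); last first.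
 by apply/funext => v; rewrite /dhinge /dhinge1 !mul1r !mulN1r.
by apply: contD; (apply: contM; [exact: contB|exact: cont_cst]).
Qed.

Lemma dhinge1_prop k u : 0 < k -> [/\ 0 <= dhinge1 k u <= 1, u <= k -> dhinge1 k u = 0 &
 2 * k <= u -> dhinge1 k u = 1] /\ [/\ 0 <= hinge1 k u, u <= k -> hinge1 k u = 0 &
 0 <= u -> hinge1 k u <= u * dhinge1 k u].
Proof.
suff h : 0 < k -> [/\ [/\ 0 <= dhinge1 k u <= 1, u <= k -> dhinge1 k u = 0 &
 2 * k <= u -> dhinge1 k u = 1], 0 <= hinge1 k u, u <= k -> hinge1 k u = 0 &
 0 <= u -> hinge1 k u <= u * dhinge1 k u].
 by move=> /h[? ? ? ?].
move=> k0; have k2 : 0 < 2 * k by lra.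
rewrite /dhinge1 /hinge1.
have [h1|h1] := leP (u - k) 0; last have [h2|h2] := leP (u - 2 * k) 0.
- have h2 : u - 2 * k <= 0 by lra.
 rewrite (dpos2_eq0 h1) (dpos2_eq0 h2) (pos2_eq0 h1) (pos2_eq0 h2) subrr mul0r mulr0.
 by rewrite lexx ler01; split => //; split => // h3; lra.
- rewrite (dpos2_eq0 h2) (pos2_eq0 h2) (dpos2_pos (ltW h1)) (pos2_pos (ltW h1)) !subr0.
 have e1 : 2 * (u - k) / (2 * k) = (u - k) / k by field; rewrite gt_eqF.
 rewrite e1; split; first split.
 + by rewrite divr_ge0 ?(ltW h1) ?(ltW k0)//= ler_pdivrMr//; lra.
 + by move=> h3; lra.
 + move=> h3; have -> : u - k = k by lra.
  by rewrite divff// gt_eqF.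
 + by side.
 + by move=> h3; lra.
 + move=> u0; rewrite ler_pdivrMr//.
  have -> : u * ((u - k) / k) * (2 * k) = 2 * u * (u - k) by field; rewrite gt_eqF.
  by nra.
- rewrite (dpos2_pos (ltW h2)) (pos2_pos (ltW h2)) (dpos2_pos (ltW h1)) (pos2_pos (ltW h1)).
 have e1 : (2 * (u - k) - 2 * (u - 2 * k)) / (2 * k) = 1 by field; rewrite gt_eqF.
 have e2 : ((u - k) ^+ 2 - (u - 2 * k) ^+ 2) / (2 * k) = u - 3 / 2 * k by field; rewrite gt_eqF.
 rewrite e1 e2 ler01 lexx mulr1; split => //; [by split => // h3; lra|lra|move=> h3; lra|move=> h3; lra].
Qed.

(** The bound |G(u)| <= |u| G'(u) lets the term in which the cut-off function is differentiated be
    absorbed with weight G'. The last two properties localise it: nothing below [k], full strength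
    from [2 * k] on. *)
Lemma dhinge_prop k u : 0 < k -> [/\ 0 <= dhinge k u <= 1,
 `|hinge k u| <= `|u| * dhinge k u, `|u| <= k -> dhinge k u = 0 &
 2 * k <= `|u| -> dhinge k u = 1].
Proof.
move=> k0; rewrite /dhinge /hinge.
wlog u0 : u / 0 <= u => [H|].
 have [u0|u0] := leP 0 u; first exact: H.
 have := H (- u); rewrite opprK normrN addrC oppr_ge0 => /(_ (ltW u0)).
 by rewrite -[hinge1 k (- u) - _]opprB normrN.
have [[a1 a2 a3] [a4 a5 a6]] := dhinge1_prop u k0.
have [[_ b2 _] [_ b5 _]] := dhinge1_prop (- u) k0.
have nu : - u <= k by lra.
by rewrite b2// b5// addr0 subr0 !ger0_norm//; split => //; exact: a6.
Qed.

End hinge.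

Section supp.
Context d (T : measurableType d) (R : realType) (mu : {measure set T -> \bar R}).
Implicit Types (f : T -> R) (D : set T).

Lemma intg_supp D f : measurable D -> (forall x, ~ D x -> f x = 0) ->
 mu.-integrable D (EFin \o f) -> L1 mu f.
Proof.
move=> mD f0 fi; have := (integrable_mkcond (EFin \o f) mD).1 fi.
congr integrable; apply/funext => x; rewrite patchE; case: ifPn => // /negP xD.
by rewrite /= f0// => Dx; apply: xD; rewrite inE.
Qed.

Lemma Rint_supp D f : (forall x, ~ D x -> f x = 0) ->
 \int[mu]_(x in D) f x = \int[mu]_x f x.
Proof.
move=> f0; rewrite Rintegral_mkcond; apply: eq_Rintegral => x _; rewrite patchE.
by case: ifPn => // /negP xD; rewrite f0// => Dx; apply: xD; rewrite inE.
Qed.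

Lemma int_supp D f : (forall x, ~ D x -> f x = 0) ->
 (\int[mu]_(x in D) (f x)%:E = \int[mu]_x (f x)%:E)%E.
Proof.
move=> f0; rewrite integral_mkcond; apply: eq_integral => x _; rewrite patchE.
by case: ifPn => // /negP xD; rewrite f0// => Dx; apply: xD; rewrite inE.
Qed.

End supp.

(** * Caccioppoli inequality for difference quotients *)

Section caccioppoli.
Context {R : realType} {n : nat}.
Local Notation E := 'rV[R]_n.
Local Notation mu := (@lebesgue_rV R n).

(* [X] is, on the cube, an L^2 limit of gradients [g j] of C^1 functions [v j],
  and [div (Th sg X) = 0] there. *)
Record hsol (sg : R -> R) (v : nat -> E -> R) (g : nat -> E -> E) (X : E -> E) (x0 : E) (r : R) : Prop :=
 HSol { hsol_C1 : forall j, C1 (v j) (g j);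
     hsol_sq : sqint (cube x0 r) X;
     hsol_cvg : L2cvg (cube x0 r) g X;
     hsol_eq : forall f h, C1 f h -> csupp f h x0 r ->
      \int[mu]_(x in cube x0 r) dotprod (Th sg (X x)) (h x) = 0 }.

Definition dq (t : R) (e : E) (f : E -> R) (x : E) : R := (f (x + t *: e) - f x) / t.
Definition dqV (t : R) (e : E) (X : E -> E) (x : E) : E := t^-1 *: (X (x + t *: e) - X x).

Lemma C1_dq f g t e : C1 f g -> C1 (dq t e f) (dqV t e g).
Proof.
move=> fg; have := C1_scale t^-1 (C1_sub (C1_shift (t *: e) fg) fg).
by congr C1; apply/funext => x; rewrite /dq mulrC.
Qed.

Variables (m M c C : R) (sg : R -> R).
Hypotheses (hs : slope m M sg) (c0 : 0 < c) (cs : continuous sg).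
Hypothesis sgb : forall t, c <= sg t <= C.

(** The algebra of testing the differenced equation with eta^2 G(w), where [e] stands for the value
    of w, a difference quotient of the C^1 approximation. Its gradient [qj] only approximates the
    quotient [q] of the solution, and the mismatch [qj - q] forms the last error term. The weight
    [S] comes from [Th_mono] and [Th_lip] alike, so it factors out of the whole inequality. *)
Lemma cacc_pointwise (c1 : R) (X Xh qj : E) (t e G dG : R) (ge : E) :
 0 < c1 -> 0 < t -> 0 <= dG -> `|G| <= `|e| * dG ->
 c1 * (sg (enorm Xh + enorm X) * enorm (Xh - X) ^+ 2) <= dotprod (Th sg Xh - Th sg X) (Xh - X) ->
 forall (eta S : R) (q : E) (L : R),
 S = sg (enorm Xh + enorm X) -> q = t^-1 *: (Xh - X) -> L = 2 * (1 + M) ->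
 c1 / 2 * (eta ^+ 2 * dG * S * enorm q ^+ 2) <=
 t^-1 * dotprod (Th sg Xh - Th sg X) (eta ^+ 2 *: (dG *: qj) + (2 * eta * G) *: ge) +
 (4 * L ^+ 2 / c1 * (enorm ge ^+ 2 * S * e ^+ 2 * dG) +
  L ^+ 2 / c1 * (eta ^+ 2 * dG * S * enorm (qj - q) ^+ 2)).
Proof.
move=> c10 t0 dG0 GdG mono eta _ _ _ -> -> ->.
set S := sg _; set q := t^-1 *: _; set L := 2 * (1 + M).
have S0 : 0 <= S by have /andP[h1 _] := sgb (enorm Xh + enorm X); exact: le_trans (ltW c0) h1.
pose D := t^-1 *: (Th sg Xh - Th sg X).
have t1 : 0 < t^-1 by side.
have DL : enorm D <= L * (S * enorm q).
 rewrite /D /q !enormZ (gtr0_norm t1).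
 have -> : L * (S * (t^-1 * enorm (Xh - X))) = t^-1 * (L * (S * enorm (Xh - X))) by ring.
 by rewrite ler_pM2l//; exact: (Th_lip Xh X hs).
have Dq : c1 * (S * enorm q ^+ 2) <= dotprod D q.
 rewrite /D /q dotZl dotZr enormZ exprMn (gtr0_norm t1).
 have -> : c1 * (S * (t^-1 ^+ 2 * enorm (Xh - X) ^+ 2)) = t^-1 * (t^-1 * (c1 * (S * enorm (Xh - X) ^+ 2))) by ring.
 by side.
rewrite -dotZl -/D dotDr !dotZr.
have -> : dotprod D qj = dotprod D q + dotprod D (qj - q) by rewrite -dotDr addrC subrK.
have b1 : - (L * (S * enorm q) * enorm (qj - q)) <= dotprod D (qj - q).
 have := dot_norm_le D (qj - q); rewrite ler_norml => /andP[h _]; apply: le_trans h.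
 by rewrite lerN2 ler_wpM2r ?enorm_ge0.
have b2 : - (2 * `|eta| * (`|e| * dG) * (L * (S * enorm q) * enorm ge)) <= 2 * eta * G * dotprod D ge.
 rewrite lerNl -mulNr; apply: le_trans (ler_norm _) _; rewrite !normrM normrN.
 rewrite !normrM (ger0_norm (ler0n _ 2)).
 apply: ler_pM; rewrite ?mulr_ge0//; first by rewrite ler_wpM2l// mulr_ge0.
 apply: le_trans (dot_norm_le D ge) _; try side.
have eta2 : eta ^+ 2 = `|eta| ^+ 2 by rewrite real_normK ?num_real.
have e2 : e ^+ 2 = `|e| ^+ 2 by rewrite real_normK ?num_real.
rewrite eta2 e2; move: b1 b2 Dq.
set A := `|eta|; set B := `|e|; set Q := enorm q; set Z := enorm (qj - q); set W := enorm ge.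
set d1 := dotprod D (qj - q); set d2 := _ * dotprod D ge; set d3 := dotprod D q.
move=> b1 b2 Dq.
have c1n : c1 != 0 by side.
(* Young's inequality for the two error terms *)
have y1 : A ^+ 2 * dG * (L * (S * Q) * Z) <= c1 / 4 * (A ^+ 2 * dG * S * Q ^+ 2) + L ^+ 2 / c1 * (A ^+ 2 * dG * S * Z ^+ 2).
 have : 0 <= (A ^+ 2 * dG * S) * (c1^-1 * (c1 / 2 * Q - L * Z) ^+ 2).
  by side.
 have -> : (A ^+ 2 * dG * S) * (c1^-1 * (c1 / 2 * Q - L * Z) ^+ 2) =
  c1 / 4 * (A ^+ 2 * dG * S * Q ^+ 2) + L ^+ 2 / c1 * (A ^+ 2 * dG * S * Z ^+ 2) - A ^+ 2 * dG * (L * (S * Q) * Z) by field.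
 by rewrite subr_ge0.
have y2 : 2 * A * (B * dG) * (L * (S * Q) * W) <= c1 / 4 * (A ^+ 2 * dG * S * Q ^+ 2) + 4 * L ^+ 2 / c1 * (W ^+ 2 * S * B ^+ 2 * dG).
 have : 0 <= (dG * S) * (c1^-1 * (c1 / 2 * A * Q - 2 * L * B * W) ^+ 2).
  by side.
 have -> : (dG * S) * (c1^-1 * (c1 / 2 * A * Q - 2 * L * B * W) ^+ 2) =
  c1 / 4 * (A ^+ 2 * dG * S * Q ^+ 2) + 4 * L ^+ 2 / c1 * (W ^+ 2 * S * B ^+ 2 * dG) - 2 * A * (B * dG) * (L * (S * Q) * W) by field.
 by rewrite subr_ge0.
have p3 : 0 <= A ^+ 2 * dG by side.
have := ler_wpM2l p3 Dq; have := ler_wpM2l p3 b1.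
have -> : A ^+ 2 * dG * (c1 * (S * Q ^+ 2)) = c1 * (A ^+ 2 * dG * S * Q ^+ 2) by ring.
have -> : A ^+ 2 * dG * - (L * (S * Q) * Z) = - (A ^+ 2 * dG * (L * (S * Q) * Z)) by ring.
have -> : A ^+ 2 * (dG * (d3 + d1)) = A ^+ 2 * dG * d3 + A ^+ 2 * dG * d1 by ring.
have -> : c1 / 2 * (A ^+ 2 * dG * S * Q ^+ 2) = c1 * (A ^+ 2 * dG * S * Q ^+ 2) / 2 by field.
move: y1 y2 b2.
have -> : c1 / 4 * (A ^+ 2 * dG * S * Q ^+ 2) = c1 * (A ^+ 2 * dG * S * Q ^+ 2) / 4 by field.
move: (c1 * _) (_ / c1 * _) (_ / c1 * _) (A ^+ 2 * dG * (L * _ * _)) (2 * A * _ * _) (A ^+ 2 * dG * d3) (A ^+ 2 * dG * d1) d2 => *.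
lra.
Qed.

Variable c1 : R.
Hypothesis c10 : 0 < c1.
Hypothesis mono : forall X Y : E,
 c1 * (sg (enorm X + enorm Y) * enorm (X - Y) ^+ 2) <= dotprod (Th sg X - Th sg Y) (X - Y).
Variables (v : nat -> E -> R) (g : nat -> E -> E) (X : E -> E) (x0 : E) (r : R).
Hypothesis sol : hsol sg v g X x0 r.

Let mU s : measurable (cube x0 s). Proof. by side. Qed.
Let mX : mble X. Proof. by have [] := hsol_sq sol. Qed.
Let mXs (z : E) : mble (fun x : E => X (x + z)).
Proof. by side. Qed.

Let out_shift s t (e x : E) : `|e| <= 1 -> 0 <= t -> s + t <= r -> ~ cube x0 r x ->
 ~ cube x0 s (x - t *: e).
Proof.
move=> e1 t0 st; apply: contra_not; rewrite /cube/= => h.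
have -> : x - x0 = (x - t *: e - x0) + t *: e by rewrite addrAC subrK.
rewrite (le_lt_trans (ler_normD _ _))// (lt_le_trans _ st)// ltr_leD//.
by rewrite normrZ ger0_norm// ler_piMr.
Qed.

(** The equation is tested with [h] and with its translate by [t e], whose support is still in the
    cube because s + t <= r; translation moves the shift from [h] onto the field. *)
Lemma EL_diff f h s t (e : E) : C1 f h -> csupp f h x0 s -> 0 < t -> `|e| <= 1 -> s + t <= r ->
 L1 mu (fun x => t^-1 * dotprod (Th sg (X (x + t *: e)) - Th sg (X x)) (h x)) /\
 \int[mu]_x (t^-1 * dotprod (Th sg (X (x + t *: e)) - Th sg (X x)) (h x)) = 0.
Proof.
move=> fh fs t0 e1 st; have [_ ch _] := fh; have mU' := mU r.
have sr : s <= r by apply: le_trans st; rewrite lerDl ltW.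
have fr : csupp f h x0 r by move=> x nx; apply: fs; apply: contra_not nx; exact: sub_cube.
have sT := sqint_Th c0 cs sgb mU' (hsol_sq sol).
have i1 : mu.-integrable (cube x0 r) (EFin \o (fun x => dotprod (Th sg (X x)) (h x))).
 by apply: (dot_integrable mU' sT); exact: sqint_cont.
have z1 x : ~ cube x0 r x -> dotprod (Th sg (X x)) (h x) = 0 by move=> /fr[_ ->]; rewrite dot0r.
have j1 := intg_supp mU' z1 i1.
have e1' := hsol_eq sol fh fr; rewrite (Rint_supp mu z1) in e1'.
have fh2 := C1_shift (- (t *: e)) fh; have [_ ch2 _] := fh2.
have fr2 : csupp (fun x => f (x - t *: e)) (fun x => h (x - t *: e)) x0 r.
 by move=> x nx; apply: fs; apply: (out_shift e1 (ltW t0) st nx).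
have i2 : mu.-integrable (cube x0 r) (EFin \o (fun x => dotprod (Th sg (X x)) (h (x - t *: e)))).
 by apply: (dot_integrable mU' sT); exact: sqint_cont.
have z2 x : ~ cube x0 r x -> dotprod (Th sg (X x)) (h (x - t *: e)) = 0 by move=> /fr2[_ ->]; rewrite dot0r.
have j2 := intg_supp mU' z2 i2.
have e2 := hsol_eq sol fh2 fr2; rewrite (Rint_supp mu z2) in e2.
have j3 := intg_shift (t *: e) j2; have e3 := Rint_shift (t *: e) j2.
have E3 : (fun x => dotprod (Th sg (X (x + t *: e))) (h (x + t *: e - t *: e))) =
  (fun x => dotprod (Th sg (X (x + t *: e))) (h x)) by apply/funext => x; rewrite addrK.
rewrite E3 e2 in e3; rewrite E3 in j3.
have j4 : L1 mu (fun x => dotprod (Th sg (X (x + t *: e)) - Th sg (X x)) (h x)).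
 have := integrableB measurableT j3 j1; congr integrable.
 by apply/funext => x /=; rewrite dotBl.
have e4 : \int[mu]_x dotprod (Th sg (X (x + t *: e)) - Th sg (X x)) (h x) = 0.
 have -> : \int[mu]_x dotprod (Th sg (X (x + t *: e)) - Th sg (X x)) (h x) =
   \int[mu]_x (dotprod (Th sg (X (x + t *: e))) (h x) - dotprod (Th sg (X x)) (h x)).
  by apply: eq_Rintegral => x _; rewrite dotBl.
 by rewrite (RintegralB measurableT j3 j1) e3 e1' subrr.
split; first by have := integrableZl measurableT t^-1 j4.
by rewrite (RintegralZl _ measurableT j4) e4 mulr0.
Qed.

Let L := 2 * (1 + M).
Definition Sdq t (e : E) x := sg (enorm (X (x + t *: e)) + enorm (X x)).

Lemma mSdq t e : mble (Sdq t e).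
Proof.
apply: (mcomp sg) => //; first exact: continuous_measurable_fun.
apply: measurable_funD; apply: menorm => //; exact: mXs.
Qed.

Lemma mdqV t e (Y : E -> E) : mble Y -> mble (dqV t e Y).
Proof.
move=> mY; apply: mscalerV; first exact: measurable_cst.
apply: maddV; last exact: moppV; try side.
Qed.

Lemma cacc (G dG : R -> R) (eta : E -> R) (heta : E -> E) s t (e : E) j :
 (forall u : R, is_derive u 1 G (dG u)) -> continuous dG ->
 (forall u, 0 <= dG u) -> (forall u, `|G u| <= `|u| * dG u) ->
 C1 eta heta -> csupp eta heta x0 s -> 0 < t -> `|e| <= 1 -> s + t <= r ->
 forall w, w = dq t e (v j) ->
 (\int[mu]_x (c1 / 2 * (eta x ^+ 2 * dG (w x) * Sdq t e x * enorm (dqV t e X x) ^+ 2))%:E <=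
  \int[mu]_x (4 * L ^+ 2 / c1 * (enorm (heta x) ^+ 2 * Sdq t e x * w x ^+ 2 * dG (w x)) +
   L ^+ 2 / c1 * (eta x ^+ 2 * dG (w x) * Sdq t e x * enorm (dqV t e (g j) x - dqV t e X x) ^+ 2))%:E)%E.
Proof.
move=> dG' cdG dG0 GdG eh es t0 e1 st w we.
have wq : C1 w (dqV t e (g j)) by rewrite we; apply: C1_dq; exact: (hsol_C1 sol).
have Gw := C1_comp wq dG' cdG.
have psi := C1_mul (C1_mul eh eh) Gw.
have ps : csupp (fun x => eta x * eta x * G (w x)) (fun x => (eta x * eta x) *: (dG (w x) *: dqV t e (g j) x) + G (w x) *: (eta x *: heta x + eta x *: heta x)) x0 s.
 by move=> x /es[-> ->]; rewrite !mul0r !scale0r !addr0 scaler0 addr0.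
have [i0 z0] := EL_diff psi ps t0 e1 st.
have [mw mq] := mC1 wq; have [meta mheta] := mC1 eh.
have mdG : mble (fun x => dG (w x)).
 by apply: measurableT_comp => //; exact: continuous_measurable_fun.
have mS := mSdq t e; have mQ := mdqV t e mX.
have S0 x : 0 <= Sdq t e x by have /andP[h1 _] := sgb (enorm (X (x + t *: e)) + enorm (X x)); exact: le_trans (ltW c0) h1.
have L0 : 0 <= L ^+ 2 / c1 by side.
have L4 : 0 <= 4 * L ^+ 2 / c1 by side.
apply: (Rint_sum0_le measurableT i0 z0).
- apply: measurable_funM => //; apply: measurable_funM; last by side.
 by side.
- apply: measurable_funD; apply: measurable_funM => //.
  apply: measurable_funM => //; apply: measurable_funM; last exact: measurable_funX; try side.
 apply: measurable_funM; last first; try side.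
- move=> x _; apply: mulr_ge0; first by side.
 apply: mulr_ge0; last exact: sqr_ge0; try side.
- move=> x _; apply: addr_ge0; apply: mulr_ge0 => //; apply: mulr_ge0 => //; try exact: sqr_ge0; try side.
move=> x _.
have := @cacc_pointwise c1 (X x) (X (x + t *: e)) (dqV t e (g j) x) t (w x) (G (w x)) (dG (w x)) (heta x)
 c10 t0 (dG0 _) (GdG _) (mono _ _) (eta x) (Sdq t e x) (dqV t e X x) L erefl erefl erefl.
have -> // : (eta x * eta x) *: (dG (w x) *: dqV t e (g j) x) + G (w x) *: (eta x *: heta x + eta x *: heta x) =
 eta x ^+ 2 *: (dG (w x) *: dqV t e (g j) x) + (2 * eta x * G (w x)) *: heta x.
congr (_ *: _ + _); rewrite -scalerDl scalerA; congr (_ *: _); ring.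
Qed.

(** For fixed [t] this error vanishes as j grows, but not uniformly in [t]; hence [j] is always
    chosen after [t]. *)
Lemma qj_err s t (e : E) j : 0 < t -> `|e| <= 1 ->
 (\int[mu]_(x in cube x0 s) (enorm (dqV t e (g j) x - dqV t e X x) ^+ 2)%:E <=
  (4 / t ^+ 2)%:E * \int[mu]_(x in cube x0 (s + t)) (enorm (g j x - X x) ^+ 2)%:E)%E.
Proof.
move=> t0 e1; have [_ mg] := mC1 (hsol_C1 sol j).
have mD : mble (fun x => g j x - X x).
 by side.
have me := menorm2 mD.
have mes : mble (fun x : E => enorm (g j (x + t *: e) - X (x + t *: e)) ^+ 2).
 by side.
have st : s <= s + t by side.
have p2 : 0 <= 2 / t ^+ 2 by side.
apply: (via (\int[mu]_(x in cube x0 s) (2 / t ^+ 2 * (enorm (g j (x + t *: e) - X (x + t *: e)) ^+ 2 + enorm (g j x - X x) ^+ 2))%:E)%E).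
 apply: int_le => //.
 - by side.
 - by side.
 - by side.
 - move=> x _; rewrite /dqV -scalerBr enormZ exprMn real_normK ?num_real//.
  have -> : g j (x + t *: e) - g j x - (X (x + t *: e) - X x) = (g j (x + t *: e) - X (x + t *: e)) + - (g j x - X x).
   by rewrite !opprD !opprK addrACA.
  apply: le_trans (ler_wpM2l _ (enormD_sqr _ _)) _; first exact: sqr_ge0.
  by rewrite enormN exprVn mulrA (mulrC _ 2).
rewrite int_Z//; try side.
rewrite int_D//; try side.
have I1 : (\int[mu]_(x in cube x0 s) (enorm (g j (x + t *: e) - X (x + t *: e)) ^+ 2)%:E <=
  \int[mu]_(x in cube x0 (s + t)) (enorm (g j x - X x) ^+ 2)%:E)%E.
 have ts : `|t *: e| + s <= s + t by rewrite addrC lerD2l normrZ gtr0_norm// ler_piMr// ltW.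
 exact: (int_shift_cube_le x0 me (fun x => sqr_ge0 _) ts).
have I2 : (\int[mu]_(x in cube x0 s) (enorm (g j x - X x) ^+ 2)%:E <=
  \int[mu]_(x in cube x0 (s + t)) (enorm (g j x - X x) ^+ 2)%:E)%E.
 by apply: int_sub => //; [exact: sub_cube|move=> x _; exact: sqr_ge0].
have p2' : (0 <= (2 / t ^+ 2)%:E)%E by side.
apply: le_trans (lee_wpmul2l p2' (leeD I1 I2)) _.
set I := (\int[mu]_(x in _) _)%E.
have -> : (I + I = 2%:E * I)%E by rewrite -(@mule2n R) muleC mule_natr.
rewrite muleA -EFinM (_ : 2 / t ^+ 2 * 2 = 4 / t ^+ 2)//.
by rewrite mulrAC; congr (_ / _); ring.
Qed.

Definition cutoff s d (x : E) := prof s d (x - x0).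
Definition dcutoff s d (x : E) : E := dprof s d (x - x0).

Lemma cutoff_C1 s d : C1 (cutoff s d) (dcutoff s d).
Proof. exact: (C1_shift (- x0) (prof_C1 s d)). Qed.

Lemma cutoff_csupp s d : 0 < s -> 0 < d -> csupp (cutoff s d) (dcutoff s d) x0 (s + d).
Proof.
move=> s0 d0 x nx; rewrite /cutoff /dcutoff.
have [i hi] : exists i, s + d <= `|(x - x0) ord0 i|.
 apply: contrapT => /forallNP H; apply: nx; rewrite /cube/=.
 apply/norm_ltP; first exact: addr_gt0.
 by move=> i; rewrite ltNge; apply/negP => h; exact: (H i).
exact: (prof_eq0 d0 hi).
Qed.

Lemma cutoff1 s d x : 0 < d -> cube x0 s x -> cutoff s d x = 1.
Proof.
move=> d0 xs; apply: prof_eq1 => // i; apply: le_trans (coord_le_norm _ _) _.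
exact: ltW.
Qed.

Lemma dcutoff_le (s d : R) x : 0 < d -> enorm (dcutoff s d x) ^+ 2 <= (n%:R * (4 / d)) ^+ 2.
Proof.
move=> d0; have p : 0 <= 4 / d by side.
rewrite lerXn2r ?nnegrE ?enorm_ge0//; first by side.
apply: le_trans (enorm_le_sum _) _.
have -> : n%:R * (4 / d) = \sum_(i < n) (4 / d) by rewrite sumr_const card_ord mulr_natl.
apply: ler_sum => i _; apply: le_trans (dprof_coord _ _ _ d0) _.
by rewrite ler_piMr//; case: ifP.
Qed.

Let b k : E := delta_mx ord0 k.
Let b1 k : `|b k| <= 1.
Proof. by apply: le_trans (norm_le_enorm _) _; rewrite enorm_delta. Qed.

Lemma wj_L2 s t k j : 0 < t ->
 (\int[mu]_(x in cube x0 s) (dq t (b k) (v j) x ^+ 2)%:E <=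
  \int[mu]_(x in cube x0 (s + t)) (enorm (g j x) ^+ 2)%:E)%E.
Proof.
move=> t0; have [mv mg] := mC1 (hsol_C1 sol j).
have [_ cg _] := hsol_C1 sol j.
have [_ fg] := sqint_cont x0 (s + t) cg.
have Ig0 : (0 <= \int[mu]_(x in cube x0 (s + t)) (enorm (g j x) ^+ 2)%:E)%E.
 by side.
have fin : (\int[mu]_(x in cube x0 (s + t)) (enorm (g j x) ^+ 2)%:E)%E \is a fin_num.
 by rewrite ge0_fin_numE.
have ts : `|t *: b k| + s <= s + t by rewrite addrC lerD2l normrZ gtr0_norm// ler_piMr// ltW.
have mdv : mble (fun x : E => (v j (x + t *: b k) - v j x) ^+ 2).
 by side.
have h : (\int[mu]_(x in cube x0 s) ((v j (x + t *: b k) - v j x) ^+ 2)%:E <=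
  (t ^+ 2 * fine (\int[mu]_(x in cube x0 (s + t)) (enorm (g j x) ^+ 2)%:E)%E)%:E)%E.
 apply: (C1_L2_shift (hsol_C1 sol j) ts).
 rewrite EFinM fineK// -int_Z//; last 3 first.
 - exact: menorm2.
 - by move=> x _; exact: sqr_ge0.
 - exact: sqr_ge0.
 apply: int_le => //; try side.
 - move=> x _; rewrite dotZr exprMn ler_wpM2l ?sqr_ge0// dot_delta.
  by rewrite -real_normK ?num_real// lerXn2r ?nnegrE ?enorm_ge0//; exact: coord_le_enorm.
have -> : (\int[mu]_(x in cube x0 s) (dq t (b k) (v j) x ^+ 2)%:E =
  \int[mu]_(x in cube x0 s) (t ^- 2 * (v j (x + t *: b k) - v j x) ^+ 2)%:E)%E.
 by apply: eq_integral => x _; rewrite /dq exprMn exprVn mulrC.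
have t2 : 0 < t ^- 2 by side.
rewrite int_Z//; try side.
apply: le_trans (lee_wpmul2l _ h) _; first by rewrite lee_fin ltW.
rewrite -EFinM mulrA mulVf ?mul1r ?fineK//; try side.
Qed.

Let gj_bound : exists2 K : R, 0 <= K & forall j e s, s <= r ->
 (\int[mu]_(x in cube x0 r) (enorm (g j x - X x) ^+ 2)%:E <= e%:E)%E ->
 (\int[mu]_(x in cube x0 s) (enorm (g j x) ^+ 2)%:E <= (2 * (e + K))%:E)%E.
Proof.
have sX := hsol_sq sol; have [_ fX] := sX.
have X0 : (0 <= \int[mu]_(x in cube x0 r) (enorm (X x) ^+ 2)%:E)%E.
 by side.
have fin : (\int[mu]_(x in cube x0 r) (enorm (X x) ^+ 2)%:E)%E \is a fin_num by rewrite ge0_fin_numE.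
exists (fine (\int[mu]_(x in cube x0 r) (enorm (X x) ^+ 2)%:E)%E); first exact: fine_ge0.
move=> j e s sr h; have [_ mg] := mC1 (hsol_C1 sol j).
have mgX : mble (fun x => enorm (g j x - X x) ^+ 2).
 by side.
have meX := menorm2 mX.
apply: (via (\int[mu]_(x in cube x0 r) (enorm (g j x) ^+ 2)%:E)%E).
 apply: int_sub => //; [exact: sub_cube|exact: menorm2|]; try side.
apply: (via (\int[mu]_(x in cube x0 r) (2 * (enorm (g j x - X x) ^+ 2 + enorm (X x) ^+ 2))%:E)%E).
 apply: int_le => //; first exact: menorm2; try side.
 - by move=> x _; have := enormD_sqr (g j x - X x) (X x); rewrite subrK.
rewrite int_Z//; try side.
rewrite int_D//; try side.
have p2 : (0 <= 2%:E :> \bar R)%E by side.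
rewrite EFinM; apply: (lee_wpmul2l p2); rewrite EFinD fineK//; exact: leeD2r.
Qed.

(** Caccioppoli's inequality with G the identity. Here [K] depends on the ellipticity bounds and on
    the solution. It is used only qualitatively, in terms multiplied by a parameter chosen after
    it. *)
Lemma dqV_L2 (s d : R) : 0 < s -> 0 < d -> s + 2 * d <= r -> exists2 K : R, 0 <= K &
 forall t k, 0 < t <= d ->
 (\int[mu]_(x in cube x0 s) (enorm (dqV t (b k) X x) ^+ 2)%:E <= K%:E)%E.
Proof.
move=> s0 d0 sdr; have [K K0 hK] := gj_bound.
have C0 : 0 < C by have /andP[h1 h2] := sgb 0; exact: lt_le_trans c0 (le_trans h1 h2).
pose B := (n%:R * (4 / d)) ^+ 2.
have B0 : 0 <= B by side.
pose Q := L ^+ 2 / c1.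
have Q0 : 0 <= Q by side.
pose K1 := 4 * Q * (B * C) * (2 * (1 + K)) + Q * C * 4.
have c10' := c10; have c0' := c0; have C0' := C0.
have CW := ltW C0; have BC : 0 <= B * C by side.
have QBC : 0 <= 4 * Q * (B * C) by side.
have K10 : 0 <= K1.
 apply: addr_ge0; first by side.
 by side.
have cc : 0 < c1 / 2 * c by side.
exists (K1 / (c1 / 2 * c)); first by side.
move=> t k /andP[t0 td].
have t2 : 0 < t ^+ 2 by side.
(* Accuracy 1 bounds the gradients [g N] independently of [t]; accuracy t^2 compensates the factor
   4/t^2 of [qj_err]. *)
have e0 : 0 < Num.min 1 (t ^+ 2) by rewrite lt_min ltr01.
have [N /(_ N (leqnn N)) hN] := hsol_cvg sol e0.
have hN1 : (\int[mu]_(x in cube x0 r) (enorm (g N x - X x) ^+ 2)%:E <= 1%:E)%E.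
 by apply: le_trans hN _; rewrite lee_fin ge_min lexx.
have hN2 : (\int[mu]_(x in cube x0 r) (enorm (g N x - X x) ^+ 2)%:E <= (t ^+ 2)%:E)%E.
 by apply: le_trans hN _; rewrite lee_fin ge_min lexx orbT.
have did (u : R) : is_derive u 1 (fun u : R => u) ((fun=> 1) u) by exact: is_derive_id.
have sdt : s + d + t <= r by apply: le_trans sdr; rewrite -addrA lerD2l; lra.
have idb (u : R) : `|u| <= `|u| * (fun=> 1) u by rewrite mulr1.
have := @cacc (fun u => u) (fun=> 1) (cutoff s d) (dcutoff s d) (s + d) t (b k) N did
 (@cont_cst R R R 1) (fun=> ler01) idb (cutoff_C1 s d) (cutoff_csupp s0 d0) t0 (b1 k) sdt _ erefl.
set w := dq t (b k) (v N); set q := dqV t (b k) X; set qj := dqV t (b k) (g N).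
have [mv mg] := mC1 (hsol_C1 sol N).
have mq : mble q by side.
have mqj : mble qj by side.
have meq := menorm2 mq.
have mw : mble w.
 by side.
have md : mble (fun x => enorm (qj x - q x) ^+ 2).
 by side.
have mS := mSdq t (b k).
have [mc md'] := mC1 (cutoff_C1 s d).
have Sb x : c <= Sdq t (b k) x <= C by exact: sgb.
have S0 x : 0 <= Sdq t (b k) x by have /andP[h _] := Sb x; exact: le_trans (ltW c0) h.
move=> cut.
have low : (\int[mu]_(x in cube x0 s) (c1 / 2 * c * enorm (q x) ^+ 2)%:E <=
  \int[mu]_x (c1 / 2 * (cutoff s d x ^+ 2 * (fun=> 1) (w x) * Sdq t (b k) x * enorm (q x) ^+ 2))%:E)%E.
 have mL : mble (fun x => c1 / 2 * (cutoff s d x ^+ 2 * (fun=> 1) (w x) * Sdq t (b k) x * enorm (q x) ^+ 2)).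
  apply: measurable_funM => //; apply: measurable_funM => //; apply: measurable_funM => //.
  by side.
 have L0' x : 0 <= c1 / 2 * (cutoff s d x ^+ 2 * (fun=> 1) (w x) * Sdq t (b k) x * enorm (q x) ^+ 2).
  apply: mulr_ge0; first by side.
  by side.
 apply: (via (\int[mu]_(x in cube x0 s) (c1 / 2 * (cutoff s d x ^+ 2 * (fun=> 1) (w x) * Sdq t (b k) x * enorm (q x) ^+ 2))%:E)%E).
  apply: int_le => //; first by side.
  - by side.
  - move=> x xs; rewrite (cutoff1 d0 xs) expr1n !mul1r -mulrA ler_wpM2l//.
    by side.
   by rewrite ler_wpM2r ?sqr_ge0//; have /andP[] := Sb x.
 by apply: int_sub => // x _; exact: L0'.
have up : (\int[mu]_x (4 * L ^+ 2 / c1 * (enorm (dcutoff s d x) ^+ 2 * Sdq t (b k) x * w x ^+ 2 * (fun=> 1) (w x)) +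
   L ^+ 2 / c1 * (cutoff s d x ^+ 2 * (fun=> 1) (w x) * Sdq t (b k) x * enorm (qj x - q x) ^+ 2))%:E <= K1%:E)%E.
 have z x : ~ cube x0 (s + d) x -> 4 * L ^+ 2 / c1 * (enorm (dcutoff s d x) ^+ 2 * Sdq t (b k) x * w x ^+ 2 * (fun=> 1) (w x)) +
   L ^+ 2 / c1 * (cutoff s d x ^+ 2 * (fun=> 1) (w x) * Sdq t (b k) x * enorm (qj x - q x) ^+ 2) = 0.
  by move=> /(cutoff_csupp s0 d0)[-> ->]; rewrite enorm0 expr0n !mul0r !mulr0 addr0.
 have mw2 : mble (fun x => w x ^+ 2) by side.
 rewrite -(int_supp mu z).
 apply: (via (\int[mu]_(x in cube x0 (s + d)) (4 * Q * (B * C) * w x ^+ 2 + Q * C * enorm (qj x - q x) ^+ 2)%:E)%E).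
  apply: int_le => //.
  - apply: measurable_funD; apply: measurable_funM => //; apply: measurable_funM => //.
    by side.
   by side.
  - by side.
  - move=> x _; apply: addr_ge0; apply: mulr_ge0.
   + by side.
   + by side.
   + exact: Q0.
   + by side.
  - move=> x _; have /andP[_ SC] := Sb x; rewrite !mulr1; apply: lerD.
    rewrite -(mulrA 4) -[leRHS]mulrA ler_wpM2l//; first by side.
    rewrite ler_wpM2r ?sqr_ge0//; apply: ler_pM => //; rewrite ?sqr_ge0//.
    exact: dcutoff_le.
   rewrite -[leRHS]mulrA ler_wpM2l// ler_wpM2r ?sqr_ge0//.
   rewrite -[leRHS]mul1r; apply: ler_pM => //; first exact: sqr_ge0.
   by rewrite expr_le1// ?prof_le1// prof_ge0.
 rewrite int_D//; last 4 first.
 - by side.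
 - by side.
 - by side.
 - by side.
 rewrite int_Z//; last by side.
 rewrite int_Z//; last 2 first.
 - by side.
 - by side.
 rewrite /K1 EFinD; apply: leeD.
  rewrite [leRHS]EFinM; apply: lee_wpmul2l; first by side.
  apply: le_trans (wj_L2 (s + d) k N t0) _; exact: hK.
 rewrite [leRHS]EFinM; apply: lee_wpmul2l; first by side.
 apply: le_trans (qj_err (s + d) N t0 (b1 k)) _.
 have p4 : (0 <= (4 / t ^+ 2)%:E)%E by side.
 have h1 : (\int[mu]_(x in cube x0 (s + d + t)) (enorm (g N x - X x) ^+ 2)%:E <= (t ^+ 2)%:E)%E.
  apply: le_trans hN2; apply: int_sub => //; first exact: sub_cube.
   by side.
  by side.
 apply: le_trans (lee_wpmul2l p4 h1) _.
 by rewrite -EFinM lee_fin divfK// gt_eqF.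
have := le_trans low (le_trans cut up).
rewrite int_Z//; last 2 first.
- by side.
- by side.
by move=> h; rewrite mulrC EFinM lee_pdivlMl.
Qed.

End caccioppoli.

Ltac msteps := repeat first
 [ assumption
 | exact: measurable_cst
 | apply: measurable_funD | apply: measurable_funB | apply: measurable_funM
 | apply: measurable_funX | apply: menorm | apply: measurable_funN
 | apply: maddV | apply: moppV ].

(** * Pointwise bounds at a fixed level *)

Section prof_family.
Context {R : realType} {n : nat}.
Local Notation E := 'rV[R]_n.

Lemma prof_comp_C1 (w : 'I_n -> E -> R) (q : 'I_n -> E -> E) (k d : R) :
 (forall i, C1 (w i) (q i)) ->
 C1 (fun x => prof k d (\row_i w i x : E))
   (fun x => \sum_i dprof k d (\row_i w i x : E) ord0 i *: q i x).
Proof.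
move=> wq.
have pc (s : R) i : C1 (fun x : E => pos2 ((s * w i x - k) / d))
  (fun x : E => (dpos2 ((s * w i x - k) / d) / d * s) *: q i x).
 have h := C1_comp (C1_scale d^-1 (C1_sub (C1_scale s (wq i)) (C1_cst k))) is_derive_pos2 cont_dpos2.
 move: h; congr C1; apply/funext => x; rewrite ?(mulrC d^-1)//.
 by rewrite /cst subr0 !scalerA -!mulrA.
pose ds (y : E) (i : 'I_n) := dpos2 ((y ord0 i - k) / d) / d - dpos2 ((- y ord0 i - k) / d) / d.
have sc : C1 (fun x => prof_sum k d (\row_i w i x : E)) (fun x => \sum_i ds (\row_i w i x) i *: q i x).
 have := @C1_sum R n _ (index_enum 'I_n) (fun i x => pos2 ((w i x - k) / d) + pos2 ((- w i x - k) / d)) (fun i x => ds (\row_i w i x) i *: q i x).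
 move=> /(_ _)[|c1' c2 c3].
  move=> i; have := C1_add (pc 1 i) (pc (-1) i).
  congr C1; apply/funext => x; rewrite !mul1r !mulN1r//.
  by rewrite mulr1 mulrN1 -scalerDl /ds !mxE.
 have eqF : (fun x => prof_sum k d (\row_i w i x : E)) = (fun x => \sum_i (pos2 ((w i x - k) / d) + pos2 ((- w i x - k) / d))).
  by apply/funext => x; apply: eq_bigr => i _; rewrite !mxE.
 by rewrite eqF; split.
have := C1_comp (C1_sub (C1_cst 1) sc) is_derive_pos2 cont_dpos2.
congr C1; apply/funext => x; rewrite /cst sub0r scalerN scaler_sumr -sumrN.
apply: eq_bigr => i _; rewrite scalerA -scaleNr; congr (_ *: _).
rewrite /dprof !mxE; congr (- (_ * _)).
rewrite /ds /dprof_sum summxE (bigD1 i)//= !mxE !eqxx mulr1 big1 ?addr0// => j ji.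
by rewrite !mxE [i == j]eq_sym (negbTE ji) andbF mulr0.
Qed.

Lemma dprof_enorm k d (y : E) : 0 < d -> enorm (dprof k d y) <= n%:R * (4 / d).
Proof.
move=> d0; have p : 0 <= 4 / d by side.
apply: le_trans (enorm_le_sum _) _.
have -> : n%:R * (4 / d) = \sum_(i < n) (4 / d) by rewrite sumr_const card_ord mulr_natl.
apply: ler_sum => i _; apply: le_trans (dprof_coord _ _ _ d0) _.
by rewrite ler_piMr//; case: ifP.
Qed.

Lemma prof_lip k d (x y : E) : 0 < d -> `|prof k d x - prof k d y| <= n%:R * (4 / d) * enorm (x - y).
Proof.
move=> d0; have [s _] := C1_mvt y (x - y) (@prof_C1 R n k d).
rewrite (addrC y) subrK => ->; apply: le_trans (dot_norm_le _ _) _.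
by rewrite ler_wpM2r ?enorm_ge0//; exact: dprof_enorm.
Qed.

End prof_family.

Section gain_pointwise.
Context {R : realType} {n : nat}.
Local Notation E := 'rV[R]_n.
Variables (m M c C K3 : R) (sg : R -> R).
Hypotheses (hs : slope m M sg) (c0 : 0 < c).
Hypothesis sgb : forall t, c <= sg t <= C.
Hypothesis he : forall s t, 0 <= s -> 0 <= t -> s <= 3 * t -> s ^+ 2 * sg s <= K3 * (t ^+ 2 * sg t).

Let en (X : E) := enorm X ^+ 2 * sg (enorm X).
Definition ind (k : R) (X : E) : R := if k < `|X| then 1 else 0.

Lemma ind_itv k X : 0 <= ind k X <= 1.
Proof. by rewrite /ind; case: ifP => _; rewrite lexx ler01. Qed.

(** The left side lives on |w| > 2k. If [w] is close to the component of X, that component exceeds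
    k, and if moreover |Xh| <= 2|X|, then [he] bounds S |X|^2 by K3 e(X). Where [w] or [Xh] is far
    from X, the squared distance dominates instead. *)
Lemma rhs_pointwise (k : R) (X Xh : E) (i : 'I_n) (w : R) : 0 < k ->
 sg (enorm Xh + enorm X) * w ^+ 2 * dhinge (2 * k) w <=
 4 * K3 * (en X * ind k X) + 4 * C * ((w - X ord0 i) ^+ 2 + enorm (Xh - X) ^+ 2).
Proof.
move=> k0; have k2 : 0 < 2 * k by lra.
have [/andP[d0 d1] _ dz _] := dhinge_prop w k2.
have [x0 xh0] := (enorm_ge0 X, enorm_ge0 Xh).
set S := sg _; have /andP[S1 S2] : c <= S <= C by exact: sgb.
have S0 : 0 <= S by exact: le_trans (ltW c0) S1.
have C0 : 0 <= C by side.
have eX : 0 <= en X by side.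
have K30 : 0 <= K3 * en X.
 by apply: le_trans (he x0 x0 _); [exact: eX|lra].
have /andP[i0 i1] := ind_itv k X.
have r1 : 0 <= 4 * K3 * (en X * ind k X) by rewrite -mulrA mulr_ge0// mulrA mulr_ge0.
have r2 : 0 <= (w - X ord0 i) ^+ 2 by side.
have r3 : 0 <= enorm (Xh - X) ^+ 2 by side.
have Cr2 : 0 <= C * (w - X ord0 i) ^+ 2 by side.
have Cr3 : 0 <= C * enorm (Xh - X) ^+ 2 by side.
have [wk|wk] := leP `|w| (2 * k).
 by rewrite dz// mulr0; lra.
have b1 : S * w ^+ 2 * dhinge (2 * k) w <= S * w ^+ 2.
 by rewrite ler_piMr// mulr_ge0// sqr_ge0.
apply: le_trans b1 _.
have w2 : w ^+ 2 = `|w| ^+ 2 by rewrite real_normK ?num_real.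
have wx2 : (w - X ord0 i) ^+ 2 = `|w - X ord0 i| ^+ 2 by rewrite real_normK ?num_real.
have w0 := normr_ge0 w.
have [hw|hw] := leP `|w| (2 * `|w - X ord0 i|).
 have q1 : w ^+ 2 <= 4 * (w - X ord0 i) ^+ 2 by rewrite w2 wx2; nra.
 have q2 : S * w ^+ 2 <= C * (4 * (w - X ord0 i) ^+ 2).
  by apply: ler_pM => //; exact: sqr_ge0.
 lra.
have Xi : `|w| <= 2 * `|X ord0 i|.
 have := ler_normD (w - X ord0 i) (X ord0 i); rewrite subrK; lra.
have kX : k < `|X| by apply: lt_le_trans (coord_le_norm X i); lra.
have xi := coord_le_enorm X i.
have q1 : w ^+ 2 <= 4 * enorm X ^+ 2 by rewrite w2; have := normr_ge0 (X ord0 i); nra.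
have q2 : S * w ^+ 2 <= S * (4 * enorm X ^+ 2) by side.
apply: le_trans q2 _.
have -> : ind k X = 1 by rewrite /ind kX.
rewrite mulr1.
have [hh|hh] := leP (enorm Xh) (2 * enorm X).
 have s1 : 0 <= enorm Xh + enorm X by side.
 have := he s1 x0 (_ : enorm Xh + enorm X <= 3 * enorm X); rewrite -/S -/(en X) => /(_ ltac:(lra)) h.
 have h2 : S * enorm X ^+ 2 <= (enorm Xh + enorm X) ^+ 2 * S.
  by rewrite mulrC ler_wpM2r// lerXn2r ?nnegrE// lerDr.
 lra.
have := enorm_sub_lt Xh X => h.
have q3 : enorm X ^+ 2 <= enorm (Xh - X) ^+ 2 by rewrite lerXn2r ?nnegrE ?enorm_ge0//; lra.
have q4 : S * enorm X ^+ 2 <= C * enorm (Xh - X) ^+ 2.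
 by apply: ler_pM => //; exact: sqr_ge0.
have : 0 <= K3 * en X by [].
lra.
Qed.

(** The main case is that [y] and [Xh] lie within k of X. Then |q|/k <= 1/d + d |q|^2/k^2; |X| > k
    allows the factor e(X)/e(k) in the first term, and the second is a multiple of S |q|^2/e(k). In
    the other case k^2 is below the sum of squared distances, and |q|/k goes into the terms with
    [dl]. *)
Lemma lhs_pointwise (k d dl : R) (X Xh q qj y : E) (i : 'I_n) :
 0 < k -> 0 < d -> 0 < dl -> 4 * k <= `|y ord0 i| -> `|y| <= 8 * k ->
 k^-1 * enorm qj <=
 d^-1 * ((k ^+ 2 * sg k)^-1 * (en X * ind k X)) +
 (16 * n%:R + 3) ^+ 2 * (d / (k ^+ 2 * sg k)) *
   (dhinge (2 * k) (y ord0 i) * sg (enorm Xh + enorm X) * enorm q ^+ 2) +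
 (dl * enorm q ^+ 2 + (4 * dl * k ^+ 4)^-1 * (enorm (y - X) ^+ 2 + enorm (Xh - X) ^+ 2) +
  (dl + (4 * dl * k ^+ 2)^-1 * enorm (qj - q) ^+ 2)).
Proof.
move=> k0 d0 dl0 yk yk8; have k2 : 0 < 2 * k by lra.
have [_ _ _ dh1] := dhinge_prop (y ord0 i) k2.
have -> : dhinge (2 * k) (y ord0 i) = 1 by apply: dh1; lra.
rewrite mul1r.
set S := sg (enorm Xh + enorm X).
have /andP[S1 _] : c <= S <= C by exact: sgb.
have S0 : 0 < S by side.
have /andP[sk1 _] := sgb k; have sk : 0 < sg k by side.
pose ek := k ^+ 2 * sg k; have ek0 : 0 < ek by side.
rewrite -/ek.
have young (a : R) : 0 <= a -> k^-1 * a <= dl + (4 * dl * k ^+ 2)^-1 * a ^+ 2.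
 move=> a0; have : 0 <= (4 * dl * k ^+ 2)^-1 * (2 * dl * k - a) ^+ 2.
  by side.
 have -> : (4 * dl * k ^+ 2)^-1 * (2 * dl * k - a) ^+ 2 = dl + (4 * dl * k ^+ 2)^-1 * a ^+ 2 - k^-1 * a.
  by field; rewrite !gt_eqF.
 by rewrite subr_ge0.
have ki : 0 < k^-1 by side.
have tri : k^-1 * enorm qj <= k^-1 * enorm q + k^-1 * enorm (qj - q).
 by rewrite -mulrDr ler_pM2l//; have := enormD q (qj - q); rewrite (addrC q) subrK.
have y1 := young _ (enorm_ge0 (qj - q)).
suff main : k^-1 * enorm q <= d^-1 * (ek^-1 * (en X * ind k X)) +
  (16 * n%:R + 3) ^+ 2 * (d / ek) * (S * enorm q ^+ 2) +
  (dl * enorm q ^+ 2 + (4 * dl * k ^+ 4)^-1 * (enorm (y - X) ^+ 2 + enorm (Xh - X) ^+ 2)).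
 by rewrite [leRHS]addrA; exact: le_trans tri (lerD main y1).
have q0 := enorm_ge0 q; have x0 := enorm_ge0 X; have xh0 := enorm_ge0 Xh.
have n0 : 0 <= n%:R :> R by side.
have eX : 0 <= en X by side.
have /andP[i0 _] := ind_itv k X.
have p1 : 0 <= d^-1 * (ek^-1 * (en X * ind k X)).
 by side.
have p2 : 0 <= (16 * n%:R + 3) ^+ 2 * (d / ek) * (S * enorm q ^+ 2).
 apply: mulr_ge0; last by side.
 by side.
have p3 : 0 <= dl * enorm q ^+ 2 by side.
have k4 : 0 < 4 * dl * k ^+ 4 by side.
have p4 : 0 <= (4 * dl * k ^+ 4)^-1 * (enorm (y - X) ^+ 2 + enorm (Xh - X) ^+ 2).
 by side.
have [good|/negP bad] := boolP ((enorm (y - X) <= k) && (enorm (Xh - X) <= k)); last first.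
 have b : k ^+ 2 <= enorm (y - X) ^+ 2 + enorm (Xh - X) ^+ 2.
  have := enorm_ge0 (y - X); have := enorm_ge0 (Xh - X) => a1 a2.
  have [h1|h1] := leP (enorm (y - X)) k; last by nra.
  have [h2|h2] := leP (enorm (Xh - X)) k; last by nra.
  by exfalso; apply: bad; rewrite h1 h2.
 have h : k^-1 * enorm q <= dl * enorm q ^+ 2 + (4 * dl * k ^+ 4)^-1 * k ^+ 2.
  have : 0 <= (4 * dl)^-1 * (2 * dl * enorm q - k^-1) ^+ 2.
   by side.
  have -> : (4 * dl)^-1 * (2 * dl * enorm q - k^-1) ^+ 2 = dl * enorm q ^+ 2 + (4 * dl * k ^+ 4)^-1 * k ^+ 2 - k^-1 * enorm q.
   by field; rewrite !gt_eqF.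
  by rewrite subr_ge0.
 have k4i : 0 <= (4 * dl * k ^+ 4)^-1 by side.
 have := ler_wpM2l k4i b; lra.
case/andP: good => g1 g2.
have yE : enorm y <= n%:R * (8 * k).
 by apply: le_trans (enorm_le_norm y) _; rewrite ler_wpM2l.
have Xi : `|X ord0 i| >= 3 * k.
 have := coord_le_enorm (y - X) i; rewrite !mxE => h.
 have := ler_normD (y ord0 i - X ord0 i) (X ord0 i); rewrite subrK; lra.
have kX : k < `|X| by apply: lt_le_trans (coord_le_norm X i); lra.
have kXe : k <= enorm X by apply: le_trans (ltW kX) (norm_le_enorm X).
have -> : ind k X = 1 by rewrite /ind kX.
rewrite mulr1.
have ekX : ek <= en X by exact: e_mono hs (ltW k0) kXe.
have d1 : d^-1 <= d^-1 * (ek^-1 * en X).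
 by rewrite ler_pMr ?invr_gt0// mulrC ler_pdivlMr// mul1r.
(* The argument of [sg] is comparable to k: |X| <= 8nk + k and |Xh| <= |X| + k give the constant 16
   n + 3. *)
pose tau := enorm Xh + enorm X.
have tk : k <= tau by rewrite /tau; lra.
have Xu : enorm X <= n%:R * (8 * k) + k.
 by have := enormD (X - y) y; rewrite subrK enormB; lra.
have Xhu : enorm Xh <= enorm X + k by have := enormD (Xh - X) X; rewrite subrK; lra.
have tu : tau <= (16 * n%:R + 3) * k by rewrite /tau; lra.
have es : ek <= tau ^+ 2 * S by exact: e_mono hs (ltW k0) tk.
have N0 : 0 <= 16 * n%:R + 3 :> R by lra.
have es2 : ek <= (16 * n%:R + 3) ^+ 2 * k ^+ 2 * S.
 apply: le_trans es _; rewrite ler_wpM2r ?(ltW S0)// -exprMn lerXn2r ?nnegrE//.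
  by side.
 by side.
have k2i : 0 < k ^+ 2 by side.
have d2 : d * (k^-1 * enorm q) ^+ 2 <= (16 * n%:R + 3) ^+ 2 * (d / ek) * (S * enorm q ^+ 2).
 have : d * enorm q ^+ 2 / (k ^+ 2 * ek) * ek <= d * enorm q ^+ 2 / (k ^+ 2 * ek) * ((16 * n%:R + 3) ^+ 2 * k ^+ 2 * S).
  by side.
 have -> : d * enorm q ^+ 2 / (k ^+ 2 * ek) * ek = d * (k^-1 * enorm q) ^+ 2 by field; rewrite !gt_eqF.
 have -> // : d * enorm q ^+ 2 / (k ^+ 2 * ek) * ((16 * n%:R + 3) ^+ 2 * k ^+ 2 * S) = (16 * n%:R + 3) ^+ 2 * (d / ek) * (S * enorm q ^+ 2) by field; rewrite !gt_eqF.
have d3 : k^-1 * enorm q <= d^-1 + d * (k^-1 * enorm q) ^+ 2.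
 set u := k^-1 * enorm q.
 have : 0 <= d^-1 * ((d * u - 2^-1) ^+ 2 + 3 / 4) by side.
 have -> : d^-1 * ((d * u - 2^-1) ^+ 2 + 3 / 4) = d^-1 + d * u ^+ 2 - u by field; rewrite gt_eqF.
 by rewrite subr_ge0.
move: p3 p4 d1 d2 d3; lra.
Qed.

End gain_pointwise.

Section int_le_lin.
Context d (T : measurableType d) (R : realType) (mu : {measure set T -> \bar R}).
Implicit Types (f g : T -> R) (D : set T).

Lemma int_D_le D f g (a b : R) : measurable D ->
 mble f -> mble g ->
 (forall x, D x -> 0 <= f x) -> (forall x, D x -> 0 <= g x) ->
 (\int[mu]_(x in D) (f x)%:E <= a%:E)%E -> (\int[mu]_(x in D) (g x)%:E <= b%:E)%E ->
 (\int[mu]_(x in D) (f x + g x)%:E <= (a + b)%:E)%E.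
Proof. by move=> mD mf mg f0 g0 fa gb; rewrite int_D// EFinD; exact: leeD. Qed.

Lemma int_Z_le D f (k a : R) : measurable D -> mble f ->
 (forall x, D x -> 0 <= f x) -> 0 <= k ->
 (\int[mu]_(x in D) (f x)%:E <= a%:E)%E ->
 (\int[mu]_(x in D) (k * f x)%:E <= (k * a)%:E)%E.
Proof. by move=> mD mf f0 k0 fa; rewrite int_Z// EFinM; apply: lee_wpmul2l. Qed.

Lemma int_sum_le D (I : finType) (F : I -> T -> R) (a : R) : measurable D ->
 (forall i, mble (F i)) -> (forall i x, D x -> 0 <= F i x) ->
 (forall i, (\int[mu]_(x in D) (F i x)%:E <= a%:E)%E) ->
 (\int[mu]_(x in D) (\sum_i F i x)%:E <= (#|I|%:R * a)%:E)%E.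
Proof.
move=> mD mF F0 Fa; rewrite int_sum//.
apply: (via (\sum_(i : I) a%:E)%E); first by apply: lee_sum => i _.
by rewrite sumEFin lee_fin sumr_const mulr_natl.
Qed.

End int_le_lin.

(** * L^1 modulus of translation of a cut-off *)

Section gain.
Context {R : realType} {n : nat}.
Local Notation E := 'rV[R]_n.
Local Notation mu := (@lebesgue_rV R n).
Variables (m M c C K3 c1 : R) (sg : R -> R).
Hypotheses (hs : slope m M sg) (c0 : 0 < c) (cs : continuous sg).
Hypothesis sgb : forall t, c <= sg t <= C.
Hypothesis he : forall s t, 0 <= s -> 0 <= t -> s <= 3 * t -> s ^+ 2 * sg s <= K3 * (t ^+ 2 * sg t).
Hypothesis c10 : 0 < c1.
Hypothesis mono : forall X Y : E,
 c1 * (sg (enorm X + enorm Y) * enorm (X - Y) ^+ 2) <= dotprod (Th sg X - Th sg Y) (X - Y).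
Variables (v : nat -> E -> R) (g : nat -> E -> E) (X : E -> E) (x0 : E) (r : R).
Hypothesis sol : hsol sg v g X x0 r.

Let b (k : 'I_n) : E := delta_mx ord0 k.
Let b1 k : `|b k| <= 1.
Proof. by apply: le_trans (norm_le_enorm _) _; rewrite enorm_delta. Qed.
Let mU s : measurable (cube x0 s). Proof. by side. Qed.
Let mX : mble X. Proof. by have [] := hsol_sq sol. Qed.
Let mXs (z : E) : mble (fun x : E => X (x + z)).
Proof. by side. Qed.
Let mv j : mble (v j). Proof. by have [] := mC1 (hsol_C1 sol j). Qed.
Let mg j : mble (g j). Proof. by have [] := mC1 (hsol_C1 sol j). Qed.
Let mw t k j : mble (dq t (b k) (v j)).
Proof.
by side.
Qed.
Let mXk k : mble (fun x => X x ord0 k). Proof. by side. Qed.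

Lemma shift_L2 (s d : R) : 0 < s -> 0 < d -> s + 2 * d <= r -> exists2 K : R, 0 <= K &
 forall t k, 0 <= t <= d ->
 (\int[mu]_(x in cube x0 s) (enorm (X (x + t *: b k) - X x) ^+ 2)%:E <= (K * t ^+ 2)%:E)%E.
Proof.
move=> s0 d0 sdr; have [K K0 hK] := dqV_L2 hs c0 cs sgb c10 mono sol s0 d0 sdr.
exists K => // t k /andP[t0 td].
have [->|tn] := eqVneq t 0.
 have -> : (\int[mu]_(x in cube x0 s) (enorm (X (x + 0 *: b k) - X x) ^+ 2)%:E = 0)%E.
  by apply: integral0_eq => x _; rewrite scale0r addr0 subrr enorm0 expr0n.
 by side.
have tp : 0 < t by rewrite lt_neqAle eq_sym tn.
have h := hK t k (_ : 0 < t <= d); rewrite tp td in h; have {}h := h isT.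
have mq : mble (dqV t (b k) X) by side.
have -> : (\int[mu]_(x in cube x0 s) (enorm (X (x + t *: b k) - X x) ^+ 2)%:E =
  \int[mu]_(x in cube x0 s) (t ^+ 2 * enorm (dqV t (b k) X x) ^+ 2)%:E)%E.
 apply: eq_integral => x _; congr EFin.
 by rewrite /dqV enormZ exprMn real_normK ?num_real// exprVn mulrA mulfV ?mul1r// expf_neq0.
rewrite mulrC; apply: int_Z_le => //; try side.
Qed.

(** The increment of [v j] is an average of [g j] over a segment of length [t]. Replacing [g j] by X
    costs [eps], and moving X back along the segment costs K t^2 by [shift_L2]. *)
Lemma wk_err (s d : R) : 0 < s -> 0 < d -> s + 2 * d <= r -> exists2 K : R, 0 <= K &
 forall t k j eps, 0 < t <= d ->
 (\int[mu]_(x in cube x0 (s + d)) (enorm (g j x - X x) ^+ 2)%:E <= eps%:E)%E ->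
 (\int[mu]_(x in cube x0 s) ((dq t (b k) (v j) x - X x ord0 k) ^+ 2)%:E <= (2 * (eps + K * t ^+ 2))%:E)%E.
Proof.
move=> s0 d0 sdr; have [K K0 hK] := shift_L2 s0 d0 sdr; exists K => // t k j eps /andP[t0 td] hj.
have t2 : 0 < t ^+ 2 by side.
have mc : mble (fun x => t * X x ord0 k) by side.
have mD : mble (fun x => g j x - X x).
 by side.
have me := menorm2 mD.
have h : (\int[mu]_(x in cube x0 s) ((v j (x + t *: b k) - v j x - t * X x ord0 k) ^+ 2)%:E <=
   (t ^+ 2 * (2 * (eps + K * t ^+ 2)))%:E)%E.
 apply: (C1_L2_diff (hsol_C1 sol j) (mU s) mc) => u /andP[u0 u1].
 have ut : 0 <= u * t <= d.
  by rewrite mulr_ge0 ?(ltW t0)//=; apply: le_trans td; rewrite ler_piMl// ltW.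
 have mes : mble (fun x : E => enorm (g j (x + (u * t) *: b k) - X (x + (u * t) *: b k)) ^+ 2).
  by side.
 have mXX : mble (fun x : E => enorm (X (x + (u * t) *: b k) - X x) ^+ 2).
  by side.
 apply: (via (\int[mu]_(x in cube x0 s) (t ^+ 2 * (2 * (enorm (g j (x + (u * t) *: b k) - X (x + (u * t) *: b k)) ^+ 2 + enorm (X (x + (u * t) *: b k) - X x) ^+ 2)))%:E)%E).
  apply: int_le => //.
  - apply: measurable_funX; apply: measurable_funB => //.
   apply: mdot; last exact: measurable_cst.
   by side.
  - by side.
  - by side.
  - move=> x _; rewrite dotZr dot_delta scalerA -mulrBr exprMn ler_wpM2l ?sqr_ge0//.
   have := coord_le_enorm (g j (x + (u * t) *: b k) - X x) k; rewrite !mxE => h1.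
   have h2 : (g j (x + (u * t) *: b k) ord0 k - X x ord0 k) ^+ 2 <= enorm (g j (x + (u * t) *: b k) - X x) ^+ 2.
    by rewrite -real_normK ?num_real// lerXn2r ?nnegrE ?enorm_ge0.
   apply: le_trans h2 _.
   have := enormD_sqr (g j (x + (u * t) *: b k) - X (x + (u * t) *: b k)) (X (x + (u * t) *: b k) - X x).
   by rewrite addrA subrK.
 have n0 (x : E) (f h : E -> R) : 0 <= f x ^+ 2 + h x ^+ 2 by side.
 apply: int_Z_le => //.
 - by side.
 - by side.
 - by side.
 apply: int_Z_le => //.
 - by side.
 - by side.
 apply: (int_D_le (mU s) mes mXX (fun x _ => sqr_ge0 _) (fun x _ => sqr_ge0 _)).
 - apply: le_trans hj; apply: (int_shift_cube_le x0 me (fun x => sqr_ge0 _)).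
  have /andP[ut0 utd] := ut; rewrite addrC lerD2l normrZ ger0_norm//.
  by apply: le_trans utd; rewrite ler_piMr.
 - apply: le_trans (hK _ k ut) _; rewrite lee_fin ler_wpM2l// lerXn2r ?nnegrE ?(ltW t0)//.
   by side.
  by rewrite ler_piMl// ltW.
have -> : (\int[mu]_(x in cube x0 s) ((dq t (b k) (v j) x - X x ord0 k) ^+ 2)%:E =
  \int[mu]_(x in cube x0 s) (t ^- 2 * (v j (x + t *: b k) - v j x - t * X x ord0 k) ^+ 2)%:E)%E.
 apply: eq_integral => x _; congr EFin; rewrite /dq -exprVn -exprMn; congr (_ ^+ 2).
 by field; rewrite gt_eqF.
have -> : 2 * (eps + K * t ^+ 2) = t ^- 2 * (t ^+ 2 * (2 * (eps + K * t ^+ 2))).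
 by rewrite [RHS]mulrA mulVf ?[RHS]mul1r// expf_neq0// gt_eqF.
have mvt : mble (fun x : E => (v j (x + t *: b k) - v j x - t * X x ord0 k) ^+ 2).
 apply: measurable_funX; apply: measurable_funB => //; apply: measurable_funB => //.
 by side.
have ti : 0 <= t ^- 2 by side.
exact: (int_Z_le (mU s) mvt (fun x _ => sqr_ge0 _) ti h).
Qed.

(** The quotients of [v j] are close to X, X is close to its translate, and the quotients of [g j]
    are close to those of X, all up to [eps]. Only the last bound [K] is not small. *)
Definition good_approx (s eps K t : R) (j : nat) (k : 'I_n) :=
 [/\ (\int[mu]_(x in cube x0 s) ((dq t (b k) (v j) x - X x ord0 k) ^+ 2)%:E <= eps%:E)%E,
   (\int[mu]_(x in cube x0 s) (enorm (X (x + t *: b k) - X x) ^+ 2)%:E <= eps%:E)%E,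
   (\int[mu]_(x in cube x0 s) (enorm (dqV t (b k) (g j) x - dqV t (b k) X x) ^+ 2)%:E <= eps%:E)%E &
   (\int[mu]_(x in cube x0 s) (enorm (dqV t (b k) X x) ^+ 2)%:E <= K%:E)%E].

Lemma approx_ex (s d : R) : 0 < s -> 0 < d -> s + 2 * d <= r -> exists2 K : R, 0 <= K &
 forall eps : R, 0 < eps -> exists t j, 0 < t <= d /\ forall k, good_approx s eps K t j k.
Proof.
move=> s0 d0 sdr.
have [K1 K10 hK1] := shift_L2 s0 d0 sdr.
have [K2 K20 hK2] := wk_err s0 d0 sdr.
have [K3' K30 hK3] := dqV_L2 hs c0 cs sgb c10 mono sol s0 d0 sdr.
exists K3' => // eps e0.
pose K := K1 + K2 + 1.
have Kp : 0 < K by side.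
(* The step comes first, making the terms in t^2 at most eps/4; the index [N] is then accurate to
   eps t^2/4, since errors of quotients are divided by t^2. *)
pose t := Num.min d (Num.min 1 (eps / (4 * K))).
have K4 : 0 < 4 * K by side.
have t0 : 0 < t by rewrite !lt_min d0 ltr01 divr_gt0.
have td : t <= d by rewrite ge_min lexx.
have t1 : t <= 1 by rewrite !ge_min lexx orbT.
have te : t * (4 * K) <= eps by rewrite -ler_pdivlMr// !ge_min lexx !orbT.
have t2 : 0 < t ^+ 2 by side.
have tt : t ^+ 2 <= t by rewrite expr2 ler_piMr// ltW.
have k1t : K1 * t ^+ 2 <= eps / 4 by rewrite /K in te; nra.
have k2t : K2 * t ^+ 2 <= eps / 4 by rewrite /K in te; nra.
have ep : 0 < Num.min (eps / 4) (eps * t ^+ 2 / 4).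
 by rewrite lt_min !divr_gt0// mulr_gt0.
have [N /(_ N (leqnn N)) hN] := hsol_cvg sol ep.
have mD : mble (fun x => enorm (g N x - X x) ^+ 2).
 by side.
have loc s' : s' <= r -> (\int[mu]_(x in cube x0 s') (enorm (g N x - X x) ^+ 2)%:E <= (Num.min (eps / 4) (eps * t ^+ 2 / 4))%:E)%E.
 move=> sr; apply: le_trans hN; apply: int_sub => //; first exact: sub_cube.
 by side.
have sd : s + d <= r by apply: le_trans sdr; rewrite lerD2l; lra.
have td' : 0 < t <= d by side.
exists t, N; split => // k; split.
- apply: le_trans (hK2 t k N (eps / 4) td' _) _; last by rewrite lee_fin; lra.
 by apply: le_trans (loc _ sd) _; rewrite lee_fin ge_min lexx.
- apply: le_trans (hK1 t k _) _; first by side.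
 by rewrite lee_fin; lra.
- apply: le_trans (qj_err sol s N t0 (b1 k)) _.
 have st : s + t <= r by apply: le_trans sd; rewrite lerD2l.
 have p4 : (0 <= (4 / t ^+ 2)%:E)%E by side.
 apply: le_trans (lee_wpmul2l p4 (loc _ st)) _; rewrite -EFinM lee_fin.
 apply: (via (4 / t ^+ 2 * (eps * t ^+ 2 / 4))).
  by rewrite ler_wpM2l ?divr_ge0 ?(ltW t2)// ge_min lexx orbT.
 by apply: eqW; field; rewrite gt_eqF.
- exact: hK3.
Qed.

Let en (Y : E) := enorm Y ^+ 2 * sg (enorm Y).
Let Q := (2 * (1 + M)) ^+ 2 / c1.

Lemma measurable_ind (k : R) : mble (fun x => ind k (X x)).
Proof.
have oU : open [set y : E | k < `|y|].
 have := @norm_continuous R E; rewrite (_ : [set y : E | _] = (fun y : E => `|y|) @^-1` [set u | k < u])//.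
 by move=> cn; apply: open_comp; [move=> y _; exact: cn|exact: open_gt].
have mS : measurable (X @^-1` [set y : E | k < `|y|]).
 by rewrite -[X in measurable X]setTI; apply: mX => //; exact: mopen.
rewrite (_ : (fun x => _) = \1_(X @^-1` [set y : E | k < `|y|])); first exact: mindicT.
apply/funext => x; rewrite indicE /ind; case: ifP => h.
 by rewrite mem_set.
by rewrite memNset//= h.
Qed.

Lemma men : mble (fun x => en (X x)).
Proof.
apply: (@measurable_e R n sg X) => //; apply: contM => //; exact: cont_id.
Qed.

(** The truncation [hinge (2 * k)] makes the right side of Caccioppoli's inequality see, by
    [rhs_pointwise], only the energy of X above level k, up to multiples of [eps]. *)
Lemma cacc_k (s d k eps K a t : R) (j : nat) (i : 'I_n) : 0 < s -> 0 < d -> 0 < k ->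
 s + d + d <= r -> 0 < t <= d -> good_approx (s + d) eps K t j i ->
 (\int[mu]_(x in cube x0 (s + d)) (en (X x) * ind k (X x))%:E <= a%:E)%E ->
 (\int[mu]_(x in cube x0 s) (dhinge (2 * k) (dq t (b i) (v j) x) * Sdq sg X t (b i) x *
   enorm (dqV t (b i) X x) ^+ 2)%:E <=
  (2 / c1 * (4 * Q * (n%:R * (4 / d)) ^+ 2 * (4 * K3 * a + 4 * C * (eps + eps)) + Q * C * eps))%:E)%E.
Proof.
move=> s0 d0 k0 sdr /andP[t0 td] [g1 g2 g3 _] ha.
have k2 : 0 < 2 * k by lra.
have dp u := dhinge_prop u k2.
have dG0 u : 0 <= dhinge (2 * k) u by have [/andP[]] := dp u.
have dG1 u : dhinge (2 * k) u <= 1 by have [/andP[]] := dp u.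
have GdG u : `|hinge (2 * k) u| <= `|u| * dhinge (2 * k) u by have [] := dp u.
have sdt : s + d + t <= r by apply: le_trans sdr; rewrite lerD2l.
have := cacc hs c0 cs sgb c10 mono sol (j := j) (is_derive_hinge (2 * k)) (@cont_dhinge R (2 * k)) dG0 GdG
  (cutoff_C1 x0 s d) (cutoff_csupp s0 d0) t0 (b1 i) sdt erefl.
set w := dq t (b i) (v j); set q := dqV t (b i) X; set qj := dqV t (b i) (g j); set S := Sdq sg X t (b i).
have mw' : mble w by side.
have mq : mble q by side.
have mqj : mble qj by side.
have meq := menorm2 mq.
have md : mble (fun x => enorm (qj x - q x) ^+ 2).
 by side.
have mS : mble S by exact: (mSdq cs sol t (b i)).
have [mc md'] := mC1 (cutoff_C1 x0 s d).
have mdG : mble (fun x => dhinge (2 * k) (w x)).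
 apply: measurableT_comp => //; apply: continuous_measurable_fun; exact: cont_dhinge.
have Sb x : c <= S x <= C by exact: sgb.
have S0 x : 0 <= S x by have /andP[h _] := Sb x; exact: le_trans (ltW c0) h.
have C0 : 0 <= C by have /andP[_ h] := Sb 0; exact: le_trans (S0 0) h.
have Q0 : 0 <= Q by side.
have Qe : 4 * (2 * (1 + M)) ^+ 2 / c1 = 4 * Q by rewrite -mulrA.
rewrite Qe -/Q.
pose B := (n%:R * (4 / d)) ^+ 2.
have B0 : 0 <= B by side.
move=> cut.
have mdSq : mble (fun x => dhinge (2 * k) (w x) * S x * enorm (q x) ^+ 2) by msteps.
have low : (\int[mu]_(x in cube x0 s) (c1 / 2 * (dhinge (2 * k) (w x) * S x * enorm (q x) ^+ 2))%:E <=
  \int[mu]_x (c1 / 2 * (cutoff x0 s d x ^+ 2 * dhinge (2 * k) (w x) * S x * enorm (q x) ^+ 2))%:E)%E.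
 have mL : mble (fun x => c1 / 2 * (cutoff x0 s d x ^+ 2 * dhinge (2 * k) (w x) * S x * enorm (q x) ^+ 2)) by msteps.
 have cc0 : 0 <= c1 / 2 by side.
 have L0' x : 0 <= c1 / 2 * (cutoff x0 s d x ^+ 2 * dhinge (2 * k) (w x) * S x * enorm (q x) ^+ 2).
  apply: mulr_ge0 => //; apply: mulr_ge0; last exact: sqr_ge0.
  by side.
 apply: (via (\int[mu]_(x in cube x0 s) (c1 / 2 * (cutoff x0 s d x ^+ 2 * dhinge (2 * k) (w x) * S x * enorm (q x) ^+ 2))%:E)%E).
  apply: int_le => //; first by side.
  - move=> x _; apply: mulr_ge0 => //; apply: mulr_ge0; last exact: sqr_ge0.
   by side.
  - by move=> x xs; rewrite (cutoff1 d0 xs) expr1n mul1r.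
 by apply: int_sub => // x _; exact: L0'.
have up : (\int[mu]_x (4 * Q * (enorm (dcutoff x0 s d x) ^+ 2 * S x * w x ^+ 2 * dhinge (2 * k) (w x)) +
   Q * (cutoff x0 s d x ^+ 2 * dhinge (2 * k) (w x) * S x * enorm (qj x - q x) ^+ 2))%:E <=
   (4 * Q * B * (4 * K3 * a + 4 * C * (eps + eps)) + Q * C * eps)%:E)%E.
 have z x : ~ cube x0 (s + d) x -> 4 * Q * (enorm (dcutoff x0 s d x) ^+ 2 * S x * w x ^+ 2 * dhinge (2 * k) (w x)) +
   Q * (cutoff x0 s d x ^+ 2 * dhinge (2 * k) (w x) * S x * enorm (qj x - q x) ^+ 2) = 0.
  by move=> /(cutoff_csupp s0 d0)[-> ->]; rewrite enorm0 expr0n !mul0r !mulr0 addr0.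
 rewrite -(int_supp mu z).
 have me := men; have mi := measurable_ind k.
 have mwX : mble (fun x => (w x - X x ord0 i) ^+ 2) by side.
 have mXX : mble (fun x : E => enorm (X (x + t *: b i) - X x) ^+ 2).
  by side.
 have mei : mble (fun x => en (X x) * ind k (X x)) by side.
 have K30 : 0 <= K3 * en (X x0).
  apply: le_trans (he (enorm_ge0 (X x0)) (enorm_ge0 (X x0)) _); first exact: e_ge0 hs (enorm_ge0 _).
  by have := enorm_ge0 (X x0); lra.
 have K3p : 0 <= K3.
  have := he ler01 ler01 (_ : 1 <= 3 * 1); rewrite expr1n !mul1r mulr1 => /(_ ltac:(lra)).
  by have /andP[h1 h2] := sgb 1; have c0' := c0; nra.
 have ei0 x : 0 <= en (X x) * ind k (X x).
  by apply: mulr_ge0; [exact: e_ge0 hs (enorm_ge0 _)|have /andP[] := ind_itv k (X x)].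
 have QB : 0 <= 4 * Q * B by side.
 apply: (via (\int[mu]_(x in cube x0 (s + d)) (4 * Q * B * (4 * K3 * (en (X x) * ind k (X x)) + 4 * C * ((w x - X x ord0 i) ^+ 2 + enorm (X (x + t *: b i) - X x) ^+ 2)) + Q * C * enorm (qj x - q x) ^+ 2)%:E)%E).
  apply: int_le => //.
  - by side.
  - by msteps.
  - move=> x _; apply: addr_ge0; apply: mulr_ge0 => //; first by side.
   + apply: mulr_ge0 => //; apply: mulr_ge0; last exact: sqr_ge0.
    by side.
   + apply: mulr_ge0; last exact: sqr_ge0.
    by side.
  - move=> x _; have /andP[_ SC] := Sb x; apply: lerD.
    rewrite -[leRHS]mulrA ler_wpM2l//; first by side.
    have h := rhs_pointwise hs c0 sgb he (X x) (X (x + t *: b i)) i (w x) k0.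
    rewrite -/(en (X x)) -/(Sdq sg X t (b i) x) -/(S x) in h.
    have -> : enorm (dcutoff x0 s d x) ^+ 2 * S x * w x ^+ 2 * dhinge (2 * k) (w x) =
      enorm (dcutoff x0 s d x) ^+ 2 * (S x * w x ^+ 2 * dhinge (2 * k) (w x)) by rewrite !mulrA.
    apply: ler_pM; [exact: sqr_ge0| |exact: dcutoff_le|exact: h].
    by side.
   rewrite -[leRHS]mulrA ler_wpM2l// ler_wpM2r ?sqr_ge0//.
   rewrite -[leRHS]mul1r; apply: ler_pM => //.
    by side.
   rewrite -[leRHS]mul1r; apply: ler_pM => //; first exact: sqr_ge0.
   by rewrite expr_le1// ?prof_le1// prof_ge0.
 have s1 x : 0 <= (w x - X x ord0 i) ^+ 2 + enorm (X (x + t *: b i) - X x) ^+ 2 by side.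
 have K34 : 0 <= 4 * K3 by side.
 have C4 : 0 <= 4 * C by side.
 have s2 x : 0 <= 4 * K3 * (en (X x) * ind k (X x)) + 4 * C * ((w x - X x ord0 i) ^+ 2 + enorm (X (x + t *: b i) - X x) ^+ 2).
  by side.
 have QC : 0 <= Q * C by side.
 apply: int_D_le => //; [by msteps|by msteps|by move=> x _; exact: mulr_ge0|by move=> x _; rewrite mulr_ge0 ?sqr_ge0| |].
  apply: int_Z_le => //; first by msteps.
  apply: int_D_le => //; [by msteps|by msteps|by move=> x _; exact: mulr_ge0|by move=> x _; exact: mulr_ge0| |].
   exact: int_Z_le.
  apply: int_Z_le => //; first by msteps.
  by apply: int_D_le => //; move=> x _; exact: sqr_ge0.
 exact: (int_Z_le (mU _) md (fun x _ => sqr_ge0 _) QC g3).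
have := le_trans low (le_trans cut up).
rewrite int_Z//; last 2 first.
- by side.
- by side.
have cc0 : 0 < c1 / 2 by side.
rewrite -/B => h; rewrite EFinM.
have -> : 2 / c1 = (c1 / 2)^-1 by rewrite invf_div.
by rewrite lee_pdivlMl.
Qed.

Let dqs t j (x : E) : E := \row_i dq t (b i) (v j) x.
Let ek k := k ^+ 2 * sg k.

(** The ellipticity bounds [c] and [C] of the truncated nonlinearity are absent; [C] enters only
    through [Perr], multiplied by [eps]. This is why the decay estimate survives the removal of the
    truncation. *)
Definition Kgain := 1 + (16 * n%:R + 3) ^+ 2 * (2 / c1 * (4 * Q * (n%:R * 4) ^+ 2 * (4 * K3))).

Let K3p : 0 <= K3.
Proof.
have := he ler01 ler01 (_ : 1 <= 3 * 1); rewrite expr1n !mul1r mulr1 => /(_ ltac:(lra)).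
by have /andP[h1 h2] := sgb 1; have c0' := c0; nra.
Qed.
Let C0 : 0 <= C.
Proof. by have /andP[h1 h2] := sgb 0; exact: le_trans (ltW c0) (le_trans h1 h2). Qed.
Let Q0 : 0 <= Q. Proof. by side. Qed.

Let mdqs t j : mble (dqs t j).
Proof.
by apply: measurable_fun_rV => i; rewrite /dqs; under eq_fun do rewrite mxE; exact: mw.
Qed.

Let Perr (d k dl : R) := (16 * n%:R + 3) ^+ 2 * (d / ek k) * (2 / c1 * (4 * Q * (n%:R * (4 / d)) ^+ 2 * (8 * C) + Q * C)) +
 ((4 * dl * k ^+ 4)^-1 * (n%:R + 1) + (4 * dl * k ^+ 2)^-1).

Lemma dqs_err s eps K t j : (forall i, good_approx s eps K t j i) ->
 (\int[mu]_(x in cube x0 s) (enorm (dqs t j x - X x) ^+ 2)%:E <= (n%:R * eps)%:E)%E.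
Proof.
move=> ha; have -> : (\int[mu]_(x in cube x0 s) (enorm (dqs t j x - X x) ^+ 2)%:E =
  \int[mu]_(x in cube x0 s) (\sum_(i < n) (dq t (b i) (v j) x - X x ord0 i) ^+ 2)%:E)%E.
 apply: eq_integral => x _; congr EFin; rewrite enorm_sqr /dotprod; apply: eq_bigr => i _.
 by rewrite !mxE expr2.
rewrite -[n in n%:R]card_ord; apply: int_sum_le => //; try side.
- by move=> i; have [] := ha i.
Qed.

(** In direction [i] the profile varies only where the i-th quotient is at least 4k, and there
    [dhinge (2 * k)] equals 1: the two thresholds are paired for this. [lhs_pointwise] is then
    integrated against [cacc_k]; the weight d meets the squared gradient of the cut-off, of order
    d^-2, so both contributions are of order 1/d. *)
Lemma grad_term (s d k dl eps K a t : R) (j : nat) (i : 'I_n) :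
 0 < s -> 0 < d -> 0 < k -> 0 < dl -> 0 <= K ->
 s + d + d <= r -> 0 < t <= d -> (forall l, good_approx (s + d) eps K t j l) ->
 (\int[mu]_(x in cube x0 (s + d)) (en (X x) * ind k (X x))%:E <= a%:E)%E ->
 (\int[mu]_(x in cube x0 s) (`|dprof (4 * k) (4 * k) (dqs t j x) ord0 i| * enorm (dqV t (b i) (g j) x))%:E <=
  (Kgain * (a / (d * ek k)) + (dl * (K + (2 * s) ^+ n) + Perr d k dl * eps))%:E)%E.
Proof.
move=> s0 d0 k0 dl0 K0 sdr /andP[t0 td] ha haa.
have ek0 : 0 < ek k.
 by rewrite /ek mulr_gt0 ?exprn_gt0//; have /andP[h _] := sgb k; exact: lt_le_trans h.
have k4 : 0 < 4 * k by side.
have [_ g2 g3 g4] := ha i.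
have cac := cacc_k s0 d0 k0 sdr (introT andP (conj t0 td)) (ha i) haa.
have ss : cube x0 s `<=` cube x0 (s + d) by apply: sub_cube; rewrite lerDl ltW.
have loc (f : E -> R) u : mble f -> (forall x, 0 <= f x) ->
  (\int[mu]_(x in cube x0 (s + d)) (f x)%:E <= u)%E -> (\int[mu]_(x in cube x0 s) (f x)%:E <= u)%E.
 by move=> mf f0 hf; apply: le_trans hf; apply: (int_sub mu (mU s) (mU (s + d)) ss mf) => x _; exact: f0.
have mq : mble (dqV t (b i) X) by side.
have mqj : mble (dqV t (b i) (g j)) by side.
have mS : mble (Sdq sg X t (b i)) by exact: (mSdq cs sol t (b i)).
have me : mble (fun x => en (X x)) by exact: men.
have mi := measurable_ind k.
have mdG : mble (fun x => dhinge (2 * k) (dq t (b i) (v j) x)).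
 apply: (measurableT_comp _ (mw t i j)); apply: continuous_measurable_fun; exact: cont_dhinge.
have mdp : mble (fun x => dprof (4 * k) (4 * k) (dqs t j x) ord0 i).
 have [_ md] := mC1 (prof_C1 (4 * k) (4 * k) : C1 (_ : E -> R) _).
 by side.
pose f1 x := en (X x) * ind k (X x).
pose f2 x := dhinge (2 * k) (dq t (b i) (v j) x) * Sdq sg X t (b i) x * enorm (dqV t (b i) X x) ^+ 2.
pose f3 x := enorm (dqV t (b i) X x) ^+ 2.
pose f4 x := enorm (dqs t j x - X x) ^+ 2.
pose f5 x := enorm (X (x + t *: b i) - X x) ^+ 2.
pose f6 x := enorm (dqV t (b i) (g j) x - dqV t (b i) X x) ^+ 2.
have m1 : mble f1 by side.
have m3 : mble f3 by side.
have m2 : mble f2 by side.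
have m4 : mble f4.
 by side.
have m5 : mble f5.
 by side.
have m6 : mble f6.
 by side.
have p1 x : 0 <= f1 x.
 by apply: mulr_ge0; [exact: e_ge0 hs (enorm_ge0 _)|have /andP[] := ind_itv k (X x)].
have p3 x : 0 <= f3 x by side.
have p4 x : 0 <= f4 x by side.
have p5 x : 0 <= f5 x by exact: sqr_ge0.
have p6 x : 0 <= f6 x by exact: sqr_ge0.
have p2 x : 0 <= f2 x.
 apply: mulr_ge0; last exact: sqr_ge0.
 apply: mulr_ge0; first by have [/andP[]] := dhinge_prop (dq t (b i) (v j) x) (mulr_gt0 (ltr0Sn _ 1) k0).
 by have /andP[h _] := sgb (enorm (X (x + t *: b i)) + enorm (X x)); exact: le_trans (ltW c0) h.
pose cc := (16 * n%:R + 3) ^+ 2 * (d / ek k).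
have cc0 : 0 <= cc by side.
pose u4 := (4 * dl * k ^+ 4)^-1; pose u2 := (4 * dl * k ^+ 2)^-1.
have u40 : 0 <= u4 by side.
have u20 : 0 <= u2 by side.
have dd0 : 0 <= d^-1 by side.
have ee0 : 0 <= (ek k)^-1 by side.
have dl0' := ltW dl0.
apply: (via (\int[mu]_(x in cube x0 s) (d^-1 * ((ek k)^-1 * f1 x) + cc * f2 x + (dl * f3 x + u4 * (f4 x + f5 x) + (dl + u2 * f6 x)))%:E)%E).
 apply: int_le => //.
 - apply: measurable_funM; first by side.
  by side.
 - by side.
 - by side.
 - move=> x _.
  have rhs0 : 0 <= d^-1 * ((ek k)^-1 * f1 x) + cc * f2 x + (dl * f3 x + u4 * (f4 x + f5 x) + (dl + u2 * f6 x)).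
   apply: addr_ge0; [apply: addr_ge0|apply: addr_ge0; apply: addr_ge0 => //];
    apply: mulr_ge0 => //; [exact: mulr_ge0|exact: addr_ge0].
  have [y8|y8] := leP `|dqs t j x| (8 * k); last first.
   suff -> : dprof (4 * k) (4 * k) (dqs t j x) = 0 by rewrite mxE normr0 mul0r.
   have [l hl] : exists l, 8 * k < `|dqs t j x ord0 l|.
    apply: contrapT => hn; move: y8; apply/negP; rewrite -leNgt.
    apply: norm_leP; first by side.
    by move=> l; rewrite leNgt; apply/negP => hl; apply: hn; exists l.
   have [] // := @prof_eq0 R n (4 * k) (4 * k) (dqs t j x) l k4.
   by apply: le_trans (ltW hl); lra.
  have := dprof_coord (4 * k) (dqs t j x) i k4.
  case: ifPn => yk dp; last first.
   have -> : `|dprof (4 * k) (4 * k) (dqs t j x) ord0 i| = 0.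
    by apply/eqP; rewrite eq_le normr_ge0 andbT; move: dp; rewrite mulr0.
   by rewrite mul0r.
  rewrite mulr1 in dp.
  have h := lhs_pointwise hs c0 sgb (X x) (X (x + t *: b i)) (dqV t (b i) X x) (dqV t (b i) (g j) x) k0 d0 dl0 yk y8.
  apply: le_trans (_ : k^-1 * enorm (dqV t (b i) (g j) x) <= _).
   rewrite ler_wpM2r ?enorm_ge0//; apply: le_trans dp _.
   by rewrite invfM mulrA mulfV// mul1r.
  apply: le_trans h _; rewrite -/(ek k) -/cc -/u4 -/u2 -/(en (X x)).
  by rewrite -/(f1 x) -/(f3 x) -/(f4 x) -/(f5 x) -/(f6 x) /f2 /dqs mxE lexx.
have -> : Kgain * (a / (d * ek k)) + (dl * (K + (2 * s) ^+ n) + Perr d k dl * eps) =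
 d^-1 * ((ek k)^-1 * a) + cc * (2 / c1 * (4 * Q * (n%:R * (4 / d)) ^+ 2 * (4 * K3 * a + 4 * C * (eps + eps)) + Q * C * eps)) +
 (dl * K + u4 * (n%:R * eps + eps) + (dl * (2 * s) ^+ n + u2 * eps)).
 rewrite /Kgain /Perr -/cc -/u4 -/u2 /cc; field.
 by side.
apply: int_D_le => //.
- by side.
- by side.
- by side.
- by move=> x _; apply: addr_ge0; apply: addr_ge0 => //; apply: mulr_ge0 => //; exact: addr_ge0.
- apply: int_D_le => //.
 + by side.
 + by side.
 + by side.
 + by side.
 + apply: int_Z_le => //; first by side.
   by side.
  exact: (int_Z_le (mU s) m1 (fun x _ => p1 x) ee0 (loc _ _ m1 p1 haa)).
 + exact: int_Z_le.
apply: int_D_le => //.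
- by side.
- by side.
- by move=> x _; apply: addr_ge0; apply: mulr_ge0 => //; exact: addr_ge0.
- by side.
- apply: int_D_le => //.
 + by side.
 + by side.
 + by move=> x _; exact: mulr_ge0.
 + by side.
 + exact: (int_Z_le (mU s) m3 (fun x _ => p3 x) dl0' (loc _ _ m3 p3 g4)).
 + apply: int_Z_le => //; first by side.
   by move=> x _; exact: addr_ge0.
  apply: int_D_le => //; last exact: (loc _ _ m5 p5 g2).
  exact: (loc _ _ m4 p4 (dqs_err ha)).
apply: int_D_le => //.
- by side.
- by side.
- by rewrite int_cst_cube// lee_fin lexx.
- exact: (int_Z_le (mU s) m6 (fun x _ => p6 x) u20 (loc _ _ m6 p6 g3)).
Qed.

(** The profile of X is not known to be differentiable. It is replaced by the profile of the
    difference quotients of [v j], a C^1 function whose gradient [grad_term] bounds in L^1; the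
    replacement costs terms in [dl] and [eps]. *)
Lemma trans_bound (s d k a : R) (z : E) : 0 < s -> 0 < d -> 0 < k -> s + 5 * d <= r -> `|z| <= d ->
 (\int[mu]_(x in cube x0 (s + 2 * d)) (en (X x) * ind k (X x))%:E <= a%:E)%E ->
 (\int[mu]_(x in cube x0 s) `|prof (4 * k) (4 * k) (X (x + z)) - prof (4 * k) (4 * k) (X x)|%:E <=
  (n%:R * enorm z * (Kgain * (a / (d * ek k))))%:E)%E.
Proof.
move=> s0 d0 k0 sdr zd ha.
have s1 : 0 < s + d by side.
have s2 : 0 < s + d + d by side.
have [|K K0 hK] := approx_ex s2 d0; first by lra.
have k4 : 0 < 4 * k by side.
set f := prof (4 * k) (4 * k).
apply: lee_addeps_real => e e0.
pose V := (2 * (s + d)) ^+ n.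
have V0 : 0 <= V by side.
(* [A1] collects what is proportional to [dl], [A2] what is proportional to [eps]. As [A2] depends
   on [dl], the latter is fixed first; each side costs at most e/2. *)
pose A1 := 2 * (n%:R * (4 / (4 * k))) * V + n%:R * enorm z * (K + V).
have kn : 0 <= n%:R * (4 / (4 * k)) by side.
have nz : 0 <= n%:R * enorm z by side.
have A10 : 0 <= A1.
 apply: addr_ge0; last by side.
 by side.
pose dl := e / (2 * (A1 + 1)).
have dl0 : 0 < dl by rewrite divr_gt0// mulr_gt0// ltr_wpDl.
have dlA : dl * A1 <= e / 2.
 have : dl * (2 * (A1 + 1)) = e by rewrite divfK// gt_eqF// mulr_gt0// ltr_wpDl.
 by move: (ltW dl0); nra.
pose A2 := 2 * (n%:R * (4 / (4 * k))) * ((4 * dl)^-1 * n%:R) + n%:R * enorm z * Perr d k dl.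
pose eps := e / (2 * (Num.max A2 0 + 1)).
have m0 : 0 <= Num.max A2 0 by rewrite le_max lexx orbT.
have eps0 : 0 < eps by side.
have epsA : A2 * eps <= e / 2.
 have h : eps * (2 * (Num.max A2 0 + 1)) = e by rewrite divfK// gt_eqF// mulr_gt0// ltr_wpDl.
 have h2 : A2 <= Num.max A2 0 by rewrite le_max lexx.
 by move: (ltW eps0); nra.
have [t [j [td ga]]] := hK eps eps0.
pose F x := f (dqs t j x).
pose G x := \sum_i dprof (4 * k) (4 * k) (dqs t j x) ord0 i *: dqV t (b i) (g j) x.
have FG : C1 F G by exact: (prof_comp_C1 (4 * k) (4 * k) (fun i => C1_dq t (b i) (hsol_C1 sol j))).
have [mF mG] := mC1 FG.
have [mf mdf] := mC1 (prof_C1 (4 * k) (4 * k) : C1 (_ : E -> R) _).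
have mfX : mble (fun x => f (X x)) by side.
have mFX : mble (fun x => `|F x - f (X x)|) by side.
have m4 : mble (fun x => enorm (dqs t j x - X x) ^+ 2).
 by side.
have sub12 : cube x0 (s + d) `<=` cube x0 (s + d + d) by apply: sub_cube; rewrite lerDl ltW.
have ga' l : good_approx (s + d + d) eps K t j l by exact: ga.
have errF : (\int[mu]_(x in cube x0 (s + d)) `|F x - f (X x)|%:E <=
  (n%:R * (4 / (4 * k)) * (dl * V + (4 * dl)^-1 * (n%:R * eps)))%:E)%E.
 apply: (via (\int[mu]_(x in cube x0 (s + d)) (n%:R * (4 / (4 * k)) * (dl + (4 * dl)^-1 * enorm (dqs t j x - X x) ^+ 2))%:E)%E).
  apply: int_le => //.
  - by side.
  - move=> x _; apply: le_trans (prof_lip _ _ _ k4) _; rewrite ler_wpM2l//.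
   (* The profile error is linear in the distance while its square is what is known to be small: u
      <= dl + u^2/(4 dl). *)
   set u := enorm _; have -> : dl + (4 * dl)^-1 * u ^+ 2 = u + (4 * dl)^-1 * (u - 2 * dl) ^+ 2.
    by field; rewrite gt_eqF.
   by side.
 have dl4 : 0 <= (4 * dl)^-1 by side.
 apply: int_Z_le => //.
 - by side.
 - by side.
 apply: int_D_le => //.
 - by side.
 - by side.
 - by side.
 - by rewrite int_cst_cube// lee_fin lexx.
 apply: (int_Z_le (mU _) m4 (fun x _ => sqr_ge0 _) dl4).
 apply: le_trans (dqs_err ga').
 exact: (int_sub mu (mU _) (mU _) sub12 m4 (fun x _ => sqr_ge0 _)).
have gradF : (\int[mu]_(x in cube x0 (s + d)) `|dotprod (G x) z|%:E <=
  (n%:R * enorm z * (Kgain * (a / (d * ek k)) + (dl * (K + V) + Perr d k dl * eps)))%:E)%E.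
 have mt i : mble (fun x => `|dprof (4 * k) (4 * k) (dqs t j x) ord0 i| * enorm (dqV t (b i) (g j) x)).
  apply: measurable_funM.
   apply: measurableT_comp => //.
   by side.
  by side.
 apply: (via (\int[mu]_(x in cube x0 (s + d)) (enorm z * \sum_i (`|dprof (4 * k) (4 * k) (dqs t j x) ord0 i| * enorm (dqV t (b i) (g j) x)))%:E)%E).
  apply: int_le => //.
  - by side.
  - by side.
  - move=> x _; apply: le_trans (dot_norm_le _ _) _; rewrite mulrC ler_wpM2l ?enorm_ge0//.
   rewrite /G; elim/big_ind2 : _ => [|u1 u2 w1 w2 h1 h2|l _].
   + by rewrite enorm0.
   + by apply: le_trans (enormD _ _) _; exact: lerD.
   + by rewrite enormZ.
 have -> : n%:R * enorm z * (Kgain * (a / (d * ek k)) + (dl * (K + V) + Perr d k dl * eps)) =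
   enorm z * (n%:R * (Kgain * (a / (d * ek k)) + (dl * (K + V) + Perr d k dl * eps))) by ring.
 have t0 i x : 0 <= `|dprof (4 * k) (4 * k) (dqs t j x) ord0 i| * enorm (dqV t (b i) (g j) x).
  by side.
 apply: int_Z_le => //.
 - by side.
 - by side.
 - by side.
 have ti i : (\int[mu]_(x in cube x0 (s + d)) (`|dprof (4 * k) (4 * k) (dqs t j x) ord0 i| * enorm (dqV t (b i) (g j) x))%:E <=
   (Kgain * (a / (d * ek k)) + (dl * (K + V) + Perr d k dl * eps))%:E)%E.
  apply: grad_term => //; first by lra.
  by rewrite (_ : s + d + d = s + 2 * d)//; lra.
 by have := int_sum_le (mU (s + d)) mt (fun i x _ => t0 i x) ti; rewrite card_ord.
have zs : `|z| + s <= s + d by rewrite addrC lerD2l.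
have hF := C1_L1_shift FG zs gradF.
have h1 : (\int[mu]_(x in cube x0 s) `|F (x + z) - f (X (x + z))|%:E <=
  (n%:R * (4 / (4 * k)) * (dl * V + (4 * dl)^-1 * (n%:R * eps)))%:E)%E.
 by apply: le_trans errF; apply: (int_shift_cube_le x0 mFX (fun x => normr_ge0 _) zs).
have h2 : (\int[mu]_(x in cube x0 s) `|F x - f (X x)|%:E <=
  (n%:R * (4 / (4 * k)) * (dl * V + (4 * dl)^-1 * (n%:R * eps)))%:E)%E.
 apply: le_trans errF; apply: (int_sub mu (mU _) (mU _) _ mFX (fun x _ => normr_ge0 _)).
 by apply: sub_cube; rewrite lerDl ltW.
have mFs := mshiftf z mF; have mfXs := mshiftf z mfX.
have mFXs := mshiftf z mFX.
have mFF : mble (fun x : E => `|F (x + z) - F x|) by side.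
apply: (via (\int[mu]_(x in cube x0 s) (`|F (x + z) - f (X (x + z))| + (`|F (x + z) - F x| + `|F x - f (X x)|))%:E)%E).
 apply: int_le => //.
 - by side.
 - by side.
 - move=> x _.
  rewrite (_ : f (X (x + z)) - f (X x) = - (F (x + z) - f (X (x + z))) + ((F (x + z) - F x) + (F x - f (X x)))); last by ring.
  by apply: le_trans (ler_normD _ _) _; rewrite normrN lerD2l; exact: ler_normD.
have := int_D_le (mU s) mFXs (measurable_funD mFF mFX) (fun x _ => normr_ge0 _) (fun x _ => addr_ge0 (normr_ge0 _) (normr_ge0 _)) h1
  (int_D_le (mU s) mFF mFX (fun x _ => normr_ge0 _) (fun x _ => normr_ge0 _) hF h2).
move=> h; apply: (le_trans h); rewrite lee_fin.
set g1 := Kgain * _; move: dlA epsA; rewrite /A1 /A2; set q := n%:R * (4 / _); set w := (4 * dl)^-1.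
set nn := n%:R; set P := Perr _ _ _.
move=> dlA epsA; nra.
Qed.

End gain.

(** * Decay of the energy over levels *)

Lemma bernoulli_pow (R : realType) (x : R) n : 0 <= x <= 1 -> 1 - n%:R * x <= (1 - x) ^+ n.
Proof.
move=> /andP[x0 x1]; elim: n => [|n ih]; first by rewrite mul0r subr0.
rewrite exprS; apply: (via ((1 - x) * (1 - n%:R * x))); last by side.
by have n0 : 0 <= n%:R :> R by []; rewrite -natr1; nra.
Qed.

Lemma geom_sum_le (R : realType) (t : R) J : 0 <= t < 1 -> \sum_(i < J) t ^+ i <= (1 - t)^-1.
Proof.
move=> /andP[t0 t1]; have p : 0 < 1 - t by side.
rewrite -(ler_pM2l p) mulfV ?gt_eqF// -opprB mulNr -subrX1 opprB.
by rewrite lerBlDr lerDl exprn_ge0.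
Qed.

Section param_bound.
Context {d1 d2} {T1 : measurableType d1} {T2 : measurableType d2} {R : realType}.
Variables (m1 : {sigma_finite_measure set T1 -> \bar R}) (m2 : {sigma_finite_measure set T2 -> \bar R}).

Lemma param_bound (D : set T1) (Z : set T2) (k : T1 -> R) (H : T1 * T2 -> R) (K V : R) :
 measurable D -> measurable Z -> mble k -> (forall x, 0 <= k x) ->
 mble H -> (forall p, 0 <= H p) -> m2 Z = V%:E ->
 (forall x, D x -> ((k x)%:E <= \int[m2]_(z in Z) (H (x, z))%:E)%E) ->
 (forall z, Z z -> (\int[m1]_(x in D) (H (x, z))%:E <= K%:E)%E) ->
 (\int[m1]_(x in D) (k x)%:E <= (K * V)%:E)%E.
Proof.
move=> mD mZ mk k0 mH H0 ZV kH hK.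
apply: (via (\int[m1]_(x in D) \int[m2]_(z in Z) (H (x, z))%:E)%E).
 apply: ge0_le_integral => //.
 - by side.
 - by side.
 - apply: measurable_funTS.
  have := @measurable_fun_fubini_tonelli_F _ _ _ _ R m2 (fun p : T1 * T2 => (H p * \1_Z p.2)%:E).
  rewrite /fubini_F => mF; under eq_fun do rewrite int_indic.
  apply: mF; last by side.
  apply: mEFin; apply: measurable_funM => //.
  by apply: measurableT_comp; [exact: measurable_indic|exact: measurable_snd].
rewrite (tonelli_dom m1 m2 mD mZ mH H0).
apply: (via (\int[m2]_(s in Z) (cst K%:E s))%E).
 apply: ge0_le_integral => //.
 - by side.
 - apply: measurable_funTS.
  have := @measurable_fun_fubini_tonelli_G _ _ _ _ R m1 (fun p : T1 * T2 => (H p * \1_D p.1)%:E).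
  rewrite /fubini_G => mF; under eq_fun do rewrite int_indic.
  apply: mF; last by side.
  apply: mEFin; apply: measurable_funM => //.
  by apply: measurableT_comp; [exact: measurable_indic|exact: measurable_fst].
have -> := @integral_cst _ _ R m2 _ mZ K%:E.
by rewrite EFinM le_eqVlt; apply/orP; left; apply/eqP; congr (_ * _)%E; exact: ZV.
Qed.

End param_bound.

Section decay.
Context {R : realType} {n : nat}.
Local Notation E := 'rV[R]_n.
Local Notation mu := (@lebesgue_rV R n).
Variables (m M Kt Ke r : R) (sg : R -> R) (X : E -> E) (x0 : E).
Let en (Y : E) := enorm Y ^+ 2 * sg (enorm Y).
Let ek k := k ^+ 2 * sg k.
Hypotheses (hs : slope m M sg) (n0 : (0 < n)%N) (Kt0 : 0 <= Kt) (mX : mble X).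
Hypothesis me : mble (fun x => en (X x)).
Hypothesis mi : forall k, mble (fun x => ind k (X x)).
Hypothesis heK : forall s t, 0 <= s -> 0 <= t -> s <= 16 * n%:R * t -> ek s <= Ke * ek t.
Hypothesis tb : forall (s d k a : R) (z : E), 0 < s -> 0 < d -> 0 < k -> s + 5 * d <= r -> `|z| <= d ->
 (\int[mu]_(x in cube x0 (s + 2 * d)) (en (X x) * ind k (X x))%:E <= a%:E)%E ->
 (\int[mu]_(x in cube x0 s) `|prof (4 * k) (4 * k) (X (x + z)) - prof (4 * k) (4 * k) (X x)|%:E <=
  (enorm z * (Kt * (a / (d * ek k))))%:E)%E.

Let mU x s : measurable (cube x s : set E). Proof. by side. Qed.
Let ei0 k x : 0 <= en (X x) * ind k (X x).
Proof. by apply: mulr_ge0; [exact: e_ge0 hs (enorm_ge0 _)|have /andP[] := ind_itv k (X x)]. Qed.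
Let mei k : mble (fun x => en (X x) * ind k (X x)).
Proof. by side. Qed.
Let ek_gt0 k : 0 < k -> 0 < ek k.
Proof. by move=> k0; have [_ _ h _] := hs; rewrite /ek mulr_gt0 ?exprn_gt0// h. Qed.
Let ind0 k (Y : E) : 0 <= ind k Y. Proof. by have /andP[] := ind_itv k Y. Qed.

(** Where |X(x)| > 8k the profile is 0, whereas it is 1 at points with |X| <= k, and these fill at
    least half of the cube of radius p around x. So the increments of the profile over this cube
    integrate to at least half of its volume; integrating in x and exchanging the order bounds the
    measure by the modulus of translation. *)
Lemma level_meas (s d k a p : R) : 0 < s -> 0 < d -> 0 < k -> 0 < p <= d -> s + 5 * d <= r -> 0 <= a ->
 (\int[mu]_(x in cube x0 (s + 2 * d)) (en (X x) * ind k (X x))%:E <= a%:E)%E ->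
 2 * a <= (2 * p) ^+ n * ek k ->
 (\int[mu]_(x in cube x0 s) (ind (8 * k) (X x))%:E <= (2 * (n%:R * p * (Kt * (a / (d * ek k)))))%:E)%E.
Proof.
move=> s0 d0 k0 /andP[p0 pd] sdr a0 ha hap.
have ekp := ek_gt0 k0.
have P0 : 0 < (2 * p) ^+ n by side.
have c0 : 0 < (2 * p) ^+ n / 2 by side.
have k4 : 0 < 4 * k by side.
have tb' := tb s0 d0 k0 sdr _ ha; set f := prof (4 * k) (4 * k) in tb' *.
have [mf _] := mC1 (prof_C1 (4 * k) (4 * k) : C1 (f : E -> R) _).
have mfX : mble (fun x => f (X x)) by side.
have f0 Y : 0 <= f Y by side.
have mik := mi k.
(* Chebyshev's inequality: e(k) times the measure of |X| > k is at most [a], so this measure is at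
   most half of the volume (2p)^n. *)
have hik (x : E) : cube x0 s x ->
  (\int[mu]_(z in cube 0 p) (ind k (X (x + z)))%:E <= ((2 * p) ^+ n / 2)%:E)%E.
 move=> xs.
 have -> : (\int[mu]_(z in cube 0 p) (ind k (X (x + z)))%:E = \int[mu]_(z in cube x p) (ind k (X z))%:E)%E.
  rewrite -[in RHS](add0r x) -(int_shift_cube 0 x p mik (fun z => ind0 k _)).
  by apply: eq_integral => z _; rewrite addrC.
 apply: (via (\int[mu]_(z in cube x0 (s + 2 * d)) (ind k (X z))%:E)%E).
  apply: (int_sub mu (mU x p) (mU _ _) _ mik (fun z _ => ind0 k _)).
  apply: sub_cube_shift; move: xs; rewrite /cube /= => xs.
  by apply: le_trans (lerD (ltW xs) pd) _; lra.
 apply: (via ((ek k)^-1 * a)%:E).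
  apply: (via (\int[mu]_(z in cube x0 (s + 2 * d)) ((ek k)^-1 * (en (X z) * ind k (X z)))%:E)%E).
   apply: int_le => //; first by side.
   move=> z _; rewrite mulrA /ind; case: ifP => kz; last by side.
   rewrite !mulr1 -ler_pdivrMl ?invr_gt0// invrK mulr1.
   by apply: (e_mono hs (ltW k0)); apply: le_trans (norm_le_enorm _); exact: ltW.
  apply: (int_Z_le (mU _ _) (mei k) (fun z _ => ei0 k z)) => //.
  by side.
 by rewrite lee_fin ler_pdivrMl// mulrA ler_pdivlMr// mulrC (mulrC (ek k)).
have mH : mble (fun q : E * E => `|f (X (q.1 + q.2)) - f (X q.1)|).
 apply: measurableT_comp => //; apply: measurable_funB.
  apply: (measurableT_comp mfX).
  by side.
 by side.
have main : (\int[mu]_(x in cube x0 s) ((2 * p) ^+ n / 2 * ind (8 * k) (X x))%:E <=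
  (n%:R * p * (Kt * (a / (d * ek k))) * (2 * p) ^+ n)%:E)%E.
 apply: (param_bound (m1 := mu) (m2 := mu) (H := fun q : E * E => `|f (X (q.1 + q.2)) - f (X q.1)|)
   (mU x0 s) (mU 0 p)) => //.
 - by side.
 - by side.
 - exact: mu_cube.
 - move=> x xs /=; rewrite {1}/ind; case: ifP => x8; last first.
   by rewrite mulr0; apply: int_ge0 => z _; exact: normr_ge0.
  have -> : f (X x) = 0.
   have [l hl] : exists l, 8 * k < `|X x ord0 l|.
    apply: contrapT => hn; move: x8; apply/negP; rewrite -leNgt.
    apply: norm_leP; first by side.
    by move=> l; rewrite leNgt; apply/negP => hl; apply: hn; exists l.
   have [] // := @prof_eq0 R n (4 * k) (4 * k) (X x) l k4.
   by apply: le_trans (ltW hl); lra.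
  have mfs : mble (fun z : E => f (X (x + z))).
   have := mshiftf x mfX; rewrite (_ : (fun z : E => f (X (z + x))) = (fun z => f (X (x + z))))//.
   by apply/funext => z; rewrite addrC.
  have mis : mble (fun z : E => ind k (X (x + z))).
   have := mshiftf x mik; rewrite (_ : (fun z : E => ind k (X (z + x))) = (fun z => ind k (X (x + z))))//.
   by apply/funext => z; rewrite addrC.
  have h1 : ((2 * p) ^+ n)%:E = (\int[mu]_(z in cube (0%R : E) p) (cst 1%R z)%:E)%E.
   by rewrite int_cst_cube// mul1r.
  have h2 : (((2 * p) ^+ n)%:E <= \int[mu]_(z in cube (0%R : E) p) (f (X (x + z)) + ind k (X (x + z)))%:E)%E.
   rewrite h1; apply: int_le => //; first by side.
   move=> z _ /=; rewrite /ind; case: ifP => kz; first by side.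
   rewrite addr0 /f prof_eq1//.
   move=> l; apply: le_trans (coord_le_norm _ _) _; move/negbT: kz; rewrite -leNgt => kz.
   by apply: le_trans kz _; lra.
  rewrite (int_D mu (mU _ _) mfs mis (fun z _ => f0 _) (fun z _ => ind0 k _)) in h2.
  rewrite mulr1 (_ : (\int[mu]_(z in _) _ = \int[mu]_(z in cube (0%R : E) p) (f (X (x + z)))%:E)%E); last first.
   by apply: eq_integral => z _; rewrite subr0 ger0_norm.
  have h3 := hik x xs.
  have h4 := le_trans h2 (leeD2l _ h3).
  rewrite (_ : (2 * p) ^+ n / 2 = (2 * p) ^+ n - (2 * p) ^+ n / 2); last by field.
  by rewrite EFinB leeBlDr.
 - move=> z zp /=; move: zp; rewrite /cube/= subr0 => zp.
  apply: le_trans (tb' _ _) _; first exact: le_trans (ltW zp) pd.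
  rewrite lee_fin; apply: ler_wpM2r.
   by side.
  apply: le_trans (enorm_le_norm _) _.
  by apply: ler_wpM2l => //; exact: ltW.
rewrite (int_Z mu (mU _ _) (mi (8 * k)) (fun z _ => ind0 _ _) (ltW c0)) in main.
have : (2 * (n%:R * p * (Kt * (a / (d * ek k)))))%:E = (((2 * p) ^+ n / 2)^-1%:E * (n%:R * p * (Kt * (a / (d * ek k))) * (2 * p) ^+ n)%:E)%E.
 rewrite -EFinM; congr EFin; field.
 by side.
by move=> ->; rewrite lee_pdivlMl.
Qed.

Let tr (k : R) (x : E) : R := if `|X x| <= k then 1 else 0.

(** On the layer between 8 2^i k and twice that value, |X| <= n 16 2^i k, so [heK] bounds e(X) by a
    multiple of e(2^i k); this is the origin of the constant 16 n. The truncation [tr] keeps the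
    number of layers finite. *)
Lemma layers (k : R) J x : 0 < k ->
 en (X x) * ind (8 * k) (X x) * tr (8 * (2 ^+ J * k)) x <=
 \sum_(i < J) Ke * ek (2 ^+ i * k) * ind (8 * (2 ^+ i * k)) (X x).
Proof.
move=> k0; elim: J => [|J ih].
 rewrite big_ord0 expr0 mul1r /tr /ind.
 by have [h|h] := leP `|X x| (8 * k); rewrite ?mulr0 ?mul0r.
rewrite big_ord_recr /=.
have Ke0 i : 0 <= Ke * ek (2 ^+ i * k).
 have p : 0 <= 2 ^+ i * k by side.
 apply: le_trans (heK p p _); first exact: e_ge0 hs p.
 rewrite ler_peMl//; have : 1 <= n%:R :> R by rewrite ler1n.
 by lra.
have t0 i : 0 <= Ke * ek (2 ^+ i * k) * ind (8 * (2 ^+ i * k)) (X x) by side.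
rewrite {1}/tr; case: ifP => h1; last first.
 by rewrite mulr0; apply: addr_ge0 => //; apply: sumr_ge0 => i _.
have [h2|h2] := leP `|X x| (8 * (2 ^+ J * k)).
 by move: ih; rewrite /tr h2 => ih; apply: le_trans ih _; rewrite lerDl.
rewrite mulr1; apply: ler_wpDl; first by side.
have pk : 0 <= 2 ^+ J * k by side.
rewrite {2}/ind h2 mulr1.
apply: (via (en (X x))).
 by rewrite ler_piMr//; [exact: e_ge0 hs (enorm_ge0 _)|have /andP[] := ind_itv (8 * k) (X x)].
apply: heK => //; first exact: enorm_ge0.
apply: le_trans (enorm_le_norm _) _.
apply: le_trans (ler_wpM2l _ h1) _ => //.
by rewrite exprS le_eqVlt; apply/orP; left; apply/eqP; ring.
Qed.

(** [level_meas] is applied at every level 2^i k, with the radius shrunk to p th^i so that the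
    resulting bounds form a geometric series; Fatou removes the bound on the number of levels. *)
Lemma decay_step (s d k a p : R) : 0 < s -> 0 < d -> 0 < k -> 0 < p <= d -> s + 5 * d <= r -> 0 <= a ->
 (\int[mu]_(x in cube x0 (s + 2 * d)) (en (X x) * ind k (X x))%:E <= a%:E)%E ->
 2 * a <= (2 * p) ^+ n * ek k ->
 (\int[mu]_(x in cube x0 s) (en (X x) * ind (8 * k) (X x))%:E <= (4 * n%:R ^+ 2 * Ke * Kt * (p / d) * a)%:E)%E.
Proof.
move=> s0 d0 k0 /andP[p0 pd] sdr a0 ha hap.
have nR : 1 <= n%:R :> R by rewrite ler1n.
have nR0 : 0 < n%:R :> R by side.
(* With th = 1 - 1/(2n), Bernoulli's inequality gives th^n >= 1/2, and the geometric series sums to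
   2n. *)
pose u : R := (2 * n%:R)^-1.
have u0 : 0 < u by side.
have u1 : u <= 1 by rewrite invf_le1 ?mulr_gt0//; lra.
have nu : n%:R * u = 2^-1 by rewrite /u; field; rewrite gt_eqF.
pose th := 1 - u.
have th0 : 0 <= th by side.
have th1 : th <= 1 by rewrite lerBlDr lerDl ltW.
have thn : 2^-1 <= th ^+ n.
 by apply: le_trans (bernoulli_pow n _); [rewrite nu; lra|rewrite (ltW u0)].
have thp : 0 < th by rewrite /th; move: nu nR u0; nra.
have Ke0 i : 0 <= Ke * ek (2 ^+ i * k).
 have pk : 0 <= 2 ^+ i * k by side.
 apply: le_trans (heK pk pk _); first exact: e_ge0 hs pk.
 by rewrite ler_peMl//; lra.
have mtr J : mble (tr (8 * (2 ^+ J * k))).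
 rewrite (_ : tr _ = (fun x => 1 - ind (8 * (2 ^+ J * k)) (X x))).
  by side.
 by apply/funext => x; rewrite /tr /ind leNgt; case: (_ < _); rewrite /= ?subrr ?subr0.
have tr0 J x : 0 <= tr J x by rewrite /tr; case: ifP.
apply: (int_fatou (mu := mu) (h := fun J x => en (X x) * ind (8 * k) (X x) * tr (8 * (2 ^+ J * k)) x)) => //.
- by side.
- by side.
- apply/aeW => x _; apply: cvg_near_cst.
 exists (Num.truncn (`|X x| / k)).+1 => // J /= hJ; apply/eqP.
 rewrite /tr ifT ?mulr1//.
 have h1 : `|X x| / k < J%:R.
  apply: lt_le_trans (truncnS_gt _) _.
  by rewrite ler_nat.
 rewrite ltr_pdivrMr// in h1; apply: le_trans (ltW h1) _; rewrite mulrA; apply: ler_wpM2r; first exact: ltW.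
 have : J%:R <= 2 ^+ J :> R by rewrite -natrX ler_nat; exact/ltnW/ltn_expl.
 by have : 0 <= J%:R :> R by []; lra.
move=> e e0; exists 0 => J _.
apply: (via (4 * n%:R ^+ 2 * Ke * Kt * (p / d) * a)%:E); last by side.
have hi i : (\int[mu]_(x in cube x0 s) (Ke * ek (2 ^+ i * k) * ind (8 * (2 ^+ i * k)) (X x))%:E <=
  (2 * n%:R * Ke * Kt * (p / d) * a * th ^+ i)%:E)%E.
 have k2 : 0 < 2 ^+ i * k :> R by side.
 have ti0 : 0 < th ^+ i by side.
 have ti1 : th ^+ i <= 1 by rewrite exprn_ile1.
 have i1 : 1 <= 2 ^+ i :> R by rewrite exprn_ege1//; lra.
 have pp : 0 < p * th ^+ i <= d.
  by rewrite mulr_gt0//=; apply: le_trans pd; rewrite ler_piMr// ltW.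
 have hai : (\int[mu]_(x in cube x0 (s + 2 * d)) (en (X x) * ind (2 ^+ i * k) (X x))%:E <= a%:E)%E.
  apply: le_trans ha; apply: int_le => // x _; apply: ler_wpM2l; first exact: e_ge0 hs (enorm_ge0 _).
  rewrite {1}/ind; case: ifP => h; last exact: ind0.
  rewrite /ind ifT//; apply: le_lt_trans h; rewrite ler_peMl//; exact: ltW.
 have ekek : ek k <= (2 ^+ i)^-1 * ek (2 ^+ i * k).
  have i01 : 0 <= (2 ^+ i : R)^-1 <= 1.
   by rewrite invr_ge0 exprn_ge0//= invf_le1// exprn_gt0.
  have := e_small hs (ltW k2) i01; rewrite mulrA mulVf ?mul1r//.
 (* The volume loses at most the factor 2^i, because th^n >= 1/2, and e(2^i k) >= 2^i e(k) makes up
    for it. *)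
 have hapi : 2 * a <= (2 * (p * th ^+ i)) ^+ n * ek (2 ^+ i * k).
  apply: (le_trans hap); rewrite [2 * (p * _)]mulrA [(2 * p * _) ^+ n]exprMn -[leRHS]mulrA.
  apply: ler_wpM2l; first by side.
  apply: (le_trans ekek); apply: ler_wpM2r; first exact: e_ge0 hs (ltW k2).
  by rewrite -exprM mulnC exprM -exprVn lerXn2r// nnegrE ?invr_ge0// exprn_ge0.
 have h := level_meas s0 d0 k2 pp sdr a0 hai hapi.
 have := int_Z_le (mU _ _) (mi _) (fun x _ => ind0 _ _) (Ke0 i) h.
 move=> h'; apply: (le_trans h'); rewrite lee_fin le_eqVlt; apply/orP; left; apply/eqP.
 by field; rewrite !gt_eqF// ek_gt0.
have m0 i : mble (fun x => Ke * ek (2 ^+ i * k) * ind (8 * (2 ^+ i * k)) (X x)).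
 by side.
have p0' i x : 0 <= Ke * ek (2 ^+ i * k) * ind (8 * (2 ^+ i * k)) (X x) by side.
apply: (via (\int[mu]_(x in cube x0 s) (\sum_(i < J) Ke * ek (2 ^+ i * k) * ind (8 * (2 ^+ i * k)) (X x))%:E)%E).
 apply: int_le => //.
 - by side.
 - by side.
 - by side.
 - by move=> x _; exact: layers.
rewrite int_sum//.
apply: (via (\sum_(i < J) (2 * n%:R * Ke * Kt * (p / d) * a * th ^+ i)%:E)%E).
 by apply: lee_sum => i _; exact: hi.
rewrite sumEFin lee_fin -mulr_sumr.
have Kep : 0 <= Ke by have := Ke0 0%N; rewrite pmulr_lge0//; apply: ek_gt0; rewrite mul1r.
have c0 : 0 <= 2 * n%:R * Ke * Kt * (p / d) * a.
 by side.
have th01 : 0 <= th < 1 by rewrite th0 /th ltrBlDr ltrDl.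
apply: le_trans (ler_wpM2l c0 (geom_sum_le J th01)) _.
rewrite (_ : 1 - th = u); last by rewrite /th; ring.
by rewrite /u invrK le_eqVlt; apply/orP; left; apply/eqP; ring.
Qed.

(** [q] steps of [decay_step] with p = r/T, each raising the level by 8 and gaining a factor of
    order 1/T. The starting level T^n s0 makes the smallness condition hold: cubes of radius r/T
    have lost the factor T^n in volume, and e(T^n s0) >= T^n e(s0). *)
Lemma decay (q : nat) (T s0 : R) : 0 < s0 -> 0 < r -> 2 * (2 * q%:R + 3) <= T ->
 (\int[mu]_(x in cube x0 r) (en (X x))%:E <= (r ^+ n * ek s0)%:E)%E ->
 (\int[mu]_(x in cube x0 (r / 2)) (en (X x) * ind (8 ^+ q * (T ^+ n * s0)) (X x))%:E <=
  ((8 * n%:R ^+ 2 * Ke * Kt * (2 * q%:R + 3) / T) ^+ q * (r ^+ n * ek s0))%:E)%E.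
Proof.
move=> s00 r0 qT hr; have q3 : 0 < 2 * q%:R + 3 :> R by rewrite ltr_wpDl// mulr_ge0.
have T0 : 0 < T by apply: lt_le_trans qT; rewrite mulr_gt0.
have T1 : 1 <= T by apply: le_trans qT; have : 0 <= q%:R :> R by []; lra.
(* Each of the [q] steps shrinks the radius by 2d and needs 5d of room; the first one is the
   tightest, r/2 + 2d (q - 1) + 5d = r. *)
pose d := r / (2 * (2 * q%:R + 3)).
have d0 : 0 < d by side.
have dE : d * (2 * (2 * q%:R + 3)) = r by rewrite divfK// gt_eqF// mulr_gt0.
pose a0 := r ^+ n * ek s0.
have a00 : 0 <= a0 by side.
pose G := 8 * n%:R ^+ 2 * Ke * Kt * (2 * q%:R + 3) / T.
have Kep : 0 <= Ke.
 have := heK (ltW s00) (ltW s00) _; have h1 : 1 <= n%:R :> R by rewrite ler1n.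
 have h2 : s0 <= 16 * n%:R * s0 by rewrite ler_peMl ?(ltW s00)//; lra.
 by move=> /(_ h2) h3; have h4 := ek_gt0 s00; move: h3 h4; nra.
have G0 : 0 <= G by side.
pose k0 := T ^+ n * s0.
have k00 : 0 < k0 by side.
have ek0 : T ^+ n * ek s0 <= ek k0.
 have Ti : 0 <= (T ^+ n)^-1 <= 1 by rewrite invr_ge0 exprn_ge0 ?(ltW T0)//= invf_le1 ?exprn_gt0// exprn_ege1.
 have := e_small hs (ltW k00) Ti; rewrite /k0 mulrA mulVf ?mul1r; last by side.
 by move=> h; rewrite -ler_pdivlMl ?exprn_gt0.
pose sp p := r / 2 + 2 * d * (q%:R - p%:R).
suff main p : (p <= q)%N ->
 (\int[mu]_(x in cube x0 (sp p)) (en (X x) * ind (8 ^+ p * k0) (X x))%:E <= (G ^+ p * a0)%:E)%E.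
 by have := main q (leqnn q); rewrite /sp subrr mulr0 addr0.
have bnd j : (j <= q)%N -> (\int[mu]_(x in cube x0 (sp j)) (en (X x) * ind (8 ^+ j * k0) (X x))%:E <= a0%:E)%E.
 move=> pq; apply: le_trans hr.
 apply: (via (\int[mu]_(x in cube x0 (sp j)) (en (X x))%:E)%E).
  apply: int_le => // x _; apply: ler_piMr; first exact: e_ge0 hs (enorm_ge0 _).
  by have /andP[] := ind_itv (8 ^+ j * k0) (X x).
 apply: (int_sub mu (mU _ _) (mU _ _) _ me (fun x _ => e_ge0 hs (enorm_ge0 _))).
 apply: sub_cube; rewrite /sp; have : 0 <= j%:R :> R by [].
 by move: dE (ltW d0); nra.
elim: p => [|p ih] pq; first by rewrite [G ^+ 0]expr0 [1 * a0]mul1r; exact: bnd.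
have spS : sp p = sp p.+1 + 2 * d by rewrite /sp -natr1; ring.
have pqR : p.+1%:R <= q%:R :> R by rewrite ler_nat.
have sp0 : 0 < sp p.+1.
 by rewrite /sp ltr_wpDr ?divr_gt0// mulr_ge0 ?subr_ge0// mulr_ge0// ltW.
have k8 : 0 < 8 ^+ p * k0 by side.
have pd : 0 < r / T <= d.
 rewrite divr_gt0//= ler_pdivrMr// -dE ler_wpM2l// ltW//.
have sd : sp p.+1 + 5 * d <= r.
 by rewrite /sp; have : 1 <= p.+1%:R :> R by [rewrite ler1n]; move: dE (ltW d0); nra.
(* The factor [G] may exceed 1, in which case the smallness condition would be lost by iteration;
   the total energy is always available as a bound. *)
pose a := Num.min (G ^+ p * a0) a0.
have Gp : 0 <= G ^+ p * a0 by side.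
have aa : 0 <= a by rewrite le_min Gp a00.
have ha : (\int[mu]_(x in cube x0 (sp p.+1 + 2 * d)) (en (X x) * ind (8 ^+ p * k0) (X x))%:E <= a%:E)%E.
 rewrite -spS /a; have [_|_] := leP (G ^+ p * a0) a0; first exact: ih (ltnW pq).
 exact: bnd (ltnW pq).
have hc : 2 * a <= (2 * (r / T)) ^+ n * ek (8 ^+ p * k0).
 apply: (via (2 * a0)); first by rewrite ler_wpM2l// ge_min lexx orbT.
 apply: (via ((2 * (r / T)) ^+ n * ek k0)); last first.
  apply: ler_wpM2l; first by side.
  apply: (e_mono hs (ltW k00)); apply: ler_peMl; first exact: ltW.
  by rewrite exprn_ege1//; lra.
 apply: (via ((2 * (r / T)) ^+ n * (T ^+ n * ek s0))); last first.
  by side.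
 rewrite mulrA -exprMn mulrA divfK ?gt_eqF// exprMn -mulrA; apply: ler_wpM2r => //.
 by rewrite -[leLHS]expr1 ler_weXn2l//; lra.
have h := decay_step sp0 d0 k8 pd sd aa ha hc.
rewrite [8 ^+ p.+1]exprS -[8 * _ * k0]mulrA; apply: (le_trans h); rewrite lee_fin [G ^+ _]exprS -[leRHS]mulrA.
have -> : 4 * n%:R ^+ 2 * Ke * Kt * (r / T / d) = G.
 by rewrite /G -dE; field; rewrite !gt_eqF.
by apply: ler_wpM2l => //; rewrite ge_min lexx.
Qed.

End decay.

Definition ev {R : realType} {n} (sg : R -> R) (X : 'rV[R]_n) : R := enorm X ^+ 2 * sg (enorm X).

(** * Pointwise Young inequalities for fields *)

Section pointwise_young.
Context {R : realType} {n : nat}.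
Local Notation E := 'rV[R]_n.

Lemma ev_ge0 m M sg (X : E) : slope m M sg -> 0 <= ev sg X.
Proof. by move=> h; exact: e_ge0 h (enorm_ge0 _). Qed.

Lemma evN sg (X : E) : ev sg (- X) = ev sg X. Proof. by rewrite /ev enormN. Qed.

Lemma evB sg (X Y : E) : ev sg (X - Y) = ev sg (Y - X). Proof. by rewrite -evN opprB. Qed.

Lemma ev_add (M : R) : 1 <= M -> exists C : R, 1 <= C /\
 forall m sg, slope m M sg -> forall X Y : E, ev sg (X + Y) <= C * (ev sg X + ev sg Y).
Proof.
move=> M1; have [C [C1 hC]] := e_add M1; exists C; split => // m sg h X Y.
by apply: (hC m sg h) => //; [exact: enorm_ge0|exact: enorm_ge0|exact: enorm_ge0|exact: enormD].
Qed.

(** Counterpart of [young] with the small coefficient on the energy of [s]: either t <= k s, or s <=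
    t/k and e(t/k) is a bounded multiple of e(t). *)
Lemma young_rev (M : R) : 1 <= M -> forall k : R, 0 < k -> exists C : R, 0 < C /\
 forall m sg, slope m M sg -> forall s t, 0 <= s -> 0 <= t ->
 s * sg s * t <= k * (s ^+ 2 * sg s) + C * (t ^+ 2 * sg t).
Proof.
move=> M1 k k0; have [C [C1 hC]] := e_scale M1 k^-1.
have C0 : 0 < C by side.
exists (k * C); split; first exact: mulr_gt0.
move=> m sg h s t s0 t0; have es := e_ge0 h s0; have et := e_ge0 h t0.
have ss := slope_al_ge0 h s0.
have [ts|/ltW st] := leP t (k * s).
 rewrite (le_trans (_ : _ <= k * (s ^+ 2 * sg s)))//; last first.
  by side.
 apply: le_trans (ler_wpM2l ss ts) _.
 by apply: eqW; ring.
have sk : s <= k^-1 * t by rewrite -ler_pdivrMl ?invr_gt0// invrK.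
rewrite (le_trans (_ : _ <= k * C * (t ^+ 2 * sg t)))//; last by side.
have u0 : 0 <= k^-1 * t by side.
apply: le_trans (ler_wpM2r t0 (slope_mono0 h s0 sk)) _.
rewrite -mulrA; apply: le_trans (ler_wpM2l (ltW k0) (hC m sg h _ _ u0 t0 (lexx _))).
by apply: eqW; field; rewrite gt_eqF.
Qed.

Lemma Th_enorm m M sg (X : E) : slope m M sg -> enorm (Th sg X) = enorm X * sg (enorm X).
Proof.
move=> h; rewrite /Th enormZ; have := enorm_ge0 X; rewrite le_eqVlt => /predU1P[<-|X0].
 by rewrite mulr0 mul0r.
by rewrite gtr0_norm 1?mulrC//; have [_ _ + _] := h; exact.
Qed.

(** Meant for [a] a local average of X, so that e(X - a) is small. With S = |X| + |a|, [Th_lip] and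
    [young_diff] leave S sg(S) |X - a|, which [young_rev] splits into a small multiple of e(S),
    comparable to e(X) + e(X - a), and a multiple of e(X - a). The coefficient [k3] is what turns
    the former into k' e(X). *)
Lemma pt_young (m M : R) : 0 < m <= 1 -> 1 <= M -> forall k k' : R, 0 < k -> 0 < k' -> exists C : R, 0 < C /\
 forall sg, slope m M sg -> forall (a X F : E) w, 0 <= w ->
 (enorm (Th sg X - Th sg a) + enorm (Th sg F)) * w <=
 k * (w ^+ 2 * sg w) + k' * ev sg X + C * (ev sg (X - a) + ev sg F).
Proof.
move=> m01 M1 k k' k0 kp0; pose L := 2 * (1 + M); have L0 : 0 < L by side.
have k1 : 0 < k / (2 * L) by side.
have [C1 [C10 h1]] := young_diff m01 k1.
have k2' : 0 < k / 2 by lra.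
have [C2 [C20 h2]] := young m01 k2'.
have [Ca [Ca1 ha]] := e_add M1; have [Cs [Cs1 hs]] := e_scale M1 2.
have Cap : 0 < Ca by side.
have Csp : 0 < Cs by side.
pose k3 := k' / (L * C1 * (Ca * Cs)).
have k30 : 0 < k3   := divr_gt0 kp0 (mulr_gt0 (mulr_gt0 L0 C10) (mulr_gt0 Cap Csp)).
have [C3 [C30 h3]] := young_rev M1 k30.
pose K := L * C1 * (k3 * Ca + C3).
have K0 : 0 < K := mulr_gt0 (mulr_gt0 L0 C10) (addr_gt0 (mulr_gt0 k30 Cap) C30).
exists (K + C2); split; first exact: addr_gt0.
move=> sg h a X F w w0; have ew := e_ge0 h w0.
pose S := enorm X + enorm a; pose D := enorm (X - a).
have S0 : 0 <= S by side.
have D0 : 0 <= D := enorm_ge0 _.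
have DS : D <= S by exact: enormB_le.
have eX := ev_ge0 X h; have eD := ev_ge0 (X - a) h; have eF := ev_ge0 F h.
have SE : S ^+ 2 * sg S <= Ca * (Cs * ev sg X + ev sg (X - a)).
 have X2 : 0 <= 2 * enorm X by side.
 apply: le_trans (ha m sg h S _ _ X2 D0 S0 _) _.
  by have := enorm_sub_lt a X; rewrite enormB -/D /S; lra.
 rewrite ler_wpM2l ?(ltW Cap)// lerD2r.
 exact: (hs m sg h _ _ X2 (enorm_ge0 X) (lexx _)).
have q1 := h1 M sg h S D w D0 DS w0.
have q3 := h3 m sg h S D S0 D0.
have q2 := h2 M sg h (enorm F) w (enorm_ge0 F) w0.
have q4 := ler_wpM2r w0 (Th_lip X a h).
rewrite mulrDl (Th_enorm F h).
have t1 : enorm (Th sg X - Th sg a) * w <= k / 2 * (w ^+ 2 * sg w) + k' * ev sg X + K * ev sg (X - a).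
 apply: (le_trans q4); rewrite -/S -/D -/L.
 have -> : L * (sg S * D) * w = L * (sg S * D * w) by ring.
 apply: (le_trans (ler_wpM2l (ltW L0) q1)).
 have b1 := le_trans q3 (lerD (ler_wpM2l (ltW k30) SE) (lexx _)).
 have b2 := ler_wpM2l (ltW (mulr_gt0 L0 C10)) b1.
 rewrite -/(ev sg (X - a)) in b2.
 have e1 : L * (k / (2 * L) * (w ^+ 2 * sg w)) = k / 2 * (w ^+ 2 * sg w) by field; rewrite gt_eqF.
 have e2 : L * C1 * (k3 * (Ca * (Cs * ev sg X + ev sg (X - a))) + C3 * ev sg (X - a)) =
   k' * ev sg X + K * ev sg (X - a).
  by rewrite /K /k3; field; rewrite !gt_eqF.
 rewrite mulrDr e1 -addrA lerD2l -e2.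
 by rewrite -[leLHS]mulrA in b2 *; apply: le_trans b2 => //; rewrite !mulrA.
apply: (le_trans (lerD t1 q2)); rewrite -/(ev sg F).
have : 0 <= K * ev sg F by side.
have : 0 <= C2 * ev sg (X - a) by side.
have -> : k / 2 * (w ^+ 2 * sg w) = 2^-1 * (k * (w ^+ 2 * sg w)) by field.
set kw := k * (w ^+ 2 * sg w).
rewrite !mulrDr !mulrDl; lra.
Qed.

End pointwise_young.

(** * Comparing truncated and original energies *)

Section regularisation.
Context {R : realType}.
Variables (m M : R) (sg : R -> R).
Hypotheses (hs : slope m M sg) (cs : continuous (fun t : R => t * sg t)).

(** Only t sg(t) is continuous on the whole line. The truncated argument stays above [lo], so
    dividing by it is harmless. *)
Lemma clamp_continuous lo hi : 0 < lo -> lo <= hi -> continuous (sg \o clamp lo hi).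
Proof.
move=> lo0 lohi.
have cl t : 0 < clamp lo hi t by apply: lt_le_trans lo0 _; case/andP: (clamp_itv t lohi).
have -> : sg \o clamp lo hi = (fun t => (clamp lo hi t)^-1 * (clamp lo hi t * sg (clamp lo hi t))).
 by apply/funext => t /=; rewrite mulrA mulVf ?mul1r// gt_eqF.
have cc := cont_comp (@cont_clamp R lo hi) cs.
move=> t; apply: cvgM; last exact: cc.
by apply: cvgV; [rewrite gt_eqF|exact: cont_clamp].
Qed.

Lemma clamp_bounds lo hi : 0 < lo -> lo <= hi -> exists c C : R, 0 < c /\
 forall t, c <= (sg \o clamp lo hi) t <= C.
Proof.
move=> lo0 lohi; have hi0 := lt_le_trans lo0 lohi.
have [_ _ p _] := hs.
exists (lo * sg lo / hi), (hi * sg hi / lo); split.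
 by side.
move=> t /=; have /andP[c1 c2] := clamp_itv t lohi; set u := clamp lo hi t in c1 c2 *.
have u0 := lt_le_trans lo0 c1; have pu := p _ u0.
apply/andP; split.
 rewrite ler_pdivrMr// [leRHS]mulrC; apply: le_trans (slope_mono hs lo0 c1) _.
 by side.
rewrite ler_pdivlMr// [leLHS]mulrC; apply: le_trans (slope_mono hs u0 c2).
by side.
Qed.

(* Between the two thresholds the truncated energy is the original one; below, both are small. *)
Lemma e_clamp lo hi t : 0 < lo -> lo <= hi -> 0 <= t <= hi ->
 t ^+ 2 * sg (clamp lo hi t) <= t ^+ 2 * sg t + lo ^+ 2 * sg lo /\
 t ^+ 2 * sg t <= t ^+ 2 * sg (clamp lo hi t) + lo ^+ 2 * sg lo.
Proof.
move=> lo0 lohi /andP[t0 th].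
have el := e_ge0 hs (ltW lo0); have et := e_ge0 hs t0.
have [lt|tl] := leP lo t; first by rewrite clamp_id ?lt//; split; rewrite lerDl.
have [_ _ p _] := hs.
have -> : clamp lo hi t = lo by rewrite /clamp max_l ?(ltW tl)// min_r.
have h1 : t ^+ 2 * sg lo <= lo ^+ 2 * sg lo.
 by rewrite ler_wpM2r ?(ltW (p _ lo0))// lerXn2r ?nnegrE ?(ltW lo0)// ltW.
split; first by apply: le_trans h1 _; rewrite lerDr.
apply: le_trans (e_mono hs t0 (ltW tl)) _; rewrite lerDr mulr_ge0 ?sqr_ge0//.
exact: ltW (p _ lo0).
Qed.

Lemma e_vanish (eta : R) : 0 < eta -> exists2 e0 : R, 0 < e0 & forall t, 0 <= t <= e0 -> t ^+ 2 * sg t <= eta.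
Proof.
move=> eta0; have e1 := e_ge0 hs ler01; rewrite expr1n mul1r in e1.
pose e0 := Num.min 1 (eta / (sg 1 + 1)).
have s1 : 0 < sg 1 + 1 by side.
exists e0; first by rewrite lt_min ltr01 divr_gt0.
move=> t /andP[t0]; rewrite le_min => /andP[t1 t2].
have := e_small hs ler01 (introT andP (conj t0 t1)); rewrite mulr1 expr1n mul1r => h.
by apply: le_trans h _; rewrite ler_pdivlMr// in t2; nra.
Qed.

Lemma al_infty (B : R) : 0 <= B -> exists2 T : R, 0 < T & forall t, T <= t -> B <= t * sg t.
Proof.
move=> B0; have [m01 _ p _] := hs; have s1 : 0 < sg 1 by side.
have k0 : 0 < sg 1 / (B + 1) by side.
have [r [/andP[r0 r1] hr]] := slope_decay m01 k0.
exists r^-1; first by side.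
move=> t rt; have := hr _ _ hs r^-1; rewrite invr_gt0 => /(_ r0).
rewrite mulfV ?gt_eqF// mul1r mulrAC ler_pdivlMr ?ltr_wpDl// => h.
have r0' : 0 < r^-1 by side.
apply: le_trans (slope_mono hs r0' rt).
have := h; rewrite ler_pM2l// => h'; apply: le_trans h'; by side.
Qed.

End regularisation.

(** * The mollified field and its equation *)

Section averaging.
Context {R : realType} {n : nat}.
Local Notation E := 'rV[R]_n.
Local Notation mu := (@lebesgue_rV R n).

Lemma avg_bound (D : set E) (d b : R) (G : E * E -> R) : 0 < d -> measurable D -> 0 <= b ->
 mble G -> (forall p, 0 <= G p) ->
 (forall z, `|z| < d -> (\int[mu]_(x in D) (G (x, z))%:E <= b%:E)%E) ->
 (\int[mu]_(x in D) \int[mu]_z (rho d z * G (x, z))%:E <= b%:E)%E.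
Proof.
move=> d0 mD b0 mG G0 h.
have mr : mble (fun p : E * E => rho d p.2).
 by apply: (measurableT_comp (mrho d)); exact: measurable_snd.
have r0 (z : E) := rho_ge0 z d0.
have := tonelli_dom mu mu (f := fun p : E * E => rho d p.2 * G p) mD measurableT
 (measurable_funM mr mG) (fun p => mulr_ge0 (r0 _) (G0 p)).
rewrite /= => ->.
apply: (via (\int[mu]_z (b * rho d z)%:E)%E); last first.
 rewrite (int_Z mu measurableT (mrho d) (fun x _ => r0 x) b0).
 have -> : (\int[mu]_z (rho d z)%:E = 1%:E)%E by exact: rho_int.
 by rewrite mule1.
apply: ge0_le_integral => //.
- by side.
- have := @measurable_fun_fubini_tonelli_G _ _ _ _ R mu (fun p : E * E => (rho d p.2 * G p * \1_D p.1)%:E).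
 rewrite /fubini_G => mF; under eq_fun do rewrite int_indic.
 apply: mF; last by side.
 apply: mEFin; apply: measurable_funM; first exact: measurable_funM.
 by apply: measurableT_comp; [exact: measurable_indic|exact: measurable_fst].
- by apply: mEFin; apply: measurable_funM => //; exact: mrho.
move=> z _; have mGz : mble (fun x => G (x, z)).
 by apply: (measurableT_comp mG); exact: measurable_pair2.
rewrite (int_Z mu mD mGz (fun x _ => G0 _) (r0 z)).
have -> : (b * rho d z)%:E = ((rho d z)%:E * b%:E)%E by rewrite -EFinM mulrC.
have [zd|zd] := ltP `|z| d; first by apply: lee_wpmul2l; [rewrite lee_fin|exact: h].
by rewrite rho_eq0// !mul0e.
Qed.

End averaging.

Ltac pos_hook ::= match goal with
 | |- is_true (_ _ _ (ind ?k ?x)) => by case/andP: (ind_itv k x)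
 | |- is_true (_ _ _ (rho _ _)) => apply: rho_ge0; pos
 | H : slope _ _ ?sg |- is_true (_ _ _ (ev ?sg _)) => exact: (ev_ge0 _ H)
 | H : slope _ _ ?sg |- is_true (_ _ _ (_ ^+ 2 * ?sg _)) => apply: (e_ge0 H); pos
 | H : slope _ _ ?sg |- is_true (_ _ _ (_ * ?sg _)) => apply: (slope_al_ge0 H); pos
 end.

Section comparison.
Local Opaque rho.
Context {R : realType} {n : nat}.
Local Notation E := 'rV[R]_n.
Local Notation mu := (@lebesgue_rV R n).

Lemma cont_field_mol d (Y : E -> E) : 0 < d ->
 (forall i, L1 mu (fun y => Y y ord0 i)) -> continuous (field_mol d Y).
Proof.
move=> d0 iY.
have /choice[L hL] : forall i, exists L, 0 <= L /\
  forall x y, `|mol (rho d) (fun y => Y y ord0 i) y - mol (rho d) (fun y => Y y ord0 i) x| <= L * `|y - x|.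
 by move=> i; have [L L0 h] := mol_lip (iY i) (kernel_rho d0); exists L.
apply: (@lip_continuous _ _ _ _ (\sum_i L i)) => x y.
have sL : 0 <= \sum_i L i by apply: sumr_ge0 => i _; have [] := hL i.
apply: norm_leP; first by side.
move=> i; rewrite !mxE; apply: le_trans ((hL i).2 x y) _.
rewrite ler_wpM2r// (bigD1 i)//= lerDl; apply: sumr_ge0 => j _.
by have [] := hL j.
Qed.

Variables (m M : R) (sg : R -> R) (X F : E -> E).
Hypotheses (hs : slope m M sg) (cs : continuous (fun t : R => t * sg t)).
Hypothesis iX : forall i, L1 mu (fun y => X y ord0 i).
Hypothesis mX : mble X.
Hypothesis mF : mble F.
Hypothesis eX : (\int[mu]_x (ev sg (X x))%:E < +oo)%E.
Hypothesis eF : (\int[mu]_x (ev sg (F x))%:E < +oo)%E.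
Let mU x0 r : measurable (cube x0 r : set E). Proof. by side. Qed.
Let ev0 (Y : E) : 0 <= ev sg Y. Proof. by side. Qed.
Let mev (T : Type) : mble (@ev R n sg).
Proof. by apply: (measurable_e cs (F := id)). Qed.
Let mevX : mble (fun x => ev sg (X x)). Proof. exact: (measurable_e cs mX). Qed.
Let mevF : mble (fun x => ev sg (F x)). Proof. exact: (measurable_e cs mF). Qed.

Section mollified.
Variables (d k C Ca Cm : R).
Hypotheses (d0 : 0 < d) (k0 : 0 <= k) (C0 : 0 <= C) (Ca0 : 1 <= Ca) (Cm0 : 0 <= Cm).
Hypothesis hCa : forall Y Z : E, ev sg (Y + Z) <= Ca * (ev sg Y + ev sg Z).
Hypothesis hCm : forall x a : E, ((ev sg (field_mol d X x - a))%:E <=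
  \int[mu]_y (Cm * (rho d (x - y) * ev sg (X y - a)))%:E)%E.
Let XD := field_mol d X.
Let cXD : continuous XD. Proof. exact: cont_field_mol. Qed.
Let mXD : mble XD. Proof. exact: mcvg_rV. Qed.
Let r0 (z : E) : 0 <= rho d z. Proof. by side. Qed.
Let mr : mble (rho d : E -> R). Proof. exact: mrho. Qed.
Let mr2 : mble (fun p : E * E => rho d p.2).
Proof. by side. Qed.
Let madd : mble (fun p : E * E => p.1 + p.2).
Proof. by side. Qed.
Let mX2 : mble (fun p : E * E => X (p.1 + p.2)).
Proof. by side. Qed.
Let mev2 (Z : E -> E) : mble Z ->
 mble (fun p : E * E => ev sg (X (p.1 + p.2) - Z p.1)).
Proof.
move=> mZ; apply: (measurableT_comp (mev unit)); apply: maddV => //.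
by side.
Qed.

(** The right side of [pt_young], with [a] the mollified field at x, averaged over the kernel around
    x. Its integral is controlled by the energies of X and F and by the modulus of translation of
    X. *)
Definition osc_avg (x : E) : \bar R :=
 (\int[mu]_z (rho d z * (k * ev sg (X (x + z)%R) + C * (ev sg (X (x + z)%R - XD x) + ev sg (F (x + z)%R))))%:E)%E.

Let G (p : E * E) := k * ev sg (X (p.1 + p.2)) + C * (ev sg (X (p.1 + p.2) - XD p.1) + ev sg (F (p.1 + p.2))).
Let mG : mble G.
Proof.
apply: measurable_funD; apply: measurable_funM => //.
 exact: (measurableT_comp mevX madd).
apply: measurable_funD; first exact: mev2.
exact: (measurableT_comp mevF madd).
Qed.
Let G0 p : 0 <= G p.
Proof. by side. Qed.

Lemma mosc_avg : mble osc_avg.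
Proof.
have := @measurable_fun_fubini_tonelli_F _ _ _ _ R mu (fun p : E * E => (rho d p.2 * G p)%:E).
rewrite /fubini_F; apply; last by side.
by side.
Qed.

Lemma osc_avg_ge0 x : (0 <= osc_avg x)%E.
Proof. by side. Qed.

Lemma osc_avg_fin x : (osc_avg x < +oo)%E.
Proof.
have [B B0 hB] := kernel_bounded (kernel_rho (n := n) d0).
pose A := C * (Ca * ev sg (- XD x)).
have A0 : 0 <= A by side.
have kC : 0 <= k + C * Ca by side.
have sX : mble (fun z : E => ev sg (X (x + z))).
 by under eq_fun do rewrite addrC; exact: (mshiftf x mevX).
have sF : mble (fun z : E => ev sg (F (x + z))).
 by under eq_fun do rewrite addrC; exact: (mshiftf x mevF).
have mGx : mble (fun z => G (x, z)).
 by apply: (measurableT_comp mG); exact: measurable_pair1.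
apply: (@le_lt_trans _ _ (\int[mu]_z (A * rho d z + (B * (k + C * Ca) * ev sg (X (x + z)) + B * C * ev sg (F (x + z))))%:E)%E).
 apply: int_le => //.
 - by side.
 - by side.
 - by side.
 - move=> z _; have := hB z; rewrite ger0_norm// => hBz.
  have h1 := hCa (X (x + z)) (- XD x).
  have h2 : rho d z * (k * ev sg (X (x + z)) + C * (ev sg (X (x + z) - XD x) + ev sg (F (x + z)))) <=
    rho d z * (A + ((k + C * Ca) * ev sg (X (x + z)) + C * ev sg (F (x + z)))).
   apply: ler_wpM2l => //; apply: (via (k * ev sg (X (x + z)) + C * (Ca * (ev sg (X (x + z)) + ev sg (- XD x)) + ev sg (F (x + z))))).
    by rewrite lerD2l ler_wpM2l// lerD2r.
   by apply: eqW; rewrite /A; ring.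
  apply: (le_trans h2); rewrite mulrDr [rho d z * A]mulrC lerD2l.
  have -> : B * (k + C * Ca) * ev sg (X (x + z)) + B * C * ev sg (F (x + z)) =
    B * ((k + C * Ca) * ev sg (X (x + z)) + C * ev sg (F (x + z))) by ring.
  apply: ler_wpM2r => //.
  by side.
have sh (f : E -> R) : mble f -> (forall x, 0 <= f x) -> (\int[mu]_z (f (x + z)%R)%:E = \int[mu]_z (f z)%:E)%E.
 by move=> mf f0; under eq_integral do rewrite addrC; exact: int_shiftT.
have p1 (z : E) : 0 <= A * rho d z by side.
have BkC : 0 <= B * (k + C * Ca) by side.
have BC : 0 <= B * C by side.
have ma : mble (fun z : E => A * rho d z) by side.
have mb : mble (fun z : E => B * (k + C * Ca) * ev sg (X (x + z))) by side.
have mc : mble (fun z : E => B * C * ev sg (F (x + z))) by side.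
have p2 (z : E) : 0 <= B * (k + C * Ca) * ev sg (X (x + z)) by side.
have p3 (z : E) : 0 <= B * C * ev sg (F (x + z)) by side.
rewrite (int_D mu measurableT ma (measurable_funD mb mc) (fun z _ => p1 z) (fun z _ => addr_ge0 (p2 z) (p3 z))).
rewrite (int_D mu measurableT mb mc (fun z _ => p2 z) (fun z _ => p3 z)).
rewrite (int_Z mu measurableT mr (fun z _ => r0 z) A0) (int_Z mu measurableT sX (fun z _ => ev0 _) BkC).
rewrite (int_Z mu measurableT sF (fun z _ => ev0 _) BC).
rewrite (sh _ mevX ltac:(done)) (sh _ mevF ltac:(done)) (rho_int d0).
have fin (f : \bar R) (c : R) : (0 <= f)%E -> (f < +oo)%E -> (c%:E * f < +oo)%E.
 by case: f => // f f0 _; rewrite -EFinM ltry.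
rewrite mule1 lte_add_pinfty ?ltry// lte_add_pinfty// fin//; apply: int_ge0 => // z _.
Qed.

Variables (x0 : E) (r J EX EF : R).
Hypotheses (r0' : 0 < r) (dr : d <= r).
Hypothesis hJ0 : 0 <= J.
Hypothesis hJ : forall z : E, `|z| < d -> (\int[mu]_x (ev sg (X (x + z) - X x))%:E <= J%:E)%E.
Hypothesis hEX : (\int[mu]_(x in cube x0 (2 * r)) (ev sg (X x))%:E <= EX%:E)%E.
Hypothesis hEF : (\int[mu]_(x in cube x0 (2 * r)) (ev sg (F x))%:E <= EF%:E)%E.

Let hJU (z : E) : `|z| < d -> (\int[mu]_(x in cube x0 r) (ev sg (X (x + z) - X x))%:E <= J%:E)%E.
Proof.
move=> /hJ h; apply: le_trans h; apply: (int_sub mu (mU _ _) measurableT) => //.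
apply: (measurableT_comp (mev unit)); apply: maddV; last exact: moppV.
by side.
Qed.

Lemma mol_dist_int : (\int[mu]_(x in cube x0 r) (ev sg (XD x - X x))%:E <= (Cm * J)%:E)%E.
Proof.
have mXX : mble (fun x => ev sg (XD x - X x)).
 by apply: (measurableT_comp (mev unit)); apply: maddV => //; exact: moppV.
have mH : mble (fun p : E * E => Cm * ev sg (X (p.1 + p.2) - X p.1)).
 by side.
have H0 p : 0 <= Cm * ev sg (X (p.1 + p.2) - X p.1) by side.
apply: (via (\int[mu]_(x in cube x0 r) \int[mu]_z (rho d z * (Cm * ev sg (X (x + z)%R - X x)))%:E)%E).
 apply: ge0_le_integral; first exact: mU.
 - by side.
 - by side.
 - apply: measurable_funTS.
  have := @measurable_fun_fubini_tonelli_F _ _ _ _ R mu (fun p : E * E => (rho d p.2 * (Cm * ev sg (X (p.1 + p.2) - X p.1)))%:E).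
  rewrite /fubini_F; apply; last by side.
  by side.
 - move=> x _; apply: le_trans (hCm x (X x)) _.
  have mXa : mble (fun y => Cm * ev sg (X y - X x)).
   apply: measurable_funM => //; apply: (measurableT_comp (mev unit)).
   by side.
  rewrite -(rho_shift x d0 mXa (fun y => mulr_ge0 Cm0 (ev0 _))).
  apply: eqW; apply: eq_integral => y _.
  by rewrite mulrCA.
apply: (avg_bound (G := fun p : E * E => Cm * ev sg (X (p.1 + p.2) - X p.1)) d0 (mU _ _)) => //.
 by side.
move=> z zd /=; apply: int_Z_le => //; last exact: hJU.
apply: (measurableT_comp (mev unit)); apply: maddV; last exact: moppV.
by side.
Qed.

Lemma osc_avg_int :
 (\int[mu]_(x in cube x0 r) osc_avg x <= (k * EX + C * (Ca * (J + Cm * J) + EF))%:E)%E.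
Proof.
have Cap : 0 <= Ca by side.
have EX0 : 0 <= EX by rewrite -lee_fin; apply: le_trans hEX; apply: int_ge0.
have EF0 : 0 <= EF by rewrite -lee_fin; apply: le_trans hEF; apply: int_ge0.
apply: (avg_bound (G := G) d0 (mU _ _)) => //.
 apply: addr_ge0; apply: mulr_ge0 => //; apply: addr_ge0 => //; apply: mulr_ge0 => //.
 by side.
move=> z zd; rewrite /G /=.
have m1 := mshiftf z mevX; have m2 := mshiftf z mevF.
have m3 : mble (fun x : E => ev sg (X (x + z) - X x)).
 apply: (measurableT_comp (mev unit)); apply: maddV; last exact: moppV.
 by side.
have m4 : mble (fun x : E => ev sg (XD x - X x)).
 by apply: (measurableT_comp (mev unit)); apply: maddV => //; exact: moppV.
have m5 : mble (fun x : E => ev sg (X (x + z) - XD x)).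
 apply: (measurableT_comp (mev unit)); apply: maddV; last exact: moppV.
 by side.
have zr : `|z| + r <= 2 * r by rewrite mulr2n mulrDl !mul1r lerD2r; exact: le_trans (ltW zd) dr.
have i1 := le_trans (int_shift_cube_le x0 mevX (fun x => ev0 _) zr) hEX.
have i2 := le_trans (int_shift_cube_le x0 mevF (fun x => ev0 _) zr) hEF.
have p12 x : 0 <= ev sg (X (x + z) - X x) + ev sg (XD x - X x) by side.
apply: (int_D_le (mU _ _)); [exact: measurable_funM| |by move=> x _; exact: mulr_ge0| | |].
- by side.
- by side.
- exact: (int_Z_le (mU _ _) m1).
apply: (int_Z_le (mU _ _)); [exact: measurable_funD|by move=> x _; exact: addr_ge0|exact: C0|].
apply: (int_D_le (mU _ _) m5 m2) => //.
apply: (via (\int[mu]_(x in cube x0 r) (Ca * (ev sg (X (x + z) - X x) + ev sg (XD x - X x)))%:E)%E).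
 apply: int_le => //.
 - by side.
 - move=> x _; apply: le_trans (_ : ev sg ((X (x + z) - X x) + (X x - XD x)) <= _).
   by rewrite addrA subrK.
  by rewrite (evB sg (XD x)); exact: hCa.
apply: int_Z_le => //; first exact: measurable_funD.
apply: (int_D_le (mU _ _) m3 m4) => //; [exact: hJU|exact: mol_dist_int].
Qed.

(** Bounds the commutator between mollification and [Th]. As Th(XD x) is constant under the average,
    the difference is an average of Th(X y) - Th(XD x) - Th(F y), and the pointwise inequality
    applies for each y; the factor [n] is that of [field_mol_dist]. *)
Lemma mol_field_young (Y : E -> E) (C' : R) (x : E) (w : R) :
 (forall i, L1 mu (fun y => Y y ord0 i)) ->
 (forall y, `|y - x| < d -> Y y = Th sg (X y) - Th sg (F y)) -> 0 <= w -> 0 <= C' ->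
 (forall a Z G0 : E, (enorm (Th sg Z - Th sg a) + enorm (Th sg G0)) * w <=
   C' * (w ^+ 2 * sg w) + k * ev sg Z + C * (ev sg (Z - a) + ev sg G0)) ->
 ((enorm (field_mol d Y x - Th sg (XD x)) * w)%:E <=
  (n%:R * (C' * (w ^+ 2 * sg w)))%:E + n%:R%:E * osc_avg x)%E.
Proof.
move=> iY YE w0 C'0 hy.
have [i1 h1] := field_mol_dist x (Th sg (XD x)) d0 iY.
have iw : L1 mu (fun y => enorm (Y y - Th sg (XD x)) * rho d (x - y) * w).
 by have := integrableZr measurableT w i1; apply: eq_integrable.
have mYi i : mble (fun y => Y y ord0 i) by apply/measurable_EFinP; case/integrableP: (iY i).
have ew := e_ge0 hs w0.
have mXa : mble (fun y => ev sg (X y - XD x)).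
 by apply: (measurableT_comp (mev unit)); apply: maddV.
have mrx : mble (fun y : E => rho d (x - y)).
 by apply: mrefl; exact: cont_rho.
pose G1 y := k * ev sg (X y) + C * (ev sg (X y - XD x) + ev sg (F y)).
have mG1 : mble G1.
 by side.
have G10 y : 0 <= G1 y by apply: addr_ge0; apply: mulr_ge0 => //; exact: addr_ge0.
have oE : osc_avg x = (\int[mu]_y (rho d (x - y) * G1 y)%:E)%E by rewrite rho_shift.
have r0x (y : E) : 0 <= rho d (x - y) by side.
have cw : 0 <= C' * (w ^+ 2 * sg w) by side.
have bound : ((\int[mu]_y (enorm (Y y - Th sg (XD x)) * rho d (x - y) * w))%:E <=
  (C' * (w ^+ 2 * sg w))%:E + osc_avg x)%E.
 apply: (via (\int[mu]_y (C' * (w ^+ 2 * sg w) * rho d (x - y) + rho d (x - y) * G1 y)%:E)%E); last first.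
  have ma : mble (fun y : E => C' * (w ^+ 2 * sg w) * rho d (x - y)) by side.
  have mb : mble (fun y : E => rho d (x - y) * G1 y) by side.
  rewrite (int_D mu measurableT ma mb (fun y _ => mulr_ge0 cw (r0x y)) (fun y _ => mulr_ge0 (r0x y) (G10 y))).
  rewrite (int_Z mu measurableT mrx (fun y _ => r0x y) cw) (rho_int_refl x d0) mule1 oE; exact: lexx.
 apply: (Rint_le_int measurableT iw).
 - by side.
 - by side.
 move=> y _; have [xy|xy] := ltP `|x - y| d; last by rewrite rho_eq0// !mulr0 !mul0r addr0.
 rewrite YE; last by rewrite distrC.
 have h := hy (XD x) (X y) (F y).
 set u := enorm _; have -> : u * rho d (x - y) * w = rho d (x - y) * (u * w) by ring.
 have -> : C' * (w ^+ 2 * sg w) * rho d (x - y) + rho d (x - y) * G1 y =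
  rho d (x - y) * (C' * (w ^+ 2 * sg w) + G1 y) by ring.
 apply: ler_wpM2l => //.
 apply: (via ((enorm (Th sg (X y) - Th sg (XD x)) + enorm (Th sg (F y))) * w)).
  apply: ler_wpM2r => //; rewrite /u addrAC; exact: enormB_le.
 by apply: (le_trans h); rewrite /G1 addrA.
apply: (via (n%:R%:E * (\int[mu]_y (enorm (Y y - Th sg (XD x)) * rho d (x - y) * w))%:E)%E).
 rewrite RintegralZr// -EFinM lee_fin mulrA; exact: ler_wpM2r.
apply: le_trans (lee_wpmul2l _ bound) _; first by side.
by rewrite muleDr// ?EFinM// ge0_adde_def// inE ?lee_fin// osc_avg_ge0.
Qed.

End mollified.
End comparison.

(** * Comparison with the homogeneous problem *)

Section comparison_estimate.
Context {R : realType} {n : nat}.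
Local Notation E := 'rV[R]_n.
Local Notation mu := (@lebesgue_rV R n).

(* [X] is a gradient and [Th sg X - Th sg F] is divergence free, both expressed after mollification. *)
Record field_solution (sg : R -> R) (X F : E -> E) : Prop := FieldSolution {
 fs_integrable : forall i, L1 mu (fun y => X y ord0 i);
 fs_measurable : mble X;
 fs_measurableF : mble F;
 fs_energy : (\int[mu]_x (ev sg (X x))%:E < +oo)%E;
 fs_energyF : (\int[mu]_x (ev sg (F x))%:E < +oo)%E;
 fs_grad : forall d, 0 < d -> exists v, C1 v (field_mol d X);
 fs_div : forall x0 r d, 0 < r -> 0 < d -> exists Y : E -> E,
  [/\ forall i, L1 mu (fun y => Y y ord0 i),
    forall y, cube x0 (r + d) y -> Y y = Th sg (X y) - Th sg (F y) &
    forall f g, C1 f g -> csupp f g x0 r -> \int[mu]_x dotprod (field_mol d Y x) (g x) = 0] }.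

Lemma sub_telescope (V : zmodType) (a b c y : V) : a - c = (a - y) + ((b - c) + (y - b)).
Proof. by rewrite [X in _ = _ + X]addrC [y - b + _]addrA subrK addrA subrK. Qed.

(** The two error terms together carry k (N + 3) times the energy to be bounded. After
    multiplication by C2 this is half of c1 times that energy, and is absorbed on the left. *)
Lemma comparison_absorb (k2 k Cy C2 c1 N ew ea el P f A1 A2 H : R) :
 0 < c1 -> 0 < C2 -> 0 <= ew -> 0 <= el -> C2 * k * (N + 3) * 2 = c1 ->
 ew <= k2 * ea + C2 * P -> c1 * P <= f + (A1 + A2) ->
 A1 <= 2 * k * ew + 2 * Cy * el -> A2 <= k * (N + 1) * ew + N * k * el + N * H ->
 ew <= 2 * C2 / c1 * f + (2 * k2 * ea + 2 * C2 / c1 * ((N * k + 2 * Cy) * el + N * H)).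
Proof.
move=> c10 C20 ew0 el0 hk h1 h2 h3 h4.
have g1 : c1 * ew <= c1 * (k2 * ea) + C2 * (f + (A1 + A2)).
 have := ler_wpM2l (ltW c10) h1; rewrite mulrDr => h; apply: (le_trans h).
 by rewrite lerD2l mulrCA ler_wpM2l// ltW.
have g2 : C2 * (A1 + A2) <= C2 * (k * (N + 3) * ew + ((N * k + 2 * Cy) * el + N * H)).
 rewrite ler_wpM2l ?(ltW C20)//; apply: (le_trans (lerD h3 h4)).
 by apply: eqW; ring.
have g3 : C2 * (k * (N + 3) * ew) = c1 * ew / 2 by rewrite -hk; field.
rewrite -(ler_pM2l c10).
have -> : c1 * (2 * C2 / c1 * f + (2 * k2 * ea + 2 * C2 / c1 * ((N * k + 2 * Cy) * el + N * H))) =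
 2 * C2 * f + 2 * (c1 * (k2 * ea)) + 2 * C2 * ((N * k + 2 * Cy) * el + N * H).
 by field; rewrite gt_eqF.
move: g1 g2 g3; lra.
Qed.

Lemma comparison_arith (N k2 Ca EX kappa L kp C EF J Cm V k Cy el el1 eta : R) :
 2 * k2 * Ca * EX <= kappa / 2 * EX -> L * (N * kp) * EX <= kappa / 2 * EX ->
 J * (2 * (2 * k2 * Ca * Cm + L * (N * (C * (Ca * (1 + Cm)))) + Cm + 1)) = eta -> 0 <= J ->
 el1 * (2 * ((2 * k2 + L * (N * k + 2 * Cy)) * V + 1)) = eta ->
 el * ((2 * k2 + L * (N * k + 2 * Cy)) * V) <= el1 * ((2 * k2 + L * (N * k + 2 * Cy)) * V) ->
 0 <= Cm -> 0 <= EF -> 0 <= el1 ->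
 2 * k2 * (Ca * (EX + Cm * J) + el * V) +
  L * ((N * k + 2 * Cy) * el * V + N * (kp * EX + C * (Ca * (J + Cm * J) + EF))) <=
 kappa * EX + (L * (N * C) + 1) * EF + eta.
Proof.
move=> g1 g2 hJ J0 hel he Cm0 EF0 el10.
have CJ : 0 <= Cm * J by side.
by lra.
Qed.

Lemma comparison_arith2 (Cm J Q eta : R) : 0 <= Cm -> 0 <= J -> 0 <= Q ->
 J * (2 * (Q + Cm + 1)) = eta -> Cm * J <= eta.
Proof.
move=> Cm0 J0 Q0 <-; have : 0 <= Q * J by side.
by have : 0 <= Cm * J; [exact: mulr_ge0|lra].
Qed.

(** The equation of X' and the mollified equation of X are both tested with X' - XD, where XD is the
    mollified X. [Th_mono] and [e_diff] bound the energy of X' - XD by two errors: the truncation of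
    Th at XD, small with [lo], and the commutator of [mol_field_young]. Small coefficients in
    Young's inequalities give [kappa], the translation modulus and [lo] give [eta]; [K] depends on
    n, m, M and [kappa] only. *)
Lemma comparison (m M : R) : 0 < m <= 1 -> 1 <= M -> forall kappa : R, 0 < kappa ->
 exists K : R, 0 < K /\ forall sg (X F : E -> E), slope m M sg -> continuous (fun t : R => t * sg t) ->
 field_solution sg X F ->
 forall x0 (r EX EF eta T0 : R), 0 < r -> 0 < eta -> 0 <= T0 ->
 (\int[mu]_(x in cube x0 (2 * r)) (ev sg (X x))%:E <= EX%:E)%E ->
 (\int[mu]_(x in cube x0 (2 * r)) (ev sg (F x))%:E <= EF%:E)%E ->
 exists d lo hi v g (X' : E -> E),
 [/\ [/\ 0 < d, 0 < lo, lo <= hi, lo <= eta & lo ^+ 2 * sg lo <= eta],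
   forall x, cube x0 r x -> enorm (field_mol d X x) + T0 <= hi,
   hsol (sg \o clamp lo hi) v g X' x0 r,
   (\int[mu]_(x in cube x0 r) (ev (sg \o clamp lo hi) (X' x - field_mol d X x))%:E <=
    (kappa * EX + K * EF + eta)%:E)%E &
   (\int[mu]_(x in cube x0 r) (ev sg (field_mol d X x - X x))%:E <= eta%:E)%E].
Proof.
move=> m01 M1 kappa kap0.
have [c1 [c10 hc1]] := @Th_mono R n m M m01 M1.
have [Ca [Ca1 hCa]] := @ev_add R n M M1.
have [Cm [Cm1 hCm]] := @field_mol_e R n M M1.
have Cap : 0 < Ca by side.
have Cmp : 0 <= Cm by side.
(* The part of the energy of XD that [e_diff] brings in then costs at most half of [kappa * EX]; the
   other half is reserved for [kp]. *)
pose k2 := Num.min 1 (kappa / (4 * Ca)).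
have k20 : 0 < k2 by rewrite lt_min ltr01 divr_gt0// mulr_gt0.
have k21 : k2 <= 1 by rewrite ge_min lexx.
have k2a : 2 * k2 * Ca <= kappa / 2.
 have h : k2 * (4 * Ca) <= kappa by rewrite -ler_pdivlMr ?mulr_gt0// ge_min lexx orbT.
 by lra.
pose C2 := 1 + 2 / k2; have C20 : 0 < C2 by side.
have n0 : 0 <= n%:R :> R by [].
have n3 : 0 < n%:R + 3 :> R by side.
pose k := c1 / (2 * C2 * (n%:R + 3)).
have k0 : 0 < k by side.
have hk : C2 * k * (n%:R + 3) * 2 = c1 by rewrite /k; field; rewrite !gt_eqF.
clearbody k; pose L := 2 * C2 / c1; have L0 : 0 < L by side.
pose kp := kappa / (2 * L * (n%:R + 1)).
have n1 : 0 < n%:R + 1 :> R by rewrite ltr_wpDl.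
have kp0 : 0 < kp by side.
have hkp : L * (n%:R * kp) <= kappa / 2.
 have -> : L * (n%:R * kp) = kappa / 2 * (n%:R / (n%:R + 1)) by rewrite /kp; field; rewrite !gt_eqF.
 by rewrite ler_piMr ?divr_ge0 ?(ltW kap0)// ler_pdivrMr// mul1r lerDl.
clearbody kp; have [C [C0 hC]] := @pt_young R n m M m01 M1 k kp k0 kp0.
have [Cy [Cy0 hCy]] := young m01 k0.
exists (L * (n%:R * C) + 1); split; first by rewrite ltr_wpDl// mulr_ge0 ?(ltW L0)// mulr_ge0// ltW.
move=> sg X F hs cs [iX mX mF eX eF gradX divY] x0 r EX EF eta T0 r0 eta0 T00 hEX hEF.
have mU s : measurable (cube x0 s : set E) by side.
have ev0 (Y : E) : 0 <= ev sg Y by side.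
have EX0 : 0 <= EX by rewrite -lee_fin; apply: le_trans hEX; apply: int_ge0.
have EF0 : 0 <= EF by rewrite -lee_fin; apply: le_trans hEF; apply: int_ge0.
pose V := (2 * r) ^+ n; have V0 : 0 <= V by side.
pose Q1 := 2 * k2 * Ca * Cm + L * (n%:R * (C * (Ca * (1 + Cm)))) + Cm.
have L0' := ltW L0; have k20' := ltW k20; have Cap' := ltW Cap; have C0' := ltW C0.
have q1 : 0 <= 2 * k2 * Ca * Cm := mulr_ge0 (mulr_ge0 (mulr_ge0 (ler0n _ 2) k20') Cap') Cmp.
have q2 : 0 <= L * (n%:R * (C * (Ca * (1 + Cm)))).
 by side.
have Q10 : 0 <= Q1.
 by side.
pose J := eta / (2 * (Q1 + 1)).
have J0 : 0 < J by rewrite divr_gt0// mulr_gt0// ltr_wpDl.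
have hJQ : J * (2 * (Q1 + 1)) = eta by rewrite divfK// gt_eqF// mulr_gt0// ltr_wpDl.
pose Q2 := (2 * k2 + L * (n%:R * k + 2 * Cy)) * V.
have Q20 : 0 <= Q2.
 apply: mulr_ge0 V0; apply: addr_ge0; first exact: mulr_ge0 (ler0n _ 2) k20'.
 by side.
pose el1 := eta / (2 * (Q2 + 1)).
have el10 : 0 < el1 by rewrite divr_gt0// mulr_gt0// ltr_wpDl.
have hel1 : el1 * (2 * (Q2 + 1)) = eta by rewrite divfK// gt_eqF// mulr_gt0// ltr_wpDl.
clearbody J el1; have [d1 [d10 hd1]] := modular_translation hs cs iX eX J0.
pose d := Num.min d1 r.
have d0 : 0 < d by rewrite lt_min d10.
have dr : d <= r by rewrite ge_min lexx orbT.
have hJ (z : E) : `|z| < d -> (\int[mu]_x (ev sg (X (x + z) - X x))%:E <= J%:E)%E.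
 by move=> zd; apply: hd1; apply: lt_le_trans zd _; rewrite ge_min lexx.
have [Y [iY YE Y0]] := divY x0 r d r0 d0.
have [v0 Cv0] := gradX d d0.
set XD := field_mol d X in Cv0 *; set YD := field_mol d Y in Y0.
have cXD : continuous XD by exact: cont_field_mol.
have cYD : continuous YD by exact: cont_field_mol.
have [B1 B10 hB1] := cont_bounded (`|x0| + r) (cont_comp cXD (@cont_enorm R n)).
have [BY BY0 hBY] := cont_bounded (`|x0| + r) (cont_comp cYD (@cont_enorm R n)).
have inU (x : E) : cube x0 r x -> `|x| <= `|x0| + r.
 rewrite /cube/= => xr; have -> : x = x0 + (x - x0) by rewrite addrC subrK.
 by apply: le_trans (ler_normD _ _) _; rewrite lerD2l ltW.
have {}hB1 x : cube x0 r x -> enorm (XD x) <= B1.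
 by move=> /inU /hB1; apply: le_trans; exact: ler_norm.
have {}hBY x : cube x0 r x -> enorm (YD x) <= BY.
 by move=> /inU /hBY; apply: le_trans; exact: ler_norm.
(* [B2] bounds |YD - Th XD| on the cube. Beyond [T1] the value a(t) exceeds B2/k, which disposes of
   the points where X' - XD is larger than the truncation level. *)
pose B2 := BY + B1 * sg B1.
have aB1 := slope_al_ge0 hs B10.
have B20 : 0 <= B2 / k by side.
have [T1 T10 hT1] := al_infty hs B20.
have [e0 e00 he0] := e_vanish hs (eta := Num.min el1 eta) ltac:(by rewrite lt_min el10).
pose lo := Num.min e0 eta.
have lo0 : 0 < lo by rewrite lt_min e00.
have elo : lo ^+ 2 * sg lo <= Num.min el1 eta by apply: he0; rewrite (ltW lo0) ge_min lexx.
(* Up to [hi] the truncation from above does not touch XD, with a headroom [T0] at the disposal of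
   later arguments. *)
pose hi := Num.max (Num.max (T0 + B1) T1) lo.
have lohi : lo <= hi by rewrite le_max lexx orbT.
have hiT : T0 + B1 <= hi by rewrite !le_max lexx.
have hiT1 : T1 <= hi by rewrite !le_max lexx orbT.
have hi0 : 0 < hi by side.
pose sg' := sg \o clamp lo hi.
have hs' : slope m M sg' by exact: slope_clamp.
have cs' : continuous sg' by exact: clamp_continuous cs _ _ lo0 lohi.
have [c [C' [cpos sgb]]] := clamp_bounds hs lo0 lohi.
have [phi [gphi [X' [adm sX' cvgX EL]]]] := minimizer_exists x0 r hs' cpos cs' sgb Cv0.
have {}cvgX : L2cvg (cube x0 r) (fun j x => XD x + gphi j x) X' by side.
have sXD : sqint (cube x0 r) XD by exact: sqint_cont.
have sYD : sqint (cube x0 r) YD by exact: sqint_cont.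
have mXD : mble XD by case: sXD.
have mX' : mble X' by case: sX'.
pose W x := X' x - XD x.
have sW : sqint (cube x0 r) W by exact: sqintB.
have mW : mble W by side.
have sT : sqint (cube x0 r) (fun x => Th sg' (X' x)) by exact: (sqint_Th cpos cs' sgb (mU r) sX').
have sH : sqint (cube x0 r) (fun x => Th sg' (X' x) - YD x) by exact: sqintB.
pose f x := dotprod (Th sg' (X' x) - YD x) (W x).
have fi : mu.-integrable (cube x0 r) (EFin \o f) by exact: dot_integrable.
(* The fields [gphi j] converge to X' - XD in L^2 and are admissible in both equations, so the
   tested difference vanishes in the limit. *)
have f0 : \int[mu]_(x in cube x0 r) f x = 0.
 rewrite /f; under eq_Rintegral do rewrite dotC.
 have sGp j : sqint (cube x0 r) (gphi j) by have [[_ cg _] _] := adm j; exact: sqint_cont.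
 apply: (dot_lim (mU r) sGp sW sH).
 - move=> e /cvgX[N hN]; exists N => j /hN h; apply: le_trans h.
  apply: eqW; apply: eq_integral => x _; congr ((_ ^+ 2)%:E); congr enorm.
  by rewrite /W opprB addrA [gphi j x + _]addrC.
 - move=> e e0'; exists 0 => j _; have [Cj sj] := adm j.
  have sg2 : sqint (cube x0 r) (gphi j) by have [_ cg _] := Cj; exact: sqint_cont.
  have -> : \int[mu]_(x in cube x0 r) dotprod (gphi j x) (Th sg' (X' x) - YD x) =
    \int[mu]_(x in cube x0 r) dotprod (Th sg' (X' x)) (gphi j x) - \int[mu]_(x in cube x0 r) dotprod (YD x) (gphi j x).
   rewrite -RintegralB//; [|exact: dot_integrable|exact: dot_integrable].
   by apply: eq_Rintegral => x _; rewrite dotC dotBl.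
  rewrite (EL _ _ Cj sj) sub0r normrN.
  have z x : ~ cube x0 r x -> dotprod (YD x) (gphi j x) = 0 by move=> /sj[_ ->]; rewrite dot0r.
  by rewrite (Rint_supp mu z) (Y0 _ _ Cj sj) normr0 ltW.
have hCa' (Y1 Z1 : E) : ev sg (Y1 + Z1) <= Ca * (ev sg Y1 + ev sg Z1) by exact: (hCa m sg hs).
have hCm' (x a : E) : ((ev sg (field_mol d X x - a))%:E <=
  \int[mu]_y (Cm * (rho d (x - y) * ev sg (X y - a)))%:E)%E by exact: (hCm m sg hs cs d X x a d0 iX).
have distXD := mol_dist_int hs cs iX mX d0 Cmp hCm' x0 r (ltW J0) hJ.
have oscI := osc_avg_int hs cs iX mX mF d0 (ltW kp0) (ltW C0) Ca1 Cmp hCa' hCm' dr (ltW J0) hJ hEX hEF.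
pose H x := fine (osc_avg sg X F d kp C x).
have HE x : (H x)%:E = osc_avg sg X F d kp C x.
 rewrite /H fineK// ge0_fin_numE; last exact: (osc_avg_ge0 X F hs d0 (ltW kp0) (ltW C0)).
 exact: (osc_avg_fin hs cs iX mX mF eX eF d0 (ltW kp0) (ltW C0) Ca1 hCa').
have mH : mble H.
 by apply: measurableT_comp => //; exact: (mosc_avg hs cs iX mX mF d0 (ltW kp0) (ltW C0)).
have H0 x : 0 <= H x by rewrite -lee_fin HE; exact: (osc_avg_ge0 X F hs d0 (ltW kp0) (ltW C0)).
pose el := lo ^+ 2 * sg lo.
have el0 : 0 <= el by side.
have ev0' (Z : E) : 0 <= ev sg' Z by side.
pose Q x := 2 * k2 * (Ca * (ev sg (X x) + ev sg (XD x - X x)) + el) + L * ((n%:R * k + 2 * Cy) * el + n%:R * H x).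
have main x : cube x0 r x -> ev sg' (W x) <= L * f x + Q x.
 move=> xU; pose w := enorm (W x); have w0 : 0 <= w := enorm_ge0 _.
 have ea : ev sg' (XD x) <= Ca * (ev sg (X x) + ev sg (XD x - X x)) + el.
  have t1 : 0 <= enorm (XD x) <= hi.
   by rewrite enorm_ge0/=; apply: le_trans (hB1 x xU) _; apply: le_trans hiT; rewrite lerDr.
  have [h1 _] := e_clamp hs lo0 lohi t1; apply: le_trans h1 _; rewrite lerD2r.
  rewrite -/(ev sg (XD x)) -{1}(subrK (X x) (XD x)) addrC.
  by side.
 have a1 : enorm (Th sg (XD x) - Th sg' (XD x)) * w <= 2 * k * ev sg' (W x) + 2 * Cy * el.
  have rhs0 : 0 <= 2 * k * ev sg' (W x) + 2 * Cy * el.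
   apply: addr_ge0; first by side.
   by side.
  have [aLo|aLo] := ltP (enorm (XD x)) lo; last first.
   have -> : Th sg' (XD x) = Th sg (XD x).
    rewrite /Th /sg' /= clamp_id// aLo/=.
    by apply: le_trans (hB1 x xU) _; apply: le_trans hiT; rewrite lerDr.
   by rewrite subrr enorm0 mul0r.
  have slo : sg' lo = sg lo by rewrite /sg' /= clamp_id// lexx.
  have b1 : enorm (Th sg (XD x) - Th sg' (XD x)) <= 2 * (lo * sg' lo).
   apply: le_trans (enormB_le _ _) _; rewrite (Th_enorm _ hs) (Th_enorm _ hs') mulr2n mulrDl !mul1r.
   apply: lerD; last exact: (slope_mono0 hs' (enorm_ge0 _) (ltW aLo)).
   by rewrite slo; exact: (slope_mono0 hs (enorm_ge0 _) (ltW aLo)).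
  apply: le_trans (ler_wpM2r w0 b1) _.
  have -> : 2 * k * ev sg' (W x) + 2 * Cy * el = 2 * (k * ev sg' (W x) + Cy * el) by ring.
  rewrite -[leLHS]mulrA ler_wpM2l//.
  by have := hCy M sg' hs' lo w (ltW lo0) w0; rewrite -/(ev sg' (W x)) slo.
 have a2 : enorm (YD x - Th sg (XD x)) * w <= k * (n%:R + 1) * ev sg' (W x) + n%:R * k * el + n%:R * H x.
  have nH : 0 <= n%:R * H x by side.
  have nkel : 0 <= n%:R * k * el by side.
  (* For w <= hi the truncated and original energies of w differ by at most [el]. Beyond [hi] the
     truncated energy is quadratic with weight sg(hi), and the crude bound by [B2] suffices. *)
  have [whi|hiw] := leP w hi.
   have YE' y : `|y - x| < d -> Y y = Th sg (X y) - Th sg (F y).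
    move=> yx; apply: YE; rewrite /cube/= -(subrK x y) -addrA addrC.
    by apply: le_lt_trans (ler_normD _ _) _; apply: ltrD.
   have := mol_field_young hs cs mX mF d0 (ltW kp0) (ltW C0) iY YE' w0 (ltW k0) (fun a Z G0 => hC sg hs a Z G0 w w0).
   rewrite -HE -EFinM -EFinD lee_fin => h; apply: (le_trans h); rewrite lerD2r.
   have w1 : 0 <= w <= hi by side.
   have [_ h2] := e_clamp hs lo0 lohi w1.
   have h3 : w ^+ 2 * sg w <= ev sg' (W x) + el by side.
   rewrite mulrA; apply: le_trans (ler_wpM2l (mulr_ge0 n0 (ltW k0)) h3) _.
   rewrite mulrDr lerD2r; apply: ler_wpM2r => //.
   by rewrite mulrC; apply: ler_wpM2l (ltW k0) _ _ _; rewrite lerDl.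
  have s' : sg' w = sg hi.
   by rewrite /sg' /= /clamp max_r ?(le_trans lohi (ltW hiw))// min_l// ltW.
  have b2 : enorm (YD x - Th sg (XD x)) <= k * (hi * sg hi).
   apply: (via B2).
    apply: le_trans (enormB_le _ _) _; apply: lerD; first exact: hBY.
    by rewrite (Th_enorm _ hs); exact: (slope_mono0 hs (enorm_ge0 _) (hB1 x xU)).
   by rewrite -ler_pdivrMl// mulrC; exact: hT1.
  have sh0 : 0 < sg hi by have [_ _ p _] := hs; exact: p.
  apply: (via (k * ev sg' (W x))).
   apply: le_trans (ler_wpM2r w0 b2) _; rewrite /ev -/w s'.
   have -> : k * (hi * sg hi) * w = k * (sg hi * w * hi) by ring.
   have -> : k * (w ^+ 2 * sg hi) = k * (sg hi * w * w) by ring.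
   apply: ler_wpM2l (ltW k0) _ _ _; apply: ler_wpM2l (ltW hiw).
   by side.
  rewrite -[leRHS]addrA; apply: ler_wpDr; first exact: addr_ge0.
  by apply: ler_wpM2r => //; rewrite ler_peMr ?(ltW k0)// lerDr.
 have hd : c1 * (sg' (enorm (X' x) + enorm (XD x)) * w ^+ 2) <=
   f x + (enorm (Th sg (XD x) - Th sg' (XD x)) * w + enorm (YD x - Th sg (XD x)) * w).
  apply: le_trans (hc1 sg' hs' (X' x) (XD x)) _; rewrite -/(W x).
  have -> : Th sg' (X' x) - Th sg' (XD x) = (Th sg' (X' x) - YD x) +
    ((Th sg (XD x) - Th sg' (XD x)) + (YD x - Th sg (XD x))).
   exact: sub_telescope.
  rewrite dotDl lerD2l dotDl; apply: lerD; exact: dot_le_enorm.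
 have k2b : 0 < k2 <= 1 by side.
 have he := e_diff hs' k2b (enorm_ge0 (XD x)) (enorm_ge0 (X' x)) w0.
 have {}he : ev sg' (W x) <= k2 * ev sg' (XD x) + C2 * (sg' (enorm (X' x) + enorm (XD x)) * w ^+ 2).
  rewrite [enorm (X' x) + _]addrC; apply: he.
   by rewrite addrC; exact: enormB_le.
  by rewrite -{1}(subrK (XD x) (X' x)) addrC; exact: enormD.
 have h := comparison_absorb c10 C20 (ev0' (W x)) el0 hk he hd a1 a2.
 apply: (le_trans h); rewrite -/L lerD2l lerD2r; apply: ler_wpM2l => //.
 by side.
have mevX : mble (fun x => ev sg (X x)) by exact: (measurable_e cs mX).
have mXDX : mble (fun x => XD x - X x) by side.
have mevD : mble (fun x => ev sg (XD x - X x)) by exact: (measurable_e cs mXDX).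
have mevW : mble (fun x => ev sg' (W x)).
 by apply: (measurable_e _ mW); apply: contM => //; exact: cont_id.
have mQ : mble Q.
 by repeat first [assumption|exact: measurable_cst|apply: measurable_funD|apply: measurable_funM].
have nk0 : 0 <= (n%:R * k + 2 * Cy) * el.
 by side.
have p1 x : 0 <= Ca * (ev sg (X x) + ev sg (XD x - X x)) by side.
have p2 x : 0 <= 2 * k2 * (Ca * (ev sg (X x) + ev sg (XD x - X x)) + el).
 by side.
have p3 x : 0 <= L * ((n%:R * k + 2 * Cy) * el + n%:R * H x).
 by side.
have Q0 x : 0 <= Q x by exact: addr_ge0.
have Lfi : mu.-integrable (cube x0 r) (EFin \o (fun x => L * f x)).
 by have := integrableZl (mU r) L fi; apply: eq_integrable.
have Lf0 : \int[mu]_(x in cube x0 r) (L * f x) = 0 by rewrite RintegralZl// f0 mulr0.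
have PQ := Rint_sum0_le (mU r) Lfi Lf0 mevW mQ (fun x _ => ev0' _) (fun x _ => Q0 x) main.
have cstI (b : R) : (\int[mu]_(x in cube x0 r) b%:E <= (b * V)%:E)%E.
 by have -> := int_cst_cube x0 b r0; exact: lexx.
have subU : cube x0 r `<=` cube x0 (2 * r) by apply: sub_cube; rewrite ler_peMl ?(ltW r0)// ler1n.
have EXU := le_trans (int_sub mu (mU r) (mU (2 * r)) subU mevX (fun x _ => ev0 _)) hEX.
have HU : (\int[mu]_(x in cube x0 r) (H x)%:E <= (kp * EX + C * (Ca * (J + Cm * J) + EF))%:E)%E.
 by under eq_integral do rewrite HE; exact: oscI.
have QU : (\int[mu]_(x in cube x0 r) (Q x)%:E <= (2 * k2 * (Ca * (EX + Cm * J) + el * V) +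
  L * ((n%:R * k + 2 * Cy) * el * V + n%:R * (kp * EX + C * (Ca * (J + Cm * J) + EF))))%:E)%E.
 have ma : mble (fun x => ev sg (X x) + ev sg (XD x - X x)) by side.
 have mb : mble (fun x => Ca * (ev sg (X x) + ev sg (XD x - X x))) by side.
 have mc : mble (fun x => Ca * (ev sg (X x) + ev sg (XD x - X x)) + el) by side.
 have me : mble (fun x => 2 * k2 * (Ca * (ev sg (X x) + ev sg (XD x - X x)) + el)) by side.
 have mf : mble (fun x => n%:R * H x) by side.
 have mg : mble (fun x => (n%:R * k + 2 * Cy) * el + n%:R * H x) by side.
 have mh : mble (fun x => L * ((n%:R * k + 2 * Cy) * el + n%:R * H x)) by side.
 have p4 x : 0 <= ev sg (X x) + ev sg (XD x - X x) by side.
 have p5 x : 0 <= Ca * (ev sg (X x) + ev sg (XD x - X x)) + el by side.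
 have p6 x : 0 <= n%:R * H x by side.
 have p7 x : 0 <= (n%:R * k + 2 * Cy) * el + n%:R * H x by side.
 apply: (int_D_le (mU r) me mh (fun x _ => p2 x) (fun x _ => p3 x)).
  apply: (int_Z_le (mU r) mc (fun x _ => p5 x)); first by side.
  apply: (int_D_le (mU r) mb (measurable_cst el) (fun x _ => p1 x) (fun x _ => el0)) (cstI el).
  apply: (int_Z_le (mU r) ma (fun x _ => p4 x) Cap').
  exact: (int_D_le (mU r) mevX mevD (fun x _ => ev0 _) (fun x _ => ev0 _) EXU distXD).
 apply: (int_Z_le (mU r) mg (fun x _ => p7 x) L0').
 apply: (int_D_le (mU r) (measurable_cst _) mf (fun x _ => nk0) (fun x _ => p6 x) (cstI _)).
 exact: (int_Z_le (mU r) mH (fun x _ => H0 x) n0 HU).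
exists d, lo, hi, (fun j x => v0 x + phi j x), (fun j x => XD x + gphi j x), X'; split.
- split => //; first by rewrite ge_min lexx orbT.
 by apply: le_trans elo _; rewrite ge_min lexx orbT.
- by move=> x xU; apply: le_trans hiT; rewrite addrC lerD2l; exact: hB1.
- exact: (HSol (fun j => C1_add Cv0 (adm j).1) sX' cvgX EL).
- apply: (le_trans PQ); apply: (le_trans QU); rewrite lee_fin.
 have e1 : el <= el1 by apply: le_trans elo _; rewrite ge_min lexx.
 exact: (comparison_arith (ler_wpM2r EX0 k2a) (ler_wpM2r EX0 hkp) hJQ (ltW J0) hel1 (ler_wpM2r Q20 e1) Cmp EF0 (ltW el10)).
- apply: (le_trans distXD); rewrite lee_fin.
 exact: (comparison_arith2 Cmp (ltW J0) (addr_ge0 q1 q2) hJQ).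
Qed.

End comparison_estimate.

(** * Decay transferred from the homogeneous solution *)

Section good_lambda_core.
Context {R : realType} {n : nat}.
Local Notation E := 'rV[R]_n.
Local Notation mu := (@lebesgue_rV R n).

(** The quantifiers are the point: the constant is found before [sg], [c] and [C'], hence is common
    to all truncations. *)
Lemma reg_decay (m M : R) (q : nat) : 0 < m <= 1 -> 1 <= M -> (0 < n)%N ->
 exists C : R, 0 <= C /\ forall sg c C' v g (X : E -> E) x0 (r s0 T : R),
 slope m M sg -> continuous sg -> 0 < c -> (forall t, c <= sg t <= C') ->
 hsol sg v g X x0 r -> 0 < r -> 0 < s0 -> 2 * (2 * q%:R + 3) <= T ->
 (\int[mu]_(x in cube x0 r) (ev sg (X x))%:E <= (r ^+ n * (s0 ^+ 2 * sg s0))%:E)%E ->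
 (\int[mu]_(x in cube x0 (r / 2)) (ev sg (X x) * ind (8 ^+ q * (T ^+ n * s0)) (X x))%:E <=
  ((C / T) ^+ q * (r ^+ n * (s0 ^+ 2 * sg s0)))%:E)%E.
Proof.
move=> m01 M1 n0.
have [c1 [c10 hc1]] := @Th_mono R n m M m01 M1.
have [K3 [K31 hK3]] := e_scale M1 3.
have [Ke [Ke1 hKe]] := e_scale M1 (16 * n%:R).
have K30 : 0 <= K3 by side.
have Ke0 : 0 <= Ke by side.
pose Kt := n%:R * @Kgain R n M K3 c1.
have Kt0 : 0 <= Kt.
 rewrite mulr_ge0// /Kgain addr_ge0//; apply: mulr_ge0; first exact: sqr_ge0.
 apply: mulr_ge0; first by side.
 apply: mulr_ge0; last exact: mulr_ge0.
 apply: mulr_ge0; last exact: sqr_ge0.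
 by side.
have q0 : 0 <= 2 * q%:R + 3 :> R by side.
exists (8 * n%:R ^+ 2 * Ke * Kt * (2 * q%:R + 3)); split.
 by side.
move=> sg c C' v g X x0 r s0 T hs cs c0 sgb sol r0 s00 qT hX.
have he s t : 0 <= s -> 0 <= t -> s <= 3 * t -> s ^+ 2 * sg s <= K3 * (t ^+ 2 * sg t).
 exact: (hK3 m sg hs).
have heK s t : 0 <= s -> 0 <= t -> s <= 16 * n%:R * t -> s ^+ 2 * sg s <= Ke * (t ^+ 2 * sg t).
 exact: (hKe m sg hs).
have mono := hc1 sg hs.
have mX : mble X by have [] := hsol_sq sol.
apply: (decay hs n0 Kt0 mX (men cs sol) (measurable_ind sol) heK _ s00 r0 qT hX).
move=> s d k a z s1 d0 k0 sdr zd ha.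
have := trans_bound hs c0 cs sgb he c10 mono sol s1 d0 k0 sdr zd ha.
by rewrite /Kt -!mulrA [n%:R * (enorm z * _)]mulrCA.
Qed.

(** If |X| > 2k but |X'| <= k in the max norm, then |X| <= 2 |X - X'|, so the energy of the
    difference pays for e(X). Otherwise X' is above level k itself. *)
Lemma core_pointwise (m M : R) : 1 <= M -> exists C : R, 1 <= C /\
 forall sg, slope m M sg -> forall (k : R) (X X' Z : E), 0 <= k ->
 ev sg X * ind (2 * k) X <= C * (ev sg X' * ind k X' + (ev sg (X' - Z) + ev sg (Z - X))).
Proof.
move=> M1; have [Ca [Ca1 hCa]] := @ev_add R n M M1.
have [Cs [Cs1 hCs]] := e_scale M1 (2 * n%:R).
have Ca0 : 0 <= Ca by side.
have Cs0 : 0 <= Cs by side.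
exists ((Ca + Cs) * Ca); split; first by nra.
move=> sg hs k X X' Z k0.
have ev0 (Y : E) : 0 <= ev sg Y by side.
have i0 (Y : E) : 0 <= ind k Y by side.
set D := ev sg (X' - Z) + ev sg (Z - X).
have D0 : 0 <= D by side.
have hD : ev sg (X - X') <= Ca * D.
 by rewrite evB; have := hCa m sg hs (X' - Z) (Z - X); rewrite addrA subrK.
have rhs0 : 0 <= (Ca + Cs) * Ca * (ev sg X' * ind k X' + D).
 by side.
rewrite {1}/ind; case: ifP => kX; last by rewrite mulr0.
rewrite mulr1; have [kX'|kX'] := ltP k `|X'|.
 rewrite /ind kX' mulr1.
 have h := hCa m sg hs X' (X - X'); rewrite addrC subrK in h.
 have c2 : Ca <= (Ca + Cs) * Ca by nra.
 have h2 := ler_wpM2l Ca0 hD; have g1 := ler_wpM2r (ev0 X') c2.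
 have g3 : 0 <= Cs * (Ca * D) by side.
 by apply: (le_trans h); lra.
have h : ev sg X <= Cs * ev sg (X - X').
 apply: (hCs m sg hs) (enorm_ge0 _) (enorm_ge0 _) _.
 apply: le_trans (enorm_le_norm _) _; rewrite (mulrC 2) -mulrA ler_wpM2l//.
 have h1 := ler_normD (X - X') X'; rewrite subrK in h1.
 have h2 := norm_le_enorm (X - X').
 by lra.
apply: (le_trans h); apply: (via (Cs * (Ca * D))); first exact: ler_wpM2l.
have h3 : 0 <= (Ca + Cs) * Ca * (ev sg X' * ind k X').
 apply: mulr_ge0; last exact: mulr_ge0.
 by side.
have h4 : 0 <= Ca * (Ca * D) by side.
by lra.
Qed.

Lemma core_arith1 (ka EX K EF eta Ca el V : R) : 0 <= EX -> ka <= 1 -> K * EF <= EX ->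
 eta * (V + 1) <= EX -> el <= eta -> 0 <= V -> 0 <= eta -> 0 <= Ca ->
 ka * EX + K * EF + eta + (Ca * (EX + eta) + el * V) <= (4 + 2 * Ca) * EX.
Proof.
move=> EX0 ka1 h1 h2 h3 V0 eta0 Ca0.
have g1 := ler_wpM2r EX0 ka1; have g2 := ler_wpM2r V0 h3.
have g3 : 0 <= eta * V by side.
have g4 : Ca * eta <= Ca * EX by apply: ler_wpM2l => //; lra.
by lra.
Qed.

Lemma core_arith2 (Cp Cd Z X1 ka kappa EX K EF eta el V e : R) :
 0 <= Cp -> 1 <= Cd -> 0 <= Z -> 0 <= EX -> 0 <= EF -> 0 <= K -> ka <= kappa -> 0 <= ka ->
 X1 <= Z * (Cd * EX) -> el <= eta -> 0 <= V -> eta * (V + Cp * (2 + V)) <= e ->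
 Cp * (X1 + (ka * EX + K * EF + eta + (eta + el * V))) + el * V <=
 Cp * Cd * ((Z + kappa) * EX) + Cp * K * EF + e.
Proof.
move=> Cp0 Cd1 Z0 EX0 EF0 K0 hk ka0 hX hel V0 he.
have g1 := ler_wpM2r EX0 hk; have g2 := ler_wpM2r V0 hel.
have kE : 0 <= kappa * EX by side.
have g3 := ler_wpM2r kE Cd1; rewrite mul1r in g3.
have g4 : Cp * (X1 + (ka * EX + K * EF + eta + (eta + el * V))) <=
 Cp * (Z * (Cd * EX) + (Cd * (kappa * EX) + K * EF + eta + (eta + eta * V))).
 by apply: ler_wpM2l => //; lra.
by lra.
Qed.

(** [comparison] on the cube of radius r, [reg_decay] for X' in its half, [core_pointwise] to return
    to X. [Cq] precedes [kappa] in the quantifiers: later the decay fixes T, and only then is the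
    comparison made accurate enough. *)
Lemma core (m M : R) : 0 < m <= 1 -> 1 <= M -> (0 < n)%N -> exists C0 D : R, 1 <= C0 /\ 1 <= D /\
 forall q : nat, exists Cq : R, 0 <= Cq /\ forall kappa : R, 0 < kappa ->
 exists K : R, 0 < K /\ forall sg (X F : E -> E), slope m M sg -> continuous (fun t : R => t * sg t) ->
 field_solution sg X F -> forall x0 (r s0 T EF : R), 0 < r -> 0 < s0 -> 2 * (2 * q%:R + 3) <= T ->
 (\int[mu]_(x in cube x0 (2 * r)) (ev sg (X x))%:E <= (r ^+ n * (s0 ^+ 2 * sg s0))%:E)%E ->
 (\int[mu]_(x in cube x0 (2 * r)) (ev sg (F x))%:E <= EF%:E)%E ->
 (\int[mu]_(x in cube x0 (r / 2)) (ev sg (X x) * ind (2 * (8 ^+ q * (T ^+ n * (D * s0)))) (X x))%:E <=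
  (C0 * (((Cq / T) ^+ q + kappa) * (r ^+ n * (s0 ^+ 2 * sg s0))) + K * EF)%:E)%E.
Proof.
move=> m01 M1 n0.
have [Ca [Ca1 hCa]] := @ev_add R n M M1.
have Ca0 : 0 <= Ca by side.
have [Cp [Cp1 hCp]] := @core_pointwise m M M1.
have Cp0 : 0 <= Cp by side.
(* The energy of X' on the cube is at most [D * EX] by [core_arith1], and D e(s0) <= e(D s0):
   relative to X' the level is [D * s0]. *)
pose D := Ca * (4 + 2 * Ca).
have D1 : 1 <= D by rewrite /D; nra.
have D0 : 0 < D by side.
have [Cd [Cd1 hCd]] := e_scale M1 D.
have Cd0 : 0 <= Cd by side.
exists (Cp * Cd), D; split; first by nra.
split => // q; have [Cq [Cq0 hCq]] := reg_decay q m01 M1 n0.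
exists Cq; split => // kappa kap0.
pose ka := Num.min kappa 1.
have ka0 : 0 < ka by rewrite lt_min kap0/=.
have ka1 : ka <= 1 by rewrite ge_min lexx orbT.
have kak : ka <= kappa by rewrite ge_min lexx.
have [K [K0 hK]] := @comparison R n m M m01 M1 ka ka0.
have K0' := ltW K0.
exists (Cp * K); split; first by side.
move=> sg X F hs cs sol x0 r s0 T EF r0 s00 qT hEX hEF.
set EX := r ^+ n * (s0 ^+ 2 * sg s0) in hEX *.
have [iX mX mF eX eF _ _] := sol.
have mU s : measurable (cube x0 s : set E) by side.
have ev0 (Y : E) : 0 <= ev sg Y by side.
have i0 k (Y : E) : 0 <= ind k Y by side.
have i1 k (Y : E) : ind k Y <= 1 by have /andP[] := ind_itv k Y.
have mevX : mble (fun x => ev sg (X x)) by exact: (measurable_e cs mX).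
have mind k (Z : E -> E) : mble Z -> mble (fun x => ind k (Z x)).
 move=> mZ; have oU : open [set y : E | k < `|y|].
  have := @norm_continuous R E; rewrite (_ : [set y : E | _] = (fun y : E => `|y|) @^-1` [set u | k < u])//.
  by move=> cn; apply: open_comp; [move=> y _; exact: cn|exact: open_gt].
 have mS : measurable (Z @^-1` [set y : E | k < `|y|]).
  by rewrite -[X in measurable X]setTI; apply: mZ => //; exact: mopen.
 rewrite (_ : (fun x => _) = \1_(Z @^-1` [set y : E | k < `|y|])); first exact: mindicT.
 apply/funext => x; rewrite indicE /ind; case: ifP => h; first by rewrite mem_set.
 by rewrite memNset//= h.
have EF0 : 0 <= EF by rewrite -lee_fin; apply: le_trans hEF; apply: int_ge0.
have es0 : 0 < s0 ^+ 2 * sg s0 by have [_ _ p _] := hs; rewrite mulr_gt0 ?exprn_gt0// p.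
have EX0 : 0 < EX by side.
have T0 : 0 < T by apply: lt_le_trans qT; rewrite mulr_gt0// ltr_wpDl// mulr_ge0.
have CqT : 0 <= (Cq / T) ^+ q by side.
set kk := 8 ^+ q * (T ^+ n * (D * s0)).
have kk0 : 0 <= kk by side.
pose V := (2 * r) ^+ n; have V0 : 0 <= V by side.
have r2 : r / 2 <= r by rewrite ler_pdivrMr// ler_peMr ?(ltW r0)// ler1n.
have mXi : mble (fun x => ev sg (X x) * ind (2 * kk) (X x)).
 by side.
have Xi0 x : 0 <= ev sg (X x) * ind (2 * kk) (X x) by side.
(* If F dominates, the whole energy of X on the large cube is already below [K * EF]. Otherwise
   [K * EF] is absorbed into [EX] when the level of X' is estimated. *)
have [EFX|EFX] := ltP EX (K * EF).
 apply: (via EX%:E).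
  apply: le_trans hEX; apply: (via (\int[mu]_(x in cube x0 (2 * r)) (ev sg (X x) * ind (2 * kk) (X x))%:E)%E).
   apply: (int_sub mu (mU _) (mU _) _ mXi (fun x _ => Xi0 x)); apply: sub_cube.
   by apply: (le_trans r2); rewrite ler_peMl ?(ltW r0)// ler1n.
  by apply: int_le => // x _; rewrite ler_piMr.
 rewrite lee_fin; apply: le_trans (ltW EFX) _.
 apply: ler_wpDl.
  by side.
 by rewrite -[leRHS]mulrA ler_peMl// mulr_ge0.
(* The energies of X before and after truncation are comparable only below [hi]. The bound is proved
   on |X| <= J with [hi] above J, uniformly in J, and Fatou lets J grow. *)
pose trunc J x : R := if enorm (X x) <= J then 1 else 0.
have mtr J : mble (trunc J).
 have mS : measurable [set x : E | enorm (X x) <= J].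
  have mE : mble (fun x => enorm (X x)) by side.
  have := mE measurableT _ (measurable_itv `]-oo, J]); rewrite setTI.
  by side.
 rewrite (_ : trunc J = \1_[set x : E | enorm (X x) <= J]); first exact: mindicT.
 by apply/funext => x; rewrite indicE /trunc; case: ifP => h; [rewrite mem_set|rewrite memNset//= h].
have tr0 J x : 0 <= trunc J x by rewrite /trunc; case: ifP.
suff bound J : (\int[mu]_(x in cube x0 (r / 2)) (ev sg (X x) * ind (2 * kk) (X x) * trunc J x)%:E <=
  (Cp * Cd * (((Cq / T) ^+ q + kappa) * EX) + Cp * K * EF)%:E)%E.
 apply: (int_fatou (mu := mu) (h := fun J x => ev sg (X x) * ind (2 * kk) (X x) * trunc J%:R x)) => //.
 - by side.
 - by side.
 - apply/aeW => x _; apply: cvg_near_cst.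
  exists (Num.truncn (enorm (X x))).+1 => // J /= hJ; apply/eqP.
  rewrite /trunc ifT ?mulr1//; apply: (le_trans (ltW (truncnS_gt _))).
  by rewrite ler_nat.
 - move=> e e0; exists 0 => J _; apply: le_trans (bound J%:R) _.
  by side.
apply: lee_addeps_real => e e0.
pose A := V + Cp * (2 + V).
have A0 : 0 <= A by side.
(* In turn: the total error stays below e, the lower threshold stays below [D * s0], and the errors
   are small against [EX] as [core_arith1] requires. *)
pose eta := Num.min (e / (A + 1)) (Num.min s0 (EX / (V + 1))).
have V1 : 0 < V + 1 by side.
have A1 : 0 < A + 1 by side.
have eta0 : 0 < eta by rewrite !lt_min s00 !divr_gt0.
have etaA : eta * A <= e.
 have h : eta * (A + 1) <= e by rewrite -ler_pdivlMr// ge_min lexx.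
 by move: (ltW eta0); nra.
have etas : eta <= s0 by rewrite !ge_min lexx orbT.
have etaV : eta * (V + 1) <= EX by rewrite -ler_pdivlMr// !ge_min lexx !orbT.
have T00 : 0 <= Num.max J (D * s0) by rewrite le_max mulr_ge0 ?orbT// ltW.
have [d [lo [hi [v [g [X' [[d0 lo0 lohi loeta elo] hhi sol' cmp dist]]]]]]] :=
 hK sg X F hs cs sol x0 r EX EF eta _ r0 eta0 T00 hEX hEF.
set sg' := sg \o clamp lo hi in sol' cmp; set XD := field_mol d X in hhi cmp dist.
pose el := lo ^+ 2 * sg lo.
have el0 : 0 <= el by side.
have hs' : slope m M sg' by exact: slope_clamp.
have cs' : continuous sg' by exact: clamp_continuous cs _ _ lo0 lohi.
have cts' : continuous (fun t : R => t * sg' t) by apply: contM => //; exact: cont_id.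
have [c [C' [cpos sgb]]] := clamp_bounds hs lo0 lohi.
have mX' : mble X' by have [] := hsol_sq sol'.
have cXD : continuous XD by exact: cont_field_mol.
have mXD : mble XD by exact: mcvg_rV.
have ev0' (Y : E) : 0 <= ev sg' Y by side.
have mW : mble (fun x => X' x - XD x) by side.
have mDX : mble (fun x => XD x - X x) by side.
have mevW : mble (fun x => ev sg' (X' x - XD x)) by exact: (measurable_e cts' mW).
have mevD : mble (fun x => ev sg (XD x - X x)) by exact: (measurable_e cs mDX).
have mevX' : mble (fun x => ev sg' (X' x)) by exact: (measurable_e cts' mX').
have cstI s b : 0 < s -> s <= r -> 0 <= b -> (\int[mu]_(x in cube x0 s) b%:E <= (b * V)%:E)%E.
 move=> s1 sr b0; have -> := int_cst_cube x0 b s1; rewrite lee_fin ler_wpM2l// lerXn2r ?nnegrE ?mulr_ge0 ?(ltW s1) ?(ltW r0)//.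
 by side.
have sub2 : cube x0 r `<=` cube x0 (2 * r) by apply: sub_cube; rewrite ler_peMl ?(ltW r0)// ler1n.
have EXU := le_trans (int_sub mu (mU r) (mU (2 * r)) sub2 mevX (fun x _ => ev0 _)) hEX.
have hiJ x : cube x0 r x -> enorm (XD x) <= hi /\ enorm (XD x) + J <= hi /\ enorm (XD x) + D * s0 <= hi.
 move=> /hhi h; split; first by apply: le_trans h; rewrite lerDl.
 by split; apply: le_trans h; rewrite lerD2l le_max lexx ?orbT.
have Ds0 : lo <= D * s0 <= hi.
 have x0U : cube x0 r x0 by rewrite /cube/= subrr normr0.
 have [_ [_ h]] := hiJ x0 x0U; apply/andP; split; last by apply: le_trans h; rewrite lerDr enorm_ge0.
 by apply: (le_trans loeta); apply: (le_trans etas); rewrite ler_peMl// ltW.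
have eDs : (D * s0) ^+ 2 * sg' (D * s0) = (D * s0) ^+ 2 * sg (D * s0) by rewrite /sg' /= clamp_id.
have Ds00 : 0 < D * s0 by side.
have D01 : 0 <= D^-1 <= 1 by rewrite invr_ge0 (ltW D0) invf_le1.
have eD : D * (s0 ^+ 2 * sg s0) <= (D * s0) ^+ 2 * sg (D * s0).
 have Di : D^-1 * (D * s0) = s0 by rewrite [D^-1 * _]mulrA [D^-1 * D]mulVf ?[1 * s0]mul1r// gt_eqF.
 have := e_small hs (ltW Ds00) D01; rewrite Di.
 by rewrite -[D * _ <= _]ler_pdivlMl.
have X'U : (\int[mu]_(x in cube x0 r) (ev sg' (X' x))%:E <= (r ^+ n * ((D * s0) ^+ 2 * sg' (D * s0)))%:E)%E.
 have b1 : (\int[mu]_(x in cube x0 r) (Ca * (ev sg (X x) + ev sg (XD x - X x)) + el)%:E <=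
   (Ca * (EX + eta) + el * V)%:E)%E.
  have ma : mble (fun x => ev sg (X x) + ev sg (XD x - X x)) by side.
  have mb : mble (fun x => Ca * (ev sg (X x) + ev sg (XD x - X x))) by side.
  have pa x : 0 <= ev sg (X x) + ev sg (XD x - X x) by side.
  have pb x : 0 <= Ca * (ev sg (X x) + ev sg (XD x - X x)) by side.
  apply: (int_D_le (mU r) mb (measurable_cst el) (fun x _ => pb x) (fun x _ => el0)) (cstI r el r0 (lexx _) el0).
  apply: (int_Z_le (mU r) ma (fun x _ => pa x) Ca0).
  exact: (int_D_le (mU r) mevX mevD (fun x _ => ev0 _) (fun x _ => ev0 _) EXU dist).
 have md : mble (fun x => Ca * (ev sg (X x) + ev sg (XD x - X x)) + el).
  by side.
 have pd x : 0 <= Ca * (ev sg (X x) + ev sg (XD x - X x)) + el.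
  by side.
 have b2 := int_Z_le (mU r) (measurable_funD mevW md) (fun x _ => addr_ge0 (ev0' _) (pd x)) Ca0
   (int_D_le (mU r) mevW md (fun x _ => ev0' _) (fun x _ => pd x) cmp b1).
 apply: (@le_trans _ _ _ _ _ _ (le_trans b2 _)).
  apply: int_le => //.
  - by side.
  - move=> x xU; have h := hCa m sg' hs' (X' x - XD x) (XD x); rewrite subrK in h.
   apply: (le_trans h); apply: (ler_wpM2l Ca0); rewrite lerD2l.
   have t1 : 0 <= enorm (XD x) <= hi by rewrite enorm_ge0/=; have [] := hiJ x xU.
   have [h1 _] := e_clamp hs lo0 lohi t1; apply: (le_trans h1); rewrite lerD2r.
   have h2 := hCa m sg hs (X x) (XD x - X x); rewrite addrC subrK in h2.
   exact: h2.
 rewrite lee_fin eDs; apply: (via (r ^+ n * (D * (s0 ^+ 2 * sg s0)))); last first.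
  by side.
 have -> : r ^+ n * (D * (s0 ^+ 2 * sg s0)) = Ca * ((4 + 2 * Ca) * EX) by rewrite /D /EX; ring.
 apply: (ler_wpM2l Ca0).
 exact: core_arith1 (ltW EX0) ka1 EFX etaV elo V0 (ltW eta0) Ca0.
have r20 : 0 < r / 2 by side.
have dec := hCq sg' c C' v g X' x0 r (D * s0) T hs' cs' cpos sgb sol' r0 Ds00 qT X'U.
rewrite -/kk eDs in dec.
have eCd : (D * s0) ^+ 2 * sg (D * s0) <= Cd * (s0 ^+ 2 * sg s0) by exact: (hCd m sg hs _ _ (ltW Ds00) (ltW s00)).
have mi' : mble (fun x => ev sg' (X' x) * ind kk (X' x)) by side.
have pi' x : 0 <= ev sg' (X' x) * ind kk (X' x) by side.
have sub1 : cube x0 (r / 2) `<=` cube x0 r by exact: sub_cube.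
have cmp2 := le_trans (int_sub mu (mU (r / 2)) (mU r) sub1 mevW (fun x _ => ev0' _)) cmp.
have dist2 := le_trans (int_sub mu (mU (r / 2)) (mU r) sub1 mevD (fun x _ => ev0 _)) dist.
have mDe : mble (fun x => ev sg (XD x - X x) + el) by side.
have pDe x : 0 <= ev sg (XD x - X x) + el by side.
have b3 := int_D_le (mU (r / 2)) mevD (measurable_cst el) (fun x _ => ev0 _) (fun x _ => el0) dist2 (cstI (r / 2) el r20 r2 el0).
have b4 := int_D_le (mU (r / 2)) mevW mDe (fun x _ => ev0' _) (fun x _ => pDe x) cmp2 b3.
have m4 := measurable_funD mevW mDe.
have p4 x : 0 <= ev sg' (X' x - XD x) + (ev sg (XD x - X x) + el) by side.
have b5 := int_Z_le (mU (r / 2)) (measurable_funD mi' m4) (fun x _ => addr_ge0 (pi' x) (p4 x)) Cp0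
 (int_D_le (mU (r / 2)) mi' m4 (fun x _ => pi' x) (fun x _ => p4 x) dec b4).
have m5 := measurable_funM (measurable_cst Cp) (measurable_funD mi' m4).
have p5 x : 0 <= Cp * (ev sg' (X' x) * ind kk (X' x) + (ev sg' (X' x - XD x) + (ev sg (XD x - X x) + el))).
 by side.
have b6 := int_D_le (mU (r / 2)) m5 (measurable_cst el) (fun x _ => p5 x) (fun x _ => el0) b5 (cstI (r / 2) el r20 r2 el0).
apply: (@le_trans _ _ _ _ _ _ (le_trans b6 _)).
 apply: int_le => //.
 - by side.
 - by side.
 - by side.
 move=> x xs; suff p6 : ev sg (X x) * ind (2 * kk) (X x) * trunc J x <=
   Cp * (ev sg' (X' x) * ind kk (X' x) + (ev sg' (X' x - XD x) + (ev sg (XD x - X x) + el))) + el by side.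
 rewrite /trunc; case: ifP => hJ; last by rewrite mulr0; exact: (addr_ge0 (p5 x) el0).
 rewrite mulr1; have xU := sub1 _ xs; have [h1 [h2 _]] := hiJ x xU.
 have t1 : 0 <= enorm (X x) <= hi.
  rewrite enorm_ge0/=; apply: le_trans hJ _; apply: le_trans h2; by side.
 have [_ g1] := e_clamp hs lo0 lohi t1.
 have t2 : 0 <= enorm (XD x - X x) <= hi.
  rewrite enorm_ge0/=; apply: le_trans (enormB_le _ _) _; apply: le_trans h2.
  by rewrite lerD2l.
 have [g2 _] := e_clamp hs lo0 lohi t2.
 apply: (via (ev sg' (X x) * ind (2 * kk) (X x) + el)).
  apply: (via ((ev sg' (X x) + el) * ind (2 * kk) (X x))); first exact: ler_wpM2r.
  by rewrite mulrDl lerD2l ler_piMr.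
 rewrite lerD2r; apply: le_trans (hCp sg' hs' kk (X x) (X' x) (XD x) kk0) _.
 by apply: (ler_wpM2l Cp0); rewrite lerD2l lerD2l.
rewrite lee_fin.
have dd : (Cq / T) ^+ q * (r ^+ n * ((D * s0) ^+ 2 * sg (D * s0))) <= (Cq / T) ^+ q * (Cd * EX).
 apply: (ler_wpM2l CqT); rewrite /EX [leRHS]mulrCA; apply: ler_wpM2l eCd.
 by side.
exact: core_arith2 Cp0 Cd1 CqT (ltW EX0) EF0 K0' kak (ltW ka0) dd elo V0 etaA.
Qed.

End good_lambda_core.

(** * Stopping cubes and Vitali covering *)

Section covering.
Context {R : realType} {n : nat}.
Local Notation E := 'rV[R]_n.
Local Notation mu := (@lebesgue_rV R n).
Implicit Types (F G H : E -> R) (s : seq (E * R)).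
Let mU (x0 : E) r : measurable (cube x0 r). Proof. by side. Qed.

Definition cubes s : set E := [set x | exists2 c, c \in s & cube c.1 c.2 x].

Lemma cubes_cons c s : cubes (c :: s) = cube c.1 c.2 `|` cubes s.
Proof.
apply/seteqP; split => x /=.
 by move=> [d]; rewrite inE => /orP[/eqP->|ds] xd; [left|right; exists d].
move=> [xc|[d ds xd]]; first by exists c; rewrite ?inE ?eqxx.
by exists d; rewrite ?inE ?ds ?orbT.
Qed.

Lemma mcubes s : measurable (cubes s).
Proof.
elim: s => [|c s ih]; last by rewrite cubes_cons; exact: measurableU.
by rewrite (_ : cubes [::] = set0)//; apply/seteqP; split => x // [].
Qed.

Lemma int_setU_le (A B : set E) F : measurable A -> measurable B ->
 mble F -> (forall x, 0 <= F x) ->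
 (\int[mu]_(x in A `|` B) (F x)%:E <= \int[mu]_(x in A) (F x)%:E + \int[mu]_(x in B) (F x)%:E)%E.
Proof.
move=> mA mB mF F0.
have -> : A `|` B = A `|` (B `\` A) by rewrite setDE setUIr setUCr setIT.
rewrite ge0_integral_setU//.
- apply: leeD2l; apply: (int_sub mu (measurableD mB mA) mB) => //; exact: subDsetl.
- exact: measurableD.
- by side.
- by side.
- by rewrite disj_set2E setDE setICA setICr setI0.
Qed.

Lemma max_radius s : s != [::] -> exists2 c, c \in s & forall d, d \in s -> d.2 <= c.2.
Proof.
elim: s => // c [|c' s] ih _; first by exists c; rewrite ?inE// => d; rewrite inE => /eqP->.
have [e es he] := ih isT.
have [ce|ec] := leP c.2 e.2.
 exists e; first by rewrite in_cons es orbT.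
 by move=> d; rewrite in_cons => /orP[/eqP->//|]; exact: he.
exists c; first exact: mem_head.
move=> d; rewrite in_cons => /orP[/eqP->//|/he h].
exact: le_trans h (ltW ec).
Qed.

(** Select a cube of largest radius, discard all cubes meeting it, and recurse. The discarded ones
    lie in the 4-fold enlargement of the selected cube, where its hypothesis bounds H; the integrals
    of G add up because the selected cubes are disjoint. *)
Lemma vitali_bound s G H (t : R) : 0 <= t ->
 mble G -> mble H -> (forall x, 0 <= G x) -> (forall x, 0 <= H x) ->
 (forall c, c \in s -> 0 < c.2 /\
  (\int[mu]_(x in cube c.1 (4 * c.2)) (H x)%:E <= t%:E * \int[mu]_(x in cube c.1 c.2) (G x)%:E)%E) ->
 (\int[mu]_(x in cubes s) (H x)%:E <= t%:E * \int[mu]_(x in cubes s) (G x)%:E)%E.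
Proof.
move=> t0 mG mH G0 H0; have [k] := ubnP (size s); elim: k s => // k ih s sk hs.
have [->|sn] := eqVneq s [::].
 have -> : cubes [::] = set0 by apply/seteqP; split => x // [].
 by rewrite !integral_set0 mule0.
have [c cs hc] := max_radius sn; have [c0 hcH] := hs c cs.
(* Centres at distance at least the sum of the radii mean disjoint open cubes. A cube that is not
   far lies within distance d.2 + c.2 + d.2 <= 3 c.2 of the centre of c. *)
pose far (d : E * R) := c.2 + d.2 <= `|d.1 - c.1|.
pose s' := [seq d <- s | far d].
have s's d : d \in s' -> d \in s by rewrite mem_filter => /andP[].
have szs : (size s' < size s)%N.
 rewrite size_filter -(count_predC far s) -addn1 leq_add2l -has_count.
 by apply/hasP; exists c => //=; rewrite /far subrr normr0 -ltNge addr_gt0.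
have ih' := ih s' (leq_trans szs sk) (fun d ds => hs d (s's d ds)).
have mc := mU c.1 c.2; have mc4 := mU c.1 (4 * c.2).
have ms := mcubes s; have ms' := mcubes s'.
have sub1 : cubes s `<=` cubes s' `|` cube c.1 (4 * c.2).
 move=> x [d ds xd]; have [fd|nfd] := boolP (far d).
  by left; exists d => //; rewrite mem_filter fd.
 right; move: xd nfd; rewrite /cube/= /far -ltNge => xd nfd.
 rewrite -(subrK d.1 x) -addrA; apply: le_lt_trans (ler_normD _ _) _.
 by have := hc d ds; lra.
have disj : [disjoint cubes s' & cube c.1 c.2].
 apply/disj_setPS => x [[d]]; rewrite mem_filter => /andP[fd ds]; rewrite /cube/= => xd xc.
 move: fd; rewrite /far leNgt => /negP; apply.
 rewrite (_ : d.1 - c.1 = (x - c.1) - (x - d.1)); last by rewrite opprB [RHS]addrC addrA subrK.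
 by apply: le_lt_trans (ler_normB _ _) _; exact: ltrD.
have sub2 : cubes s' `|` cube c.1 c.2 `<=` cubes s.
 move=> x [[d ds xd]|xc]; last by exists c.
 by exists d => //; exact: s's.
apply: (via (\int[mu]_(x in cubes s' `|` cube c.1 (4 * c.2)) (H x)%:E)%E).
 exact: (int_sub mu ms (measurableU _ _ ms' mc4) sub1 mH (fun x _ => H0 x)).
apply: le_trans (int_setU_le ms' mc4 mH H0) _.
apply: le_trans (leeD ih' hcH) _.
rewrite -ge0_muleDr//; try side.
rewrite -ge0_integral_setU//; try side.
apply: lee_wpmul2l; first by side.
exact: (int_sub mu (measurableU _ _ ms' mc) ms sub2 mG (fun x _ => G0 x)).
Qed.

Section exit.
Variables (F : E -> R) (N lam : R).
Hypotheses (n0 : (0 < n)%N) (mF : mble F) (F0 : forall x, 0 <= F x).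
Hypotheses (FN : (\int[mu]_x (F x)%:E <= N%:E)%E) (lam0 : 0 < lam).

Let Fi : L1 mu F.
Proof.
apply: (@intg_dom _ _ _ mu setT F F) => //; last by apply: le_lt_trans FN _; rewrite ltry.
by move=> x _; rewrite ger0_norm.
Qed.
Let N0 : 0 <= N. Proof. by rewrite -lee_fin; apply: le_trans FN; apply: int_ge0. Qed.
Let subF (A : set E) : measurable A -> (\int[mu]_(x in A) (F x)%:E <= N%:E)%E.
Proof. by move=> mA; apply: le_trans FN; exact: (int_sub mu mA measurableT (@subsetT _ A) mF (fun x _ => F0 x)). Qed.
Let mFs (x : E) : mble (fun z : E => F (x + z)).
Proof. by under eq_fun do rewrite addrC; exact: (mshiftf x mF). Qed.

(** Divided by the volume it tends to 0 in L^1 as r tends to 0, by continuity of translations, hence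
    almost everywhere along a subsequence. This does the work of Lebesgue points. *)
Definition osc (r : R) (x : E) : \bar R := (\int[mu]_(z in cube 0%R r) (`|F (x + z)%R - F x|)%:E)%E.

Let madd2 : mble (fun p : E * E => `|F (p.1 + p.2) - F p.1|).
Proof.
apply: measurableT_comp => //; apply: measurable_funB.
 apply: (measurableT_comp mF); apply: maddV; [exact: measurable_fst|exact: measurable_snd].
by side.
Qed.

Lemma osc_fin r x : 0 < r -> osc r x \is a fin_num.
Proof.
move=> r0; rewrite /osc ge0_fin_numE; last by side.
apply: (@le_lt_trans _ _ (\int[mu]_(z in cube (0%R : E) r) (F (x + z) + F x)%:E)%E).
 apply: int_le => //; try side.
 - by move=> z _; apply: le_trans (ler_normB _ _) _; rewrite !ger0_norm.
have i1 : (\int[mu]_(z in cube (0%R : E) r) (F (x + z))%:E <= N%:E)%E.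
 have -> : (\int[mu]_(z in cube (0%R : E) r) (F (x + z))%:E = \int[mu]_(z in cube (0 + x)%R r) (F z)%:E)%E.
  by rewrite -(int_shift_cube 0 x r mF F0); apply: eq_integral => z _; rewrite (addrC x).
 exact: subF.
have i2 : (\int[mu]_(z in cube (0%R : E) r) (F x)%:E <= (F x * (2 * r) ^+ n)%:E)%E.
 by have -> := int_cst_cube (0 : E) (F x) r0; exact: lexx.
have h := int_D_le (mU 0 r) (mFs x) (measurable_cst (F x)) (fun z _ => F0 _) (fun z _ => F0 x) i1 i2.
by apply: le_lt_trans h _; rewrite ltry.
Qed.

Lemma mosc r : mble (osc r).
Proof.
have := @measurable_fun_fubini_tonelli_F _ _ _ _ R mu (fun p : E * E => (`|F (p.1 + p.2) - F p.1| * \1_(cube 0 r) p.2)%:E).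
rewrite /fubini_F /osc => mo; under eq_fun do rewrite int_indic.
apply: mo; last by side.
apply: mEFin; apply: measurable_funM => //.
by apply: measurableT_comp; [exact: mindicT|exact: measurable_snd].
Qed.

Lemma osc_int r e : 0 < r -> (forall z : E, `|z| < r -> (\int[mu]_x (`|F (x + z) - F x|)%:E <= e%:E)%E) ->
 (\int[mu]_x osc r x <= (e * (2 * r) ^+ n)%:E)%E.
Proof.
move=> r0 he.
have mo : mble (fun x => fine (osc r x)).
 by apply: measurableT_comp => //; exact: mosc.
have oE x : (fine (osc r x))%:E = osc r x by rewrite fineK// osc_fin.
have -> : (\int[mu]_x osc r x = \int[mu]_x (fine (osc r x))%:E)%E by apply: eq_integral => x _; rewrite oE.
apply: (param_bound (m1 := mu) (m2 := mu) (H := fun p : E * E => `|F (p.1 + p.2) - F p.1|) measurableT (mU 0 r)) => //.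
- by move=> x; apply: fine_ge0; apply: int_ge0 => z _; exact: normr_ge0.
- exact: mu_cube.
- by move=> x _; rewrite oE.
- by move=> z; rewrite /cube/= subr0 => zr; exact: he.
Qed.

(** If the integral over every cube around x were below lam r^n, that is a mean below 2^-n lam, then
    F x would be at most 2^-n lam by vanishing oscillation along a subsequence. The least index,
    hence the largest dyadic radius, at which lam r^n is reached is a stopping radius: 64 times this
    radius either belongs to a smaller index or exceeds [Rad]. *)
Lemma exit_ae : exists2 Rad : R, 0 < Rad & {ae mu, forall x, 2^-1 ^+ n * lam < F x ->
 exists j : nat, ((lam * (Rad * 2^-1 ^+ j) ^+ n)%:E <= \int[mu]_(y in cube x (Rad * 2^-1 ^+ j)) (F y)%:E)%E /\
  (\int[mu]_(y in cube x (64 * (Rad * 2^-1 ^+ j))) (F y)%:E <= (lam * (64 * (Rad * 2^-1 ^+ j)) ^+ n)%:E)%E}.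
Proof.
(* From this radius on lam r^n exceeds the total integral, so that the stopping condition fails. *)
pose Rad := N / lam + 1.
have Rad1 : 1 <= Rad by rewrite lerDr divr_ge0// ltW.
have Rad0 : 0 < Rad by side.
have RadN : N < lam * Rad ^+ n.
 apply: (@lt_le_trans _ _ (lam * Rad)); first by rewrite mulrDr mulrCA mulfV ?gt_eqF// !mulr1 ltrDl.
 by rewrite ler_wpM2l ?(ltW lam0)// ler_eXnr.
pose rad j := Rad * 2^-1 ^+ j.
have rad0 j : 0 < rad j by side.
have vol0 j : 0 < (2 * rad j) ^+ n by side.
pose h j x := ((2 * rad j) ^+ n)^-1 * fine (osc (rad j) x).
have vi j : 0 <= ((2 * rad j) ^+ n)^-1 by side.
have fo0 j x : 0 <= fine (osc (rad j) x).
 by apply: fine_ge0; apply: int_ge0 => z _; exact: normr_ge0.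
have mfo j : mble (fun x => fine (osc (rad j) x)).
 by apply: measurableT_comp => //; exact: mosc.
have conv e : 0 < e -> exists J, forall k, (J <= k)%N -> (\int[mu]_x (h k x)%:E <= e%:E)%E.
 move=> e0; have [d [d0 hd]] := tc_integrable Fi e0.
 have [J hJ] := @expr_small R 2^-1 (d / Rad) ltac:(lra) (divr_gt0 d0 Rad0).
 exists J => k Jk.
 have kd : rad k <= d.
  rewrite /rad mulrC -ler_pdivlMr//; apply: le_trans hJ.
  by rewrite ler_wiXn2l ?invr_ge0 ?invf_le1 ?ler1n.
 rewrite (int_Z mu measurableT (mfo k) (fun x _ => fo0 k x) (vi k)).
 have -> : (\int[mu]_x (fine (osc (rad k) x))%:E = \int[mu]_x osc (rad k) x)%E.
  by apply: eq_integral => x _; rewrite fineK// osc_fin.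
 have := osc_int (rad0 k) (fun z zr => hd z (lt_le_trans zr kd)).
 move=> /(lee_wpmul2l (x := (((2 * rad k) ^+ n)^-1)%:E)); rewrite lee_fin => /(_ (vi k)) h1.
 by apply: (le_trans h1); rewrite -EFinM mulrCA mulVf ?mulr1// gt_eqF.
have [phi [_ hphi]] := int_ae_subseq measurableT
 (fun j => measurable_funM (measurable_cst _) (mfo j)) (fun j x _ => mulr_ge0 (vi j) (fo0 j x)) conv.
exists Rad => //; apply: filterS hphi => x /(_ I) cx Fx.
pose P j := `[< ((lam * rad j ^+ n)%:E <= \int[mu]_(y in cube x (rad j)) (F y)%:E)%E >].
have [j0 Pj0] : exists j, P j.
 apply: contrapT => nP.
 suff : F x <= 2^-1 ^+ n * lam by rewrite leNgt Fx.
 apply/ler_addgt0Pr => e e0.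
 have /cvgrPdist_lt/(_ e e0)[k _ /(_ k (leqnn k))] := cx.
 rewrite sub0r normrN => hk.
 have h0 : 0 <= h (phi k) x by side.
 rewrite ger0_norm// in hk.
 set j := phi k in hk *.
 have npj : (\int[mu]_(y in cube x (rad j)) (F y)%:E <= (lam * rad j ^+ n)%:E)%E.
  by rewrite leNgt; apply/negP => /ltW hh; apply: nP; exists j; apply/asboolP.
 have npz : (\int[mu]_(z in cube (0%R : E) (rad j)) (F (x + z))%:E <= (lam * rad j ^+ n)%:E)%E.
  apply: le_trans npj; rewrite -{2}(add0r x) -(int_shift_cube 0 x (rad j) mF F0).
  by apply: eqW; apply: eq_integral => z _; rewrite (addrC x).
 have : ((F x * (2 * rad j) ^+ n)%:E <= (fine (osc (rad j) x) + lam * rad j ^+ n)%:E)%E.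
  have -> : (F x * (2 * rad j) ^+ n)%:E = (\int[mu]_(z in cube (0%R : E) (rad j)) (F x)%:E)%E.
   by have -> := int_cst_cube (0 : E) (F x) (rad0 j).
  have mo : mble (fun z : E => `|F (x + z) - F x|).
   by side.
  apply: (via (\int[mu]_(z in cube (0%R : E) (rad j)) (`|F (x + z) - F x| + F (x + z))%:E)%E).
   apply: int_le => //; first exact: measurable_funD.
   move=> z _; have := ler_norm (F x - F (x + z)); rewrite distrC; lra.
  apply: (int_D_le (mU _ _) mo (mFs x) (fun z _ => normr_ge0 _) (fun z _ => F0 _) _ npz).
  by rewrite fineK ?osc_fin.
 rewrite lee_fin => h1.
 have h2 : F x <= ((2 * rad j) ^+ n)^-1 * (fine (osc (rad j) x) + lam * rad j ^+ n).
  by rewrite ler_pdivlMl// mulrC.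
 apply: (le_trans h2); rewrite mulrDr [leRHS]addrC; apply: lerD; first exact: ltW hk.
 rewrite exprMn le_eqVlt; apply/orP; left; apply/eqP; rewrite exprVn; field; try side.
have exP : exists j, P j by exists j0.
case: (ex_minnP exP) => j /asboolP Pj minj.
exists j; rewrite -/(rad j); split => //.
(* 64 = 2^6: six indices down if possible. Otherwise 64 rad(j) is at least [Rad], and the total
   integral is small enough. *)
have [j6|j6] := leqP 6 j.
 have -> : 64 * rad j = rad (j - 6)%N.
  rewrite /rad -{1}(subnK j6) exprD; have -> : (2^-1 ^+ 6 : R) = 64^-1 by rewrite exprVn -natrX.
  by field.
 rewrite leNgt; apply/negP => /ltW/asboolP/minj; rewrite leqNgt => /negP; apply.
 by rewrite ltn_subrL (leq_trans _ j6).
apply: le_trans (subF (mU _ _)) _; rewrite lee_fin; apply: le_trans (ltW RadN) _.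
rewrite ler_wpM2l ?(ltW lam0)// lerXn2r ?nnegrE ?mulr_ge0 ?(ltW Rad0) ?(ltW (rad0 j))//.
rewrite /rad mulrCA ler_peMr ?(ltW Rad0)//.
have h6 : 2^-1 ^+ 6 <= 2^-1 ^+ j :> R by rewrite ler_wiXn2l ?invr_ge0 ?invf_le1 ?ler1n// ltnW.
have one : 64 * 2^-1 ^+ 6 = 1 :> R by rewrite exprVn -natrX mulfV// pnatr_eq0.
by apply: (via (64 * 2^-1 ^+ 6)); [rewrite one|rewrite ler_wpM2l].
Qed.

Lemma rat_point (x : E) (e : R) : 0 < e -> exists q : 'rV[rat]_n, `|x - map_mx ratr q| < e.
Proof.
move=> e0; have /choice[q hq] : forall i, exists q : rat, `|x ord0 i - ratr q| < e.
 move=> i; have [|q] := @rat_in_itvoo R (x ord0 i - e) (x ord0 i + e); first by lra.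
 by rewrite in_itv/= => /andP[h1 h2]; exists q; rewrite ltr_norml; apply/andP; split; lra.
exists (\row_i q i); apply/norm_ltP => // i; rewrite !mxE; exact: hq.
Qed.

(** [vitali_bound] handles finite families. Cubes with rational centres and dyadic radii satisfying
    the stopping conditions are countable, the first indices give finite families through [pickle],
    and Fatou passes to their union, which covers almost all points where H is not 0. *)
Lemma covering_bound G H (t b : R) : 0 <= t ->
 mble G -> mble H -> (forall x, 0 <= G x) -> (forall x, 0 <= H x) ->
 (\int[mu]_x (G x)%:E <= b%:E)%E ->
 (forall x, H x != 0 -> 2^-1 ^+ n * lam < F x) ->
 (forall q r, 0 < r -> ((2^-1 ^+ n * lam * r ^+ n)%:E <= \int[mu]_(x in cube q r) (F x)%:E)%E ->
  (\int[mu]_(x in cube q (16 * r)) (F x)%:E <= (lam * (32 * r) ^+ n)%:E)%E ->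
  (\int[mu]_(x in cube q (4 * r)) (H x)%:E <= t%:E * \int[mu]_(x in cube q r) (G x)%:E)%E) ->
 (\int[mu]_x (H x)%:E <= (t * b)%:E)%E.
Proof.
move=> t0 mG mH G0 H0 Gb HF step.
have [Rad Rad0 exits] := exit_ae.
pose T : countType := ('rV[rat]_n * nat)%type.
(* The centre moves by less than r to a rational point and the radius is doubled: the new cube
   contains the old one, and its 16-fold enlargement, of radius 32 r, stays in the 64-fold
   enlargement of the old one. *)
pose cub (p : T) : E * R := (map_mx ratr p.1, 2 * (Rad * 2^-1 ^+ p.2)).
pose ok (c : E * R) := `[< ((2^-1 ^+ n * lam * c.2 ^+ n)%:E <= \int[mu]_(x in cube c.1 c.2) (F x)%:E)%E /\
  (\int[mu]_(x in cube c.1 (16 * c.2)) (F x)%:E <= (lam * (32 * c.2) ^+ n)%:E)%E >].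
pose s K := [seq c <- map cub (pmap (@unpickle T) (iota 0 K)) | ok c].
have rad0 j : 0 < Rad * 2^-1 ^+ j by side.
have mi K : mble (\1_(cubes (s K)) : E -> R).
 by apply: mindicT; exact: mcubes.
apply: (int_fatou (mu := mu) (h := fun K x => H x * \1_(cubes (s K)) x)) => //; try side.
- apply: filterS exits => x hx _; apply: cvg_near_cst.
 have [Hx|Hx] := eqVneq (H x) 0; first by apply: nearW => K; rewrite Hx mul0r.
 have [j [lower upper]] := hx (HF x Hx); set r := Rad * 2^-1 ^+ j in lower upper.
 have r0 : 0 < r by side.
 have [q qx] := rat_point x r0.
 pose p : T := (q, j).
 have p1 : `|x - (cub p).1| < r by [].
 have p2 : (cub p).2 = 2 * r by [].
 have okp : ok (cub p).
  apply/asboolP; rewrite p2; split.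
   have -> : 2^-1 ^+ n * lam * (2 * r) ^+ n = lam * r ^+ n.
    by rewrite exprMn mulrAC mulrA -exprMn mulVf ?expr1n ?mul1r 1?mulrC// pnatr_eq0.
   apply: (le_trans lower); apply: (int_sub mu (mU _ _) (mU _ _) _ mF (fun z _ => F0 z)).
   by apply: sub_cube_shift; move: (ltW p1); lra.
  have -> : 32 * (2 * r) = 64 * r by ring.
  apply: le_trans upper; apply: (int_sub mu (mU _ _) (mU _ _) _ mF (fun z _ => F0 z)).
  by apply: sub_cube_shift; rewrite distrC; lra.
 exists (pickle p).+1 => // K /= Kp; apply/eqP; rewrite indicE mem_set ?mulr1//.
 exists (cub p); last by rewrite p2 /cube/=; apply: lt_trans p1 _; rewrite ltr_pMl// ltr1n.
 rewrite mem_filter okp/=; apply: map_f; rewrite mem_pmap; apply/mapP; exists (pickle p).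
  by rewrite mem_iota.
 by rewrite pickleK.
- move=> e e0; exists 0 => K _; apply: (via (t * b)%:E); last by side.
 rewrite -int_indic; apply: (via (t%:E * \int[mu]_(x in cubes (s K)) (G x)%:E)%E).
  apply: vitali_bound => // c; rewrite mem_filter => /andP[/asboolP[lower upper] /mapP[p _ cE]].
  have c0 : 0 < c.2 by rewrite cE mulr_gt0.
  by split => //; exact: step.
 rewrite EFinM; apply: lee_wpmul2l; first by side.
 apply: le_trans Gb; apply: (int_sub mu (mcubes _) measurableT _ mG (fun x _ => G0 x)).
 exact: subsetT.
Qed.

End exit.
End covering.

(** * Good-lambda inequality *)

Section good_lambda.
Context {R : realType} {n : nat}.
Local Notation E := 'rV[R]_n.
Local Notation mu := (@lebesgue_rV R n).

Definition cut (t y : R) : R := if t < y then y else 0.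

Lemma cut_ge0 t y : 0 <= y -> 0 <= cut t y. Proof. by rewrite /cut; case: ifP. Qed.

Lemma cut_le t y : 0 <= y -> cut t y <= y. Proof. by rewrite /cut; case: ifP. Qed.

Lemma mcut d (T : measurableType d) t (f : T -> R) :
 mble f -> mble (fun x => cut t (f x)).
Proof.
move=> mf; apply: measurable_fun_ifT => //.
by apply: measurable_fun_ltr.
Qed.

(** If the sum exceeds 2L, the larger of x and y/g exceeds L and bounds the sum by twice itself. *)
Lemma cut_add (L g x y : R) : 0 < g -> 0 <= x -> 0 <= y ->
 cut (2 * L) (x + g^-1 * y) <= 2 * (cut L x + g^-1 * cut (g * L) y).
Proof.
move=> g0 x0 y0; have gi : 0 <= g^-1 by side.
have hg : (g * L < y) = (L < g^-1 * y) by rewrite ltr_pdivlMl.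
have gy := mulr_ge0 gi y0.
rewrite /cut hg; case: ltP => h1; case: ltP => h2; case: ltP => h3; lra.
Qed.

Lemma pow2_bound (x : R) : exists j : nat, x <= 2 ^+ j.
Proof.
exists (Num.truncn x).+1; apply: le_trans (ltW (truncnS_gt x)) _.
by rewrite -natrX ler_nat; apply/ltnW/ltn_expl.
Qed.

Lemma pow2_small (x y : R) : 0 < y -> exists j : nat, forall l, (j <= l)%N -> x * 2^-1 ^+ l <= y.
Proof.
move=> y0; have [j hj] := pow2_bound (`|x| / y); exists j => l jl.
have p0 : 0 < 2 ^+ l :> R by side.
rewrite exprVn ler_pdivrMr//; apply: le_trans (ler_norm x) _.
move: hj; rewrite ler_pdivrMr// mulrC => hj; apply: (le_trans hj).
by rewrite ler_wpM2l ?(ltW y0)// ler_weXn2l ?ler1n.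
Qed.

Lemma e_pow2 (m M E2 : R) sg j t : slope m M sg -> 0 <= E2 ->
 (forall t, 0 <= t -> (2 * t) ^+ 2 * sg (2 * t) <= E2 * (t ^+ 2 * sg t)) ->
 0 <= t -> (2 ^+ j * t) ^+ 2 * sg (2 ^+ j * t) <= E2 ^+ j * (t ^+ 2 * sg t).
Proof.
move=> hs E20 h2 t0; elim: j => [|j ih]; first by rewrite !expr0 !mul1r.
rewrite [2 ^+ j.+1]exprS -[2 * _ * t]mulrA [E2 ^+ j.+1]exprS -[leRHS]mulrA.
apply: le_trans (h2 _ _) _; first by side.
by side.
Qed.

Lemma e_surj (m M : R) sg (L : R) : slope m M sg -> continuous (fun t : R => t * sg t) -> 0 < L ->
 exists2 s, 0 < s & s ^+ 2 * sg s = L.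
Proof.
move=> hs cs L0; have [T T0 hT] := al_infty hs (ltW L0).
pose b := Num.max T 1.
have b1 : 1 <= b by rewrite le_max lexx orbT.
have b0 : 0 <= b by side.
have hb : L <= b ^+ 2 * sg b.
 have h1 : L <= b * sg b by apply: hT; rewrite le_max lexx.
 rewrite expr2 -mulrA; apply: (le_trans h1); rewrite ler_peMl//; exact: le_trans (ltW L0) h1.
have ce : continuous (fun t : R => t ^+ 2 * sg t).
 rewrite (_ : (fun t : R => _) = (fun t : R => t * (t * sg t))).
  by apply: contM => //; exact: cont_id.
 by apply/funext => t; rewrite expr2 mulrA.
have [|c] := @IVT R (fun t => t ^+ 2 * sg t) 0 b L b0 (continuous_subspaceT ce).
 by rewrite expr0n mul0r ge_min (ltW L0) le_max hb orbT.
rewrite in_itv/= => /andP[c0 _] cL; exists c => //.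
rewrite lt_neqAle c0 andbT eq_sym; apply/eqP => cz.
by move: cL; rewrite cz expr0n mul0r => z; rewrite -z ltxx in L0.
Qed.

Lemma mind_comp k (Z : E -> E) : mble Z ->
 mble (fun x => ind k (Z x)).
Proof.
move=> mZ; have oU : open [set y : E | k < `|y|].
 have := @norm_continuous R E; rewrite (_ : [set y : E | _] = (fun y : E => `|y|) @^-1` [set u | k < u])//.
 by move=> cn; apply: open_comp; [move=> y _; exact: cn|exact: open_gt].
have mS : measurable (Z @^-1` [set y : E | k < `|y|]).
 by rewrite -[X in measurable X]setTI; apply: mZ => //; exact: mopen.
rewrite (_ : (fun x => _) = \1_(Z @^-1` [set y : E | k < `|y|])); first exact: mindicT.
apply/funext => x; rewrite indicE /ind; case: ifP => h; first by rewrite mem_set.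
by rewrite memNset//= h.
Qed.

(** The race between decay and doubling, with T = 2^l. By Dh <= 2^P1, the loss Dh^(k + k1) is a
    constant times T^(P1 P n); the exponent q = P1 P n + 1 of the decay exceeds that by one, and a
    factor 1/T = 2^-l is left over to beat all constants. *)
Lemma good_lambda_choice (C0 Cq Dh : R) (P1 P q a0 l k k1 : nat) (c : R) :
 0 <= Cq -> 0 <= C0 -> 0 <= Dh -> Dh <= 2 ^+ P1 -> k = (P * (a0 + 3 * q + l * n))%N -> q = (P1 * P * n).+1 ->
 C0 * (2 ^+ (P1 * (P * (a0 + 3 * q) + k1)) * Cq ^+ q) * 2^-1 ^+ l <= c ->
 C0 * ((Cq / 2 ^+ l) ^+ q * Dh ^+ (k + k1)) <= c.
Proof.
move=> Cq0 C00 Dh0 hD hk hq; apply: le_trans; rewrite -mulrA; apply: ler_wpM2l => //.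
have h1 : Dh ^+ (k + k1) <= 2 ^+ (P1 * (k + k1)).
 by rewrite exprM lerXn2r// nnegrE exprn_ge0.
apply: (via ((Cq / 2 ^+ l) ^+ q * 2 ^+ (P1 * (k + k1)))).
 by side.
rewrite exprMn [leLHS]mulrAC -mulrA [leRHS]mulrAC [leRHS]mulrC; apply: ler_wpM2l; first by side.
have -> : (P1 * (k + k1) = P1 * (P * (a0 + 3 * q) + k1) + l * (P1 * P * n))%N by rewrite hk; ring.
rewrite [in leLHS]hq exprD.
have -> : ((2 ^+ l)^-1 : R) ^+ (P1 * P * n).+1 = (2^-1 ^+ l) * ((2 ^+ (l * (P1 * P * n)))^-1).
 by rewrite exprS exprVn; congr (_ * _); rewrite ?exprVn ?exprM.
by rewrite -hq mulrACA mulfV ?mulr1// expf_neq0.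
Qed.

(** Stopping cubes of F0 = e(X) + e(F)/gam at level [lam]: [core] controls the energy of X above a
    high level on the 4-fold cube, and [covering_bound] sums. The constants precede [sg], X and F,
    and the smallness of [th] is measured against Dh^K, the growth of the weight between the two
    levels. *)
Lemma good_lambda (m M Dh : R) : 0 < m <= 1 -> 1 <= M -> (0 < n)%N -> 1 <= Dh ->
 exists (K : nat) (gam th : R), [/\ 0 < gam, 0 <= th, th * Dh ^+ K <= 4^-1 &
 forall sg (X F : E -> E), slope m M sg -> continuous (fun t : R => t * sg t) ->
 field_solution sg X F -> forall (L a b : R), 0 < L ->
 (\int[mu]_x (cut L (ev sg (X x)))%:E <= a%:E)%E ->
 (\int[mu]_x (cut (gam * L) (ev sg (F x)))%:E <= b%:E)%E ->
 (\int[mu]_x (cut (2 ^+ K * L) (ev sg (X x)))%:E <= (th * (a + b / gam))%:E)%E].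
Proof.
move=> m01 M1 n0 Dh1.
have [C0 [D [C01 [D1 hcore]]]] := @core R n m M m01 M1 n0.
have [E2 [E21 hE2]] := e_scale M1 2.
have Dh0 : 0 < Dh by side.
have [P hP] := pow2_bound E2; have [P1 hP1] := pow2_bound Dh.
have [a0 ha0] := pow2_bound (2 * n%:R * D).
(* [q] is the exponent demanded by [good_lambda_choice]; k1 = 4n + 2 is such that the threshold
   [lam * 4^-1 ^+ n / 2] below equals 2L. *)
pose q := (P1 * P * n).+1; pose k1 := (4 * n + 2)%N.
have [Cq [Cq0 hq]] := hcore q.
pose c4 : R := 4 * 64 ^+ n.
have c40 : 0 < c4 by side.
have C00 : 0 < C0 by side.
have cC0 : 0 < c4 * C0 by side.
(* The admissible 1/4 is shared in thirds by the decay term, by the comparison error [kap] and by F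
   through [gam]. *)
have t12 : 0 < 12^-1 :> R by side.
have [l1 hl1] := pow2_small (c4 * C0 * (2 ^+ (P1 * (P * (a0 + 3 * q) + k1)) * Cq ^+ q)) t12.
have [l2 hl2] := pow2_bound (2 * (2 * q%:R + 3)).
pose l := maxn l1 l2.
pose T : R := 2 ^+ l.
have hT : 2 * (2 * q%:R + 3) <= T.
 by apply: le_trans hl2 _; rewrite ler_weXn2l ?ler1n// leq_maxr.
have T0 : 0 < T by side.
pose k := (P * (a0 + 3 * q + l * n))%N.
pose K := (k + k1)%N.
have DK : 0 < Dh ^+ K by side.
have g1 : c4 * C0 * ((Cq / T) ^+ q * Dh ^+ K) <= 12^-1.
 apply: (@good_lambda_choice _ _ _ P1 P q a0 l k k1) => //; [exact: ltW|exact: ltW|].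
 by apply: hl1; exact: leq_maxl.
pose kap := 12^-1 / (c4 * C0 * Dh ^+ K).
have kap0 : 0 < kap by side.
have [Kc [Kc0 hcr]] := hq kap kap0.
pose gam := 12^-1 / (c4 * Kc * Dh ^+ K).
have gam0 : 0 < gam by side.
pose tc := 2 * 64 ^+ n * (C0 * ((Cq / T) ^+ q + kap) + Kc * gam).
have CqT : 0 <= (Cq / T) ^+ q by side.
have tc0 : 0 <= tc.
 apply: mulr_ge0; first by side.
 apply: addr_ge0; apply: mulr_ge0; rewrite ?(ltW C00) ?(ltW Kc0) ?(ltW gam0)//.
 by side.
exists K, gam, (2 * tc); split => //.
- by side.
- have -> : 2 * tc * Dh ^+ K = c4 * C0 * ((Cq / T) ^+ q * Dh ^+ K) + 12^-1 + 12^-1.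
  rewrite /tc /kap /gam /c4; field.
  by side.
 by move: g1; lra.
move=> sg X F hs cs sol L a b L0 ha hb.
have [iX mX mF eX eF _ _] := sol.
have ev0 (Y : E) : 0 <= ev sg Y by side.
have mevX : mble (fun x => ev sg (X x)) by exact: (measurable_e cs mX).
have mevF : mble (fun x => ev sg (F x)) by exact: (measurable_e cs mF).
pose L1 := 2 ^+ k1 * L.
have L10 : 0 < L1 by side.
have [s0 s00 sE] := e_surj hs cs L10.
pose f x := ev sg (X x); pose g x := ev sg (F x).
have f0 x : 0 <= f x by side.
have g0 x : 0 <= g x by side.
pose F0 x := f x + gam^-1 * g x.
have gi0 : 0 <= gam^-1 by side.
have mF0 : mble F0 by side.
have F00 x : 0 <= F0 x by side.
pose lam := L1 / 4 ^+ n.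
have lam0 : 0 < lam by side.
pose kk := 2 * (8 ^+ q * (T ^+ n * (D * s0))).
have D0 : 0 < D by side.
have T1 : 1 <= T by rewrite exprn_ege1// ler1n.
have skk : s0 <= kk.
 have t1 : 1 <= T ^+ n by rewrite exprn_ege1.
 have e1 : 1 <= 8 ^+ q :> R by rewrite exprn_ege1// ler1n.
 rewrite /kk !mulrA ler_peMl ?(ltW s00)//.
 rewrite -!mulrA; apply: mulr_ege1; first by rewrite ler1n.
 by apply: mulr_ege1 => //; apply: mulr_ege1.
pose H x := f x * ind kk (X x).
have mH : mble H.
 apply: measurable_funM => //; exact: (mind_comp kk mX).
have ind0 (Y : E) : 0 <= ind kk Y by have /andP[] := ind_itv kk Y.
have H0 x : 0 <= H x by exact: (mulr_ge0 (f0 x) (ind0 _)).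
pose G x := cut (lam * 4^-1 ^+ n / 2) (F0 x).
have mG : mble G by exact: mcut.
have G0 x : 0 <= G x by exact: cut_ge0.
have Lk : lam * 4^-1 ^+ n / 2 = 2 * L.
 rewrite /lam /L1 /k1 exprD exprM (_ : 2 ^+ 4 = 4 ^+ 2 :> R); last by rewrite -!natrX.
 rewrite -exprM mulnC exprM exprVn; field.
 by side.
have m1 : mble (fun x => cut L (f x)) by exact: mcut.
have m2 : mble (fun x => cut (gam * L) (g x)) by exact: mcut.
have GB : (\int[mu]_x (G x)%:E <= (2 * (a + gam^-1 * b))%:E)%E.
 apply: (via (\int[mu]_x (2 * (cut L (f x) + gam^-1 * cut (gam * L) (g x)))%:E)%E).
  apply: int_le => //.
   by side.
  by move=> x _; rewrite /G Lk; exact: (cut_add _ gam0 (f0 x) (g0 x)).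
 have m3 : mble (fun x => gam^-1 * cut (gam * L) (g x)) by side.
 have p1 x : 0 <= cut L (f x) by exact: cut_ge0.
 have p2 x : 0 <= cut (gam * L) (g x) by exact: cut_ge0.
 have p3 x : 0 <= gam^-1 * cut (gam * L) (g x) by side.
 apply: (int_Z_le measurableT (measurable_funD m1 m3) (fun x _ => addr_ge0 (p1 x) (p3 x))) => //.
 apply: (int_D_le measurableT m1 m3 (fun x _ => p1 x) (fun x _ => p3 x) ha).
 exact: (int_Z_le measurableT m2 (fun x _ => p2 x) gi0 hb).
have mU x0 r : measurable (cube x0 r : set E) by side.
have FN : (\int[mu]_x (F0 x)%:E < +oo)%E.
 rewrite /F0 int_D//; [|exact: measurable_funM|by move=> x _; exact: mulr_ge0].
 rewrite int_Z// lte_add_pinfty//.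
 by have := eF; rewrite -/(g _); case: (integral _ _ _) (int_ge0 mu (fun x (_ : setT x) => ev0 (F x))) => // u _ _; rewrite -EFinM ltry.
have FNr : (\int[mu]_x (F0 x)%:E <= (fine (\int[mu]_x (F0 x)%:E))%:E)%E.
 by rewrite fineK// ge0_fin_numE//; apply: int_ge0.
have main : (\int[mu]_x (H x)%:E <= (tc * (2 * (a + gam^-1 * b)))%:E)%E.
 apply: (covering_bound n0 mF0 F00 FNr lam0 tc0 mG mH G0 H0 GB).
  move=> x; rewrite /H /ind; case: ifP => hx; last by rewrite mulr0 eqxx.
  move=> _; apply: (@lt_le_trans _ _ L1).
   apply: (@lt_le_trans _ _ lam).
    by rewrite (gtr_pMl _ lam0) exprn_ilt1 ?invr_ge0 ?invf_lt1 ?ltr1n// -lt0n.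
   by rewrite /lam ler_pdivrMr ?exprn_gt0// ler_peMr ?(ltW L10)// exprn_ege1// ler1n.
  apply: (via (f x)); last by rewrite lerDl mulr_ge0.
  rewrite -sE; apply: (e_mono hs (ltW s00)); apply: (le_trans skk).
  by apply: le_trans (ltW hx) _; exact: norm_le_enorm.
 (* [core] is used at radius 8r: it looks at the 16-fold cube, where the stopping rule bounds the
    integral by (8r)^n e(s0), and concludes on the 4-fold cube required by the covering. *)
 move=> x0 r r0 lower upper.
 have r8 : 0 < 8 * r by side.
 have e16 : 2 * (8 * r) = 16 * r by ring.
 have upf : (\int[mu]_(x in cube x0 (2 * (8 * r))) (ev sg (X x))%:E <= ((8 * r) ^+ n * (s0 ^+ 2 * sg s0))%:E)%E.
  rewrite e16 sE; apply: (via (lam * (32 * r) ^+ n)%:E).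
   apply: le_trans upper; apply: int_le => // x _; by rewrite lerDl mulr_ge0.
  rewrite lee_fin /lam !exprMn (_ : 32 = 8 * 4 :> R); last by rewrite -natrM.
  by rewrite exprMn le_eqVlt; apply/orP; left; apply/eqP; field; rewrite expf_neq0.
 have upg : (\int[mu]_(x in cube x0 (2 * (8 * r))) (ev sg (F x))%:E <= (gam * (lam * (32 * r) ^+ n))%:E)%E.
  rewrite e16; apply: (via (\int[mu]_(x in cube x0 (16 * r)) (gam * F0 x)%:E)%E).
   apply: int_le => //; first exact: measurable_funM.
   by move=> x _; rewrite /F0 mulrDr mulrA mulfV ?gt_eqF// mul1r lerDr mulr_ge0// ltW.
  exact: (int_Z_le (mU _ _) mF0 (fun x _ => F00 x) (ltW gam0) upper).
 have := hcr sg X F hs cs sol x0 (8 * r) s0 T _ r8 s00 hT upf upg.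
 have -> : 8 * r / 2 = 4 * r by field.
 move=> hc; apply: (le_trans hc).
 (* Cutting F0 at [lam * 4^-1 ^+ n / 2] over a cube of volume (2r)^n removes at most half of the
    lower bound 2^-n lam r^n, so G retains the other half. *)
 have lowG : ((2^-1 ^+ n * lam * r ^+ n / 2)%:E <= \int[mu]_(x in cube x0 r) (G x)%:E)%E.
  have h1 : (\int[mu]_(x in cube x0 r) (F0 x)%:E <= (2^-1 ^+ n * lam * r ^+ n / 2)%:E + \int[mu]_(x in cube x0 r) (G x)%:E)%E.
   have cG : (\int[mu]_(x in cube x0 r) (lam * 4^-1 ^+ n / 2)%:E = (2^-1 ^+ n * lam * r ^+ n / 2)%:E)%E.
    have -> := int_cst_cube x0 (lam * 4^-1 ^+ n / 2) r0.
    congr EFin; rewrite exprMn (_ : 4^-1 = 2^-1 * 2^-1 :> R); last by rewrite -invfM -natrM.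
    by rewrite exprMn !exprVn; field; rewrite expf_neq0.
   have l0 : 0 <= lam * 4^-1 ^+ n / 2 by side.
   rewrite -cG -(int_D mu (mU x0 r) (measurable_cst _) mG (fun x _ => l0) (fun x _ => G0 x)).
   apply: int_le => //; first exact: measurable_funD.
   by move=> x _; rewrite /G /cut /=; case: ltP => h; [rewrite lerDr|rewrite addr0].
  have h2 := le_trans lower h1.
  have -> : 2^-1 ^+ n * lam * r ^+ n / 2 = 2^-1 ^+ n * lam * r ^+ n - 2^-1 ^+ n * lam * r ^+ n / 2 by field.
  by rewrite EFinB leeBlDl.
 apply: le_trans (lee_wpmul2l _ lowG); last by side.
 rewrite -EFinM lee_fin /tc sE.
 have -> : L1 = lam * 4 ^+ n by rewrite /lam divfK// expf_neq0.
 apply: eqW.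
 rewrite (_ : 64 = 2 * 8 * 4 :> R); last by rewrite -!natrM.
 rewrite (_ : 32 = 8 * 4 :> R); last by rewrite -natrM.
 rewrite !exprMn exprVn; field.
 by side.
have -> : 2 * tc * (a + b / gam) = tc * (2 * (a + gam^-1 * b)) by rewrite [b / gam]mulrC; ring.
apply: le_trans main; apply: int_le => //; first exact: mcut.
 by move=> x _; exact: cut_ge0.
move=> x _; rewrite /cut; case: ifP => hx; last exact: H0.
rewrite /H /ind; case: ifP => hk; first by rewrite mulr1.
(* Below the level kk one has |X| <= n kk <= 2^(a0 + 3q + ln) s0, and doubling of the energy gives
   e(X) <= 2^k e(s0) = 2^K L, against the assumption. *)
exfalso; move/negbT: hk; rewrite -leNgt => hk.
move: hx; apply/negP; rewrite -leNgt.
have kk0 : 0 <= kk by exact: le_trans (ltW s00) skk.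
have j0 : 0 <= 2 ^+ (a0 + 3 * q + l * n) * s0 by side.
apply: (via ((2 ^+ (a0 + 3 * q + l * n) * s0) ^+ 2 * sg (2 ^+ (a0 + 3 * q + l * n) * s0))).
 apply: (e_mono hs (enorm_ge0 _)); apply: le_trans (enorm_le_norm _) _.
 apply: le_trans (ler_wpM2l _ hk) _ => //.
 have -> : n%:R * kk = 2 * n%:R * D * (8 ^+ q * T ^+ n * s0) by rewrite /kk; ring.
 rewrite !exprD [2 ^+ (3 * q)]exprM (_ : 2 ^+ 3 = 8 :> R); last by rewrite -natrX.
 rewrite [2 ^+ (l * n)]exprM -/T -[leRHS]mulrA -[leRHS]mulrA -[8 ^+ q * T ^+ n * s0]mulrA.
 apply: ler_wpM2r => //.
 by side.
have e2 t : 0 <= t -> (2 * t) ^+ 2 * sg (2 * t) <= E2 * (t ^+ 2 * sg t).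
 by move=> t0; apply: (hE2 m sg hs) => //; rewrite mulr_ge0.
have E20 : 0 <= E2 by side.
apply: le_trans (e_pow2 _ hs E20 e2 (ltW s00)) _.
rewrite sE /L1 mulrA; apply: ler_wpM2r; first exact: ltW.
rewrite /K [2 ^+ (k + k1)]exprD; apply: ler_wpM2r; first by side.
by rewrite /k [2 ^+ (P * _)]exprM lerXn2r// nnegrE ?exprn_ge0.
Qed.

End good_lambda.

(** * Summation over dyadic levels *)

Section dyadic_sums.
Context {R : realType}.

Lemma slope_pow2 (m M D : R) sg j y : slope m M sg -> 0 <= D ->
 (forall t, 0 < t -> 2 * t * sg (2 * t) <= D * (t * sg t)) -> 0 <= y ->
 2 ^+ j * y * sg (2 ^+ j * y) <= D ^+ j * (y * sg y).
Proof.
move=> hs D0 hD; rewrite le_eqVlt => /predU1P[<-|y0]; first by rewrite !mulr0 !mul0r mulr0.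
elim: j => [|j ih]; first by rewrite !expr0 !mul1r.
rewrite [2 ^+ _]exprS [D ^+ _]exprS -[2 * _ * y]mulrA -[leRHS]mulrA.
apply: le_trans (hD _ _) _; first by side.
by side.
Qed.

(** Shifting the index by K costs Dh^K in the weights and gains [th], together at most 1/4, so the
    sum of the [A i * P i] reappears on the right with coefficient 1/4. It is finite and can be
    absorbed. The first K terms, out of reach of the shift, are bounded crudely through [N]. *)
Lemma seq_absorb (A P Q : nat -> R) (Dh th N : R) (K J : nat) :
 (forall i, 0 <= A i) -> (forall i, 0 <= P i) -> (forall i, 0 <= Q i) ->
 0 <= Dh -> 0 <= th -> th * Dh ^+ K <= 4^-1 ->
 (forall i, A i.+1 <= Dh * A i) -> (forall i, (i <= K)%N -> A i <= A K) ->
 (forall i, P (i + K)%N <= th * (P i + Q i)) -> (forall i, P i <= N) ->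
 \sum_(0 <= i < J) A i * P i <= 2 * (K%:R * (A K * N)) + \sum_(0 <= i < J) A i * Q i.
Proof.
move=> A0 P0 Q0 Dh0 th0 hth hA hK hP hN.
have AK i : A (i + K)%N <= Dh ^+ K * A i.
 elim: K {hth hK hP} => [|k ih]; first by rewrite addn0 expr0 mul1r.
 rewrite addnS [Dh ^+ _]exprS -mulrA; apply: le_trans (hA _) _; exact: ler_wpM2l.
have step i : A (i + K)%N * P (i + K)%N <= 4^-1 * (A i * P i + A i * Q i).
 have pq : 0 <= P i + Q i by side.
 apply: (via (Dh ^+ K * A i * (th * (P i + Q i)))).
  by apply: ler_pM.
 have -> : Dh ^+ K * A i * (th * (P i + Q i)) = th * Dh ^+ K * (A i * (P i + Q i)) by ring.
 by rewrite -mulrDr ler_wpM2r// mulr_ge0.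
have AP0 i : 0 <= A i * P i by side.
have h1 : \sum_(0 <= i < J) A i * P i <= \sum_(0 <= i < K + J) A i * P i.
 rewrite [leRHS](@big_cat_nat _ _ _ J)//= ?leq_addl// lerDl; exact: sumr_ge0.
have h2 : \sum_(0 <= i < K + J) A i * P i <= K%:R * (A K * N) + 4^-1 * (\sum_(0 <= i < J) A i * P i + \sum_(0 <= i < J) A i * Q i).
 rewrite (@big_cat_nat _ _ _ K)//= ?leq_addr//; apply: lerD.
  rewrite big_mkord; apply: (via (\sum_(i < K) A K * N)).
   by apply: ler_sum => i _; apply: ler_pM => //; apply: hK; exact: ltnW.
  by rewrite sumr_const card_ord mulr_natl.
 rewrite -{1}[K]add0n big_addn addKn -big_split/= mulr_sumr.
 by apply: ler_sum => i _; exact: step.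
have AN : 0 <= K%:R * (A K * N).
 by rewrite mulr_ge0// mulr_ge0//; apply: le_trans (P0 0%N) (hN _).
have : 0 <= \sum_(0 <= i < J) A i * Q i by side.
move: h1 h2 AN; lra.
Qed.

Variables (m M : R) (sg : R -> R).
Hypothesis hs : slope m M sg.

Lemma slope_half (t : R) : 0 <= t -> t * sg t <= (1 - m / 2) * (2 * t * sg (2 * t)).
Proof.
have [m01 M1 p h] := hs.
rewrite le_eqVlt => /predU1P[<-|t0]; first by rewrite mulr0 !mul0r mulr0.
have t2 : t <= 2 * t by lra.
have /andP[_ h1] := h t (2 * t) t0 t2; apply: (le_trans h1).
by apply: eqW; field.
Qed.

Lemma slope_half_iter j (t : R) : 0 <= t ->
 2^-1 ^+ j * t * sg (2^-1 ^+ j * t) <= (1 - m / 2) ^+ j * (t * sg t).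
Proof.
have [/andP[m0 m1] _ _ _] := hs.
have c0 : 0 <= 1 - m / 2 by lra.
elim: j t => [|j ih] t t0; first by rewrite !expr0 !mul1r.
have t2 : 0 <= 2^-1 * t by side.
have -> : 2^-1 ^+ j.+1 * t = 2^-1 ^+ j * (2^-1 * t) by rewrite exprSr mulrA.
apply: le_trans (ih _ t2) _; rewrite [_ ^+ j.+1]exprSr -[leRHS]mulrA.
apply: ler_wpM2l; first exact: exprn_ge0.
by have := slope_half t2; rewrite (_ : 2 * (2^-1 * t) = t)// mulrA mulfV// mul1r.
Qed.

(** By [slope_half] the terms decrease geometrically downwards with ratio 1 - m/2, and the series
    with this ratio sums to 2/m. *)
Lemma dyadic_sum N (l : R) : 0 <= l ->
 \sum_(0 <= i < N.+1) 2 ^+ i * l * sg (2 ^+ i * l) <= 2 / m * (2 ^+ N * l * sg (2 ^+ N * l)).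
Proof.
move=> l0; have [/andP[m0 m1] _ _ _] := hs.
have p0 i : 0 <= 2 ^+ i * l by side.
have a0 i : 0 <= 2 ^+ i * l * sg (2 ^+ i * l) by side.
elim: N => [|N ih].
 rewrite big_nat1 ler_peMl// ler_pdivlMr//; lra.
rewrite big_nat_recr//=.
have := slope_half (p0 N); rewrite mulrA -exprS.
have := a0 N.+1; move: ih.
set u := _ * sg (2 ^+ N.+1 * l); set v := _ * sg (2 ^+ N * l); set S := \sum_(_ <= _ < _) _.
move=> hS u0 hv; rewrite -(ler_pM2l m0).
have {}hS : m * S <= 2 * v.
 have := ler_wpM2l (ltW m0) hS.
 by have -> : m * (2 / m * v) = 2 * v by field; rewrite gt_eqF.
have -> : m * (2 / m * u) = 2 * u by field; rewrite gt_eqF.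
rewrite mulrDr; lra.
Qed.

(** Levels from z upwards contribute nothing, and the highest level below z dominates the sum of all
    lower ones. *)
Lemma dyadic_sum_below N (l z : R) : 0 <= l -> 0 <= z ->
 \sum_(0 <= i < N) (2 ^+ i * l * sg (2 ^+ i * l)) * cut (2 ^+ i * l) z <= 2 / m * (z * (z * sg z)).
Proof.
move=> l0 z0; have [/andP[m0 m1] _ _ _] := hs.
have p0 i : 0 <= 2 ^+ i * l by side.
have a0 i : 0 <= 2 ^+ i * l * sg (2 ^+ i * l) by side.
have m20 : 0 <= 2 / m by side.
have zz : 0 <= z * (z * sg z) by side.
elim: N => [|N ih]; first by rewrite big_geq// mulr_ge0.
rewrite big_nat_recr//= {2}/cut; case: ltP => h; last by rewrite mulr0 addr0.
have e : \sum_(0 <= i < N.+1) 2 ^+ i * l * sg (2 ^+ i * l) * z <= 2 / m * (z * (z * sg z)).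
 rewrite -mulr_suml [leRHS]mulrCA [leRHS]mulrC; apply: ler_wpM2r => //.
 apply: le_trans (dyadic_sum N l0) _; apply: ler_wpM2l => //.
 by apply: (slope_mono0 hs (p0 N)); exact: ltW.
apply: le_trans e; rewrite [leRHS]big_nat_recr//= lerD2r.
by apply: ler_sum => i _; apply: ler_wpM2l => //; exact: cut_le.
Qed.

(** A single term suffices: the level with 2^i l < y <= 2^(i+1) l, at which doubling compares the
    weight with its value at y. Together with [dyadic_sum_below] this is the layer-cake formula up
    to constants. *)
Lemma dyadic_sum_above D J (l y : R) :
 (forall t, 0 < t -> 2 * t * sg (2 * t) <= D * (t * sg t)) -> 0 <= D ->
 0 < l -> l < y -> y <= 2 ^+ J * l ->
 y * (y * sg y) <= D * \sum_(0 <= i < J) (2 ^+ i * l * sg (2 ^+ i * l)) * cut (2 ^+ i * l) y.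
Proof.
move=> hD D0 l0 ly.
have y0 : 0 <= y by apply: ltW; exact: lt_trans ly.
have p0 i : 0 < 2 ^+ i * l by side.
have a0 i : 0 <= 2 ^+ i * l * sg (2 ^+ i * l) by side.
have c0 i : 0 <= (2 ^+ i * l * sg (2 ^+ i * l)) * cut (2 ^+ i * l) y.
 by apply: mulr_ge0 => //; exact: cut_ge0.
elim: J => [|J ih]; first by rewrite expr0 mul1r leNgt ly.
rewrite big_nat_recr//= => hy; have [hJ|hJ] := leP y (2 ^+ J * l).
 by apply: le_trans (ih hJ) _; apply: ler_wpM2l => //; rewrite lerDl.
apply: (via (D * (2 ^+ J * l * sg (2 ^+ J * l) * cut (2 ^+ J * l) y))); last first.
 by side.
have -> : D * (2 ^+ J * l * sg (2 ^+ J * l) * cut (2 ^+ J * l) y) = y * (D * (2 ^+ J * l * sg (2 ^+ J * l))).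
 by rewrite /cut hJ; ring.
apply: ler_wpM2l => //.
apply: le_trans (hD _ (p0 J)); rewrite mulrA -exprS.
exact: (slope_mono0 hs y0 hy).
Qed.

End dyadic_sums.

(** * Integrating the good-lambda inequality *)

Section good_lambda_sum.
Context {d : measure_display} {T : measurableType d} {R : realType}.
Variable mu : {measure set T -> \bar R}.

Lemma int_sum_Z (A P : nat -> R) (F : nat -> T -> R) J :
 (forall i, mble (F i)) -> (forall i x, 0 <= F i x) -> (forall i, 0 <= A i) ->
 (forall i, \int[mu]_x (F i x)%:E = (P i)%:E)%E ->
 (\int[mu]_x (\sum_(0 <= i < J) A i * F i x)%:E = (\sum_(0 <= i < J) A i * P i)%:E)%E.
Proof.
move=> mF F0 A0 FP; rewrite int_sum//; first last.
- by side.
- by side.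
rewrite -sumEFin; apply: eq_bigr => i _.
by rewrite int_Z// FP -EFinM.
Qed.

Lemma cut_scale (k l y : R) : 0 < k -> cut (k * l) y = k * cut l (y / k).
Proof.
move=> k0; rewrite /cut ltr_pdivlMr// [l * k]mulrC; case: ifP => _; last by rewrite mulr0.
by rewrite mulrC divfK// gt_eqF.
Qed.

(** With l = 2^-k the levels 2^i l, i < 2k, cover the range 2^-k < f <= 2^k, and the hypothesis at
    each of them feeds [seq_absorb]. The a priori bound [Nf] enters only the K lowest levels, with
    weight h(2^K l); as k grows this weight tends to 0, so [Nf] leaves no trace in the conclusion.
    The threshold [gam] on g costs Dh^p, since h(y/gam) <= h(2^p y). *)
Lemma good_lambda_integral (m M Dh gam th Nf : R) K p (sg : R -> R) (f g : T -> R) :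
 slope m M sg -> continuous (fun t : R => t * sg t) ->
 1 <= Dh -> (forall t, 0 < t -> 2 * t * sg (2 * t) <= Dh * (t * sg t)) ->
 0 < gam -> gam^-1 <= 2 ^+ p -> 0 <= th -> th * Dh ^+ K <= 4^-1 ->
 mble f -> (forall x, 0 <= f x) -> mble g -> (forall x, 0 <= g x) ->
 (\int[mu]_x (f x)%:E <= Nf%:E)%E -> (\int[mu]_x (g x)%:E < +oo)%E ->
 (forall L a b : R, 0 < L ->
  (\int[mu]_x (cut L (f x))%:E <= a%:E)%E ->
  (\int[mu]_x (cut (gam * L) (g x))%:E <= b%:E)%E ->
  (\int[mu]_x (cut (2 ^+ K * L) (f x))%:E <= (th * (a + b / gam))%:E)%E) ->
 (\int[mu]_x (f x * (f x * sg (f x)))%:E <=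
  (Dh * (2 / m * Dh ^+ p / gam))%:E * \int[mu]_x (g x * (g x * sg (g x)))%:E)%E.
Proof.
move=> hs cs Dh1 hD gam0 hp th0 hth mf f0 mg g0 fN gN GL.
have [/andP[m0 m1] M1 _ _] := hs.
have Dh0 : 0 <= Dh by side.
have m20 : 0 <= 2 / m by side.
have gi0 : 0 <= gam^-1 by side.
have mh : mble (fun t : R => t * (t * sg t)).
 have := msq_sg cs.
 by rewrite (_ : (fun t => _) = (fun t => t * (t * sg t)))//; apply/funext => t; rewrite expr2 mulrA.
have mfh : mble (fun x => f x * (f x * sg (f x))) by exact: (measurableT_comp mh mf).
have mgh : mble (fun x => g x * (g x * sg (g x))) by exact: (measurableT_comp mh mg).
have fh0 t : 0 <= t -> 0 <= t * (t * sg t).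
 by side.
have [|fin] := boolP (\int[mu]_x (g x * (g x * sg (g x)))%:E == +oo)%E.
 move=> /eqP ->; rewrite gt0_muley ?leey// lte_fin !mulr_gt0 ?invr_gt0 ?exprn_gt0//; exact: lt_le_trans Dh1.
have gh0 : (0 <= \int[mu]_x (g x * (g x * sg (g x)))%:E)%E by side.
have GG : (\int[mu]_x (g x * (g x * sg (g x)))%:E < +oo)%E by rewrite ltey.
pose G := fine (\int[mu]_x (g x * (g x * sg (g x)))%:E)%E.
have eG : (\int[mu]_x (g x * (g x * sg (g x)))%:E = G%:E)%E by rewrite fineK// ge0_fin_numE.
have Nf0 : 0 <= Nf.
 by rewrite -lee_fin; apply: le_trans fN; apply: int_ge0.
(* Restriction to a compact range of values makes finitely many levels sufficient; Fatou removes
   it. *)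
pose RR j y := if 2^-1 ^+ j < y then (if y <= 2 ^+ j then y * (y * sg y) else 0) else 0 : R.
have mR j : mble (fun x => RR j (f x)).
 apply: measurable_fun_ifT => //; first exact: measurable_fun_ltr.
 by apply: measurable_fun_ifT => //; exact: measurable_fun_ler.
have R0 j y : 0 <= y -> 0 <= RR j y.
 by rewrite /RR => y0; case: ifP => // _; case: ifP => // _; exact: fh0.
rewrite eG -EFinM.
apply: (int_fatou (mu := mu) (h := fun j x => RR j (f x))) => //.
- by side.
- by side.
- apply: aeW => x _; have := f0 x; rewrite le_eqVlt => /predU1P[<-|y0].
  rewrite mul0r; apply: cvg_near_cst; near=> j.
  by rewrite /RR ltNge exprn_ge0 ?invr_ge0.
 have [j1 h1] := pow2_small 2 y0; have [j2 h2] := pow2_bound (f x).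
 apply: cvg_near_cst; exists (maxn j1 j2) => // j /= hj; rewrite /RR.
 have -> : 2^-1 ^+ j < f x.
  have := h1 j (leq_trans (leq_maxl _ _) hj).
  have : 0 < 2^-1 ^+ j :> R by side.
  set z := 2^-1 ^+ j; lra.
 have -> // : f x <= 2 ^+ j.
 by apply: le_trans h2 _; rewrite ler_weXn2l ?ler1n// (leq_trans (leq_maxr _ _) hj).
move=> e e0.
have c01 : 0 <= 1 - m / 2 < 1 by lra.
(* (1 - m/2)^k W bounds the contribution of the K lowest levels, by [slope_half_iter]. *)
pose W := Dh * (2 * (K%:R * (2 ^+ K * sg (2 ^+ K) * Nf))).
have W0 : 0 <= W.
 rewrite mulr_ge0// mulr_ge0// mulr_ge0// mulr_ge0//.
 by side.
have W1 : 0 < W + 1 by lra.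
have [j hj] := expr_small c01 (divr_gt0 e0 W1); exists j => k jk.
have ck : (1 - m / 2) ^+ k * W <= e.
 have : (1 - m / 2) ^+ k <= e / (W + 1).
  by apply: le_trans hj; apply: ler_wiXn2l jk; lra.
 rewrite ler_pdivlMr// => h; apply: le_trans h.
 by rewrite ler_wpM2l ?exprn_ge0 ?lerDl//; lra.
pose l : R := 2^-1 ^+ k.
have l0 : 0 < l by side.
pose A i := 2 ^+ i * l * sg (2 ^+ i * l).
have p0 i : 0 < 2 ^+ i * l by side.
have A0 i : 0 <= A i by side.
have mcf t : mble (fun x => cut t (f x)) by exact: mcut.
have mcg t : mble (fun x => cut t (g x)) by exact: mcut.
have cf0 t x : 0 <= cut t (f x) by exact: cut_ge0.
have cg0 t x : 0 <= cut t (g x) by exact: cut_ge0.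
have cfN t : (\int[mu]_x (cut t (f x))%:E <= Nf%:E)%E.
 by apply: le_trans fN; apply: int_le => // x _; exact: cut_le.
have cgN t : (\int[mu]_x (cut t (g x))%:E < +oo)%E.
 by apply: le_lt_trans gN; apply: int_le => // x _; exact: cut_le.
pose P i := fine (\int[mu]_x (cut (2 ^+ i * l) (f x))%:E)%E.
have eP i : (\int[mu]_x (cut (2 ^+ i * l) (f x))%:E = (P i)%:E)%E.
 by rewrite fineK// ge0_fin_numE ?int_ge0//; apply: le_lt_trans (cfN _) _; exact: ltry.
pose q i := fine (\int[mu]_x (cut (gam * (2 ^+ i * l)) (g x))%:E)%E.
have eq i : (\int[mu]_x (cut (gam * (2 ^+ i * l)) (g x))%:E = (q i)%:E)%E.
 by rewrite fineK// ge0_fin_numE ?int_ge0.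
have P0 i : 0 <= P i by apply: fine_ge0; exact: int_ge0.
have q0 i : 0 <= q i by apply: fine_ge0; exact: int_ge0.
have PN i : P i <= Nf by rewrite -lee_fin -eP.
have Q0 i : 0 <= q i / gam by side.
have AS i : A i.+1 <= Dh * A i.
 by apply: le_trans (hD _ (p0 i)); rewrite /A mulrA -exprS.
have AK i : (i <= K)%N -> A i <= A K.
 move=> iK; apply: (slope_mono0 hs (ltW (p0 i))).
 by rewrite (ler_pM2r l0) ler_weXn2l ?ler1n.
have PK i : P (i + K)%N <= th * (P i + q i / gam).
 rewrite -lee_fin -eP addnC exprD -mulrA; apply: GL => //; [by rewrite eP|by rewrite eq].
have S := seq_absorb (k + k) A0 P0 Q0 Dh0 th0 hth AS AK PK PN.
have SQ : \sum_(0 <= i < k + k) A i * q i <= 2 / m * Dh ^+ p * G.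
 rewrite -lee_fin -(int_sum_Z (k + k) (fun i => mcg _) (fun i => cg0 _) A0 eq).
 rewrite EFinM -eG -(int_Z mu measurableT mgh (fun x _ => fh0 _ (g0 x))); last by side.
 apply: int_le => //.
 - by side.
 - by side.
 - by side.
 move=> x _; set y := g x; have y0 : 0 <= y by side.
 have yg : 0 <= y / gam by side.
 apply: (via (gam * \sum_(0 <= i < k + k) A i * cut (2 ^+ i * l) (y / gam))).
  rewrite mulr_sumr; apply: ler_sum => i _.
  by rewrite cut_scale// mulrCA.
 apply: (via (gam * (2 / m * (y / gam * (y / gam * sg (y / gam)))))).
  by apply: ler_wpM2l; [exact: ltW|exact: (dyadic_sum_below hs _ (ltW l0) yg)].
 have -> : gam * (2 / m * (y / gam * (y / gam * sg (y / gam)))) = 2 / m * (y * (y / gam * sg (y / gam))).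
  by field; rewrite !gt_eqF.
 rewrite -[leRHS]mulrA; apply: ler_wpM2l => //; rewrite [leRHS]mulrCA; apply: ler_wpM2l => //.
 have y2 : y / gam <= 2 ^+ p * y by rewrite mulrC ler_wpM2r.
 apply: (le_trans (slope_mono0 hs yg y2)).
 exact: (slope_pow2 p hs Dh0 hD y0).
have SP : \sum_(0 <= i < k + k) A i * P i <= 2 * (K%:R * (A K * Nf)) + 2 / m * Dh ^+ p * G / gam.
 apply: (le_trans S); rewrite lerD2l.
 have -> : \sum_(0 <= i < k + k) A i * (q i / gam) = (\sum_(0 <= i < k + k) A i * q i) / gam.
  by rewrite mulr_suml; apply: eq_bigr => i _; rewrite mulrA.
 by side.
have AKs : A K <= (1 - m / 2) ^+ k * (2 ^+ K * sg (2 ^+ K)).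
 by rewrite /A [2 ^+ K * l]mulrC; apply: (slope_half_iter hs); exact: exprn_ge0.
apply: (via (\int[mu]_x (Dh * \sum_(0 <= i < k + k) A i * cut (2 ^+ i * l) (f x))%:E)%E).
 have s0 x : 0 <= \sum_(0 <= i < k + k) A i * cut (2 ^+ i * l) (f x).
  by side.
 apply: int_le => //.
 - by side.
 - by side.
 move=> x _; rewrite /RR; case: ifP => h1; last exact: mulr_ge0.
 case: ifP => h2; last exact: mulr_ge0.
 apply: (dyadic_sum_above hs hD Dh0 l0 h1).
 by rewrite /l exprVn exprD mulfK// expf_neq0.
rewrite int_Z//; first last.
- by side.
- by side.
rewrite (int_sum_Z (k + k) (fun i => mcf _) (fun i => cf0 _) A0 eP) -EFinM lee_fin.
apply: (le_trans (ler_wpM2l Dh0 SP)).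
have : Dh * (2 * (K%:R * (A K * Nf))) <= e.
 apply: le_trans ck; rewrite /W.
 have -> : (1 - m / 2) ^+ k * (Dh * (2 * (K%:R * (2 ^+ K * sg (2 ^+ K) * Nf)))) =
  Dh * (2 * (K%:R * ((1 - m / 2) ^+ k * (2 ^+ K * sg (2 ^+ K)) * Nf))) by ring.
 by do 3 (apply: ler_wpM2l => //); exact: ler_wpM2r.
move=> h; rewrite mulrDr addrC; apply: lerD => //.
by apply: eqW; ring.
Unshelve. all: by end_near.
Qed.

End good_lambda_sum.

(** * Primitives of growth functions *)

Section growth_primitive.
Context {R : realType}.

Lemma slope_ext (m M : R) sg sg' : (forall t, 0 < t -> sg t = sg' t) ->
 slope m M sg -> slope m M sg'.
Proof.
move=> h [m01 M1 p hs]; split => //; first by move=> t t0; rewrite -h// p.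
by move=> s t s0 st; rewrite -!h//; [exact: hs|exact: lt_le_trans st].
Qed.

(** The function sg belonging to f. Extending f by f(0) = 0 to negative arguments makes t * ratio f
    t continuous on the whole line; the default value of the division at 0 is always multiplied by
    0. *)
Definition ratio (f : R -> R) t := f (Num.max t 0) / t.

Variable f : R -> R.
Hypothesis gf : growth_function f.

Let phi t := f (Num.max t 0).

Lemma ratioE t : t * ratio f t = f (Num.max t 0).
Proof.
have [_ f0 _ _] := gf; rewrite /ratio; have [->|t0] := eqVneq t 0.
 by rewrite mul0r maxxx f0.
by rewrite mulrC divfK.
Qed.

Lemma ratioE0 t : 0 <= t -> t * ratio f t = f t.
Proof. by move=> t0; rewrite ratioE max_l. Qed.

Lemma cont_growth : continuous (fun t : R => f (Num.max t 0)).
Proof.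
have [[/subspace_continuousP cf _] _ _ _] := gf.
have cm : continuous (fun t : R => Num.max t 0).
 by move=> t; apply: (@continuous_max _ _ id (cst 0)); [exact: cvg_id|exact: cvg_cst].
move=> t; have m0 : 0 <= Num.max t 0 by rewrite le_max lexx orbT.
have hx : `[0, +oo[%classic (Num.max t 0) by rewrite /= in_itv/= m0.
apply/cvgrPdist_le => e e0.
have /cvgrPdist_le/(_ e e0) hN := cf _ hx.
have hN' : \forall u \near Num.max t 0, `[0, +oo[%classic u -> `|f (Num.max t 0) - f u| <= e by exact: hN.
have hc := cm t _ hN'; near=> s.
have : `[0, +oo[%classic (Num.max s 0) -> `|f (Num.max t 0) - f (Num.max s 0)| <= e by near: s; exact: hc.
by apply; rewrite /= in_itv/= le_max lexx orbT.
Unshelve. all: by end_near. Qed.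

Lemma growth_ratio_slope : exists m M, slope m M (ratio f).
Proof.
have [m [M hs]] := growth_slope gf; exists m, M; apply: slope_ext hs => t t0.
by rewrite /ratio max_l// ltW.
Qed.

Lemma cont_ratio : continuous (fun t : R => t * ratio f t).
Proof.
rewrite (_ : (fun t => _) = (fun t => f (Num.max t 0))); first exact: cont_growth.
by apply/funext => t; rewrite ratioE.
Qed.

Lemma growth_mono s t : s <= t -> f (Num.max s 0) <= f (Num.max t 0).
Proof.
have [m [M hs]] := growth_ratio_slope => st.
have hm (u : R) : 0 <= Num.max u 0 by rewrite le_max lexx orbT.
rewrite -!ratioE0//; apply: (slope_mono0 hs) => //.
by rewrite ge_max !le_max st lexx !orbT.
Qed.

Lemma growth_ge0 t : 0 <= f (Num.max t 0).
Proof.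
have [_ f0 fp _] := gf; have : 0 <= Num.max t 0 by rewrite le_max lexx orbT.
by rewrite le_eqVlt => /predU1P[<-|h]; [rewrite f0|exact/ltW/fp].
Qed.

Lemma primitiveE t : primitive f t = \int[@lebesgue_measure R]_(s in `[0, t]) phi s.
Proof.
apply: eq_Rintegral => s; rewrite inE/= in_itv/= => /andP[s0 _].
by rewrite /phi max_l.
Qed.

Lemma primitive_le0 t : t <= 0 -> primitive f t = 0.
Proof.
rewrite le_eqVlt => /predU1P[->|t0]; rewrite /primitive.
 by rewrite set_itv1 Rintegral_set1.
by rewrite set_itv_ge ?bnd_simp -?ltNge// Rintegral_set0.
Qed.

Lemma primitive_max t : primitive f (Num.max t 0) = primitive f t.
Proof. by case: (leP t 0) => // t0; rewrite primitive_le0// primitive_le0. Qed.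

Lemma primitive_incr0 s t : 0 <= s -> s <= t ->
 (t - s) * f s <= primitive f t - primitive f s <= (t - s) * f t.
Proof.
move=> s0 st; have t0 := le_trans s0 st.
have mi : measurable (`]s, t]%classic : set R) by exact: measurable_itv.
have integ : (@lebesgue_measure R).-integrable `[0, t] (EFin \o phi).
 apply: continuous_compact_integrable; first exact: segment_compact.
 exact: continuous_subspaceT cont_growth.
have integ' : (@lebesgue_measure R).-integrable `]s, t] (EFin \o phi).
 apply: integrableS integ => //.
 by move=> x /=; rewrite !in_itv/= => /andP[sx ->]; rewrite (le_trans s0 (ltW sx)).
have ic c : (@lebesgue_measure R).-integrable `]s, t] (EFin \o cst c).
 have ic' : (@lebesgue_measure R).-integrable `[s, t] (EFin \o cst c).
  apply: continuous_compact_integrable; first exact: segment_compact.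
  by apply: continuous_subspaceT => x; exact: cvg_cst.
 apply: integrableS ic' => //.
 by move=> x /=; rewrite !in_itv/= => /andP[sx ->]; rewrite ltW.
have hc c : \int[@lebesgue_measure R]_(x in `]s, t]) c = (t - s) * c.
 rewrite Rintegral_cst//= lebesgue_measure_itv/= lte_fin mulrC.
 by rewrite lt_neqAle st andbT; case: eqVneq => [->|_] //=; rewrite subrr.
rewrite !primitiveE Rintegral_itvB//.
rewrite -!hc; apply/andP; split.
 apply: le_Rintegral; [by []|exact: ic|exact: integ'|move=> x /=; rewrite in_itv/= => /andP[sx xt]].
 by have := growth_mono (ltW sx); rewrite [Num.max s 0]max_l.
apply: le_Rintegral; [by []|exact: integ'|exact: ic|move=> x /=; rewrite in_itv/= => /andP[sx xt]].
by have := growth_mono xt; rewrite [Num.max t 0]max_l.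
Qed.

Lemma primitive_incr s t : s <= t ->
 0 <= primitive f t - primitive f s <= (t - s) * f (Num.max t 0).
Proof.
move=> st; rewrite -(primitive_max s) -(primitive_max t).
have s0 : 0 <= Num.max s 0 by rewrite le_max lexx orbT.
have mst : Num.max s 0 <= Num.max t 0 by rewrite ge_max !le_max st lexx !orbT.
have /andP[h1 h2] := primitive_incr0 s0 mst; apply/andP; split.
 by apply: le_trans h1; rewrite mulr_ge0 ?growth_ge0 ?subr_ge0.
apply: (le_trans h2); rewrite ler_wpM2r ?growth_ge0//.
by case: (leP s 0) => hs; case: (leP t 0) => ht; lra.
Qed.

Lemma primitive_ge0 t : 0 <= primitive f t.
Proof.
have [t0|t0] := leP t 0; first by rewrite primitive_le0.
by have /andP[h _] := primitive_incr (ltW t0); rewrite (primitive_le0 (lexx 0)) subr0 in h.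
Qed.

Lemma cont_primitive : continuous (primitive f).
Proof.
move=> x; apply/cvgrPdist_le => e e0.
pose L := f (Num.max (x + 1) 0) + 1.
have L0 : 0 < L by rewrite ltr_wpDl// growth_ge0.
near=> y.
have h1 : `|x - y| <= 1 by near: y; apply: cvgr_dist_le; [exact: cvg_id|].
have h2 : `|x - y| <= e / L by near: y; apply: cvgr_dist_le; [exact: cvg_id|rewrite divr_gt0].
have yx : y <= x + 1 by move: h1; rewrite ler_norml; lra.
have xx : x <= x + 1 by lra.
have fy := growth_mono yx; have fx := growth_mono xx.
rewrite ler_pdivlMr// in h2; apply: le_trans h2; rewrite [leRHS]mulrC.
have g0 := growth_ge0 (x + 1).
have [xy|yx'] := leP x y.
 have /andP[a b] := primitive_incr xy.
 rewrite [`|primitive f x - _|]distrC [`|x - y|]distrC (ger0_norm a) ger0_norm ?subr_ge0//; apply: (le_trans b).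
 by rewrite [L * _]mulrC ler_wpM2l ?subr_ge0// /L; lra.
have /andP[a b] := primitive_incr (ltW yx').
rewrite (ger0_norm a) ger0_norm ?subr_ge0 ?(ltW yx')//; apply: (le_trans b).
by rewrite [L * _]mulrC ler_wpM2l ?subr_ge0 ?(ltW yx')// /L; lra.
Unshelve. all: by end_near. Qed.

(** The upper bound on t f(t) comes from the upper half of the interval: the integral over [t/2, t]
    is at least (t/2) f(t/2), and doubling compares f(t/2) with f(t). *)
Lemma primitive_bounds : exists D : R, 1 <= D /\ forall t, 0 <= t ->
 primitive f t <= t * f t <= D * primitive f t.
Proof.
have [m [M hs]] := growth_ratio_slope; have [_ M1 _ _] := hs.
have [D [D1 hD]] := slope_doubling M1; exists (2 * D); split; first lra.
move=> t t0; apply/andP; split.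
 by have /andP[_] := primitive_incr0 (lexx 0) t0; rewrite (primitive_le0 (lexx 0)) !subr0.
move: t0; rewrite le_eqVlt => /predU1P[<-|t0]; first by rewrite mul0r primitive_le0// mulr0.
have h0 : 0 < t / 2 by side.
have ht : t / 2 <= t by lra.
have := hD _ _ hs _ h0; rewrite (_ : 2 * (t / 2) = t); last by field.
rewrite !ratioE0 ?(ltW t0) ?(ltW h0)// => hd.
have /andP[h1 _] := primitive_incr0 (ltW h0) ht.
have := primitive_ge0 (t / 2) => p0.
have {}h1 : t / 2 * f (t / 2) <= primitive f t.
 have e : t - t / 2 = t / 2 by field.
 by rewrite e in h1; apply: (le_trans h1); rewrite gerBl.
apply: (via (t * (D * f (t / 2)))); first by side.
have -> : t * (D * f (t / 2)) = 2 * D * (t / 2 * f (t / 2)) by field.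
by side.
Qed.

(** The partial inverse cancels on the left because the primitive is strictly increasing on [0,
    +oo[. *)
Lemma inverse_primitive t : 0 <= t -> inverse_nonneg (primitive f) (primitive f t) = t.
Proof.
have [_ _ fp _] := gf.
have lt s u : 0 <= s -> s < u -> primitive f s < primitive f u.
 move=> s0 su; pose v := (s + u) / 2.
 have sv : s < v by rewrite /v; lra.
 have vu : v < u by rewrite /v; lra.
 have v0 := le_lt_trans s0 sv.
 have /andP[h1 _] := primitive_incr (ltW sv).
 have /andP[h2 _] := primitive_incr0 (ltW v0) (ltW vu).
 have : 0 < (u - v) * f v by side.
 by lra.
move=> t0; apply: pinvKV; last by rewrite inE/= in_itv/= t0.
move=> s u; rewrite !inE/= !in_itv/= !andbT => s0 u0 e.
by case: (ltgtP s u) => // /lt; [move=> /(_ s0)|move=> /(_ u0)]; rewrite e ltxx.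
Qed.

End growth_primitive.

(** * From the weak equation to the mollified one *)

Section weak_field.
Context {R : realType} {n : nat}.
Local Notation E := 'rV[R]_n.
Local Notation mu := (@lebesgue_rV R n).

(** Only t sg(t) is known to be continuous, so sg(|X|) is written as |X| sg(|X|) times |X|^-1, with
    the measurable real power; where X = 0 the coefficient multiplies the zero vector. *)
Lemma mTh_field sg (X : E -> E) : continuous (fun t : R => t * sg t) ->
 mble X -> mble (fun x => Th sg (X x)).
Proof.
move=> cs mX; have me := menorm mX.
rewrite (_ : (fun x => _) = (fun x => (enorm (X x) * sg (enorm (X x)) * enorm (X x) `^ (-1)) *: X x)).
 apply: mscalerV => //; apply: measurable_funM.
  apply: (mcomp (fun t : R => t * sg t)) => //.
  exact: continuous_measurable_fun.
 by apply: (mcomp (fun t : R => t `^ (-1))) => //; exact: measurable_powR.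
apply/funext => x; rewrite /Th; have [->|x0] := eqVneq (X x) 0; first by rewrite !scaler0.
have e0 : 0 < enorm (X x).
 rewrite lt_neqAle enorm_ge0 andbT eq_sym; apply: contra x0 => /eqP h.
 by rewrite -normr_le0 -h; exact: norm_le_enorm.
by rewrite powR_inv1 ?(ltW e0)// mulrAC mulfV ?mul1r// gt_eqF.
Qed.

(** Makes Th(X) integrable on bounded sets when the energy is finite: up to 1 monotonicity bounds
    a(t) by a(1), beyond 1 it is at most t a(t). *)
Lemma slope_al_le (m M : R) sg t : slope m M sg -> 0 <= t ->
 t * sg t <= sg 1 + t ^+ 2 * sg t.
Proof.
move=> hs t0; have [_ _ p _] := hs; have p1 := p 1 ltr01.
have a0 := slope_al_ge0 hs t0.
have e2 : t ^+ 2 * sg t = t * (t * sg t) by rewrite expr2 mulrA.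
have [t1|t1] := leP t 1.
 have := slope_mono0 hs t0 t1; rewrite mul1r => h; apply: (le_trans h).
 by rewrite lerDl e2 mulr_ge0.
by rewrite e2; apply: ler_wpDl; [exact: ltW|rewrite ler_peMl// ltW].
Qed.

Lemma intg_Th_cube (m M : R) sg (X : E -> E) (x0 : E) r i : slope m M sg ->
 continuous (fun t : R => t * sg t) -> mble X ->
 (\int[mu]_x (ev sg (X x))%:E < +oo)%E -> 0 < r ->
 L1 mu (fun y => (\1_(cube x0 r) y *: Th sg (X y)) ord0 i).
Proof.
move=> hs cs mX eX r0.
have mQ : mble (\1_(cube x0 r) : E -> R) by side.
have mT := mTh_field cs mX.
have [_ _ p _] := hs; have s1 := ltW (p 1 ltr01).
have mev : mble (fun x => ev sg (X x)) by exact: (measurable_e cs mX).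
have q0 y : 0 <= \1_(cube x0 r) y :> R by side.
have ev0 y : 0 <= ev sg (X y) by side.
have mqs : mble (fun y => sg 1 * \1_(cube x0 r) y : R) by side.
have qs0 y : 0 <= sg 1 * \1_(cube x0 r) y by side.
apply: (@intg_dom _ _ _ _ _ _ (fun y => sg 1 * \1_(cube x0 r) y + ev sg (X y))) => //.
- by side.
- by side.
- move=> y _; apply: le_trans (coord_le_enorm _ _) _.
 rewrite enormZ (ger0_norm (q0 y)) (Th_enorm _ hs) indicE.
 have := slope_al_le hs (enorm_ge0 (X y)); rewrite -/(ev sg (X y)).
 by case: (y \in _); rewrite ?mul1r ?mulr1 ?mul0r ?mulr0 ?add0r.
rewrite (int_D mu measurableT mqs mev (fun y _ => qs0 y) (fun y _ => ev0 y)).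
rewrite (int_Z mu measurableT mQ (fun y _ => q0 y) s1).
have hI : (\int[mu]_y (\1_(cube x0 r) y)%:E = ((2 * r) ^+ n)%:E)%E.
 rewrite integral_indic//; last exact: mcube.
 by rewrite setIT; exact: (mu_cube x0 r0).
by rewrite hI -EFinM lte_add_pinfty// ltry.
Qed.

(** Fields are cut to Q to become integrable. When the kernel centred at x does not reach outside Q,
    the cut is invisible to the test function y |-> k(x - y), and the weak equation says that the
    mollified divergence vanishes at x. *)
Lemma mol_weak_div k (Z W : E -> E) (Q : set E) (x : E) (d : R) : kernel k ->
 smooth (fun y => k (x - y)) -> (forall z, ~ cube 0 d z -> k z = 0) ->
 (forall y, `|x - y| <= d -> Q y) ->
 (forall i, L1 mu (fun y => (\1_Q y *: Z y) ord0 i)) ->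
 (forall i, L1 mu (fun y => (\1_Q y *: W y) ord0 i)) ->
 (forall phi, test_function phi ->
  \int[mu]_y dotprod (Z y) (grad phi y) = \int[mu]_y dotprod (W y) (grad phi y)) ->
 \sum_i mol (partial i k) (fun y => (\1_Q y *: Z y - \1_Q y *: W y) ord0 i) x = 0.
Proof.
move=> kk sr k0 hQ Zi Wi hw.
have [tf pf] := kernel_test kk sr.
have key (V : E -> E) : (forall i, L1 mu (fun y => (\1_Q y *: V y) ord0 i)) ->
  \int[mu]_y dotprod (V y) (grad (fun y => k (x - y)) y) =
  - \sum_i mol (partial i k) (fun y => (\1_Q y *: V y) ord0 i) x.
 move=> Vi.
 have mi i := mol_integrable (Vi i) x (kernel_partial i kk).
 rewrite -(Rint_sum _ measurableT mi).2 -[RHS]mulN1r -RintegralZl//; last exact: (Rint_sum _ measurableT mi).1.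
 apply: eq_Rintegral => y _; rewrite mulN1r -sumrN; apply: eq_bigr => i _.
 rewrite mxE pf mulrN mxE indicE; case: (boolP (y \in Q)) => [_|yQ]; first by rewrite mul1r.
 (* Outside Q the distance to x exceeds [d] strictly, so that [C1_csupp] makes the gradient of the
    kernel vanish there too. *)
 have dxy : d < `|x - y|.
  by rewrite ltNge; apply: contra yQ => h; rewrite inE; exact: hQ.
 have [|_ g0] := C1_csupp (s := `|x - y|) (smooth_C1 kk.1) k0 dxy (x := x - y).
  by rewrite /cube/= subr0 ltxx.
 have := congr1 (fun z : E => z ord0 i) g0; rewrite !mxE => ->.
 by rewrite !mulr0.
have mZ i := mol_integrable (Zi i) x (kernel_partial i kk).
have mW i := mol_integrable (Wi i) x (kernel_partial i kk).
rewrite (eq_bigr (fun i => mol (partial i k) (fun y => (\1_Q y *: Z y) ord0 i) x -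
  mol (partial i k) (fun y => (\1_Q y *: W y) ord0 i) x)); last first.
 move=> i _; rewrite /mol -RintegralB//; apply: eq_Rintegral => y _.
 by rewrite [in LHS]mxE [X in (_ + X) * _]mxE mulrBl.
rewrite sumrB; apply/eqP; rewrite subr_eq0; apply/eqP/oppr_inj.
by rewrite -!key//; exact: hw.
Qed.

Lemma Theta_ratio a (x : E) : Theta a x = Th (ratio a) x.
Proof.
rewrite /Theta /Th; case: eqP => [->|_]; first by rewrite scaler0.
by rewrite /ratio max_l// enorm_ge0.
Qed.

Lemma ev_ratio a (x : E) : growth_function a -> ev (ratio a) x = enorm x * a (enorm x).
Proof. by move=> ga; rewrite /ev expr2 -mulrA ratioE0// enorm_ge0. Qed.

Lemma orlicz_field_energy a (F : E -> E) : growth_function a -> orlicz_field (primitive a) F ->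
 (\int[mu]_x (ev (ratio a) (F x))%:E < +oo)%E.
Proof.
move=> ga [mF [Fi eF]]; have [D [D1 hD]] := primitive_bounds ga.
have [m [M hs]] := growth_ratio_slope ga; have cs := cont_ratio ga.
have mp : mble (fun x => primitive a (enorm (F x))).
 apply: (mcomp (primitive a)); last exact: menorm.
 by apply: continuous_measurable_fun; exact: cont_primitive.
have p0 x : 0 <= primitive a (enorm (F x)) by exact: primitive_ge0.
have D0 : 0 <= D by side.
apply: (@le_lt_trans _ _ (\int[mu]_x (D * primitive a (enorm (F x)))%:E)%E).
 apply: int_le => //; [exact: (measurable_e cs mF)|exact: measurable_funM| |].
  by side.
 by move=> x _; rewrite ev_ratio//; have /andP[] := hD _ (enorm_ge0 (F x)).
rewrite (int_Z mu measurableT mp (fun x _ => p0 x) D0).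
have : (\int[mu]_x (primitive a (enorm (F x)))%:E < +oo)%E.
 apply: le_lt_trans eF; apply: int_le => //.
  apply: (mcomp (primitive a)).
   by apply: continuous_measurable_fun; exact: cont_primitive.
  by apply: measurableT_comp => //; exact: menorm.
 by move=> x _; rewrite /= ger0_norm ?enorm_ge0.
have : (0 <= \int[mu]_x (primitive a (enorm (F x)))%:E)%E by side.
by case: (integral _ _ _) => //= v _ _; rewrite -EFinM ltry.
Qed.

(** Th(Du) and Th(F) are integrable on bounded sets, so they are cut to the cube of radius r + d.
    From points of the cube of radius r the kernel of radius d does not leave it. *)
Lemma weak_field_solution a (F : E -> E) (u : E -> R) (Du : E -> E) :
 growth_function a -> orlicz_field (primitive a) F ->
 orlicz_sobolev (primitive a) u Du -> weak_solution a Du F ->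
 field_solution (ratio a) Du F.
Proof.
move=> ga oF [[ui _] wg oD] ws.
have eF := orlicz_field_energy ga oF; have eD := orlicz_field_energy ga oD.
have [mF _] := oF; have [mD [Di _]] := oD.
have [m [M hs]] := growth_ratio_slope ga; have cs := cont_ratio ga.
have Dui := intg_field mD Di.
split => //.
- move=> d d0; exists (mol (rho d) u).
 have := mol_C1 ui (kernel_rho d0); congr C1; apply/funext => x; apply/rowP => i.
 by rewrite !mxE; exact: (mol_weak (kernel_rho d0) (rho_smoothN d x) ui (Dui i) wg).
move=> x0 r d r0 d0; have rd : 0 < r + d by side.
pose Q : set E := cube x0 (r + d).
have iX i := intg_Th_cube x0 i hs cs mD eD rd.
have iF i := intg_Th_cube x0 i hs cs mF eF rd.
exists (fun y => \1_Q y *: Th (ratio a) (Du y) - \1_Q y *: Th (ratio a) (F y)).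
have iY i : L1 mu (fun y => (\1_Q y *: Th (ratio a) (Du y) - \1_Q y *: Th (ratio a) (F y)) ord0 i).
 have := integrableB measurableT (iX i) (iF i); congr integrable.
 by apply/funext => y /=; rewrite [in RHS]mxE [X in (_ + X)%:E]mxE EFinB.
split => //.
 by move=> y Qy; rewrite indicE mem_set// !scale1r.
move=> f g fg fs; apply: (mol_div0 (kernel_rho d0) iY _ fg fs) => x Qx.
apply: (mol_weak_div (d := d) (kernel_rho d0) (rho_smoothN d x)) => //.
- by move=> z; rewrite /cube/= subr0 => /negP; rewrite -leNgt; exact: rho_eq0.
- move=> y hy; rewrite /Q /cube/=.
 have -> : y - x0 = (x - x0) - (x - y) by rewrite opprB [RHS]addrC addrA subrK.
 by apply: le_lt_trans (ler_normB _ _) _; exact: ltr_leD.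
move=> phi tp; have := ws phi tp.
by under eq_Rintegral do rewrite Theta_ratio; under [in RHS]eq_Rintegral do rewrite Theta_ratio.
Qed.

End weak_field.

(** B is the primitive of h composed with that of a. [primitive_bounds] for h compares it with A
    h(A), for a it compares A with e = t a(t), and doubling of h moves the argument from A to e. *)
Lemma composed_bounds (R : realType) (a h B : R -> R) :
 growth_function a -> growth_function h ->
 (forall t, 0 <= t -> B (inverse_nonneg (primitive a) t) = primitive h t) ->
 (forall t, 0 <= t -> B t = primitive h (primitive a t)) /\
 exists C : R, 0 < C /\ forall t, 0 <= t ->
  B t <= t * a t * h (t * a t) <= C * B t.
Proof.
move=> ga gh hB.
have BE t : 0 <= t -> B t = primitive h (primitive a t).
 by move=> t0; rewrite -hB ?primitive_ge0// inverse_primitive.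
split => //.
have [Da [Da1 hDa]] := primitive_bounds ga.
have [Dp [Dp1 hDp]] := primitive_bounds gh.
have [m [M hs]] := growth_ratio_slope gh; have [_ M1 _ _] := hs.
have [D [D1 hD]] := slope_doubling M1.
have [j hj] := pow2_bound Da.
have Dj : 0 < D ^+ j by side.
have Da0 : 0 < Da by side.
have Dp0 : 0 < Dp by side.
exists (Da * (D ^+ j * Dp)); split; first by side.
move=> t t0; rewrite BE//.
set A := primitive a t; have A0 : 0 <= A by exact: primitive_ge0.
have /andP[h1 h2] := hDa t t0; have /andP[h3 h4] := hDp A A0.
have e0 : 0 <= t * a t by side.
have hh s : 0 <= s -> 0 <= h s.
 by move=> s0; have := growth_ge0 gh s; rewrite max_l.
have mono s u : 0 <= s -> s <= u -> h s <= h u.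
 by move=> s0 su; have := growth_mono gh su; rewrite !max_l// (le_trans s0).
apply/andP; split.
 apply: (le_trans h3); apply: ler_pM => //; [exact: hh|exact: mono].
apply: (via (Da * A * (D ^+ j * h A))).
 apply: ler_pM => //; first exact: hh.
 have e2 : t * a t <= 2 ^+ j * A by apply: (le_trans h2); rewrite ler_wpM2r.
 apply: le_trans (mono _ _ e0 e2) _.
 have := slope_pow2 j hs (le_trans ler01 D1) (hD _ _ hs) A0.
 by rewrite !ratioE0// mulr_ge0// exprn_ge0.
rewrite -!mulrA; apply: ler_wpM2l; first exact: ltW.
by rewrite mulrCA; apply: ler_wpM2l => //; exact: ltW.
Qed.

Theorem theorem1p1 (R : realType) (n : nat) (a B h : R -> R) :
  (2 <= n)%N ->
  growth_function a ->
  (forall t : R, 0 <= t -> 0 <= B t) ->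
  growth_function h ->
  (forall t : R, 0 <= t -> B (inverse_nonneg (primitive a) t) = primitive h t) ->
  exists C : R, 0 < C /\
    forall (F : 'rV[R]_n -> 'rV[R]_n) (u : 'rV[R]_n -> R)
           (Du : 'rV[R]_n -> 'rV[R]_n),
      orlicz_field (primitive a) F ->
      orlicz_sobolev (primitive a) u Du ->
      weak_solution a Du F ->
      orlicz_field B F ->
      orlicz_field B Du /\
      (\int[lebesgue_rV n]_x (B (enorm (Du x)))%:E <=
       C%:E * \int[lebesgue_rV n]_x (B (enorm (F x)))%:E)%E.
Proof.
move=> n2 ga B0 gh hB.
have n0 : (0 < n)%N by exact: ltnW.
have [BE [Cb [Cb0 hCb]]] := composed_bounds ga gh hB.
have [m [M hs]] := growth_ratio_slope ga; have [m01 M1 _ _] := hs.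
have [mh [Mh hsh]] := growth_ratio_slope gh; have [/andP[mh0 _] Mh1 _ _] := hsh.
have [Dh [Dh1 hDh]] := slope_doubling Mh1.
have Dh0 : 0 < Dh by side.
have [K [gam [th [gam0 th0 hth GL]]]] := @good_lambda R n m M Dh m01 M1 n0 Dh1.
have [p hp] := pow2_bound gam^-1.
pose C1 := Dh * (2 / mh * Dh ^+ p / gam).
have C10 : 0 < C1 by side.
exists (C1 * Cb); split; first exact: mulr_gt0.
move=> F u Du oF oD ws [mF [FB eFB]].
have sol := weak_field_solution ga oF oD ws.
have [_ _ [mD [Di _]]] := oD.
have eF := orlicz_field_energy ga oF.
have eD := fs_energy sol.
have cs := cont_ratio ga; have csh := cont_ratio gh.
have mev (X : 'rV[R]_n -> 'rV[R]_n) : mble X -> mble (fun x : 'rV[R]_n => ev (ratio a) (X x)).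
 by move=> mX; exact: (measurable_e cs mX).
have ev0 (X : 'rV[R]_n) : 0 <= ev (ratio a) X :> R by side.
have mevh (X : 'rV[R]_n -> 'rV[R]_n) : mble X -> mble
  (fun x : 'rV[R]_n => ev (ratio a) (X x) * (ev (ratio a) (X x) * ratio h (ev (ratio a) (X x)))).
 move=> mX; apply: measurable_funM; first exact: mev.
 apply: (mcomp (fun t : R => t * ratio h t)); last exact: mev.
 exact: continuous_measurable_fun.
have mB (X : 'rV[R]_n -> 'rV[R]_n) : mble X -> mble (fun x : 'rV[R]_n => B (enorm (X x))).
 move=> mX; rewrite (_ : (fun x => _) = (fun x => primitive h (primitive a (enorm (X x))))).
  apply: (mcomp (primitive h)).
   by apply: continuous_measurable_fun; exact: cont_primitive.
  apply: (mcomp (primitive a)); last exact: menorm.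
  by apply: continuous_measurable_fun; exact: cont_primitive.
 by apply/funext => x; rewrite BE// enorm_ge0.
have bnd (X : 'rV[R]_n) : B (enorm X) <= ev (ratio a) X * (ev (ratio a) X * ratio h (ev (ratio a) X)) <= Cb * B (enorm X).
 by rewrite (ratioE0 gh (ev0 X)) ev_ratio//; exact: hCb (enorm_ge0 X).
have B00 (X : 'rV[R]_n) : 0 <= B (enorm X) by side.
have main : (\int[lebesgue_rV n]_x (B (enorm (Du x)))%:E <=
  (C1 * Cb)%:E * \int[lebesgue_rV n]_x (B (enorm (F x)))%:E)%E.
 (* The energy of Du is finite because Du belongs to L^A. This is the a priori bound that permits
    the absorption; its size does not enter the constant. *)
 have fN : (\int[lebesgue_rV n]_x (ev (ratio a) (Du x))%:E <=
   (fine (\int[lebesgue_rV n]_x (ev (ratio a) (Du x))%:E))%:E)%E.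
  by rewrite fineK// ge0_fin_numE//; exact: int_ge0.
 have := good_lambda_integral hsh csh Dh1 (hDh _ _ hsh) gam0 hp th0 hth
  (mev _ mD) (fun x => ev0 (Du x)) (mev _ mF) (fun x => ev0 (F x)) fN eF
  (GL (ratio a) Du F hs cs sol).
 move=> key.
 apply: (via (\int[lebesgue_rV n]_x (ev (ratio a) (Du x) * (ev (ratio a) (Du x) * ratio h (ev (ratio a) (Du x))))%:E)%E).
  apply: int_le => //; [exact: mB|exact: mevh|].
  by move=> x _; have /andP[] := bnd (Du x).
 apply: (le_trans key); rewrite -/C1 [(C1 * Cb)%:E]EFinM -muleA; apply: lee_wpmul2l; first by side.
 rewrite -(int_Z (lebesgue_rV n) measurableT (mB _ mF) (fun x _ => B00 (F x)) (ltW Cb0)).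
 apply: int_le => //; [exact: mevh|by apply: measurable_funM => //; exact: mB| |].
  by side.
 by move=> x _; have /andP[] := bnd (F x).
split => //; split => //; split => //.
have absE (X : 'rV[R]_n -> 'rV[R]_n) : (\int[lebesgue_rV n]_x (B `|(enorm \o X) x|)%:E = \int[lebesgue_rV n]_x (B (enorm (X x)))%:E)%E.
 by apply: eq_integral => x _; rewrite /= ger0_norm// enorm_ge0.
rewrite absE; rewrite absE in eFB; apply: (le_lt_trans main).
have : (0 <= \int[lebesgue_rV n]_x (B (enorm (F x)))%:E)%E by side.
by case: (integral _ _ _) eFB => //= v _ _; rewrite -EFinM ltry.
Qed.
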